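(* Let $\mathcal Z_{gen}$ be the generalized Zorich map described in the context, built from $\mathfrak h_{gen}$ with bi-Lipschitz constant $L$, angle constant $\theta_{\mathcal S}$ and scale factor $\lambda$. If $$\lambda>C_{h_{gen}}:=\frac{\max\{L^5,2L\}}{\min_{x\in Q}|\mathfrak h_{gen}(x)|\,\sin\theta_{\mathcal S}},$$ then $\mathcal J(\mathcal Z_{gen})=\mathbb R^3$.
   Context: Generalized Zorich maps. Let $Q=[-1,1]^2$ and let $\mathfrak h_{gen}=(\mathfrak h_{gen,1},\mathfrak h_{gen,2},\mathfrak h_{gen,3}):Q\to\mathbb R^3$ be a sense-preserving $L$-bi-Lipschitz map ($|a-b|/L\le|\mathfrak h_{gen}(a)-\mathfrak h_{gen}(b)|\le L|a-b|$) onto a surface $\mathcal S=\mathfrak h_{gen}(Q)$ such that: (1) $\mathcal S\subset\{x_3\ge0\}$; (2) the boundary $\mathfrak h_{gen}(\partial Q)$ of $\mathcal S$ lies in the plane $x_3=0$; (3) for each $x\in Q$ the ray from $0$ through $\mathfrak h_{gen}(x)$ meets $\mathcal S$ only at $\mathfrak h_{gen}(x)$; (4) (non-tangential position vector property) there are $\theta_{\mathcal S}\in(0,\pi/2)$ and $\varepsilon>0$ such that for all distinct $w,z\in\mathcal S$ with $|w-z|\le\varepsilon$ the acute angle between the line through $0$ and $z$ and the line through $w$ and $z$ is greater than $\theta_{\mathcal S}$; (5) $\min_{x\in Q}|\mathfrak h_{gen}(x)|>0$. Assume also $\mathfrak h_{gen,1}(t,t)=\mathfrak h_{gen,2}(t,t)$,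 $\mathfrak h_{gen,1}(t,-t)=-\mathfrak h_{gen,2}(t,-t)$ for $t\in[-1,1]$, $\mathfrak h_{gen}(0,0)=(0,0,1)$ and $\sup_{x\in Q}|\mathfrak h_{gen}(x)|=1$. For $\lambda\ge1$ let $h_{gen}(x_1,x_2)=\lambda\mathfrak h_{gen}(x_1/\lambda,x_2/\lambda)$ on $[-\lambda,\lambda]^2$, define $\mathcal Z_{gen}(x_1,x_2,x_3)=e^{x_3}h_{gen}(x_1,x_2)$ on $[-\lambda,\lambda]^2\times\mathbb R$, and extend to $\mathbb R^3$ by repeated reflection across the faces $x_1=(2k+1)\lambda$, $x_2=(2k+1)\lambda$ in the domain and across the plane $x_3=0$ in the range; this gives a quasiregular map with an essential singularity at infinity. Julia set. For a quasiregular map $f:\mathbb R^3\to\mathbb R^3$ with essential singularity at infinity, $\mathcal J(f)$ is the set of $x$ such that $\operatorname{cap}\big(\mathbb R^3\setminus\bigcup_{k\ge1}f^k(U)\big)=0$ for every neighbourhood $U$ of $x$, where for open $A$ and compact $C\subset A$, $\operatorname{cap}(A,C)=\inf_u\int_A|\nabla u|^3dm$ over nonnegative $u\in C_0^\infty(A)$ with $u\ge1$ on $C$; a compact set has zero capacity if $\operatorname{cap}(A,C)=0$ for some bounded open $A\supset C$, and an arbitrary set has zero capacity if all its compact subsets do. *)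

(* Defs.v *)
From HB Require Import structures.
From mathcomp Require Import all_boot all_order all_algebra.
From mathcomp Require Import all_classical all_reals all_analysis.
Import Order.TTheory GRing.Theory Num.Theory numFieldNormedType.Exports.

Set Implicit Arguments.
Unset Strict Implicit.
Unset Printing Implicit Defensive.

Local Open Scope ring_scope.
Local Open Scope classical_set_scope.

Section ZorichDefs.
Variable R : realType.

Definition sub2 (a b : R * R) : R * R := (a.1 - b.1, a.2 - b.2).
Definition norm2 (a : R * R) : R := Num.sqrt (a.1 ^+ 2 + a.2 ^+ 2).

Definition sub3 (a b : R * R * R) : R * R * R :=
  (a.1.1 - b.1.1, a.1.2 - b.1.2, a.2 - b.2).
Definition scale3 (c : R) (a : R * R * R) : R * R * R :=
  (c * a.1.1, c * a.1.2, c * a.2).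
Definition dot3 (a b : R * R * R) : R :=
  a.1.1 * b.1.1 + a.1.2 * b.1.2 + a.2 * b.2.
Definition norm3 (a : R * R * R) : R := Num.sqrt (dot3 a a).
Definition cross3 (a b : R * R * R) : R * R * R :=
  (a.1.2 * b.2 - a.2 * b.1.2, a.2 * b.1.1 - a.1.1 * b.2,
   a.1.1 * b.1.2 - a.1.2 * b.1.1).
Definition det3 (a b c : R * R * R) : R := dot3 a (cross3 b c).

Definition acute_angle (u v : R * R * R) : R :=
  acos (`|dot3 u v| / (norm3 u * norm3 v)).

Definition inQ (x : R * R) : Prop := -1 <= x.1 <= 1 /\ -1 <= x.2 <= 1.
Definition on_bdQ (x : R * R) : Prop := inQ x /\ (`|x.1| = 1 \/ `|x.2| = 1).

Definition pd1 (f : R * R -> R) (x : R * R) : R :=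
  derive1 (fun t => f (t, x.2)) x.1.
Definition pd2 (f : R * R -> R) (x : R * R) : R :=
  derive1 (fun t => f (x.1, t)) x.2.
Definition pd_ex (f : R * R -> R) (x : R * R) : Prop :=
  derivable (fun t => f (t, x.2)) x.1 1 /\ derivable (fun t => f (x.1, t)) x.2 1.

Definition comp1 (h : R * R -> R * R * R) := fun x => (h x).1.1.
Definition comp2 (h : R * R -> R * R * R) := fun x => (h x).1.2.
Definition comp3 (h : R * R -> R * R * R) := fun x => (h x).2.

Definition pd1v (h : R * R -> R * R * R) x : R * R * R :=
  (pd1 (comp1 h) x, pd1 (comp2 h) x, pd1 (comp3 h) x).
Definition pd2v (h : R * R -> R * R * R) x : R * R * R :=
  (pd2 (comp1 h) x, pd2 (comp2 h) x, pd2 (comp3 h) x).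

Definition leb2 := (@lebesgue_measure R \x @lebesgue_measure R)%E.
Definition leb3 :=
  ((@lebesgue_measure R \x @lebesgue_measure R) \x @lebesgue_measure R)%E.

(* h sense-preserving: for a.e. x in Q, h has partial derivatives at x and
   det[d1 h(x), d2 h(x), h(x)] > 0, i.e. the map (x1,x2,x3) |-> e^x3 h(x1,x2)
   has positive Jacobian a.e. *)
Definition sense_preserving (h : R * R -> R * R * R) : Prop :=
  {ae leb2, forall x, inQ x ->
     [/\ pd_ex (comp1 h) x, pd_ex (comp2 h) x, pd_ex (comp3 h) x &
         0 < det3 (pd1v h x) (pd2v h x) (h x)]}.

Definition sgn_par (k : int) : R := if odd (absz k) then -1 else 1.
(* index of the strip [(2k-1)lam, (2k+1)lam] containing s *)
Definition strip (lam s : R) : int := Num.floor ((s + lam) / (2 * lam)).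
(* the point of [-lam, lam] obtained from s by repeated reflections across
   the lines s = (2k+1) lam *)
Definition fold (lam s : R) : R :=
  sgn_par (strip lam s) * (s - 2 * (strip lam s)%:~R * lam).

(* h_gen(x) = lam * h(x / lam) on [-lam,lam]^2; Z = e^{x3} h_gen(x1,x2) there,
   extended by reflections (domain faces x_i = (2k+1) lam, range plane x3=0). *)
Definition zorich (h : R * R -> R * R * R) (lam : R) (x : R * R * R)
  : R * R * R :=
  let y := h (fold lam x.1.1 / lam, fold lam x.1.2 / lam) in
  let s := sgn_par (strip lam x.1.1) * sgn_par (strip lam x.1.2) in
  (expR x.2 * (lam * y.1.1), expR x.2 * (lam * y.1.2),
   expR x.2 * (s * (lam * y.2))).

Definition line3 (i : nat) (x : R * R * R) (t : R) : R * R * R :=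
  match i with
  | 0 => (t, x.1.2, x.2)
  | 1 => (x.1.1, t, x.2)
  | _ => (x.1.1, x.1.2, t)
  end.
Definition coord3 (i : nat) (x : R * R * R) : R :=
  match i with 0 => x.1.1 | 1 => x.1.2 | _ => x.2 end.

Definition partial3 (i : nat) (u : R * R * R -> R) (x : R * R * R) : R :=
  derive1 (fun t => u (line3 i x t)) (coord3 i x).
Definition partial3_ex (i : nat) (u : R * R * R -> R) (x : R * R * R) : Prop :=
  derivable (fun t => u (line3 i x t)) (coord3 i x) 1.

Fixpoint Cn (n : nat) (u : R * R * R -> R) : Prop :=
  continuous u /\
  match n with
  | 0 => True
  | n'.+1 => forall i, (i < 3)%N ->
               (forall x, partial3_ex i u x) /\ Cn n' (partial3 i u)
  end.
Definition smooth3 (u : R * R * R -> R) : Prop := forall n, Cn n u.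

Definition grad_norm (u : R * R * R -> R) (x : R * R * R) : R :=
  Num.sqrt (partial3 0 u x ^+ 2 + partial3 1 u x ^+ 2 + partial3 2 u x ^+ 2).

Definition support3 (u : R * R * R -> R) : set (R * R * R) :=
  closure [set x | u x != 0].

Definition cap_admissible (A C : set (R * R * R)) (u : R * R * R -> R) : Prop :=
  [/\ smooth3 u, compact (support3 u), support3 u `<=` A,
      (forall x, 0 <= u x) & (forall x, C x -> 1 <= u x)].

Definition capacity (A C : set (R * R * R)) : \bar R :=
  ereal_inf [set (\int[leb3]_(x in A) ((grad_norm u x) ^+ 3)%:E)%E
            | u in cap_admissible A C].

Definition bounded3 (A : set (R * R * R)) : Prop :=
  exists M : R, forall x, A x -> norm3 x <= M.

Definition compact_zero_cap (C : set (R * R * R)) : Prop :=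
  exists A, [/\ open A, bounded3 A, C `<=` A & capacity A C = 0%E].

Definition zero_capacity (E : set (R * R * R)) : Prop :=
  forall C, C `<=` E -> compact C -> compact_zero_cap C.

Definition julia (f : R * R * R -> R * R * R) : set (R * R * R) :=
  [set x | forall U, nbhs x U ->
     zero_capacity (~` \bigcup_(k in [set k : nat | (0 < k)%N]) (iter k f @` U))].

End ZorichDefs.

(* Main.v *)
Require Import Defs.
From HB Require Import structures.
From mathcomp Require Import all_boot all_order all_algebra.
From mathcomp Require Import all_classical all_reals all_analysis.
From mathcomp Require Import measurable_realfun.
From mathcomp Require Import ring lra.
Import Order.TTheory GRing.Theory Num.Theory numFieldNormedType.Exports.

(* In the coordinates v_i = x_i / lam (i = 1, 2), z = x_3, the map reads
   g(v, z) = (e^z h_1, e^z h_2, +-lam e^z h_3)(fold v), which is continuous and open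
   (the latter by a Poincare-Miranda argument). Let U be open.

   By the bi-Lipschitz and angle conditions the Jacobian of g is at least
   lam m e^(3z) sin(theta) / L^2, while the distance to the axis v_1 = v_2 = 0 is
   multiplied by at most L e^z; hence g expands the measure |(v_1, v_2)|^-3 dv dz by at
   least lam m sin(theta) / L^5 > 1. If no iterate of U met a plane v_1 +- v_2 = 2k,
   every iterate would stay in a cell on which g is injective, so that its measure would
   grow geometrically. But g maps the slice k <= z <= k + 1 of a cell into the part
   |z| <= lam e^(k+1) of a cell, so that such slices have Lebesgue measure O(e^(-2k));
   as almost every orbit returns infinitely often to a region where the weight is
   bounded, this is impossible. Hence some iterate of U meets a plane v_1 +- v_2 = 2k,
   and the next one an invariant plane v_1 = +-v_2. There g expands area by a factor at
   least 3 and is 2-to-1 on strips, and the same argument yields an iterate that meets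
   an axis v_1 = 2k, v_2 = 2l. Along the positive x_3-axis neighbourhoods
   blow up to cover R^3 minus the origin, and a point has zero capacity. *)

Set Implicit Arguments.
Unset Strict Implicit.
Unset Printing Implicit Defensive.

Local Open Scope ring_scope.
Local Open Scope classical_set_scope.

(** * Lebesgue measure on [R^3] *)

(** The map [h] is only Lipschitz, with partial derivatives almost everywhere, so Jacobians are
    replaced by a metric statement: a map that expands the sup norm does not decrease Lebesgue
    measure. It is applied, after linear changes of variables, on countably many closed sets where
    difference quotients are uniformly controlled. The sup norm is chosen because a set of diameter
    [d] lies in a cube of side exactly [d]; the threshold for [lam] leaves no room for a lost
    constant.

    In that threshold, two powers of [L] come from the area of the surface, which is stretched by at
    least [1 / L] in each of two directions, and three from the weight, whose exponent -3 cancels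
    the factor e^(3z) of the Jacobian. Opposite corners of the square are 2 sqrt 2 apart and the
    surface lies in the unit ball, so [L ^ 2 >= 2]: hence [L ^ 5] is the larger term of the maximum,
    and the area factor lam m sin(theta) / L on the invariant planes exceeds [L ^ 4 >= 4], enough to
    beat an overlap of two sheets. *)

Notation mR R := (measurableTypeR R).
Notation leb R := (@lebesgue_measure R).
Notation mble2 R := (@measurable _ (mR R * mR R)%type).
Notation mble3 R := (@measurable _ (mR R * mR R * mR R)%type).

Section Lebesgue.
Variable R : realType.
Local Open Scope ereal_scope.

Lemma affine_measurable (c t : R) :
  measurable_fun setT (fun x : mR R => (c * x + t)%R : mR R).
Proof.
by apply: measurable_funD.
Qed.

Lemma lebesgue_translate (t : R) (A : set R) : @measurable _ (mR R) A ->
  leb R ((fun x => (x + t)%R) @^-1` A) = leb R A.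
Proof.
move=> mA.
have mf : measurable_fun setT (fun x : mR R => (x + t)%R : mR R).
  by have := affine_measurable 1 t; under eq_fun do rewrite mul1r.
apply/esym/(@lebesgue_measure_unique R (pushforward (leb R) (fun x : mR R => (x + t)%R : mR R))) => //= _ [[a b]] _ <-.
rewrite /pushforward.
have -> : (fun x => (x + t)%R) @^-1` `]a, b] = `](a - t)%R, (b - t)%R]%classic.
  by apply/seteqP; split => x /=; rewrite !in_itv/= lerBrDr ltrBlDr.
by rewrite !lebesgue_measure_itv/= !lte_fin ltrD2r -!EFinB; case: ifP => // _; congr (_ %:E); ring.
Qed.

Lemma lebesgue_scale (c : R) (A : set R) : (0 < c)%R -> @measurable _ (mR R) A ->
  c%:E * leb R ((fun x => (c * x)%R) @^-1` A) = leb R A.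
Proof.
move=> c0 mA.
have mf : measurable_fun setT (fun x : mR R => (c * x)%R : mR R).
  by have := affine_measurable c 0; under eq_fun do rewrite addr0.
apply/esym/(@lebesgue_measure_unique R (mscale (NngNum (ltW c0))
  (pushforward (leb R) (fun x : mR R => (c * x)%R : mR R)))) => //= _ [[a b]] _ <-.
rewrite /mscale/=.
rewrite /pushforward.
have -> : (fun x => (c * x)%R) @^-1` `]a, b] = `](a / c)%R, (b / c)%R]%classic.
  by apply/seteqP; split => x /=; rewrite !in_itv/= ler_pdivlMr// ltr_pdivrMr// mulrC.
rewrite !lebesgue_measure_itv/= !lte_fin ltr_pM2r ?invr_gt0// -!EFinB; case: ifP => // _.
  by rewrite -EFinM; congr (_ %:E); field; rewrite gt_eqF.
by rewrite mule0.
Qed.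

Lemma lebesgue_affine (c t : R) (A : set R) : (c != 0)%R -> @measurable _ (mR R) A ->
  `|c|%:E * leb R ((fun x => (c * x + t)%R) @^-1` A) = leb R A.
Proof.
move=> c0 mA.
have mA' : @measurable _ (mR R) ((fun x => (x + t)%R) @^-1` A).
  have := affine_measurable 1 t; under eq_fun do rewrite mul1r.
  by move=> /(_ measurableT _ mA); rewrite setTI.
rewrite -[RHS](lebesgue_translate t)//.
have [c1|c1|c1] := ltgtP c 0%R; last by rewrite c1 eqxx in c0.
- rewrite ltr0_norm// -[RHS]lebesgue_measureN//.
  rewrite /pushforward -[RHS](@lebesgue_scale (- c)%R) ?oppr_gt0//; last first.
    have := affine_measurable (-1) 0.
    under eq_fun do rewrite mulN1r addr0.
    by move=> /(_ measurableT _ mA'); rewrite setTI.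
  congr (_ * leb R _); apply/seteqP; split => x /=; by rewrite mulNr opprK.
- by rewrite gtr0_norm// -[RHS](@lebesgue_scale c).
Qed.

Lemma leb2E (P : set (R * R)) : leb2 P = \int[leb R]_x leb R [set y | P (x, y)].
Proof.
rewrite /leb2 /product_measure1; apply: eq_integral => x _ /=.
by congr (leb R _); rewrite xsectionE.
Qed.

Lemma leb2E' (P : set (R * R)) : mble2 R P ->
  leb2 P = \int[leb R]_y leb R [set x | P (x, y)].
Proof.
move=> mP.
rewrite /leb2 (@product_measure_unique _ _ _ _ _ (leb R) (leb R) (leb R \x^ leb R))//.
  rewrite /product_measure2; apply: eq_integral => x _ /=.
  by congr (leb R _); rewrite ysectionE.
by move=> A B mA mB; exact: product_measure2E.
Qed.

Lemma leb3E (S : set (R * R * R)) :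
  leb3 S = \int[@leb2 R]_p leb R [set z | S (p, z)].
Proof.
have -> : leb3 S = (@leb2 R \x leb R) S by [].
rewrite /product_measure1; apply: eq_integral => x _ /=.
by congr (leb R _); rewrite xsectionE.
Qed.

HB.instance Definition _ := Measure.on (@leb2 R).

Let leb2_sigma_finite : sigma_finite setT (@leb2 R).
Proof.
have /sigma_finiteP[F [TF ndF Foo]] := sigma_finiteT (leb R).
exists (fun n => F n `*` F n).
  rewrite -setXTT TF; apply/seteqP; split => -[x y] /=.
    move=> [/= [n _ Fnx] [k _ Gky]]; exists (maxn n k) => //; split => /=.
    - by move: x Fnx; exact/subsetPset/ndF/leq_maxl.
    - by move: y Gky; exact/subsetPset/ndF/leq_maxr.
  by move=> [n _ []/= ? ?]; split; exists n.
move=> k; have [? ?] := Foo k.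
split; first exact: measurableX.
by rewrite /leb2 product_measure1E// lte_mul_pinfty// ge0_fin_numE.
Qed.

HB.instance Definition _ := Measure_isSigmaFinite.Build _ _ _ (@leb2 R)
  leb2_sigma_finite.

Lemma leb3E' (S : set (R * R * R)) : mble3 R S ->
  leb3 S = \int[leb R]_z leb2 [set p | S (p, z)].
Proof.
move=> mS; transitivity ((@leb2 R \x^ leb R) S).
  have /(_ (fun A B => @product_measure2E _ _ _ _ _ (@leb2 R) (leb R) A B)) :=
    @product_measure_unique _ _ _ _ R (@leb2 R) (leb R) (@leb2 R \x^ leb R).
  exact.
rewrite /product_measure2; apply: eq_integral => x _ /=.
by congr (leb2 _); rewrite ysectionE.
Qed.

(** By Fubini only the map on each fibre counts, and there it is affine with the common factor [c].
    The shift may depend on the fibre, which admits shears. *)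
Lemma leb2_fibery (c : R) (t : R -> R) (P Q : set (R * R)) : (c != 0)%R ->
  mble2 R P -> mble2 R Q -> Q = [set p | P (p.1, c * p.2 + t p.1)%R] ->
  `|c|%:E * leb2 Q = leb2 P.
Proof.
move=> c0 mP mQ QE; rewrite !leb2E -ge0_integralZl//; last first.
- rewrite (_ : (fun x => _) = leb R \o xsection Q); last first.
    by apply/funext => x /=; rewrite xsectionE.
  exact: measurable_fun_xsection.
- apply: eq_integral => x _.
  rewrite QE -[RHS](@lebesgue_affine c (t x)) => [//|//|].
  by have := measurable_xsection x mP; rewrite xsectionE.
Qed.

Lemma leb2_fiberx (c : R) (t : R -> R) (P Q : set (R * R)) : (c != 0)%R ->
  mble2 R P -> mble2 R Q -> Q = [set p | P (c * p.1 + t p.2, p.2)%R] ->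
  `|c|%:E * leb2 Q = leb2 P.
Proof.
move=> c0 mP mQ QE; rewrite !leb2E'// -ge0_integralZl//; last first.
- rewrite (_ : (fun x => _) = leb R \o ysection Q); last first.
    by apply/funext => x /=; rewrite ysectionE.
  exact: measurable_fun_ysection.
- apply: eq_integral => x _.
  rewrite QE -[RHS](@lebesgue_affine c (t x)) => [//|//|].
  by have := measurable_ysection x mP; rewrite ysectionE.
Qed.

Lemma leb3_fiberz (c : R) (t : R * R -> R) (P Q : set (R * R * R)) : (c != 0)%R ->
  mble3 R P -> mble3 R Q -> Q = [set p | P (p.1, c * p.2 + t p.1)%R] ->
  `|c|%:E * leb3 Q = leb3 P.
Proof.
move=> c0 mP mQ QE; rewrite !leb3E -ge0_integralZl//; last first.
- rewrite (_ : (fun x => _) = leb R \o xsection Q); last first.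
    by apply/funext => x /=; rewrite xsectionE.
  exact: measurable_fun_xsection.
- apply: eq_integral => x _.
  rewrite QE -[RHS](@lebesgue_affine c (t x)) => [//|//|].
  by have := measurable_xsection x mP; rewrite xsectionE.
Qed.

Lemma leb3_fiberxy (c : R) (tau : R -> R * R -> R * R) (P Q : set (R * R * R)) :
  (forall z A B, mble2 R A -> mble2 R B -> B = tau z @^-1` A ->
     `|c|%:E * leb2 B = leb2 A) ->
  mble3 R P -> mble3 R Q -> Q = [set p | P (tau p.2 p.1, p.2)] ->
  `|c|%:E * leb3 Q = leb3 P.
Proof.
move=> tauP mP mQ QE; rewrite !leb3E'// -ge0_integralZl//; last first.
- rewrite (_ : (fun x => _) = @leb2 R \o ysection Q); last first.
    by apply/funext => x /=; rewrite ysectionE.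
  exact: measurable_fun_ysection.
- apply: eq_integral => x _.
  apply: (tauP x).
  + by have := measurable_ysection x mP; rewrite ysectionE.
  + by have := measurable_ysection x mQ; rewrite ysectionE.
  + by rewrite QE.
Qed.

Definition lin3 (r1 r2 r3 x : R * R * R) : R * R * R :=
  (dot3 r1 x, dot3 r2 x, dot3 r3 x).

Lemma dot3_measurable (r : R * R * R) :
  measurable_fun [set: mR R * mR R * mR R] (fun x => dot3 r x : mR R).
Proof.
have m1 : measurable_fun [set: mR R * mR R * mR R] (fun x => x.1.1 : mR R).
  by apply: (measurableT_comp (f := fst)) => //; apply: measurable_fst.
have m2 : measurable_fun [set: mR R * mR R * mR R] (fun x => x.1.2 : mR R).
  by apply: (measurableT_comp (f := snd)) => //; apply: measurable_fst.
have m3 : measurable_fun [set: mR R * mR R * mR R] (fun x => x.2 : mR R).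
  exact: measurable_snd.
rewrite /dot3.
by do 2 ?[apply: measurable_funD];
  apply: measurable_funM.
Qed.

Lemma lin3_measurable (r1 r2 r3 : R * R * R) (S : set (R * R * R)) :
  mble3 R S -> mble3 R (lin3 r1 r2 r3 @^-1` S).
Proof.
move=> mS.
have /(_ measurableT S mS) : measurable_fun [set: mR R * mR R * mR R]
    (lin3 r1 r2 r3 : mR R * mR R * mR R -> mR R * mR R * mR R).
  by do 2 ?[apply: measurable_fun_pair]; apply: dot3_measurable.
by rewrite setTI.
Qed.

(** The linear change of variables is proved by elimination on the rows: [P] holds for the identity
    and survives replacing one row by a combination in which its own coefficient is nonzero, because
    such a step composes with a matrix that has a single nontrivial row, handled by [E1], [E2] and
    [E3]. *)
Let P r1 r2 r3 := (det3 r1 r2 r3 != 0)%R -> forall S, mble3 R S ->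
  `|det3 r1 r2 r3|%:E * leb3 (lin3 r1 r2 r3 @^-1` S) = leb3 S.

Let e1 : R * R * R := (1, 0, 0)%R.
Let e2 : R * R * R := (0, 1, 0)%R.
Let e3 : R * R * R := (0, 0, 1)%R.
Let cmb (a b c : R) (r1 r2 r3 : R * R * R) : R * R * R := 
  (a * r1.1.1 + b * r2.1.1 + c * r3.1.1, a * r1.1.2 + b * r2.1.2 + c * r3.1.2,
   a * r1.2 + b * r2.2 + c * r3.2)%R.

Let dot_cmb a b c r1 r2 r3 x : dot3 (cmb a b c r1 r2 r3) x =
  (a * dot3 r1 x + b * dot3 r2 x + c * dot3 r3 x)%R.
Proof. rewrite /dot3/cmb/=; ring. Qed.

Let E3 a b c S : (c != 0)%R -> mble3 R S ->
  `|c|%:E * leb3 (lin3 e1 e2 (a, b, c) @^-1` S) = leb3 S.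
Proof.
move=> c0 mS.
apply: (@leb3_fiberz c (fun p => a * p.1 + b * p.2)%R) => //.
  exact: lin3_measurable.
apply/seteqP; split => -[[x y] z] /=; rewrite /lin3/dot3/= !mul1r !mul0r !add0r !addr0;
 by rewrite (addrC (c * z)%R).
Qed.

Let E2 a b c S : (c != 0)%R -> mble3 R S ->
  `|c|%:E * leb3 (lin3 e1 (a, c, b) e3 @^-1` S) = leb3 S.
Proof.
move=> c0 mS.
apply: (@leb3_fiberxy c (fun z p => (p.1, c * p.2 + (a * p.1 + b * z))%R)) => //.
- move=> z A B mA mB BE.
  exact: (@leb2_fibery c (fun x => a * x + b * z)%R _ _ c0 mA mB BE).
- exact: lin3_measurable.
apply/seteqP; split => -[[x y] z] /=; rewrite /lin3/dot3/= !mul1r !mul0r !add0r !addr0;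
 by rewrite addrA (addrC (c * y)%R).
Qed.

Let E1 a b c S : (c != 0)%R -> mble3 R S ->
  `|c|%:E * leb3 (lin3 (c, a, b) e2 e3 @^-1` S) = leb3 S.
Proof.
move=> c0 mS.
apply: (@leb3_fiberxy c (fun z p => (c * p.1 + (a * p.2 + b * z), p.2)%R)) => //.
- move=> z A B mA mB BE.
  exact: (@leb2_fiberx c (fun x => a * x + b * z)%R _ _ c0 mA mB BE).
- exact: lin3_measurable.
by apply/seteqP; split => -[[x y] z] /=; rewrite /lin3/dot3/= !mul1r !mul0r !add0r !addr0 addrA.
Qed.

Let P3 a b c r1 r2 r3 : (c != 0)%R -> P r1 r2 r3 -> P r1 r2 (cmb a b c r1 r2 r3).
Proof.
move=> c0 Pr; rewrite /P.
have -> : det3 r1 r2 (cmb a b c r1 r2 r3) = (c * det3 r1 r2 r3)%R.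
  rewrite /det3/dot3/cmb/cross3/=; ring.
rewrite mulf_eq0 negb_or => /andP[_ d0] S mS.
rewrite normrM mulrC EFinM -muleA -(E3 a b c0 mS) -[X in _ = _ * X](Pr d0); last exact: lin3_measurable.
rewrite muleCA; congr (_ * (_ * leb3 _)).
apply/seteqP; split => x; rewrite /lin3 /= dot_cmb {1 3}/dot3/= /dot3/= !mul1r !mul0r !add0r !addr0 //.
Qed.

Let P2 a b c r1 r2 r3 : (c != 0)%R -> P r1 r2 r3 -> P r1 (cmb a c b r1 r2 r3) r3.
Proof.
move=> c0 Pr; rewrite /P.
have -> : det3 r1 (cmb a c b r1 r2 r3) r3 = (c * det3 r1 r2 r3)%R.
  rewrite /det3/dot3/cmb/cross3/=; ring.
rewrite mulf_eq0 negb_or => /andP[_ d0] S mS.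
rewrite normrM mulrC EFinM -muleA -(E2 a b c0 mS) -[X in _ = _ * X](Pr d0); last exact: lin3_measurable.
rewrite muleCA; congr (_ * (_ * leb3 _)).
apply/seteqP; split => x; rewrite /lin3 /= dot_cmb {1 3}/dot3/= /dot3/= !mul1r !mul0r !add0r !addr0 //.
Qed.

Let P1 a b c r1 r2 r3 : (c != 0)%R -> P r1 r2 r3 -> P (cmb c a b r1 r2 r3) r2 r3.
Proof.
move=> c0 Pr; rewrite /P.
have -> : det3 (cmb c a b r1 r2 r3) r2 r3 = (c * det3 r1 r2 r3)%R.
  rewrite /det3/dot3/cmb/cross3/=; ring.
rewrite mulf_eq0 negb_or => /andP[_ d0] S mS.
rewrite normrM mulrC EFinM -muleA -(E1 a b c0 mS) -[X in _ = _ * X](Pr d0); last exact: lin3_measurable.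
rewrite muleCA; congr (_ * (_ * leb3 _)).
apply/seteqP; split => x; rewrite /lin3 /= dot_cmb {1 3}/dot3/= /dot3/= !mul1r !mul0r !add0r !addr0 //.
Qed.

Let P0 : P e1 e2 e3.
Proof.
move=> _ S mS; have -> : det3 e1 e2 e3 = 1%R by rewrite /det3/dot3/cross3/=; ring.
rewrite normr1 mul1e; congr leb3; apply/seteqP; split => -[[x y] z];
  by rewrite /lin3/dot3/= !mul1r !mul0r !add0r !addr0.
Qed.

(** A row operation with coefficient 1 is undone by the one with opposite multiples, so [P] may also
    be tested after the operation. *)
Let P3i a b r1 r2 r3 : P r1 r2 (cmb a b 1 r1 r2 r3) -> P r1 r2 r3.
Proof.
move=> /(@P3 (- a)%R (- b)%R 1%R) => /(_ (oner_neq0 _)); congr (P _ _ _).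
case: r3 => [[? ?] ?]; rewrite /cmb/=; congr (_, _, _); ring.
Qed.

Let P2i a b r1 r2 r3 : P r1 (cmb a 1 b r1 r2 r3) r3 -> P r1 r2 r3.
Proof.
move=> /(@P2 (- a)%R (- b)%R 1%R) => /(_ (oner_neq0 _)); congr (P _ _ _).
case: r2 => [[? ?] ?]; rewrite /cmb/=; congr (_, _, _); ring.
Qed.

Let P1i a b r1 r2 r3 : P (cmb 1 a b r1 r2 r3) r2 r3 -> P r1 r2 r3.
Proof.
move=> /(@P1 (- a)%R (- b)%R 1%R) => /(_ (oner_neq0 _)); congr (P _ _ _).
case: r1 => [[? ?] ?]; rewrite /cmb/=; congr (_, _, _); ring.
Qed.

(** A zero on the diagonal kills the determinant and makes [P] vacuous; otherwise the rows are built
    from those of the identity, one at a time. *)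
Let Ptri (x p q a b w : R) : P (x, 0, 0)%R (p, q, 0)%R (a, b, w).
Proof.
have dE : det3 (x, 0, 0)%R (p, q, 0)%R (a, b, w) = (x * q * w)%R.
  rewrite /det3/dot3/cross3/=; ring.
have [x0|x0] := eqVneq x 0%R; first by rewrite /P dE x0 !mul0r eqxx.
have [q0|q0] := eqVneq q 0%R; first by rewrite /P dE q0 mulr0 mul0r eqxx.
have [w0|w0] := eqVneq w 0%R; first by rewrite /P dE w0 mulr0 eqxx.
have H1 : P (x, 0, 0)%R e2 e3.
  have := @P1 0%R 0%R x _ _ _ x0 P0; congr (P _ _ _).
  rewrite /cmb/=; congr (_, _, _); ring.
have H2 : P (x, 0, 0)%R (p, q, 0)%R e3.
  have := @P2 (p / x)%R 0%R q _ _ _ q0 H1; congr (P _ _ _).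
  rewrite /cmb/=; congr (_, _, _); field; exact: x0.
have := @P3 ((a - b / q * p) / x)%R (b / q)%R w _ _ _ w0 H2; congr (P _ _ _).
rewrite /cmb/=; congr (_, _, _); field; rewrite ?x0 ?q0//.
Qed.

Let Pblk (x y p q a b w : R) : P (x, y, 0)%R (p, q, 0)%R (a, b, w).
Proof.
have H x' y' p' q' : (q' != 0)%R -> P (x', y', 0)%R (p', q', 0)%R (a, b, w).
  move=> q0; apply: (@P1i (- y' / q')%R 0%R).
  have := @Ptri (x' - y' / q' * p')%R p' q' a b w; congr (P _ _ _).
  by rewrite /cmb/=; congr (_, _, _); field.
have [q0|] := eqVneq q 0%R; last exact: H.
have [y0|y0] := eqVneq y 0%R.
  rewrite q0 y0 /P (_ : det3 _ _ _ = 0)%R ?eqxx//.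
  by rewrite /det3/dot3/cross3/=; ring.
(* Here [q = 0] and [y] is nonzero: adding the first row to the second supplies a pivot. *)
apply: (@P2i 1%R 0%R); have := @H x y (x + p)%R (y + q)%R; rewrite q0 addr0 => /(_ y0).
by congr (P _ _ _); rewrite /cmb/=; congr (_, _, _); ring.
Qed.

Let Pall r1 r2 r3 : P r1 r2 r3.
Proof.
have H s1 s2 s3 : (s3.2 != 0)%R -> P s1 s2 s3.
  move: s1 s2 s3 => [[x y] z] [[x' y'] z'] [[a b] w] /= w0.
  apply: (@P1i 0%R (- z / w)%R); apply: (@P2i 0%R (- z' / w)%R).
  have := @Pblk (x - z / w * a)%R (y - z / w * b)%R (x' - z' / w * a)%R (y' - z' / w * b)%R a b w.
  by congr (P _ _ _); rewrite /cmb/=; congr (_, _, _); field.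
have [w0|] := eqVneq r3.2 0%R; last exact: H.
have [w1|w1] := eqVneq r1.2 0%R; last first.
  by apply: (@P3i 1%R 0%R); apply: H; rewrite /cmb/= w0 !mul1r mul0r !addr0.
have [w2|w2] := eqVneq r2.2 0%R; last first.
  by apply: (@P3i 0%R 1%R); apply: H; rewrite /cmb/= w0 w1 !mul1r mul0r addr0 add0r.
rewrite /P (_ : det3 _ _ _ = 0)%R ?eqxx//.
by rewrite /det3/dot3/cross3/= w0 w1 w2; ring.
Qed.

Lemma leb3_lin r1 r2 r3 (S : set (R * R * R)) :
  (det3 r1 r2 r3 != 0)%R -> mble3 R S ->
  `|det3 r1 r2 r3|%:E * leb3 (lin3 r1 r2 r3 @^-1` S) = leb3 S.
Proof. by move=> d0 mS; exact: Pall. Qed.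

Lemma leb3_box (A B C : set R) : @measurable _ (mR R) A ->
  @measurable _ (mR R) B -> @measurable _ (mR R) C ->
  leb3 (A `*` B `*` C) = leb R A * leb R B * leb R C.
Proof.
move=> mA mB mC.
have -> : leb3 (A `*` B `*` C) = (@leb2 R \x leb R) ((A `*` B) `*` C) by [].
rewrite product_measure1E//; last exact: measurableX.
congr (_ * _); exact: (product_measure1E (leb R) (leb R)).
Qed.

End Lebesgue.

(** * Expanding maps and measure *)

Section Space.
Variable R : realType.
Notation R3 := (R * R * R)%type.

Lemma norm_le3 (x : R3) (r : R) :
  (`|x| <= r) = [&& `|x.1.1| <= r, `|x.1.2| <= r & `|x.2| <= r].
Proof. by rewrite !prod_normE !ge_max andbA. Qed.

Lemma norm_lt3 (x : R3) (r : R) :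
  (`|x| < r) = [&& `|x.1.1| < r, `|x.1.2| < r & `|x.2| < r].
Proof. by rewrite !prod_normE !gt_max andbA. Qed.

Lemma norm_comp3 (x : R3) :
  [/\ `|x.1.1| <= `|x|, `|x.1.2| <= `|x| & `|x.2| <= `|x| ].
Proof. by apply/and3P; rewrite -norm_le3. Qed.

Lemma nbhs3P (x : R3) (A : set R3) :
  nbhs x A <-> exists2 e : R, 0 < e & forall y, `|x - y| < e -> A y.
Proof.
split.
  move=> /nbhs_ballP[e /= e0 eA]; exists e => // y xy; apply: eA.
  by rewrite ball_prod_normE.
move=> [e e0 eA]; apply/nbhs_ballP; exists e => //= y.
by rewrite ball_prod_normE; exact: eA.
Qed.

Lemma open3P (A : set R3) :
  open A <-> forall x, A x -> exists2 e : R, 0 < e & forall y, `|x - y| < e -> A y.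
Proof.
rewrite openE; split => [oA x /oA /nbhs3P //|H x /H ?]; exact/nbhs3P.
Qed.

Lemma open3_measurable (A : set R3) : open A -> mble3 R A.
Proof.
move=> /open3P oA.
pose bx (i : rat * rat * rat * rat) : set R3 :=
  `](ratr i.1.1.1 - ratr i.2), (ratr i.1.1.1 + ratr i.2)[ `*`
  `](ratr i.1.1.2 - ratr i.2), (ratr i.1.1.2 + ratr i.2)[ `*`
  `](ratr i.1.2 - ratr i.2), (ratr i.1.2 + ratr i.2)[.
have -> : A = \bigcup_i (if `[< bx i `<=` A >] then bx i else set0).
  apply/seteqP; split => x; last first.
    by move=> [i _]; case: asboolP => // + ?; apply.
  move=> Ax; have [e e0 eA] := oA _ Ax.
  have [r] := rat_in_itvoo (divr_gt0 e0 (@ltr0n R 2)); rewrite in_itv/= => /andP[r0 re].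
  have lt2 (y : R) : y - ratr r < y + ratr r by lra.
  have [q1] := rat_in_itvoo (lt2 x.1.1); rewrite in_itv/= => /andP[q11 q12].
  have [q2] := rat_in_itvoo (lt2 x.1.2); rewrite in_itv/= => /andP[q21 q22].
  have [q3] := rat_in_itvoo (lt2 x.2); rewrite in_itv/= => /andP[q31 q32].
  exists (q1, q2, q3, r) => //; case: asboolP; last first.
    case=> -[[y1 y2] y3]; rewrite /bx/= !in_itv/= => -[[/andP[? ?] /andP[? ?]] /andP[? ?]].
    by apply: eA; rewrite norm_lt3/=; apply/and3P; split; rewrite ltr_norml; lra.
  move=> _; rewrite /bx/= !in_itv/=; lra.
apply: countable_bigcupT_measurable => // i; case: ifP => // _.
by apply: measurableX => //; apply: measurableX.
Qed.

Lemma closed3_measurable (A : set R3) : closed A -> mble3 R A.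
Proof.
by move=> /closed_openC/open3_measurable/measurableC; rewrite setCK.
Qed.

Lemma compact3_closed (A : set R3) : compact A -> closed A.
Proof. by move=> /compact_closed; apply; exact: norm_hausdorff. Qed.

Lemma compact3_measurable (A : set R3) : compact A -> mble3 R A.
Proof. by move=> /compact3_closed/closed3_measurable. Qed.

Lemma compact3_bounded (A : set R3) : compact A ->
  exists2 M : R, 0 < M & forall x, A x -> `|x| <= M.
Proof.
move=> /compact_bounded[M [_ H]]; exists (`|M| + 1); first by rewrite ltr_wpDl.
by move=> x Ax; apply: (H (`|M| + 1)) => //; rewrite ltr_pwDr// ler_norm.
Qed.

Lemma bounded_closed3_compact (A : set R3) (M : R) : closed A ->
  (forall x, A x -> `|x| <= M) -> compact A.
Proof.
move=> cA AM.
have cB : compact (`[-M, M] `*` `[-M, M] `*` `[-M, M] : set R3).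
  by do 2 ?[apply: compact_setX]; exact: segment_compact.
apply: (subclosed_compact cA cB) => x /AM.
by rewrite norm_le3 /= !in_itv/= => /and3P[]; rewrite !ler_norml.
Qed.

Lemma compact3_image (f : R3 -> R3) (A : set R3) : continuous f -> compact A ->
  compact (f @` A).
Proof.
move=> cf cA; apply: continuous_compact => //.
exact: continuous_subspaceT.
Qed.

Lemma compact3_preimage (f : R3 -> R3) (A B : set R3) : continuous f -> compact A ->
  closed B -> compact (A `&` f @^-1` B).
Proof.
move=> cf cA cB; apply: (subclosed_compact _ cA); last exact: subIsetl.
apply: closedI; first exact: compact3_closed.
by apply: preimage_closed.
Qed.

Lemma measurable_fun_continuous3 (f : R3 -> R) : continuous f ->
  measurable_fun [set: (mR R * mR R * mR R)%type] (f : _ -> mR R).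
Proof.
move=> /continuousP cf; apply: (measurability _ (RGenOpens.measurableE R)).
move=> _ [_ [a [b ->] <-]]; rewrite setTI.
by apply: open3_measurable; apply: cf; exact: interval_open.
Qed.

Lemma lebesgue_cc (a b : R) : a <= b -> leb R (`[a, b]) = (b - a)%:E.
Proof.
move=> ab; rewrite lebesgue_measure_itv/= lte_fin.
by case: ltgtP ab => // -> _; rewrite subrr.
Qed.

Lemma lebesgue_co (a b : R) : a <= b -> leb R (`[a, b[) = (b - a)%:E.
Proof.
move=> ab; rewrite lebesgue_measure_itv/= lte_fin.
by case: ltgtP ab => // -> _; rewrite subrr.
Qed.

Lemma leb3_cc (a b c d : R) : 0 <= d ->
  leb3 (`[a, a + d] `*` `[b, b + d] `*` `[c, c + d] : set R3) = (d ^+ 3)%:E.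
Proof.
move=> d0; rewrite leb3_box// !lebesgue_cc ?lerDl//.
by rewrite -!EFinM; congr (_ %:E); ring.
Qed.

Lemma leb3_set0 : leb3 (set0 : set R3) = 0%E.
Proof. exact: (measure0 (@leb3 R)). Qed.

(** Each coordinate ranges over an interval of length [d] starting at its infimum, so the cube has
    side exactly [d]. The absolute value takes care of empty [A], for which [d] may be negative. *)
Lemma diameter_box (A : set R3) (d : R) :
  (forall x y, A x -> A y -> `|x - y| <= d) ->
  exists B, [/\ mble3 R B, A `<=` B & (leb3 B <= (`|d| ^+ 3)%:E)%E].
Proof.
move=> Ad; have [[a Aa]|A0] := pselect (A !=set0); last first.
  exists set0; split; [exact: measurable0| |by rewrite leb3_set0 lee_fin exprn_ge0].
  by move=> x Ax; case: A0; exists x.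
have d0 : 0 <= d by have := Ad _ _ Aa Aa; rewrite subrr normr0.
have box1 (p : R3 -> R) : (forall x y, A x -> A y -> `|p x - p y| <= d) ->
    exists m, forall x, A x -> m <= p x <= m + d.
  move=> pd; exists (inf (p @` A)) => x Ax; apply/andP; split.
    apply: ge_inf; last by exists x.
    by exists (p a - d) => _ [y Ay <-]; have := pd _ _ Aa Ay; rewrite ler_norml; lra.
  rewrite -lerBlDr; apply: lb_le_inf; first by exists (p a), a.
  by move=> _ [y Ay <-]; have := pd _ _ Ax Ay; rewrite ler_norml; lra.
have [m1 H1] : exists m, forall x, A x -> m <= x.1.1 <= m + d.
  by apply: box1 => x y Ax Ay; have := Ad _ _ Ax Ay; rewrite norm_le3 => /and3P[].
have [m2 H2] : exists m, forall x, A x -> m <= x.1.2 <= m + d.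
  by apply: box1 => x y Ax Ay; have := Ad _ _ Ax Ay; rewrite norm_le3 => /and3P[].
have [m3 H3] : exists m, forall x, A x -> m <= x.2 <= m + d.
  by apply: box1 => x y Ax Ay; have := Ad _ _ Ax Ay; rewrite norm_le3 => /and3P[].
exists (`[m1, m1 + d] `*` `[m2, m2 + d] `*` `[m3, m3 + d]); split.
- by apply: measurableX => //; apply: measurableX.
- by move=> x Ax; rewrite /= !in_itv/=; split; [split|]; [exact: H1|exact: H2|exact: H3].
- by rewrite leb3_cc// ger0_norm.
Qed.

Definition gridi (n : nat) (x : R3) : int * int * int :=
  (Num.floor (x.1.1 * 2 ^+ n), Num.floor (x.1.2 * 2 ^+ n), Num.floor (x.2 * 2 ^+ n)).

Let g1 (n : nat) (i : int) : set R := `[i%:~R / 2 ^+ n, (i + 1)%:~R / 2 ^+ n[.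

Let g1E n i x : (Num.floor (x * 2 ^+ n) = i) <-> g1 n i x.
Proof.
have p : 0 < 2 ^+ n :> R by rewrite exprn_gt0.
rewrite /g1/= in_itv/= ler_pdivrMr// ltr_pdivlMr//.
by split => [<-|?]; [exact: floor_itv|exact: floor_def].
Qed.

Lemma gridiE n i :
  gridi n @^-1` [set i] = g1 n i.1.1 `*` g1 n i.1.2 `*` g1 n i.2.
Proof.
apply/seteqP; split => -[[x y] z] /=; rewrite /gridi/=.
  by case: i => [[i j] k] [/g1E ? /g1E ? /g1E ?].
by case: i => [[i j] k] /= [[/g1E -> /g1E ->] /g1E ->].
Qed.

Lemma gridi_measurable n i : mble3 R (gridi n @^-1` [set i]).
Proof. by rewrite gridiE /g1; apply: measurableX => //; apply: measurableX. Qed.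

Lemma leb3_gridi n i : leb3 (gridi n @^-1` [set i]) = ((2 ^- n) ^+ 3)%:E.
Proof.
have H (j : int) : j%:~R / 2 ^+ n <= (j + 1)%:~R / 2 ^+ n :> R.
  by rewrite ler_pM2r ?invr_gt0 ?exprn_gt0// ler_int lerDl.
rewrite gridiE /g1 leb3_box// !lebesgue_co//.
rewrite -!EFinM !intrD; congr (_ %:E).
have : 2 ^+ n != 0 :> R by rewrite expf_neq0.
by move: (2 ^+ n) => t t0; field.
Qed.

Lemma gridi_dist n x y : gridi n x = gridi n y -> `|x - y| <= 2 ^- n.
Proof.
have p : 0 < 2 ^+ n :> R by rewrite exprn_gt0.
have H (a b : R) : Num.floor (a * 2 ^+ n) = Num.floor (b * 2 ^+ n) ->
    `|a - b| <= 2 ^- n.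
  move=> /g1E; have /g1E := erefl (Num.floor (b * 2 ^+ n)).
  rewrite /g1/= !in_itv/= intrD mulrDl mul1r ler_norml; by set v := 2 ^- n; set u := _ * v; lra.
by move=> [/H ? /H ? /H ?]; rewrite norm_le3/=; apply/and3P.
Qed.

Let floor_half (a b : R) : Num.floor (a * 2) = Num.floor (b * 2) ->
  Num.floor a = Num.floor b.
Proof.
move=> ab; apply/esym/floor_def.
have /andP[fa1 fa2] := floor_itv a.
have : (Num.floor a * 2 <= Num.floor (a * 2) < Num.floor a * 2 + 2)%R.
  rewrite floor_ge_int floor_lt_int !intrD !intrM; move: fa2; rewrite intrD; lra.
rewrite ab floor_ge_int floor_lt_int !intrD !intrM => /andP[]; lra.
Qed.

Lemma gridiS n x y : gridi n.+1 x = gridi n.+1 y -> gridi n x = gridi n y.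
Proof.
rewrite /gridi !exprSr !mulrA => -[/floor_half ? /floor_half ? /floor_half ?].
by congr (_, _, _).
Qed.

(* An expanding map does not decrease the measure of a compact set: the cells of
   a fine dyadic grid meeting [psi @` K] pull back to sets of diameter at most
   the mesh, and those cells shrink to [psi @` K]. *)
Lemma leb3_expand (K : set R3) (psi : R3 -> R3) : compact K -> continuous psi ->
  (forall a b, K a -> K b -> `|a - b| <= `|psi a - psi b|) ->
  (leb3 K <= leb3 (psi @` K))%E.
Proof.
move=> cK cpsi exK; have cS := compact3_image cpsi cK; set S := psi @` K in cS *.
(* The dyadic cells of side [2 ^- n] that meet [S], enumerated through [pickle]; codes of other
   cells give the empty set. *)
pose D n : set (int * int * int) := gridi n @` S.
pose F n k : set R3 := if pickle_inv k is Some i then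
  if `[< D n i >] then gridi n @^-1` [set i] else set0 else set0.
pose U n : set R3 := \bigcup_k F n k.
have UE n : U n = gridi n @^-1` (D n).
  apply/seteqP; split => x.
    move=> [k _]; rewrite /F; case: pickle_inv => // i.
    by case: asboolP => // Di /= ->.
  move=> Dx; exists (pickle (gridi n x)); first exact: I.
  by rewrite /F pickleK_inv; case: asboolP.
have mF n k : mble3 R (F n k).
  rewrite /F; case: pickle_inv => [i|]; last exact: measurable0.
  by case: asboolP => _; [exact: gridi_measurable|exact: measurable0].
have mU n : mble3 R (U n) by apply: bigcupT_measurable => k; exact: mF.
have tF n : trivIset setT (F n).
  apply/trivIsetP => i j _ _ ij; apply/seteqP; split => // x [].
  have := @pickle_invK (int * int * int)%type i; have := @pickle_invK (int * int * int)%type j.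
  rewrite /F; case: (pickle_inv i) => [a|//]; case: (pickle_inv j) => [b|//] /= bj ai.
  case: asboolP => // _ /= ax; case: asboolP => // _ /= bx.
  by move: ij; rewrite -ai -bj -ax -bx eqxx.
(* Since [psi] expands, the part of [K] sent into one cell has diameter at most the side of the
   cell, hence no more measure than the cell. *)
have KU n : (leb3 K <= leb3 (U n))%E.
  have /choice[B HB] k : exists B, [/\ mble3 R B, K `&` psi @^-1` F n k `<=` B &
      (leb3 B <= leb3 (F n k))%E].
    rewrite /F; case: pickle_inv => [i|]; last first.
      by exists set0; split; [exact: measurable0|move=> ? []|].
    case: asboolP => _; last first.
      by exists set0; split; [exact: measurable0|move=> ? []|].
    have [x y [Kx /= xi] [Ky /= yi]|B [mB AB Bd]] :=
      @diameter_box (K `&` psi @^-1` (gridi n @^-1` [set i])) (2 ^- n).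
      by apply: le_trans (exK _ _ Kx Ky) _; apply: gridi_dist; rewrite xi yi.
    exists B; split => //; rewrite leb3_gridi; apply: le_trans Bd _.
    by rewrite ger0_norm// invr_ge0 exprn_ge0.
  apply: (@le_trans _ _ (\sum_(0 <= k <oo) leb3 (B k))%E).
    apply: (measure_sigma_subadditive (@leb3 R)).
    - by move=> k; have [] := HB k.
    - exact: compact3_measurable.
    - move=> x Kx; have : U n (psi x) by rewrite UE /=; exists (psi x) => //; exists x.
      by move=> [k _ Fk]; exists k => //; have [_ H _] := HB k; apply: H.
  have -> : leb3 (U n) = (\sum_(0 <= k <oo) leb3 (F n k))%E.
    exact: (@measure_semi_bigcup _ _ _ (@leb3 R) (F n) (mF n) (tF n) (mU n)).
  by apply: lee_nneseries => // k _; have [] := HB k.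
have USn n m : (n <= m)%N -> U m `<=` U n.
  move=> nm x; rewrite !UE => -[y Sy yx]; exists y => //.
  elim: m nm yx => [|m IH]; first by rewrite leqn0 => /eqP ->.
  by rewrite leq_eqVlt => /predU1P[-> //|nm /gridiS]; exact: IH.
(* A point of every [U n] is a limit of points of [S], which is closed. *)
have capU : \bigcap_n U n = S.
  apply/seteqP; split => x; last first.
    by move=> Sx n _; rewrite UE; exists x.
  move=> Ux; have := compact3_closed cS; apply => A /nbhs3P[e e0 eA].
  have [n ne] : exists n, 2 ^- n < e :> R.
    have : (fun n => 2^-1 ^+ n : R) @ \oo --> 0.
      by apply: cvg_expr; rewrite ger0_norm; lra.
    move=> /cvgrPdist_lt/(_ _ e0)[N _ /(_ N (leqnn N))].
    rewrite sub0r normrN ger0_norm ?exprn_ge0// exprVn => ?; by exists N.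
  have := Ux n I; rewrite UE => -[y Sy /esym/gridi_dist xy].
  by exists y; split => //; apply: eA; exact: le_lt_trans ne.
have cvU : (@leb3 R \o U) n @[n --> \oo] --> leb3 S.
  have := @nonincreasing_cvg_mu _ _ _ (@leb3 R) U; rewrite capU; apply => //.
  - have [M M0 HM] := compact3_bounded cS.
    have : U 0%N `<=` `[- (M + 1), - (M + 1) + 2 * (M + 1)] `*`
       `[- (M + 1), - (M + 1) + 2 * (M + 1)] `*` `[- (M + 1), - (M + 1) + 2 * (M + 1)].
      move=> x; rewrite UE => -[y Sy /gridi_dist]; rewrite expr0 invr1 => xy.
      have : `|x| <= M + 1.
        have -> : x = y - (y - x) by rewrite opprB addrC subrK.
        by apply: le_trans (ler_normB _ _) _; apply: lerD => //; exact: HM.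
      rewrite norm_le3 => /and3P[]; rewrite /= !in_itv/= !ler_norml; lra.
    set B := (X in _ `<=` X) => sub.
    have mB : mble3 R B by apply: measurableX => //; apply: measurableX.
    apply: (@le_lt_trans _ _ (leb3 B)).
      by apply: (le_measure (@leb3 R)) => //; rewrite inE.
    by rewrite /B leb3_cc ?ltry//; lra.
  - exact: compact3_measurable.
  - by move=> n m /USn/subsetPset.
rewrite -(cvg_lim _ cvU)//; apply: lime_ge; first by apply/cvg_ex; eexists; exact: cvU.
by apply: nearW => n; exact: KU.
Qed.

Lemma coord3_continuous :
  [/\ continuous (fun x : R3 => x.1.1), continuous (fun x : R3 => x.1.2) &
      continuous (fun x : R3 => x.2)].
Proof.
split=> x.
- by apply: (@cvg_comp _ _ _ fst fst); [exact: cvg_fst|exact: cvg_fst].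
- by apply: (@cvg_comp _ _ _ fst snd); [exact: cvg_fst|exact: cvg_snd].
- exact: cvg_snd.
Qed.

Lemma continuous_pair3 (T : topologicalType) (f g h : T -> R) :
  continuous f -> continuous g -> continuous h ->
  continuous (fun x => (f x, g x, h x)).
Proof.
move=> cf cg ch x; apply/cvgrPdist_lt => e e0; near=> y.
rewrite norm_lt3/=; apply/and3P; split; near: y.
- by move/cvgrPdist_lt: (cf x); apply.
- by move/cvgrPdist_lt: (cg x); apply.
- by move/cvgrPdist_lt: (ch x); apply.
Unshelve. all: by end_near.
Qed.

Lemma dot3_continuous (r : R3) : continuous (dot3 r).
Proof.
have [c1 c2 c3] := coord3_continuous.
move=> x; rewrite /dot3; apply: cvgD; [apply: cvgD|]; apply: cvgM;
  [exact: cvg_cst|exact: c1|exact: cvg_cst|exact: c2|exact: cvg_cst|exact: c3].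
Qed.

Lemma lin3_continuous (r1 r2 r3 : R3) : continuous (lin3 r1 r2 r3).
Proof. by apply: continuous_pair3; exact: dot3_continuous. Qed.

Lemma lin3B (r1 r2 r3 x y : R3) :
  lin3 r1 r2 r3 (x - y) = lin3 r1 r2 r3 x - lin3 r1 r2 r3 y.
Proof.
case: x y => [[x y] z] [[x' y'] z']; rewrite /lin3/dot3/=.
by congr (_, _, _) => /=; ring.
Qed.

(** The inverse matrix has as columns the cross products of the rows, divided by the determinant. *)
Lemma lin3_inverse (b1 b2 b3 : R3) : det3 b1 b2 b3 != 0 ->
  exists c1 c2 c3, [/\ cancel (lin3 b1 b2 b3) (lin3 c1 c2 c3),
    cancel (lin3 c1 c2 c3) (lin3 b1 b2 b3) &
    det3 c1 c2 c3 = (det3 b1 b2 b3)^-1].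
Proof.
set d := det3 _ _ _ => d0.
exists ((cross3 b2 b3).1.1 / d, (cross3 b3 b1).1.1 / d, (cross3 b1 b2).1.1 / d).
exists ((cross3 b2 b3).1.2 / d, (cross3 b3 b1).1.2 / d, (cross3 b1 b2).1.2 / d).
exists ((cross3 b2 b3).2 / d, (cross3 b3 b1).2 / d, (cross3 b1 b2).2 / d).
move: d0; rewrite /d; case: b1 b2 b3 {d} => [[a b] c] [[a' b'] c'] [[a'' b''] c''].
rewrite /lin3/det3/dot3/cross3/= => d0.
split.
- by move=> [[x y] z] /=; congr (_, _, _); field.
- by move=> [[x y] z] /=; congr (_, _, _); field.
- by field.
Qed.

Lemma leb3_lin_image (b1 b2 b3 : R3) (K : set R3) : det3 b1 b2 b3 != 0 ->
  mble3 R K -> leb3 (lin3 b1 b2 b3 @` K) = (`|det3 b1 b2 b3|%:E * leb3 K)%E.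
Proof.
move=> d0 mK; have [c1 [c2 [c3 [bc cb dc]]]] := lin3_inverse d0.
have -> : lin3 b1 b2 b3 @` K = lin3 c1 c2 c3 @^-1` K.
  apply/seteqP; split => [_ [x Kx <-]|x Kx] /=; first by rewrite bc.
  by exists (lin3 c1 c2 c3 x).
rewrite -(@leb3_lin _ c1 c2 c3 K)//; last by rewrite dc invr_eq0.
rewrite muleA dc normfV -EFinM divff ?mul1e// normr_eq0//.
Qed.

(* The change of variables [psi = A o phi o B^-1] reduces this to [leb3_expand]. *)
Lemma leb3_expand_lin (K : set R3) (phi : R3 -> R3) (a1 a2 a3 b1 b2 b3 : R3) :
  compact K -> continuous phi -> det3 a1 a2 a3 != 0 -> det3 b1 b2 b3 != 0 ->
  (forall x y, K x -> K y -> `|lin3 b1 b2 b3 (x - y)| <= `|lin3 a1 a2 a3 (phi x - phi y)|) ->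
  (`|det3 b1 b2 b3|%:E * leb3 K <= `|det3 a1 a2 a3|%:E * leb3 (phi @` K))%E.
Proof.
move=> cK cphi a0 b0 H.
have [c1 [c2 [c3 [bc _ _]]]] := lin3_inverse b0.
rewrite -!leb3_lin_image//; last 2 first.
- by apply: compact3_measurable; exact: compact3_image.
- exact: compact3_measurable.
pose psi := lin3 a1 a2 a3 \o phi \o lin3 c1 c2 c3.
have -> : lin3 a1 a2 a3 @` (phi @` K) = psi @` (lin3 b1 b2 b3 @` K).
  apply/seteqP; split => [_ [_ [x Kx <-] <-]|_ [_ [x Kx <-] <-]].
    by exists (lin3 b1 b2 b3 x); [exists x|rewrite /psi/= bc].
  by exists (phi x); [exists x|rewrite /psi/= bc].
apply: leb3_expand.
- by apply: compact3_image => //; exact: lin3_continuous.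
- move=> x; apply: continuous_comp; first exact: lin3_continuous.
  by apply: continuous_comp; [exact: cphi|exact: lin3_continuous].
- move=> _ _ [x Kx <-] [y Ky <-]; rewrite /psi/= !bc -!lin3B.
  exact: H.
Qed.

End Space.

(** * Integral inequalities for images under locally expanding maps *)

Section ChangeOfVariables.
Variable R : realType.
Notation R3 := (R * R * R)%type.
Notation mu := (@leb3 R).
Notation int chi A := (\int[mu]_(x in A) (chi x)%:E)%E.

Lemma lebesgue_subsingleton (A : set R) :
  (forall x y, A x -> A y -> x = y) -> leb R A = 0%E.
Proof.
move=> AA; have [[a Aa]|A0] := pselect (A !=set0).
  have -> : A = [set a] by apply/seteqP; split => [x Ax|_ ->//]; exact: AA.
  exact: lebesgue_measure_set1.
have -> : A = set0 by apply/seteqP; split => // x Ax; case: A0; exists x.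
exact: (measure0 (leb R)).
Qed.

(* By Fubini, after a linear change of variables sending [e3] to [u]. *)
Lemma leb3_line_null (K : set R3) (u : R * R) : u != 0 -> mble3 R K ->
  (forall x y r, K x -> K y -> x - y = (r * u.1, r * u.2, 0) -> x = y) ->
  leb3 K = 0%E.
Proof.
move=> u0 mK H.
have key (r1 r2 r3 : R3) : det3 r1 r2 r3 != 0 ->
    (r1.2, r2.2, r3.2) = (u.1, u.2, 0) -> leb3 K = 0%E.
  move=> d0 E; rewrite -(leb3_lin d0 mK) leb3E integral0_eq ?mule0// => p _.
  apply: lebesgue_subsingleton => x y /= Kx Ky.
  have /H := Kx => /(_ _ (x - y) Ky); rewrite -lin3B.
  have -> : ((p, x) - (p, y) : R3) = (0, 0, x - y).
    by case: p {Kx Ky} => a b; congr (_, _, _) => /=; ring.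
  have lE t : lin3 r1 r2 r3 (0, 0, t) = (t * u.1, t * u.2, 0).
    by case: E => E1 E2 E3; rewrite /lin3/dot3/= E1 E2 E3; congr (_, _, _); ring.
  rewrite lE => /(_ erefl)/eqP; rewrite -subr_eq0 -lin3B.
  have -> : ((p, x) - (p, y) : R3) = (0, 0, x - y).
    by case: p {Kx Ky} => a b; congr (_, _, _) => /=; ring.
  rewrite lE => /eqP[/eqP + /eqP +]; rewrite !mulf_eq0 subr_eq0.
  case: (eqVneq x y) => //= _ /eqP u1 /eqP u2.
  by case/eqP: u0; case: u u1 u2 {H E lE} => /= ? ? -> ->.
have [u1|u1] := eqVneq u.1 0.
  apply: (@key (1, 0, u.1) (0, 0, u.2) (0, 1, 0)) => //.
  rewrite /det3/dot3/cross3/= u1; apply: contra u0.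
  rewrite !(mul0r, mulr0, mul1r, mulr1, add0r, addr0, subr0, sub0r) oppr_eq0 => /eqP u2.
  by apply/eqP; case: u u1 u2 {H key} => /= ? ? -> ->.
apply: (@key (0, 0, u.1) (1, 0, u.2) (0, 1, 0)) => //.
rewrite /det3/dot3/cross3/=.
by rewrite !(mul0r, mulr0, mul1r, mulr1, add0r, addr0, subr0, sub0r).
Qed.

(** The [n]-th set keeps distance at least [1 / (n + 1)] from [B]. This reduces disjoint pieces to
    compact sets, whose continuous images are measurable. *)
Lemma compact3_diff (A B : set R3) : compact A -> compact B ->
  exists K : nat -> set R3, [/\ forall n, compact (K n), nondecreasing_seq K &
    A `\` B = \bigcup_n K n].
Proof.
move=> cA cB.
exists (fun n => A `&` [set x | forall y, B y -> n.+1%:R^-1 <= `|x - y|]); split.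
- move=> n; apply: (subclosed_compact _ cA); last exact: subIsetl.
  apply: closedI; first exact: compact3_closed.
  rewrite (_ : mkset _ = \bigcap_(y in B) [set x | n.+1%:R^-1 <= `|x - y|]); last first.
    by apply/seteqP; split.
  apply: closed_bigI => y _.
  apply: (@preimage_closed _ _ (fun x : R3 => `|x - y|) [set t | n.+1%:R^-1 <= t]).
    move=> x _; apply: cvg_norm; apply: cvgB; [exact: cvg_id|exact: cvg_cst].
  exact: closed_ge.
- move=> n m nm; apply/subsetPset => x [Ax H]; split => // y /H.
  by apply: le_trans; rewrite lef_pV2 ?posrE ?ltr0n// ler_nat.
- apply/seteqP; split => [x [Ax Bx]|x [n _ [Ax H]]]; last first.
    by split => // /H; rewrite subrr normr0 leNgt invr_gt0 ltr0n.
  have /closed_openC/open3P/(_ _ Bx)[e e0 eB] := compact3_closed cB.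
  exists (Num.truncn e^-1) => //; split => // y By.
  rewrite leNgt; apply/negP => xy; apply: (eB y) => //; apply: lt_trans xy _.
  rewrite invf_plt ?posrE ?ltr0n//; exact: truncnS_gt.
Qed.

Lemma int_mono (chi : R3 -> R) (A B : set R3) : measurable_fun setT (chi : mR R * mR R * mR R -> R) ->
  (forall x, 0 <= chi x) -> mble3 R A -> mble3 R B -> A `<=` B ->
  (int chi A <= int chi B)%E.
Proof.
move=> mchi chi0 mA mB AB; apply: ge0_subset_integral => //.
- by apply: measurable_funTS; apply/measurable_EFinP.
- by move=> x _; rewrite lee_fin.
Qed.

(* The countably many pieces are made disjoint; each then is an increasing union
   of compact sets. *)
Lemma int_image_ge (E Z : set R3) (g : R3 -> R3) (chi psi : R3 -> R) (F : nat -> set R3) :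
  compact E -> continuous g ->
  measurable_fun setT (chi : mR R * mR R * mR R -> R) -> (forall x, 0 <= chi x) ->
  measurable_fun setT (psi : mR R * mR R * mR R -> R) -> (forall x, 0 <= psi x) ->
  (forall n, compact (F n)) -> (forall n, F n `<=` E) ->
  mu (E `\` \bigcup_n F n) = 0%E ->
  (forall n m x y, F n x -> F m y -> g x = g y -> x = y) ->
  (forall n K, compact K -> K `<=` F n -> (int psi K <= int chi (g @` K))%E) ->
  (int psi E <= int chi (g @` E))%E.
Proof.
move=> cE cg mchi chi0 mpsi psi0 cF FE NE inj H.
have mpsi' A : measurable_fun A (fun x : mR R * mR R * mR R => (psi x)%:E).
  by apply: measurable_funTS; apply/measurable_EFinP.
have mchi' A : measurable_fun A (fun x : mR R * mR R * mR R => (chi x)%:E).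
  by apply: measurable_funTS; apply/measurable_EFinP.
pose D n := seqDU F n.
have /choice[K HK] n : exists K : nat -> set R3, [/\ forall n, compact (K n),
    nondecreasing_seq K & D n = \bigcup_n K n].
  by apply: compact3_diff => //; apply: bigsetU_compact => i _; exact: cF.
have mK n r : mble3 R (K n r) by have [/(_ r)/compact3_measurable] := HK n.
have mgK n r : mble3 R (g @` K n r).
  by have [/(_ r)/(compact3_image cg)/compact3_measurable] := HK n.
have mD n : mble3 R (D n).
  by have [_ _ ->] := HK n; apply: bigcupT_measurable => r; exact: mK.
have mgD n : mble3 R (g @` D n).
  have [_ _ ->] := HK n; rewrite image_bigcup.
  by apply: bigcupT_measurable => r; exact: mgK.
have DF n : D n `<=` F n by move=> x [].
have step n : (int psi (D n) <= int chi (g @` D n))%E.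
  have [cK ndK DK] := HK n.
  have cv : int psi (K n r) @[r --> \oo] --> int psi (D n).
    rewrite DK; apply: ge0_nondecreasing_set_cvg_integral => //.
    by move=> r x _; rewrite lee_fin.
  rewrite -(cvg_lim _ cv)//; apply: lime_le; first by apply/cvg_ex; eexists; exact: cv.
  apply: nearW => r; apply: (@le_trans _ _ (int chi (g @` K n r))).
    by apply: (H n) => // x Kx; apply: DF; rewrite DK; exists r.
  apply: int_mono => //; apply: image_subset => x Kx; rewrite DK; by exists r.
have mE := compact3_measurable cE.
have mUF : mble3 R (\bigcup_n F n).
  by apply: bigcupT_measurable => n; exact: compact3_measurable.
have UFE : \bigcup_n F n `<=` E by move=> x [n _ /FE].
have -> : int psi E = int psi (\bigcup_n D n).
  rewrite -seqDU_bigcup_eq.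
  rewrite -{1}(setDUK UFE) ge0_integral_setU//; first last.
  - by apply/disj_setPS => x [Fx [_]].
  - by move=> x _; rewrite lee_fin.
  - exact: measurableD.
  rewrite [X in (_ + X)%E](_ : _ = 0%E) ?adde0//.
  by apply: null_set_integral => //; exact: measurableD.
have -> : int psi (\bigcup_n D n) = (\sum_(0 <= i <oo) int psi (D i))%E.
  apply: ge0_integral_bigcup => //; last exact: trivIset_seqDU.
  by move=> x _; rewrite lee_fin.
apply: (@le_trans _ _ (\sum_(0 <= i <oo) int chi (g @` D i))%E).
  apply: lee_nneseries => [n *|n *]; last exact: step.
  by apply: integral_ge0 => x _; rewrite lee_fin.
have <- : int chi (\bigcup_n (g @` D n)) = (\sum_(0 <= i <oo) int chi (g @` D i))%E.
  apply: ge0_integral_bigcup => //; first by move=> x _; rewrite lee_fin.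
  apply/trivIsetP => i j _ _ ij; apply/seteqP; split => // y [[x Dx <-] [x' Dx' xx']].
  have := inj _ _ _ _ (DF _ _ Dx') (DF _ _ Dx) xx' => E'; rewrite E' in Dx'.
  have /trivIsetP/(_ _ _ I I ij)/seteqP[/(_ x)] := trivIset_seqDU F.
  by move=> /(_ (conj Dx Dx')).
apply: int_mono => //.
- by apply: bigcupT_measurable => n; exact: mgD.
- by apply: compact3_measurable; exact: compact3_image.
- by move=> y [n _ [x /DF/FE Ex <-]]; exists x.
Qed.

Lemma int_cst (c : R) (A : set R3) : mble3 R A ->
  (\int[mu]_(x in A) c%:E = c%:E * mu A)%E.
Proof. by move=> mA; rewrite -(integral_cst mu mA). Qed.

Lemma rat_triple_near (x : R3) (r : R) : 0 < r ->
  exists q : rat * rat * rat, `|x - (ratr q.1.1, ratr q.1.2, ratr q.2)| < r.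
Proof.
move=> r0; have lt2 (y : R) : y - r < y + r by lra.
have [q1] := rat_in_itvoo (lt2 x.1.1); rewrite in_itv/= => /andP[q11 q12].
have [q2] := rat_in_itvoo (lt2 x.1.2); rewrite in_itv/= => /andP[q21 q22].
have [q3] := rat_in_itvoo (lt2 x.2); rewrite in_itv/= => /andP[q31 q32].
exists (q1, q2, q3); rewrite norm_lt3/= !ltr_norml; apply/and3P; split; lra.
Qed.

(** Near a point off [N] the functions [psi] and [chi \o g] are almost constant and the volume
    factor is almost [J], so the strict inequality between [psi] and [chi (g x) * J x] can be
    integrated over small pieces. Cutting the sets [Q j] by rational cubes leaves countably many
    such pieces. *)
Lemma int_image_ge_local (E N Z : set R3) (g : R3 -> R3) (chi psi J : R3 -> R)
    (Q : nat -> set R3) :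
  compact E -> continuous g ->
  measurable_fun setT (chi : mR R * mR R * mR R -> R) -> (forall x, 0 <= chi x) ->
  measurable_fun setT (psi : mR R * mR R * mR R -> R) -> (forall x, 0 <= psi x) ->
  (forall j, closed (Q j)) -> closed Z -> mble3 R N -> mu N = 0%E ->
  (forall x y, E x -> E y -> ~ Z x -> ~ Z y -> g x = g y -> x = y) ->
  (forall x, E x -> ~ N x -> [/\ {for x, continuous psi}, {for g x, continuous chi},
     0 < J x, psi x < chi (g x) * J x & ~ Z x]) ->
  (forall x eta, E x -> ~ N x -> 0 < eta < J x -> exists j, Q j x /\
     exists2 d, 0 < d & forall K, compact K -> K `<=` E -> K `<=` Q j ->
       (forall y, K y -> `|x - y| < d) -> (eta%:E * mu K <= mu (g @` K))%E) ->
  (int psi E <= int chi (g @` E))%E.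
Proof.
move=> cE cg mchi chi0 mpsi psi0 cQ cZ mN N0 inj HE loc.
(* The inequality is required on all compact subsets, because the pieces are later cut up to become
   disjoint. *)
pose good (P : set R3) := (forall K, compact K -> K `<=` P ->
  (int psi K <= int chi (g @` K))%E) /\ P `&` Z = set0.
pose cbox (c : rat * rat * rat) (r : rat) : set R3 :=
  [set x | `|x - (ratr c.1.1, ratr c.1.2, ratr c.2)| <= ratr r].
have ccbox c r : closed (cbox c r).
  apply: (@preimage_closed _ _ (fun x : R3 => `|x - (ratr c.1.1, ratr c.1.2, ratr c.2)|) [set t | t <= ratr r]).
    move=> x _; apply: cvg_norm; apply: cvgB; [exact: cvg_id|exact: cvg_cst].
  exact: closed_le.
pose P (i : nat * (rat * rat * rat) * rat) := E `&` (Q i.1.1 `&` cbox i.1.2 i.2).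
have cP i : compact (P i).
  apply: (subclosed_compact _ cE); last exact: subIsetl.
  apply: closedI; first exact: compact3_closed.
  by apply: closedI.
pose F n : set R3 := if pickle_inv n is Some i then
  if `[< good (P i) >] then P i else set0 else set0.
have FE n : F n `<=` E.
  by rewrite /F; case: pickle_inv => // i; case: asboolP => // _ x [].
have FZ n x : F n x -> ~ Z x.
  rewrite /F; case: pickle_inv => // i; case: asboolP => // -[_ /seteqP[PZ _]] Px Zx.
  exact: (PZ x).
apply: (@int_image_ge _ Z _ _ _ F) => //.
- move=> n; rewrite /F; case: pickle_inv => [i|]; last exact: compact0.
  by case: asboolP => _; [exact: cP|exact: compact0].
- apply: (@subset_measure0 _ _ _ mu _ N) => //.
    apply: measurableD; first exact: compact3_measurable.
    apply: bigcupT_measurable => n; rewrite /F; case: pickle_inv => [i|]; last exact: measurable0.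
    by case: asboolP => _; [exact: (compact3_measurable (cP i))|exact: measurable0].
  move=> x [Ex]; apply: contra_notP => Nx.
  have [cpsi cchi J0 lt Zx] := HE _ Ex Nx.
  set c := chi (g x) in lt *.
  have c0 : 0 < c.
    rewrite lt_neqAle chi0 andbT; apply/eqP => c0.
    by have := psi0 x; rewrite leNgt => /negP; apply; rewrite (lt_le_trans lt)// -c0 mul0r.
  have cJ0 : 0 < c * J x by exact: mulr_gt0.
  (* The gap between [rho] and 1 is shared: [chi] and [J] may each lose the factor [t], and the mean
     [t] of 1 and [rho] satisfies [t ^ 2 > rho]. *)
  pose rho := psi x / (c * J x).
  have rho1 : rho < 1 by rewrite /rho ltr_pdivrMr// mul1r.
  have rho0 : 0 <= rho by rewrite /rho divr_ge0// ltW.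
  pose t := (1 + rho) / 2.
  have t1 : t < 1 by rewrite /t; lra.
  have t0 : 0 < t by rewrite /t; lra.
  have rt : rho < t ^+ 2 by rewrite /t expr2; nra.
  have psit : psi x < (c * t) * (J x * t).
    have -> : psi x = rho * (c * J x) by rewrite /rho divfK// gt_eqF.
    have -> : c * t * (J x * t) = t ^+ 2 * (c * J x) by ring.
    by rewrite ltr_pM2r.
  have [|j [Qj [d d0 H]]] := loc x (J x * t) Ex Nx.
    by rewrite mulr_gt0//= gtr_pMr.
  have : \forall y \near x, [/\ psi y <= (c * t) * (J x * t), c * t <= chi (g y), `|x - y| < d & ~ Z y].
    near=> y; split.
    - apply: ltW; near: y; apply: (@cvgr_lt _ _ _ _ psi (psi x)) => //.
    - apply: ltW; near: y; apply: (@cvgr_gt _ _ _ _ (chi \o g) (chi (g x))); last by rewrite gtr_pMr.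
      by apply: continuous_comp; [exact: cg|exact: cchi].
    - by near: y; apply/nbhs3P; exists d.
    - by near: y; apply: open_nbhs_nbhs; split => //; exact: closed_openC.
  move=> /nbhs3P[e e0 He].
  have [r] := rat_in_itvoo (divr_gt0 e0 (@ltr0n R 2)); rewrite in_itv/= => /andP[r0 re].
  have [q xq] := rat_triple_near x r0.
  have Pe y : P (j, q, r) y -> `|x - y| < e.
    move=> [_ [_]]; rewrite /cbox/= => yq.
    rewrite (le_lt_trans (ler_distD (ratr q.1.1, ratr q.1.2, ratr q.2) _ _))//.
    by rewrite [X in _ + X]distrC; move: xq yq; clear - r0 re; lra.
  exists (pickle (j, q, r)); first exact: I.
  rewrite /F pickleK_inv; case: asboolP; last first.
    case; split; last first.
      by apply/seteqP; split => // y [/Pe/He[]].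
    move=> K cK KP; have mK := compact3_measurable cK.
    have mgK := compact3_measurable (compact3_image cg cK).
    have Kd y : K y -> `|x - y| < d by move=> /KP/Pe/He[].
    apply: (@le_trans _ _ ((c * t)%:E * mu (g @` K))%E); last first.
      rewrite -int_cst//; apply: ge0_le_integral => //.
      + by move=> y _; rewrite lee_fin mulr_ge0// ltW.
      + by apply: measurable_funTS; apply/measurable_EFinP.
      + by move=> _ [y /KP/Pe/He[] ? ? ? ? <-]; rewrite lee_fin.
    apply: (@le_trans _ _ (((c * t) * (J x * t))%:E * mu K)%E).
      rewrite -int_cst//; apply: ge0_le_integral => //.
      + by move=> y _; rewrite lee_fin.
      + by apply: measurable_funTS; apply/measurable_EFinP.
      + by move=> y /KP/Pe/He[] ? ? ? ?; rewrite lee_fin.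
    rewrite EFinM -muleA lee_pmul2l//; last by rewrite lte_fin mulr_gt0.
    apply: H => //.
    + by move=> y /KP[].
    + by move=> y /KP[_ []].
  move=> _; split => //; split => //.
  by rewrite /cbox/= ltW.
- by move=> n m x y Fx Fy; apply: inj; [exact: FE Fx|exact: FE Fy|exact: FZ Fx|exact: FZ Fy].
- move=> n K cK; rewrite /F; case: pickle_inv => [i|]; last first.
    by rewrite subset0 => ->; rewrite image_set0 !integral_set0.
  case: asboolP => [[+ _]|_]; first exact.
  by rewrite subset0 => ->; rewrite image_set0 !integral_set0.
Unshelve. all: by end_near.
Qed.

End ChangeOfVariables.

(** * The Zorich map in rescaled coordinates *)

Section Chart.
Variable R : realType.
Notation R3 := (R * R * R)%type.

(** The hypotheses in the form used below. [sn] is the sine of the angle bound; the angle condition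
    is squared, which makes it a strengthened Cauchy-Schwarz inequality, and [lam_gt] is the bound
    on [lam] cleared of denominators. *)
Record chart (h : R * R -> R3) (L sn eps m lam : R) : Prop := Chart {
  L_gt0 : 0 < L;
  L_sq : 2 <= L ^+ 2;
  h_lower : forall a b, inQ a -> inQ b ->
    norm2 (sub2 a b) <= L * norm3 (sub3 (h a) (h b));
  h_upper : forall a b, inQ a -> inQ b ->
    norm3 (sub3 (h a) (h b)) <= L * norm2 (sub2 a b);
  h_pd : {ae (@leb2 R), forall x, inQ x ->
    [/\ pd_ex (comp1 h) x, pd_ex (comp2 h) x & pd_ex (comp3 h) x]};
  h3_ge0 : forall x, inQ x -> 0 <= (h x).2;
  h3_bd : forall x, on_bdQ x -> (h x).2 = 0;
  h_rays : forall x y t, inQ x -> inQ y -> 0 <= t ->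
     h y = scale3 t (h x) -> h y = h x;
  sn_gt0 : 0 < sn;
  sn_lt1 : sn < 1;
  eps_gt0 : 0 < eps;
  h_nontangent : forall a b, inQ a -> inQ b -> norm3 (sub3 (h a) (h b)) <= eps ->
    dot3 (h b) (sub3 (h a) (h b)) ^+ 2 <=
    (1 - sn ^+ 2) * dot3 (h b) (h b) * dot3 (sub3 (h a) (h b)) (sub3 (h a) (h b));
  m_gt0 : 0 < m;
  m_le : forall x, inQ x -> m <= norm3 (h x);
  h_le1 : forall x, inQ x -> norm3 (h x) <= 1;
  h_diag1 : forall t, -1 <= t <= 1 -> (h (t, t)).1.1 = (h (t, t)).1.2;
  h_diag2 : forall t, -1 <= t <= 1 -> (h (t, - t)).1.1 = - (h (t, - t)).1.2;
  h00 : h (0, 0) = (0, 0, 1);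
  lam_gt : L ^+ 5 < lam * m * sn
}.

Lemma dot3_ge0 (x : R3) : 0 <= dot3 x x.
Proof. by rewrite /dot3 !addr_ge0// -expr2 sqr_ge0. Qed.

Lemma norm3_ge0 (x : R3) : 0 <= norm3 x. Proof. exact: sqrtr_ge0. Qed.
Lemma norm2_ge0 (x : R * R) : 0 <= norm2 x. Proof. exact: sqrtr_ge0. Qed.

Lemma norm3_sq (x : R3) : norm3 x ^+ 2 = dot3 x x.
Proof. by rewrite sqr_sqrtr// dot3_ge0. Qed.

Lemma norm2_sq (x : R * R) : norm2 x ^+ 2 = x.1 ^+ 2 + x.2 ^+ 2.
Proof. by rewrite sqr_sqrtr// addr_ge0// sqr_ge0. Qed.

Lemma norm3_le (x : R3) (r : R) : 0 <= r -> (norm3 x <= r) = (dot3 x x <= r ^+ 2).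
Proof. by move=> r0; rewrite -norm3_sq ler_pXn2r// nnegrE ?norm3_ge0. Qed.

Lemma norm2_le (x : R * R) (r : R) : 0 <= r ->
  (norm2 x <= r) = (x.1 ^+ 2 + x.2 ^+ 2 <= r ^+ 2).
Proof. by move=> r0; rewrite -norm2_sq ler_pXn2r// nnegrE ?norm2_ge0. Qed.

Lemma norm3_comp (x : R3) :
  [/\ `|x.1.1| <= norm3 x, `|x.1.2| <= norm3 x & `|x.2| <= norm3 x].
Proof.
have H (t : R) : t ^+ 2 <= dot3 x x -> `|t| <= norm3 x.
  move=> tx; rewrite -(@ler_pXn2r _ 2)// ?nnegrE ?norm3_ge0//.
  by rewrite norm3_sq real_normK// num_real.
by split; apply: H; rewrite /dot3 -!expr2; have := sqr_ge0 x.1.1;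
  have := sqr_ge0 x.1.2; have := sqr_ge0 x.2; lra.
Qed.

Lemma norm2_bound (x : R * R) (r : R) : `|x.1| <= r -> `|x.2| <= r ->
  norm2 x <= 2 * r.
Proof.
move=> x1 x2; have r0 := le_trans (normr_ge0 _) x1.
rewrite norm2_le ?mulr_ge0//.
move: x1 x2; rewrite !ler_norml => /andP[? ?] /andP[? ?]; nra.
Qed.

(** * The folding map of the line *)

Section Fold.

Lemma sgn_parS (i : int) : sgn_par R (i + 1) = - sgn_par R i.
Proof.
have E : odd `|i + 1| = ~~ odd `|i|.
  case: i => [n|n]; first by rewrite -PoszD addn1.
  have -> : Negz n + 1 = - n%:Z by rewrite NegzE -addn1 PoszD opprD subrK.
  by rewrite abszN NegzE abszN /= negbK.
by rewrite /sgn_par E; case: (odd _) => //=; rewrite opprK.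
Qed.

Lemma sgn_parN (i : int) : sgn_par R (- i) = sgn_par R i.
Proof. by rewrite /sgn_par abszN. Qed.

Lemma sgn_par_cases (i : int) : sgn_par R i = 1 \/ sgn_par R i = -1.
Proof. by rewrite /sgn_par; case: (odd _); [right|left]. Qed.

Lemma strip_bounds (s : R) : (2 * (strip 1 s)%:~R - 1 <= s < 2 * (strip 1 s)%:~R + 1).
Proof.
rewrite /strip mulr1; have := floor_itv ((s + 1) / 2); rewrite intrD.
by move: (_%:~R) => k; lra.
Qed.

Lemma strip_eq (i : int) (s : R) : 2 * i%:~R - 1 <= s < 2 * i%:~R + 1 -> strip 1 s = i.
Proof. by move=> si; apply: floor_def; rewrite intrD mulr1; lra. Qed.

(** Strips are half-open, so the right end [2 i + 1] is computed with the index [i + 1]. Both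
    formulas agree there, which makes closed strips available. *)
Lemma fold_beam (i : int) (s : R) : 2 * i%:~R - 1 <= s <= 2 * i%:~R + 1 ->
  fold 1 s = sgn_par R i * (s - 2 * i%:~R).
Proof.
move=> /andP[s1]; rewrite le_eqVlt => /predU1P[->|s2]; last first.
  by rewrite /fold (@strip_eq i) ?mulr1// s1.
rewrite /fold (@strip_eq (i + 1)) ?intrD; last lra.
by rewrite sgn_parS mulr1; ring.
Qed.

Lemma fold_bounds (s : R) : -1 <= fold 1 s <= 1.
Proof.
have sb := strip_bounds s; rewrite (@fold_beam (strip 1 s)); last lra.
by case: (sgn_par_cases (strip 1 s)) => ->; move: sb; move: (_%:~R) => k; lra.
Qed.

(** On one strip [fold] is an isometry; for adjacent strips the common wall lies between the points;
    otherwise the points are at least 2 apart, the diameter of the range. *)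
Lemma fold_lip (s t : R) : `|fold 1 s - fold 1 t| <= `|s - t|.
Proof.
wlog st : s t / strip 1 s <= strip 1 t.
  move=> H; case: (leP (strip 1 s) (strip 1 t)) => [|/ltW] /H //.
  by rewrite distrC [leRHS]distrC.
have sb := strip_bounds s; have tb := strip_bounds t.
have := fold_bounds s; have := fold_bounds t.
move: st; rewrite le_eqVlt => /predU1P[E _ _|].
  rewrite (@fold_beam (strip 1 s) s); last lra.
  rewrite E (@fold_beam (strip 1 t) t); last lra.
  set sg := sgn_par R _; rewrite [X in `|X|](_ : _ = sg * (s - t)); last by ring.
  rewrite normrM /sg.
  by case: (sgn_par_cases (strip 1 t)) => ->; rewrite ?normrN normr1 mul1r.
rewrite -lezD1 le_eqVlt => /predU1P[E _ _|].
  rewrite (@fold_beam (strip 1 s) s); last lra.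
  rewrite (@fold_beam (strip 1 t) t); last lra.
  rewrite -E sgn_parS intrD; move: sb tb; rewrite -E intrD; move: (strip 1 s)%:~R => k.
  move=> ? ?; have -> : `|s - t| = t - s by rewrite distrC ger0_norm//; lra.
  by case: (sgn_par_cases (strip 1 s)) => ->; rewrite ler_norml; lra.
rewrite -lezD1 -(ler_int R) !intrD => st fs ft.
have -> : `|s - t| = t - s by rewrite distrC ger0_norm//; lra.
by rewrite ler_norml; lra.
Qed.

Lemma fold_id (s : R) : -1 <= s <= 1 -> fold 1 s = s.
Proof.
move=> sb; rewrite (@fold_beam 0) ?mulr0 ?subr0; last lra.
by rewrite /sgn_par/= mul1r.
Qed.

Lemma fold_norm (s : R) : `|fold 1 s| <= `|s|.
Proof. by have := fold_lip s 0; rewrite (@fold_id 0) ?subr0//; lra. Qed.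

End Fold.

Section Map.
Variables (h : R * R -> R3) (lam : R).

(** The central beam with horizontal coordinates divided by [lam] in domain and range. Height is not
    rescaled, so [lam] survives in the third component alone. *)
Definition zup (v : R * R) (z : R) : R3 :=
  (expR z * (h v).1.1, expR z * (h v).1.2, expR z * (lam * (h v).2)).

Definition refl3 (s : R) (y : R3) : R3 := (y.1.1, y.1.2, s * y.2).

Definition fold2 (x : R3) : R * R := (fold 1 x.1.1, fold 1 x.1.2).

Definition sgn2 (x : R3) : R := sgn_par R (strip 1 x.1.1) * sgn_par R (strip 1 x.1.2).

Definition zmap (x : R3) : R3 := refl3 (sgn2 x) (zup (fold2 x) x.2).

Lemma fold2_Q x : inQ (fold2 x).
Proof. by split; exact: fold_bounds. Qed.

Lemma zorich_zmap (x : R3) : lam != 0 ->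
  zorich h lam (lam * x.1.1, lam * x.1.2, x.2) =
  (lam * (zmap x).1.1, lam * (zmap x).1.2, (zmap x).2).
Proof.
move=> l0.
have sE (s : R) : strip lam (lam * s) = strip 1 s.
  by rewrite /strip; congr (Num.floor _); field.
have fE (s : R) : fold lam (lam * s) / lam = fold 1 s.
  by rewrite /fold sE; field.
rewrite /zorich/= !sE !fE /zmap /refl3 /zup /sgn2 /fold2/=.
by congr (_, _, _); ring.
Qed.

Definition in_beam (i j : int) (x : R3) : Prop :=
  2 * i%:~R - 1 <= x.1.1 <= 2 * i%:~R + 1 /\ 2 * j%:~R - 1 <= x.1.2 <= 2 * j%:~R + 1.

Definition beam_coord (i j : int) (x : R3) : R * R :=
  (sgn_par R i * (x.1.1 - 2 * i%:~R), sgn_par R j * (x.1.2 - 2 * j%:~R)).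

Lemma fold2_beam i j x : in_beam i j x -> fold2 x = beam_coord i j x.
Proof. by move=> [b1 b2]; rewrite /fold2 (fold_beam b1) (fold_beam b2). Qed.

Lemma in_beam_strip (x : R3) : in_beam (strip 1 x.1.1) (strip 1 x.1.2) x.
Proof. by split; have := strip_bounds x.1.1; have := strip_bounds x.1.2; lra. Qed.

Variables (L sn eps m : R).
Hypothesis H : chart h L sn eps m lam.

(** A point of the closed strip [i] with another index must be its right end, where [fold] has
    absolute value 1 and [h] is taken at the boundary of the square. *)
Lemma h3_edge (i : int) (s t : R) : 2 * i%:~R - 1 <= s <= 2 * i%:~R + 1 ->
  strip 1 s != i -> -1 <= t <= 1 ->
  (h (fold 1 s, t)).2 = 0 /\ (h (t, fold 1 s)).2 = 0.
Proof.
move=> si ns tb.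
have s1 : s = 2 * i%:~R + 1.
  case/andP: si => s1; rewrite le_eqVlt => /predU1P[//|s2].
  by case/eqP: ns; apply: strip_eq; rewrite s1.
have f1 : `|fold 1 s| = 1.
  rewrite (@fold_beam i)//.
  by rewrite s1 addrAC subrr add0r mulr1; case: (sgn_par_cases i) => ->; rewrite ?normrN normr1.
have fb := fold_bounds s.
by split; apply: (h3_bd H); split; [split|left|split|right].
Qed.

(** On a shared wall the index, hence the sign, may belong to the neighbouring beam; but there the
    third coordinate is 0, and either sign gives the same point. *)
Lemma zmap_beam i j x : in_beam i j x ->
  zmap x = refl3 (sgn_par R i * sgn_par R j) (zup (beam_coord i j x) x.2).
Proof.
move=> b; rewrite -(fold2_beam b) /zmap /refl3; congr (_, _, _) => /=.
case: b => b1 b2.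
have [E1|n1] := eqVneq (strip 1 x.1.1) i; last first.
  have [-> _] := h3_edge b1 n1 (fold_bounds x.1.2); ring.
have [E2|n2] := eqVneq (strip 1 x.1.2) j; last first.
  have [_ ->] := h3_edge b2 n2 (fold_bounds x.1.1); ring.
by rewrite /sgn2 E1 E2.
Qed.

End Map.
End Chart.

Section ChartFacts.
Variable R : realType.
Notation R3 := (R * R * R)%type.
Variables (h : R * R -> R3) (L sn eps m lam : R).
Hypothesis H : chart h L sn eps m lam.

Lemma L_ge1 : 1 <= L.
Proof. have := L_gt0 H; have := L_sq H; nra. Qed.

Lemma m_le1 : m <= 1.
Proof.
have q0 : inQ (0, 0 : R) by split => /=; rewrite lerN10 ler01.
exact: le_trans (m_le H q0) (h_le1 H q0).
Qed.

(** From [m * sn <= 1] and [L ^ 5 >= 4]. *)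
Lemma lam_ge4 : 4 < lam.
Proof.
have L2 := L_sq H; have m0 := m_gt0 H; have s0 := sn_gt0 H.
have s1 := sn_lt1 H; have m1 := m_le1; have lg := lam_gt H; have l1 := L_ge1.
have L5 : 4 <= L ^+ 5.
  have -> : L ^+ 5 = L ^+ 2 * L ^+ 2 * L by ring.
  have : 4 <= L ^+ 2 * L ^+ 2 by nra.
  by nra.
have ms0 : 0 < m * sn by exact: mulr_gt0.
have ms1 : m * sn <= 1 by rewrite -[leRHS]mulr1 ler_pM// ltW.
rewrite -mulrA in lg; nra.
Qed.

Lemma h_inj a b : inQ a -> inQ b -> h a = h b -> a = b.
Proof.
move=> qa qb E; have := h_lower H qa qb; rewrite E.
have -> : sub3 (h b) (h b) = (0, 0, 0) by rewrite /sub3 !subrr.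
rewrite [norm3 _](_ : _ = 0) ?mulr0; last first.
  by rewrite /norm3 /dot3/= mulr0 !addr0 sqrtr0.
rewrite norm2_le// => le0.
have := sqr_ge0 (sub2 a b).1; have := sqr_ge0 (sub2 a b).2 => s1 s2.
have /eqP : (sub2 a b).1 ^+ 2 = 0 by lra.
have /eqP : (sub2 a b).2 ^+ 2 = 0 by lra.
rewrite !sqrf_eq0 !subr_eq0 => /eqP e2 /eqP e1.
by case: a b e1 e2 {qa qb E le0 s1 s2} => [? ?] [? ?] /= -> ->.
Qed.

Lemma norm3_scale (c : R) (x : R3) : norm3 (scale3 c x) = `|c| * norm3 x.
Proof.
rewrite /norm3 -sqrtr_sqr -sqrtrM ?sqr_ge0//; congr Num.sqrt.
by rewrite /dot3/=; ring.
Qed.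

Lemma h_ray_eq a b t : inQ a -> inQ b -> 0 <= t -> h b = scale3 t (h a) ->
  a = b /\ t = 1.
Proof.
move=> qa qb t0 E; have E' := h_rays H qa qb t0 E.
have ab := h_inj qb qa E'; split => //.
have := norm3_scale t (h a); rewrite -E E' ger0_norm// => /eqP.
rewrite -[X in X == _]mul1r eq_sym -subr_eq0 -mulrBl mulf_eq0 subr_eq0.
case/orP => /eqP // n0; have := m_le H qa; have := m_gt0 H; lra.
Qed.

Lemma zup_inj v z v' z' : inQ v -> inQ v' -> zup h lam v z = zup h lam v' z' ->
  v = v' /\ z = z'.
Proof.
move=> qv qv'; rewrite /zup => -[E1 E2 E3].
have l0 : lam != 0 by have := lam_ge4; lra.
have e0 : expR z' != 0 by rewrite gt_eqF ?expR_gt0.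
have hE : h v' = scale3 (expR z / expR z') (h v).
  rewrite [LHS](_ : _ = ((h v').1.1, (h v').1.2, (h v').2)); last by case: (h v') => [[]].
  rewrite /scale3; congr (_, _, _).
  - by rewrite mulrAC E1 mulrC mulKf.
  - by rewrite mulrAC E2 mulrC mulKf.
  - apply: (mulfI e0); apply: (mulfI l0).
    have -> : lam * (expR z' * (h v').2) = expR z' * (lam * (h v').2) by ring.
    by rewrite -E3; field.
have [-> E] := h_ray_eq qv qv' (divr_ge0 (expR_ge0 _) (expR_ge0 _)) hE.
by split => //; apply: expR_inj; rewrite -[LHS](divfK e0) E mul1r.
Qed.

Lemma h_lip_sup a b : inQ a -> inQ b -> forall r, `|a.1 - b.1| <= r -> `|a.2 - b.2| <= r ->
  norm3 (sub3 (h a) (h b)) <= 2 * L * r.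
Proof.
move=> qa qb r r1 r2; apply: le_trans (h_upper H qa qb) _.
rewrite [leRHS](_ : _ = L * (2 * r)); last ring.
by apply: ler_wpM2l; [exact: ltW (L_gt0 H)|exact: norm2_bound].
Qed.

Lemma h_fold_lip (x y : R3) :
  norm3 (sub3 (h (fold2 x)) (h (fold2 y))) <= 2 * L * `|x - y|.
Proof.
apply: h_lip_sup; [exact: fold2_Q|exact: fold2_Q| |];
  apply: le_trans (fold_lip _ _) _; by have [] := norm_comp3 (x - y).
Qed.

Lemma lip_continuous (f : R3 -> R) (C : R) :
  (forall x y, `|f x - f y| <= C * `|x - y|) -> continuous f.
Proof.
move=> fC x; apply/cvgrPdist_lt => e e0; apply/nbhs3P.
have C0 : 0 < `|C| + 1 by rewrite ltr_wpDl.
exists (e / (`|C| + 1)); first exact: divr_gt0.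
move=> y; rewrite ltr_pdivlMr// => xy.
apply: le_lt_trans (fC x y) _; apply: le_lt_trans xy.
by rewrite mulrC ler_wpM2l// (le_trans (ler_norm _))// lerDl.
Qed.

Lemma h_fold_continuous :
  [/\ continuous (fun x : R3 => (h (fold2 x)).1.1),
      continuous (fun x : R3 => (h (fold2 x)).1.2) &
      continuous (fun x : R3 => (h (fold2 x)).2)].
Proof.
split; apply: (@lip_continuous _ (2 * L)) => x y;
  by apply: le_trans (h_fold_lip x y); have [] := norm3_comp (sub3 (h (fold2 x)) (h (fold2 y))).
Qed.

Lemma h3_interior (x : R3) : (h (fold2 x)).2 != 0 ->
  2 * (strip 1 x.1.1)%:~R - 1 < x.1.1 < 2 * (strip 1 x.1.1)%:~R + 1 /\
  2 * (strip 1 x.1.2)%:~R - 1 < x.1.2 < 2 * (strip 1 x.1.2)%:~R + 1.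
Proof.
move=> h0; have [Q1 Q2] := fold2_Q x.
have sE (s : R) : s = 2 * (strip 1 s)%:~R - 1 -> `|fold 1 s| = 1.
  move=> E; have sb := strip_bounds s.
  rewrite (@fold_beam _ (strip 1 s)); last lra.
  rewrite {2}E addrAC subrr add0r normrM normrN normr1 mulr1.
  by case: (sgn_par_cases R (strip 1 s)) => ->; rewrite ?normrN normr1.
have := strip_bounds x.1.1; have := strip_bounds x.1.2.
rewrite ![in X in X -> _]le_eqVlt ![in X in _ -> X -> _]le_eqVlt.
move=> /andP[/predU1P[/esym/sE E|a2] ->].
  by case/eqP: h0; apply: (h3_bd H); split => //; right.
move=> /andP[/predU1P[/esym/sE E|a1] ->].
  by case/eqP: h0; apply: (h3_bd H); split => //; left.
by rewrite a1 a2.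
Qed.

Lemma sgn2_near (x : R3) : (h (fold2 x)).2 != 0 ->
  \forall y \near x, sgn2 y = sgn2 x.
Proof.
move=> /h3_interior; move: (strip 1 x.1.1) (strip 1 x.1.2) (erefl (sgn2 x)).
rewrite {1}/sgn2 => i j; have [c1 c2 _] := coord3_continuous R.
move=> + [/andP[i1 i2] /andP[j1 j2]].
have near1 : \forall y \near x, strip 1 y.1.1 = i.
  near=> y; apply: strip_eq; apply/andP; split; [apply: ltW|]; near: y.
  - exact: (cvgr_gt (f := fun y : R3 => y.1.1) x.1.1 (c1 x)).
  - exact: (cvgr_lt (f := fun y : R3 => y.1.1) x.1.1 (c1 x)).
have near2 : \forall y \near x, strip 1 y.1.2 = j.
  near=> y; apply: strip_eq; apply/andP; split; [apply: ltW|]; near: y.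
  - exact: (cvgr_gt (f := fun y : R3 => y.1.2) x.1.2 (c2 x)).
  - exact: (cvgr_lt (f := fun y : R3 => y.1.2) x.1.2 (c2 x)).
move=> _; rewrite /sgn2 (nbhs_singleton near1) (nbhs_singleton near2).
by near=> y; rewrite (near near1 y) ?(near near2 y).
Unshelve. all: by end_near.
Qed.

Lemma sgn2_norm (x : R3) : `|sgn2 x| = 1.
Proof.
rewrite /sgn2; case: (sgn_par_cases R (strip 1 x.1.1)) => ->;
  case: (sgn_par_cases R (strip 1 x.1.2)) => ->;
  by rewrite ?mulN1r ?mul1r ?opprK ?normrN ?normr1.
Qed.

(** Where the height of [h] is nonzero the sign is locally constant; where it vanishes, a quantity
    tending to 0 keeps this limit when multiplied by signs. *)
Lemma zmap_continuous : continuous (zmap h lam).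
Proof.
have [h1 h2 h3] := h_fold_continuous; have [_ _ c3] := coord3_continuous R.
have ce : continuous (fun x : R3 => expR x.2).
  by move=> x; apply: continuous_comp; [exact: c3|exact: continuous_expR].
apply: continuous_pair3 => x /=.
- by apply: cvgM; [exact: ce|exact: h1].
- by apply: cvgM; [exact: ce|exact: h2].
have [E|N] := eqVneq (h (fold2 x)).2 0; last first.
  have := sgn2_near N => sx.
  have : (fun y : R3 => sgn2 x * (expR y.2 * (lam * (h (fold2 y)).2))) @ x -->
      sgn2 x * (expR x.2 * (lam * (h (fold2 x)).2)).
    by apply: cvgM; [exact: cvg_cst|apply: cvgM; [exact: ce|apply: cvgM; [exact: cvg_cst|exact: h3]]].
  apply: cvg_trans; apply: near_eq_cvg; near=> y.
  by rewrite (near sx y).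
have k0 : (fun y : R3 => expR y.2 * (lam * (h (fold2 y)).2)) @ x --> 0.
  rewrite [X in _ --> X](_ : _ = expR x.2 * (lam * (h (fold2 x)).2)); last by rewrite E !mulr0.
  by apply: cvgM; [exact: ce|apply: cvgM; [exact: cvg_cst|exact: h3]].
suff : (fun y : R3 => sgn2 y * (expR y.2 * (lam * (h (fold2 y)).2))) @ x -->
    sgn2 x * (expR x.2 * (lam * (h (fold2 x)).2)) by [].
rewrite E !mulr0; apply/cvgrPdist_lt => e e0; near=> y.
have : `|0 - expR y.2 * (lam * (h (fold2 y)).2)| < e.
  by near: y; move/cvgrPdist_lt: k0; apply.
by rewrite !sub0r !normrN [X in _ -> X < _]normrM sgn2_norm mul1r.
Unshelve. all: by end_near.
Qed.

End ChartFacts.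

(** * Openness of the Zorich map *)

Section Sperner.
Variables (n : nat) (A B : nat -> nat -> bool).
Hypothesis A0 : forall j, (j <= n)%N -> A 0 j = false.
Hypothesis An : forall j, (j <= n)%N -> A n j = true.
Hypothesis B0 : forall i, (i <= n)%N -> B i 0 = false.
Hypothesis Bn : forall i, (i <= n)%N -> B i n = true.

(* Label [1] where [A], label [2] where [B] and not [A], label [0] elsewhere;
   [edge] detects the edges with labels [0] and [1]. *)
Let edge (a b a' b' : bool) :=
  [&& a (+) a', ~~ (~~ a && b) & ~~ (~~ a' && b')].
Let hor i j := edge (A i j) (B i j) (A i.+1 j) (B i.+1 j).
Let ver i j := edge (A i j) (B i j) (A i j.+1) (B i j.+1).
Let cell i j := (hor i j (+) hor i j.+1) (+) (ver i j (+) ver i.+1 j).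

Let telescope (f : nat -> bool) k :
  \big[addb/false]_(i < k) (f i (+) f i.+1) = f 0%N (+) f k.
Proof.
elim: k => [|k IH]; first by rewrite big_ord0 addbb.
by rewrite big_ord_recr /= IH; case: (f 0%N); case: (f k); case: (f k.+1).
Qed.

(** Double counting modulo 2. Interior edges cancel, the left, right and top sides have no edge
    between labels 0 and 1, and along the bottom, where [B] is false, the label changes an odd
    number of times. *)
Lemma sperner_cell : exists i j, [/\ (i < n)%N, (j < n)%N & cell i j].
Proof.
suff : \big[addb/false]_(i < n) \big[addb/false]_(j < n) cell i j.
  apply: contraPP => H; rewrite big1 // => i _; rewrite big1 // => j _.
  by apply/negP => cij; apply: H; exists i, j.
rewrite (eq_bigr (fun i : 'I_n => (hor i 0 (+) hor i n) (+)
    (\big[addb/false]_(j < n) ver i j (+) \big[addb/false]_(j < n) ver i.+1 j))); last first.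
  by move=> i _; rewrite big_split telescope; congr addb; rewrite big_split.
rewrite big_split (telescope (fun i => \big[addb/false]_(j < n) ver i j)) big_split.
rewrite (eq_bigr (fun i : 'I_n => A i 0 (+) A i.+1 0)); last first.
  move=> i _; rewrite /hor /edge !B0 ?andbF ?andbT //; exact: ltnW.
rewrite (telescope (fun i => A i 0)) A0 // An //.
rewrite big1; last first.
  move=> i _; rewrite /hor /edge !Bn //; last exact: ltnW.
  by case: (A i n); case: (A i.+1 n).
rewrite big1; last first.
  by move=> j _; rewrite /ver /edge !A0 //; exact: ltnW.
rewrite big1 //.
by move=> j _; rewrite /ver /edge !An //; exact: ltnW.
Qed.

(** If label 0 or 1 is missing from a square, it has no detected edge; if label 2 is missing, its
    boundary changes label an even number of times. So an odd square shows all three. *)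
Lemma sperner : exists i j, [/\ (i < n)%N, (j < n)%N &
  exists s t u : bool * bool,
   [/\ A (s.1 + i) (s.2 + j), ~~ A (t.1 + i) (t.2 + j), B (t.1 + i) (t.2 + j) &
       ~~ A (u.1 + i) (u.2 + j) && ~~ B (u.1 + i) (u.2 + j)] ].
Proof.
have [i [j [im jn cij]]] := sperner_cell; exists i, j; split => //.
have [s sA] : exists s : bool * bool, A (s.1 + i) (s.2 + j).
  apply: contrapT => N; have F (s1 s2 : bool) : A (s1 + i) (s2 + j) = false.
    by apply/negP => ?; apply: N; exists (s1, s2).
  have := F false false; have := F false true; have := F true false; have := F true true.
  rewrite /= !add0n !add1n => a1 a2 a3 a4.
  by move: cij; rewrite /cell /hor /ver /edge a1 a2 a3 a4.
have [t tA] : exists t : bool * bool, ~~ A (t.1 + i) (t.2 + j) && B (t.1 + i) (t.2 + j).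
  apply: contrapT => N; have F (s1 s2 : bool) : ~~ A (s1 + i) (s2 + j) && B (s1 + i) (s2 + j) = false.
    by apply/negP => ?; apply: N; exists (s1, s2).
  have := F false false; have := F false true; have := F true false; have := F true true.
  rewrite /= !add0n !add1n => a1 a2 a3 a4.
  move: cij; rewrite /cell /hor /ver /edge a1 a2 a3 a4 !andbT.
  by case: (A i j); case: (A i.+1 j); case: (A i j.+1); case: (A i.+1 j.+1).
have [u uA] : exists u : bool * bool, ~~ A (u.1 + i) (u.2 + j) && ~~ B (u.1 + i) (u.2 + j).
  apply: contrapT => N; have F (s1 s2 : bool) : ~~ A (s1 + i) (s2 + j) && ~~ B (s1 + i) (s2 + j) = false.
    by apply/negP => ?; apply: N; exists (s1, s2).
  have := F false false; have := F false true; have := F true false; have := F true true.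
  rewrite /= !add0n !add1n.
  move: cij; rewrite /cell /hor /ver /edge.
  by case: (A i j); case: (A i.+1 j); case: (A i j.+1); case: (A i.+1 j.+1);
     case: (B i j); case: (B i.+1 j); case: (B i j.+1); case: (B i.+1 j.+1).
exists s, t, u; split => //.
- by have /andP[] := tA.
- by have /andP[] := tA.
Qed.

End Sperner.

(** * The Poincare-Miranda theorem in the square *)

Section PoincareMiranda.
Variable R : realType.
Notation R3 := (R * R * R)%type.

(** Squares with all three labels in ever finer grids give approximate zeros. [fold2] extends the
    functions from the square to the whole space, and compactness of the unit ball then yields an
    exact zero. *)
Lemma poincare_miranda (G1 G2 : R * R -> R) (C : R) :
  (forall a b r, inQ a -> inQ b -> `|a.1 - b.1| <= r -> `|a.2 - b.2| <= r ->
     `|G1 a - G1 b| <= C * r /\ `|G2 a - G2 b| <= C * r) ->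
  (forall t, -1 <= t <= 1 ->
     [/\ G1 (-1, t) < 0, 0 < G1 (1, t), G2 (t, -1) < 0 & 0 < G2 (t, 1)]) ->
  exists x, [/\ inQ x, G1 x = 0 & G2 x = 0].
Proof.
move=> lipG side.
have C0 : 0 <= C.
  have q0 : inQ (0, 0 : R) by split => /=; rewrite lerN10 ler01.
  have H1 : `|0 - 0 : R| <= 1 by rewrite subrr normr0.
  have [+ _] := lipG _ _ 1 q0 q0 H1 H1; rewrite mulr1.
  exact: le_trans (normr_ge0 _).
pose phi (x : R3) := `|G1 (fold2 x)| + `|G2 (fold2 x)|.
have cphi : continuous phi.
  apply: (@lip_continuous _ _ (2 * C)) => x y.
  have [] := lipG (fold2 x) (fold2 y) `|x - y| (fold2_Q x) (fold2_Q y).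
  - by apply: le_trans (fold_lip _ _) _; have [] := norm_comp3 (x - y).
  - by apply: le_trans (fold_lip _ _) _; have [] := norm_comp3 (x - y).
  rewrite /phi; move: (G1 (fold2 x)) (G1 (fold2 y)) (G2 (fold2 x)) (G2 (fold2 y)) => a a' b b' d1 d2.
  have -> : `|a| + `|b| - (`|a'| + `|b'|) = (`|a| - `|a'|) + (`|b| - `|b'|) by ring.
  apply: le_trans (ler_normD _ _) _.
  by have := ler_dist_dist a a'; have := ler_dist_dist b b'; lra.
have small n : exists2 x : R3, phi x <= 3 * C * (2 / n.+1%:R) & `|x| <= 1.
  pose pt (i : nat) : R := -1 + 2 * i%:R / n.+1%:R.
  have n0 : 0 < n.+1%:R :> R by rewrite ltr0n.
  have pt0 : pt 0%N = -1 by rewrite /pt mulr0 mul0r addr0.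
  have ptn : pt n.+1 = 1 by rewrite /pt -mulrA divff ?mulr1 ?gt_eqF//; lra.
  have ptb i : (i <= n.+1)%N -> -1 <= pt i <= 1.
    move=> iN; have : 0 <= (i%:R / n.+1%:R : R) <= 1.
      by rewrite divr_ge0//= ler_pdivrMr// mul1r ler_nat.
    by rewrite /pt -mulrA; move: (i%:R / n.+1%:R) => t; lra.
  have ptd (s t : bool) i : `|pt (s + i)%N - pt (t + i)%N| <= 2 / n.+1%:R.
    rewrite /pt !natrD [X in `|X|](_ : _ = (s%:R - t%:R) * (2 / n.+1%:R)); last by ring.
    rewrite normrM [X in _ * X]ger0_norm; last by rewrite divr_ge0.
    rewrite -[leRHS]mul1r ler_wpM2r ?divr_ge0//.
    by case: s; case: t; rewrite ?subrr ?subr0 ?sub0r ?normrN ?normr1 ?normr0.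
  have [] := @sperner n.+1 (fun i j => 0 < G1 (pt i, pt j)) (fun i j => 0 < G2 (pt i, pt j)).
  - by move=> j /ptb jb; rewrite pt0; have [+ _ _ _] := side _ jb => ?; apply/negbTE; rewrite -leNgt ltW.
  - by move=> j /ptb jb; rewrite ptn; have [_ -> _ _] := side _ jb.
  - by move=> j /ptb jb; rewrite pt0; have [_ _ + _] := side _ jb => ?; apply/negbTE; rewrite -leNgt ltW.
  - by move=> j /ptb jb; rewrite ptn; have [_ _ _ ->] := side _ jb.
  move=> i [j [iN jN [s [t [u [sA tA tB /andP[uA uB]]]]]]].
  have q (b c : bool) : inQ (pt (b + i)%N, pt (c + j)%N).
    by split => /=; apply: ptb; rewrite (leq_trans (leq_add (leq_b1 _) (leqnn _))).
  have d (b c b' c' : bool) := lipG (pt (b + i)%N, pt (c + j)%N) (pt (b' + i)%N, pt (c' + j)%N)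
     (2 / n.+1%:R) (q b c) (q b' c') (ptd b b' i) (ptd c c' j).
  exists (pt (s.1 + i)%N, pt (s.2 + j)%N, 0); last first.
    have [/= q1 q2] := q s.1 s.2.
    by rewrite norm_le3 /= normr0 ler01 !ler_norml; apply/and3P.
  rewrite /phi /fold2 /= !fold_id; [|by have [] := q s.1 s.2|by have [] := q s.1 s.2].
  (* [G1] is positive at [s] but not at [t], so it is at most [e] at [s]. [G2] is positive at [t]
     but not at [u], so it is at most [e] at [t] and at most [2 e] in absolute value at [s]; the
     total is [3 e]. *)
  have [d1 d2] := d s.1 s.2 t.1 t.2; have [_ d3] := d t.1 t.2 u.1 u.2.
  move: sA tA tB uB d1 d2 d3; rewrite -!leNgt !ler_norml.
  set e := C * (2 / _); rewrite -mulrA -/e.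
  move=> ? ? ? ? ? ? ?.
  rewrite (ger0_norm (x := G1 _)); last exact: ltW.
  have : `|G2 (pt (s.1 + i)%N, pt (s.2 + j)%N)| <= 2 * e by rewrite ler_norml; lra.
  by lra.
have cS : compact (phi @` [set x | `|x| <= 1]).
  apply: continuous_compact; first exact: continuous_subspaceT.
  apply: (@bounded_closed3_compact _ _ 1) => //.
  apply: (@preimage_closed _ _ (fun x : R3 => `|x|) [set t | t <= 1]); last exact: closed_le.
  by move=> x _; apply: cvg_norm; exact: cvg_id.
have : (phi @` [set x | `|x| <= 1]) 0.
  apply: (compact_closed _ cS); first exact: norm_hausdorff.
  move=> A /nbhs_ballP[e /= e0 eA].
  have [n ne] : exists n : nat, 6 * C / n.+1%:R < e.
    exists (Num.truncn (e^-1 * (6 * C))); rewrite ltr_pdivrMr ?ltr0n// -ltr_pdivrMl//.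
    exact: truncnS_gt.
  have [x px x1] := small n; exists (phi x); split; first by exists x.
  apply: eA; rewrite /ball/= sub0r normrN ger0_norm ?addr_ge0//.
  by apply: le_lt_trans px _; apply: le_lt_trans ne; rewrite le_eqVlt; apply/orP; left; apply/eqP; ring.
move=> [x _ px]; exists (fold2 x); split; first exact: fold2_Q.
- by apply/eqP; rewrite -normr_eq0; have := normr_ge0 (G1 (fold2 x)); have := normr_ge0 (G2 (fold2 x)); move: px; rewrite /phi => ? ? ?; apply/eqP; lra.
- by apply/eqP; rewrite -normr_eq0; have := normr_ge0 (G1 (fold2 x)); have := normr_ge0 (G2 (fold2 x)); move: px; rewrite /phi => ? ? ?; apply/eqP; lra.
Qed.

End PoincareMiranda.

(** * Preimages of all nonzero points of the closed upper half-space *)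

Section Surjectivity.
Variable R : realType.
Notation R3 := (R * R * R)%type.
Variables (h : R * R -> R3) (L sn eps m lam : R).
Hypothesis H : chart h L sn eps m lam.

Let i1 : -1 <= (1 : R) <= 1. Proof. lra. Qed.
Let iN1 : -1 <= (-1 : R) <= 1. Proof. lra. Qed.

Lemma h_neq0 x : inQ x -> h x <> 0.
Proof.
move=> qx E; have := m_le H qx; rewrite E [norm3 _](_ : _ = 0); last first.
  by rewrite /norm3 /dot3/= mulr0 !addr0 sqrtr0.
by rewrite leNgt (m_gt0 H).
Qed.

Lemma pair3_eq (x y : R3) : x.1.1 = y.1.1 -> x.1.2 = y.1.2 -> x.2 = y.2 -> x = y.
Proof. by case: x y => [[? ?] ?] [[? ?] ?] /= -> -> ->. Qed.

Let a := (h (1, 1)).1.1.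
Let b := (h (-1, -1)).1.1.
Let c := (h (1, -1)).1.1.
Let d := (h (-1, 1)).1.1.
(** Coordinates along the two diagonals, signed to be positive at the images of [(1, 1)] and
    [(1, -1)] respectively. By the symmetry hypotheses every corner goes to a line where one of them
    vanishes. *)
Let al (y : R3) := a * (y.1.1 + y.1.2).
Let be (y : R3) := c * (y.1.1 - y.1.2).

Let bdx s t : -1 <= t <= 1 -> s = 1 \/ s = -1 -> on_bdQ (s, t : R).
Proof.
move=> tb st; have s1 : -1 <= s <= 1 by case: st => ->.
by split => //; left; case: st => -> /=; rewrite ?normrN normr1.
Qed.
Let bdy s t : -1 <= t <= 1 -> s = 1 \/ s = -1 -> on_bdQ (t, s : R).
Proof.
move=> tb st; have s1 : -1 <= s <= 1 by case: st => ->.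
by split => //; right; case: st => -> /=; rewrite ?normrN normr1.
Qed.

Let h11 : h (1, 1) = (a, a, 0).
Proof. by apply: pair3_eq => //=; [rewrite -(h_diag1 H i1)|apply: (h3_bd H); apply: bdx => //; left]. Qed.
Let hmm : h (-1, -1) = (b, b, 0).
Proof. by apply: pair3_eq => //=; [rewrite -(h_diag1 H iN1)|apply: (h3_bd H); apply: bdx => //; right]. Qed.
Let h1m : h (1, -1) = (c, - c, 0).
Proof.
by apply: pair3_eq => //=; [rewrite /c (h_diag2 H i1) opprK|apply: (h3_bd H); apply: bdx => //; left].
Qed.
Let hm1 : h (-1, 1) = (d, - d, 0).
Proof.
have := h_diag2 H iN1; rewrite opprK => E.
by apply: pair3_eq => //=; [rewrite /d E opprK|apply: (h3_bd H); apply: bdx => //; right].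
Qed.

Let q11 : inQ (1, 1 : R). Proof. by split. Qed.
Let q1m : inQ (1, -1 : R). Proof. by split. Qed.
Let qm1 : inQ (-1, 1 : R). Proof. by split. Qed.
Let qmm : inQ (-1, -1 : R). Proof. by split. Qed.

(** Coefficients of equal sign would put both images on one ray from 0, which meets the surface only
    once. *)
Let opp_sign (p q e : R) x y : inQ x -> inQ y -> h x = (p, e * p, 0) -> h y = (q, e * q, 0) ->
  x <> y -> p * q < 0.
Proof.
move=> qx qy hx hy xy.
have p0 : p != 0 by apply/eqP => p0; apply: (h_neq0 qx); rewrite hx p0 mulr0.
have q0 : q != 0 by apply/eqP => q0; apply: (h_neq0 qy); rewrite hy q0 mulr0.
rewrite ltNge; apply/negP => pq.
have t0 : 0 <= q / p.
  have -> : q / p = p * q / p ^+ 2 by field.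
  by rewrite divr_ge0// sqr_ge0.
apply: xy; have [] // := @h_ray_eq _ _ _ _ _ _ _ H x y (q / p) qx qy t0.
by rewrite hx hy /scale3/=; congr (_, _, _); field.
Qed.

Let ab : a * b < 0.
Proof.
apply: (@opp_sign _ _ 1 _ _ q11 qmm); rewrite ?mul1r//.
by case=> /eqP; lra.
Qed.
Let cd : c * d < 0.
Proof.
apply: (@opp_sign _ _ (-1) _ _ q1m qm1); rewrite ?mulN1r//.
by case=> /eqP; lra.
Qed.
Let a0 : a != 0. Proof. by apply/eqP => E; have := ab; rewrite E mul0r ltxx. Qed.
Let c0 : c != 0. Proof. by apply/eqP => E; have := cd; rewrite E mul0r ltxx. Qed.

(* Two nonzero vectors on a line through [0] one of whose rays meets [h x], the
   other [h y]: any other boundary point is off that line. *)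
Let line_bd (p q e : R) x y z : inQ x -> inQ y -> on_bdQ z ->
  h x = (p, e * p, 0) -> h y = (q, e * q, 0) -> p * q < 0 ->
  (h z).1.2 = e * (h z).1.1 -> z = x \/ z = y.
Proof.
move=> qx qy bz hx hy pq ze; set r := (h z).1.1 in ze.
have hz : h z = (r, e * r, 0) by apply: pair3_eq => //=; exact: (h3_bd H).
have [qz _] := bz.
have r0 : r != 0 by apply/eqP => r0; apply: (h_neq0 qz); rewrite hz r0 mulr0.
have key s w : inQ w -> h w = (s, e * s, 0) -> 0 < s * r -> z = w.
  move=> qw hw sr; have s0 : s != 0 by apply/eqP => E; rewrite E mul0r ltxx in sr.
  have t0 : 0 <= r / s.
    have -> : r / s = s * r / s ^+ 2 by field.
    by rewrite divr_ge0 ?sqr_ge0// ltW.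
  have [] // := @h_ray_eq _ _ _ _ _ _ _ H w z (r / s) qw qz t0.
  by rewrite hz hw /scale3/=; congr (_, _, _); field.
have [pr|] := ltP 0 (p * r); first by left; exact: key hx pr.
by rewrite le_eqVlt mulf_eq0 (negbTE r0) orbF => /orP[/eqP p0|pr];
  [move: pq; rewrite p0 mul0r ltxx|right; apply: key hy _ => //; nra].
Qed.

Let al_bd z : on_bdQ z -> al (h z) = 0 -> z = (1, -1) \/ z = (-1, 1).
Proof.
move=> bz /eqP; rewrite mulf_eq0 (negbTE a0)/= addr_eq0 => /eqP E.
by apply: (@line_bd c d (-1) _ _ _ q1m qm1 bz _ _ cd); rewrite ?mulN1r// E opprK.
Qed.

Let be_bd z : on_bdQ z -> be (h z) = 0 -> z = (1, 1) \/ z = (-1, -1).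
Proof.
move=> bz /eqP; rewrite mulf_eq0 (negbTE c0)/= subr_eq0 => /eqP E.
by apply: (@line_bd a b 1 _ _ _ q11 qmm bz _ _ ab); rewrite ?mul1r.
Qed.

Let lipR (f : R -> R) (C : R) :
  (forall s t, `|f s - f t| <= C * `|s - t|) -> continuous f.
Proof.
move=> fC x; apply/cvgrPdist_lt => e e0; apply/nbhs_ballP.
have C0 : 0 < `|C| + 1 by rewrite ltr_wpDl.
exists (e / (`|C| + 1)); first exact: divr_gt0.
move=> y; rewrite /ball/= ltr_pdivlMr// => xy.
apply: le_lt_trans (fC x y) _; apply: le_lt_trans xy.
by rewrite mulrC ler_wpM2l// (le_trans (ler_norm _))// lerDl.
Qed.

Let side (k : bool) (s t : R) : R * R := if k then (s, fold 1 t) else (fold 1 t, s).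

Let side_bd k s t : s = 1 \/ s = -1 -> on_bdQ (side k s t).
Proof. by move=> ?; case: k; [apply: bdx|apply: bdy] => //; exact: fold_bounds. Qed.

Let side_cont (f : R3 -> R) (C : R) k s : (forall x y, `|f x - f y| <= C * norm3 (sub3 x y)) ->
  0 <= C -> s = 1 \/ s = -1 -> continuous (fun t => f (h (side k s t))).
Proof.
move=> fC C0 s1; apply: (@lipR _ (C * (2 * L))) => t t'.
apply: le_trans (fC _ _) _; rewrite -mulrA; apply: ler_wpM2l => //.
have [q _] := side_bd k t s1; have [q' _] := side_bd k t' s1.
apply: (h_lip_sup H q q'); rewrite /side; case: k q q' => _ _ /=;
  rewrite ?subrr ?normr0//; exact: fold_lip.
Qed.

Let al_lip x y : `|al x - al y| <= (2 * `|a|) * norm3 (sub3 x y).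
Proof.
have -> : al x - al y = a * ((sub3 x y).1.1 + (sub3 x y).1.2) by rewrite /al/=; ring.
rewrite normrM [leRHS](_ : _ = `|a| * (2 * norm3 (sub3 x y))); last ring.
apply: ler_wpM2l => //.
apply: le_trans (ler_normD _ _) _.
by have [] := norm3_comp (sub3 x y); lra.
Qed.

Let be_lip x y : `|be x - be y| <= (2 * `|c|) * norm3 (sub3 x y).
Proof.
have -> : be x - be y = c * ((sub3 x y).1.1 - (sub3 x y).1.2) by rewrite /be/=; ring.
rewrite normrM [leRHS](_ : _ = `|c| * (2 * norm3 (sub3 x y))); last ring.
apply: ler_wpM2l => //.
apply: le_trans (ler_normB _ _) _.
by have [] := norm3_comp (sub3 x y); lra.
Qed.

(** A negative value at [t] forces a root between [t] and [e]. This root is [- e], which lies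
    between them only if it is [t] itself. *)
Let nonneg_of_root (f : R -> R) (e : R) : continuous f -> e = 1 \/ e = -1 ->
  (forall t, -1 <= t <= 1 -> f t = 0 -> t = - e) -> 0 < f e ->
  forall t, -1 <= t <= 1 -> 0 <= f t.
Proof.
move=> cf e1 f0 fe t tb; rewrite leNgt; apply/negP => ft.
have key u v : u <= v -> -1 <= u -> v <= 1 -> (u = t /\ v = e) \/ (u = e /\ v = t) -> False.
  move=> uv u1 v1 E.
  have [|r] := @IVT _ f u v 0 uv (continuous_subspaceT cf).
    by rewrite ge_min le_max; case: E => -[-> ->]; rewrite (ltW ft) (ltW fe) ?orbT.
  rewrite in_itv/= => /andP[ur rv] fr.
  have re : r = - e by apply: f0 => //; rewrite (le_trans u1 ur) (le_trans rv v1).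
  have tr : r = t \/ (r != t) by case: (eqVneq r t); [left|right].
  case: tr => [rt|/eqP rt]; first by move: ft; rewrite -rt fr ltxx.
  by case: E => -[? ?]; case: e1 => ?; subst; apply: rt; lra.
case/andP: tb => t1 t2; case: e1 (e1) => ee e1'.
- by apply: (@key t e) => //; [rewrite ee|rewrite ee|left].
- by apply: (@key e t) => //; [rewrite ee|rewrite ee|right].
Qed.

Let sgk (k : bool) (s : R) := if k then s else - s.

(** On a side of the square each function vanishes at one of the two corners and nowhere else, so it
    keeps the sign that it has at the other corner. *)
Let side_sign k s t : s = 1 \/ s = -1 -> -1 <= t <= 1 ->
  0 <= s * al (h (side k s t)) /\ 0 <= sgk k s * be (h (side k s t)).
Proof.
move=> s1; have sN : - s = 1 \/ - s = -1 by case: s1 => ->; rewrite ?opprK; [right|left].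
have s0 : s != 0 by case: s1 => ->; rewrite ?oppr_eq0 oner_neq0.
have fs : fold 1 s = s by apply: fold_id; case: s1 => ->.
have fsN : fold 1 (- s) = - s by apply: fold_id; case: s1 => ->; rewrite ?opprK.
have ab' := ab; have cd' := cd.
have a2 : 0 < a ^+ 2 by rewrite exprn_even_gt0.
have c2 : 0 < c ^+ 2 by rewrite exprn_even_gt0.
move=> tb; split; move: t tb.
- apply: (@nonneg_of_root _ s) => //.
  + move=> x; apply: cvgM; first exact: cvg_cst.
    exact: (side_cont al_lip).
  + move=> t tb /eqP; rewrite mulf_eq0 (negbTE s0)/= => /eqP /(al_bd (side_bd k t s1)).
    by rewrite /side fold_id//; case: k => -[[-> ->]|[-> ->]]; rewrite ?opprK.
  + have -> : side k s s = (s, s) by rewrite /side fs; case: k.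
    case: s1 => ->; rewrite ?h11 ?hmm /al/=; nra.
- apply: (@nonneg_of_root _ (- s)) => //.
  + move=> x; apply: cvgM; first exact: cvg_cst.
    exact: (side_cont be_lip).
  + have k0 : sgk k s != 0 by rewrite /sgk; case: k; rewrite ?oppr_eq0.
    move=> t tb /eqP; rewrite mulf_eq0 (negbTE k0)/= => /eqP /(be_bd (side_bd k t s1)).
    by rewrite /side fold_id// opprK; case: k {k0} => -[[-> ->]|[-> ->]].
  + rewrite /side fsN /sgk; case: k; case: s1 => ->;
      rewrite ?opprK ?h1m ?hm1 /be/=; nra.
Qed.

Let side_pos k s t : s = 1 \/ s = -1 -> -1 <= t <= 1 ->
  0 < s * al (h (side k s t)) + sgk k s * be (h (side k s t)).
Proof.
move=> s1 tb; have [p1 p2] := side_sign k s1 tb; have bz := side_bd k t s1.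
have s0 : s != 0 by case: s1 => ->; rewrite ?oppr_eq0 oner_neq0.
have k0 : sgk k s != 0 by rewrite /sgk; case: k {p1 p2 bz}; rewrite ?oppr_eq0.
rewrite lt_neqAle addr_ge0// andbT eq_sym paddr_eq0//; apply/negP => /andP[].
rewrite mulf_eq0 (negbTE s0)/= => /eqP/(al_bd bz) e1.
rewrite mulf_eq0 (negbTE k0)/= => /eqP/(be_bd bz) e2.
by case: e1 e2 => -> [] [] => *; lra.
Qed.

(** A zero of [u] is a point where [h] is proportional to the target. On the boundary [u] is [zeta]
    times the horizontal part of [h], so the sum and the difference of [al] and [be] have the signs
    that [poincare_miranda] asks for. *)
Let surj_pos (w1 w2 zeta : R) : 0 < zeta ->
  exists v, inQ v /\ exists2 r, 0 < r & (w1, w2, zeta) = scale3 r (h v).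
Proof.
move=> z0.
pose u (x : R * R) : R3 :=
  ((h x).1.1 * zeta - w1 * (h x).2, (h x).1.2 * zeta - w2 * (h x).2, 0).
pose D := 2 * zeta + `|w1| + `|w2|.
have D0 : 0 <= D by rewrite /D !addr_ge0// mulr_ge0// ltW.
have ub x y : `|(u x).1.1 - (u y).1.1| <= D * norm3 (sub3 (h x) (h y)) /\
    `|(u x).1.2 - (u y).1.2| <= D * norm3 (sub3 (h x) (h y)).
  have [n1 n2 n3] := norm3_comp (sub3 (h x) (h y)); move: n1 n2 n3.
  rewrite /u/D/=; move: (norm3 _) ((h x).1.1) ((h y).1.1) ((h x).1.2) ((h y).1.2) ((h x).2) ((h y).2).
  move=> n x1 y1 x2 y2 x3 y3 n1 n2 n3; have n0 := le_trans (normr_ge0 _) n1.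
  have W1 : `|w1| * `|x3 - y3| <= `|w1| * n by exact: ler_wpM2l.
  have W2 : `|w2| * `|x3 - y3| <= `|w2| * n by exact: ler_wpM2l.
  have Z1 : `|x1 - y1| * zeta <= n * zeta by apply: ler_wpM2r => //; exact: ltW.
  have Z2 : `|x2 - y2| * zeta <= n * zeta by apply: ler_wpM2r => //; exact: ltW.
  have P1 : 0 <= `|w1| * n by exact: mulr_ge0.
  have P2 : 0 <= `|w2| * n by exact: mulr_ge0.
  have P3 : 0 <= zeta * n by apply: mulr_ge0 => //; exact: ltW.
  split.
  - have -> : x1 * zeta - w1 * x3 - (y1 * zeta - w1 * y3) = (x1 - y1) * zeta - w1 * (x3 - y3) by ring.
    by apply: le_trans (ler_normB _ _) _; rewrite !normrM (gtr0_norm z0); lra.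
  - have -> : x2 * zeta - w2 * x3 - (y2 * zeta - w2 * y3) = (x2 - y2) * zeta - w2 * (x3 - y3) by ring.
    by apply: le_trans (ler_normB _ _) _; rewrite !normrM (gtr0_norm z0); lra.
pose K := (2 * `|a| + 2 * `|c|) * D * (2 * L).
have L0 := L_gt0 H.
have [|t tb|x [qx e1 e2]] := @poincare_miranda R (fun x => al (u x) + be (u x)) (fun x => al (u x) - be (u x)) K.
- move=> x y r qx qy r1 r2; have := h_lip_sup H qx qy r1 r2.
  have [] := ub x y; move: (norm3 _) => n u1 u2 nr.
  have Dn : D * n <= D * (2 * L * r) by exact: ler_wpM2l.
  have dal : `|al (u x) - al (u y)| <= 2 * `|a| * (D * (2 * L * r)).
    have -> : al (u x) - al (u y) = a * (((u x).1.1 - (u y).1.1) + ((u x).1.2 - (u y).1.2)).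
      by rewrite /al; ring.
    rewrite normrM [leRHS](_ : _ = `|a| * (2 * (D * (2 * L * r)))); last ring.
    by apply: ler_wpM2l => //; apply: le_trans (ler_normD _ _) _; lra.
  have dbe : `|be (u x) - be (u y)| <= 2 * `|c| * (D * (2 * L * r)).
    have -> : be (u x) - be (u y) = c * (((u x).1.1 - (u y).1.1) - ((u x).1.2 - (u y).1.2)).
      by rewrite /be; ring.
    rewrite normrM [leRHS](_ : _ = `|c| * (2 * (D * (2 * L * r)))); last ring.
    by apply: ler_wpM2l => //; apply: le_trans (ler_normB _ _) _; lra.
  have KE : K * r = 2 * `|a| * (D * (2 * L * r)) + 2 * `|c| * (D * (2 * L * r)).
    by rewrite /K; ring.
  move: dal dbe; rewrite KE !ler_norml; lra.
- have uE x : on_bdQ x -> al (u x) = zeta * al (h x) /\ be (u x) = zeta * be (h x).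
    by move=> bx; rewrite /al /be /u/= (h3_bd H bx); split; ring.
  have ft := fold_id tb.
  have s1 : (1 : R) = 1 \/ (1 : R) = -1 by left.
  have sN : (-1 : R) = 1 \/ (-1 : R) = -1 by right.
  have := side_pos true s1 tb; have := side_pos true sN tb.
  have := side_pos false s1 tb; have := side_pos false sN tb.
  have := uE _ (side_bd true t s1); have := uE _ (side_bd true t sN).
  have := uE _ (side_bd false t s1); have := uE _ (side_bd false t sN).
  rewrite /side /sgk ft => -[-> ->] [-> ->] [-> ->] [-> ->].
  by rewrite !opprK => ? ? ? ?; split; nra.
- have E1 : al (u x) = 0 by lra.
  have E2 : be (u x) = 0 by lra.
  move/eqP: E1; rewrite mulf_eq0 (negbTE a0)/= => /eqP E1.
  move/eqP: E2; rewrite mulf_eq0 (negbTE c0)/= => /eqP E2.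
  have U1 : (h x).1.1 * zeta = w1 * (h x).2 by move: E1 E2; rewrite /u/=; lra.
  have U2 : (h x).1.2 * zeta = w2 * (h x).2 by move: E1 E2; rewrite /u/=; lra.
  have h0 : (h x).2 != 0.
    apply/eqP => h0; apply: (h_neq0 qx); apply: pair3_eq => //=.
    - by apply/eqP; move/eqP: U1; rewrite h0 mulr0 mulf_eq0 (gt_eqF z0) orbF.
    - by apply/eqP; move/eqP: U2; rewrite h0 mulr0 mulf_eq0 (gt_eqF z0) orbF.
  have hp : 0 < (h x).2 by rewrite lt_neqAle eq_sym h0 (h3_ge0 H).
  exists x; split => //; exists (zeta / (h x).2); first exact: divr_gt0.
  rewrite /scale3; congr (_, _, _).
  - by apply: (mulIf h0); rewrite -U1; field.
  - by apply: (mulIf h0); rewrite -U2; field.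
  - by field.
Qed.

(** The signs of [al] and [be] at the target select a side of the square. Along it [f], a
    determinant of the target and the boundary point, changes sign between the corners; at a zero
    the two vectors are parallel, and the common signs make the factor positive. *)
Let surj_zero (w1 w2 : R) : (w1, w2) <> 0 ->
  exists v, on_bdQ v /\ exists2 r, 0 < r & (w1, w2, 0) = scale3 r (h v).
Proof.
move=> w0; set W : R3 := (w1, w2, 0).
have [k [s [s1 p1 p2]]] : exists k s, [/\ s = 1 \/ s = -1, 0 <= s * al W & 0 <= sgk k s * be W].
  have [p1|p1] := leP 0 (al W); have [p2|p2] := leP 0 (be W).
  - by exists true, 1; split; [left|rewrite mul1r|rewrite mul1r].
  - by exists false, 1; split; [left|rewrite mul1r|rewrite /sgk; lra].
  - by exists false, (-1); split; [right|lra|rewrite /sgk; lra].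
  - by exists true, (-1); split; [right|lra|rewrite /sgk; lra].
pose A t := s * al (h (side k s t)); pose B t := sgk k s * be (h (side k s t)).
pose f t := A t * (sgk k s * be W) - B t * (s * al W).
have cA : continuous A by move=> x; apply: cvgM; [exact: cvg_cst|exact: (side_cont al_lip)].
have cB : continuous B by move=> x; apply: cvgM; [exact: cvg_cst|exact: (side_cont be_lip)].
have cf : continuous f.
  by move=> x; apply: cvgB; apply: cvgM; [exact: cA|exact: cvg_cst|exact: cB|exact: cvg_cst].
have fs : fold 1 s = s by apply: fold_id; case: s1 => ->.
have fsN : fold 1 (- s) = - s by apply: fold_id; case: s1 => ->; rewrite ?opprK.
have sb : -1 <= s <= 1 by case: s1 => ->.
have sNb : -1 <= - s <= 1 by case: s1 => ->; rewrite ?opprK.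
have fp : 0 <= f s.
  rewrite /f; have -> : B s = 0.
    rewrite /B /side fs; case: k {p1 p2 cA cB cf A B f}; case: s1 => ->; rewrite ?h11 ?hmm /be/=; ring.
  by rewrite mul0r subr0 mulr_ge0//; have [] := side_sign k s1 sb.
have fn : f (- s) <= 0.
  rewrite /f; have -> : A (- s) = 0.
    rewrite /A /side fsN; case: k {p1 p2 cA cB cf fp A B f}; case: s1 => ->; rewrite ?opprK ?h1m ?hm1 /al/=; ring.
  rewrite mul0r sub0r oppr_le0 mulr_ge0//; have [] := side_sign k s1 sNb => _ //.
have [t tb ft] : exists2 t, -1 <= t <= 1 & f t = 0.
  have le11 : (-1 : R) <= 1 by lra.
  have [|t] := @IVT _ f (-1) 1 0 le11 (continuous_subspaceT cf).
  - by case: s1 fp fn => ->; rewrite ?opprK => fp fn; rewrite ge_min le_max fp fn ?orbT.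
  - by rewrite in_itv/= => tb ft; exists t.
have [A0 B0] := side_sign k s1 tb; have P := side_pos k s1 tb.
rewrite -/(A t) -/(B t) in A0 B0 P.
have bz := side_bd k t s1; exists (side k s t); split => //.
set A' := s * al W in p1; set B' := sgk k s * be W in p2.
have fE : A t * B' = B t * A' by apply/eqP; rewrite -subr_eq0; apply/eqP.
pose r := (A' + B') / (A t + B t).
have P0 : A t + B t != 0 by rewrite gt_eqF.
have rA : A' = r * A t.
  by rewrite /r mulrAC; apply/(canRL (mulfK P0)); rewrite mulrDr mulrDl mulrC [B' * _]mulrC fE; ring.
have rB : B' = r * B t.
  by rewrite /r mulrAC; apply/(canRL (mulfK P0)); rewrite mulrDr mulrDl [B' * A t]mulrC fE; ring.
have s0 : s != 0 by case: s1 => ->; rewrite ?oppr_eq0 oner_neq0.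
have k0 : sgk k s != 0 by rewrite /sgk; case: (k); rewrite ?oppr_eq0.
have AE : al W = r * al (h (side k s t)).
  by apply: (mulfI s0); rewrite -/A' rA /A; ring.
have BE : be W = r * be (h (side k s t)).
  by apply: (mulfI k0); rewrite -/B' rB /B; ring.
have WE1 : w1 + w2 = r * ((h (side k s t)).1.1 + (h (side k s t)).1.2).
  by apply: (mulfI a0); move: AE; rewrite /al/= => ->; ring.
have WE2 : w1 - w2 = r * ((h (side k s t)).1.1 - (h (side k s t)).1.2).
  by apply: (mulfI c0); move: BE; rewrite /be/= => ->; ring.
exists r.
  rewrite /r divr_gt0// lt_neqAle addr_ge0// andbT eq_sym paddr_eq0//.
  rewrite !mulf_eq0 (negbTE s0) (negbTE k0) (negbTE a0) (negbTE c0)/=.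
  apply/negP => /andP[/eqP e1 /eqP e2]; apply: w0; congr (_, _); lra.
by apply: pair3_eq; rewrite /scale3/= ?(h3_bd H bz) ?mulr0//; lra.
Qed.

Lemma zup_surj (y : R3) : y <> 0 -> 0 <= y.2 ->
  exists v z, [/\ inQ v, zup h lam v z = y & y.2 = 0 -> on_bdQ v].
Proof.
case: y => [[w1 w2] y3] y0 /= y30.
have l0 : 0 < lam by have := lam_ge4 H; lra.
have fin v r : inQ v -> 0 < r -> (w1, w2, y3 / lam) = scale3 r (h v) ->
    zup h lam v (ln r) = (w1, w2, y3).
  move=> qv r0 [E1 E2 E3]; rewrite /zup lnK ?posrE// -E1 -E2; congr (_, _, _).
  by rewrite mulrCA -E3; field; rewrite gt_eqF.
have [z0|z0] := eqVneq y3 0.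
  have [|v [bv [r r0 E]]] := @surj_zero w1 w2.
    by move=> [e1 e2]; apply: y0; rewrite z0 e1 e2.
  exists v, (ln r); split => //; first by have [] := bv.
  apply: fin => //; first by have [] := bv.
  by rewrite z0 mul0r.
have [|v [qv [r r0 E]]] := @surj_pos w1 w2 (y3 / lam).
  by rewrite divr_gt0// lt_neqAle eq_sym z0.
by exists v, (ln r); split => //; [exact: fin|move/eqP: z0].
Qed.

(** The image of such a point has height 0, so by [zup_surj] it also comes from a boundary point;
    injectivity identifies the two. *)
Lemma h3_eq0_bd v : inQ v -> (h v).2 = 0 -> on_bdQ v.
Proof.
move=> qv v0; have [|/=|v' [z [qv' E bd]]] := @zup_surj (zup h lam v 0).
- move=> [E1 E2 E3]; apply: (h_neq0 qv); move/eqP: E1; move/eqP: E2.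
  rewrite expR0 !mul1r => /eqP E2 /eqP E1; exact: pair3_eq.
- by rewrite v0 !mulr0.
have [vv _] := zup_inj H qv' qv E.
by rewrite -vv; apply: bd; rewrite /zup/= v0 !mulr0.
Qed.

End Surjectivity.

(** * Images of neighbourhoods are neighbourhoods *)

Section Open.
Variable R : realType.
Notation R3 := (R * R * R)%type.
Variables (h : R * R -> R3) (L sn eps m lam : R).
Hypothesis H : chart h L sn eps m lam.

Let lam0 : 0 < lam. Proof. by have := lam_ge4 H; lra. Qed.

(** This undoes the anisotropy of [zup]: at [zup h lam v z] it equals the square of
    [lam * expR z * norm3 (h v)], so that the image alone controls [z]. *)
Definition nsq (y : R3) : R := (lam * y.1.1) ^+ 2 + (lam * y.1.2) ^+ 2 + y.2 ^+ 2.

Lemma nsq_zup v z : inQ v ->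
  (lam * m * expR z) ^+ 2 <= nsq (zup h lam v z) <= (lam * expR z) ^+ 2.
Proof.
move=> qv; have -> : nsq (zup h lam v z) = (lam * expR z) ^+ 2 * norm3 (h v) ^+ 2.
  by rewrite norm3_sq /nsq /zup /dot3/=; ring.
have hm := m_le H qv; have h1 := h_le1 H qv; have m0 := m_gt0 H.
have e0 : 0 <= (lam * expR z) ^+ 2 by apply: sqr_ge0.
apply/andP; split.
  rewrite [leLHS](_ : _ = (lam * expR z) ^+ 2 * m ^+ 2); last ring.
  by apply: ler_wpM2l => //; apply: lerXn2r; rewrite ?nnegrE ?norm3_ge0 ?(ltW m0).
rewrite -[leRHS]mulr1; apply: ler_wpM2l => //.
by rewrite -(expr1n _ 2); apply: lerXn2r; rewrite ?nnegrE ?norm3_ge0.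
Qed.

Lemma nsq_continuous : continuous nsq.
Proof.
have [c1 c2 c3] := coord3_continuous R; move=> x; rewrite /nsq.
have cc (f : R3 -> R) (c : R) : continuous f -> continuous (fun x => (c * f x) ^+ 2).
  move=> cf y; apply: cvgM; apply: cvgM; by [exact: cvg_cst|exact: cf].
apply: cvgD; first by apply: cvgD; exact: cc.
by apply: cvgM; exact: c3.
Qed.

(** By injectivity the image of a large compact box without [W] misses the target, hence a
    neighbourhood of it. Points near the target have preimages by surjectivity, and [nsq] keeps
    these in the box; so they lie in [W]. *)
Lemma zup_open v0 z0 (U : set R3) : inQ v0 -> nbhs (v0, z0) U ->
  \forall y \near zup h lam v0 z0, 0 <= y.2 ->
    exists v z, [/\ inQ v, U (v, z) & zup h lam v z = y].
Proof.
move=> qv0; rewrite nbhsE => [[W [oW Wv] WU]].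
pose q0 := nsq (zup h lam v0 z0).
have lm : 0 < lam * m by rewrite mulr_gt0//; exact: m_gt0 H.
have q0p : 0 < q0.
  have /andP[+ _] := nsq_zup z0 qv0; apply: lt_le_trans.
  by rewrite exprn_gt0// mulr_gt0 ?expR_gt0.
(* Bounds for [expR (2 * z)] and [expR (- (2 * z))] when [nsq] lies between [q0 / 2] and
   [2 * q0]. *)
pose A := 2 * q0 / (lam * m) ^+ 2; pose B := 2 * lam ^+ 2 / q0.
have A0 : 0 <= A by rewrite divr_ge0 ?sqr_ge0// mulr_ge0// ltW.
have B0 : 0 <= B by rewrite divr_ge0 ?ltW// mulr_gt0// exprn_gt0.
pose box : set R3 := [set x | inQ x.1 /\ `|x.2| <= A + B].
have [c1 c2 c3] := coord3_continuous R.
have cbox : compact (box `&` ~` W).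
  apply: (@bounded_closed3_compact _ _ (1 + (A + B))).
    apply: closedI; last exact: open_closedC.
    have -> : box = (fun x : R3 => x.1.1) @^-1` `[-1, 1] `&`
        ((fun x : R3 => x.1.2) @^-1` `[-1, 1] `&` (fun x : R3 => x.2) @^-1` `[- (A + B), A + B]).
      apply/seteqP; split => -[[x y] z]; rewrite /box /inQ/= !in_itv/= ler_norml.
        by move=> [[-> ->] ->].
      by move=> [-> [-> ->]].
    by apply: closedI; [|apply: closedI]; apply: preimage_closed => //= *; exact: interval_closed.
  move=> x [[[q1 q2] z] _]; rewrite norm_le3; apply/and3P; split; last lra.
    rewrite ler_norml; lra.
  rewrite ler_norml; lra.
pose F (x : R3) : R3 := zup h lam (fold2 x) x.2.
have cF : continuous F.
  have [h1 h2 h3] := h_fold_continuous H.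
  have ce : continuous (fun x : R3 => expR x.2).
    by move=> x; apply: continuous_comp; [exact: c3|exact: continuous_expR].
  apply: continuous_pair3 => x /=.
  - by apply: cvgM; [exact: ce|exact: h1].
  - by apply: cvgM; [exact: ce|exact: h2].
  - by apply: cvgM; [exact: ce|apply: cvgM; [exact: cvg_cst|exact: h3]].
have FE v z : inQ v -> F (v, z) = zup h lam v z.
  by case: v => v1 v2 [b1 b2]; rewrite /F /fold2/= !fold_id.
have /compact3_closed clK := compact3_image cF cbox.
have nK : ~ (F @` (box `&` ~` W)) (zup h lam v0 z0).
  move=> [[v z] [[/= qv _] nW]]; rewrite FE// => E.
  by have [vv zz] := zup_inj H qv qv0 E; apply: nW; rewrite vv zz.
have : \forall y \near zup h lam v0 z0, (~` (F @` (box `&` ~` W))) y.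
  by apply: open_nbhs_nbhs; split => //; exact: closed_openC.
have : \forall y \near zup h lam v0 z0, q0 / 2 < nsq y.
  have q2 : q0 / 2 < q0 by lra.
  exact: (cvgr_gt (f := nsq) _ (@nsq_continuous (zup h lam v0 z0)) _ q2).
have : \forall y \near zup h lam v0 z0, nsq y < 2 * q0.
  have q2 : q0 < 2 * q0 by lra.
  exact: (cvgr_lt (f := nsq) _ (@nsq_continuous (zup h lam v0 z0)) _ q2).
apply: filterS3 => y y1 y2 nKy y30.
have [|v [z [qv zy _]]] := zup_surj H _ y30.
  by move=> E; move: y2; rewrite E /nsq/= !mulr0 !expr0n/= !addr0; lra.
exists v, z; split => //; apply: WU; apply: contrapT => nW; apply: nKy.
exists (v, z); last by rewrite FE.
split => //; split => //=.
have /andP[] := nsq_zup z qv; rewrite zy => n1 n2.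
have e2 : expR z ^+ 2 = expR (2 * z) by rewrite -expRM_natl.
have eA : expR (2 * z) <= A.
  rewrite /A ler_pdivlMr ?exprn_gt0// -e2; move: n1; rewrite exprMn => n1; lra.
have eB : expR (- (2 * z)) <= B.
  rewrite expRN /B -e2 ler_pdivlMr// mulrC ler_pdivrMr ?exprn_gt0 ?expR_gt0//.
  by move: n2; rewrite exprMn => n2; lra.
have := expR_ge1Dx (2 * z); have := expR_ge1Dx (- (2 * z)).
rewrite ler_norml; lra.
Qed.

Definition beam_pt (i j : int) (x : R3) : R3 :=
  (2 * i%:~R + sgn_par R i * x.1.1, 2 * j%:~R + sgn_par R j * x.1.2, x.2).

Lemma sgn_par_sq (i : int) : sgn_par R i * sgn_par R i = 1.
Proof. by case: (sgn_par_cases R i) => ->; ring. Qed.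

Lemma beam_ptK i j (x : R3) : beam_pt i j (beam_coord i j x, x.2) = x.
Proof.
case: x => [[x y] z]; rewrite /beam_pt /beam_coord/= !mulrA !sgn_par_sq.
by congr (_, _, _); ring.
Qed.

Lemma beam_coordK i j (x : R3) : beam_coord i j (beam_pt i j x) = x.1.
Proof.
case: x => [[x y] z]; rewrite /beam_pt /beam_coord/=.
by congr (_, _); rewrite addrAC subrr add0r mulrA sgn_par_sq mul1r.
Qed.

Lemma in_beam_pt i j (x : R3) : inQ x.1 -> in_beam i j (beam_pt i j x).
Proof.
move=> [q1 q2]; rewrite /in_beam /beam_pt/=.
by case: (sgn_par_cases R i) => ->; case: (sgn_par_cases R j) => ->; split; lra.
Qed.

Lemma beam_coord_Q i j (x : R3) : in_beam i j x -> inQ (beam_coord i j x).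
Proof.
move=> [q1 q2]; rewrite /inQ /beam_coord/=.
by case: (sgn_par_cases R i) => ->; case: (sgn_par_cases R j) => ->; split; lra.
Qed.

Lemma refl3K s : s * s = 1 -> involutive (refl3 s : R3 -> R3).
Proof. by move=> s1 [[x y] z]; rewrite /refl3/= mulrA s1 mul1r. Qed.

Lemma refl3_continuous s : continuous (refl3 s : R3 -> R3).
Proof.
have [c1 c2 c3] := coord3_continuous R.
apply: continuous_pair3 => // x; apply: cvgM; first exact: cvg_cst.
exact: c3.
Qed.

Lemma beam_pt_continuous i j : continuous (beam_pt i j).
Proof.
have [c1 c2 c3] := coord3_continuous R.
apply: continuous_pair3 => // x; apply: cvgD; try exact: cvg_cst;
  apply: cvgM; first [exact: cvg_cst|exact: c1|exact: c2].
Qed.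

Lemma beam_open i j x (U : set R3) : in_beam i j x -> nbhs x U ->
  \forall y \near zmap h lam x, 0 <= sgn_par R i * sgn_par R j * y.2 ->
    (zmap h lam @` U) y.
Proof.
move=> bx Ux; set s := _ * _.
have ss : s * s = 1 by rewrite /s mulrACA !sgn_par_sq mulr1.
have Uv : nbhs (beam_coord i j x, x.2) (beam_pt i j @^-1` U).
  by apply: (beam_pt_continuous (i:=i) (j:=j)); rewrite beam_ptK.
have E : refl3 s (zmap h lam x) = zup h lam (beam_coord i j x) x.2.
  by rewrite (zmap_beam H bx) -/s refl3K.
have N := zup_open (beam_coord_Q bx) Uv; rewrite -E in N.
have := @refl3_continuous s (zmap h lam x) _ N.
rewrite /nbhs/=; apply: filterS => y /= Ny y0.
have [v [z [qv Uvz zy]]] := Ny y0.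
exists (beam_pt i j (v, z)) => //.
by rewrite (zmap_beam H (in_beam_pt i j (x := (v, z)) qv)) beam_coordK/= -/s zy refl3K.
Qed.

Lemma h3_zmap_sign i j x : in_beam i j x -> 0 <= sgn_par R i * sgn_par R j * (zmap h lam x).2.
Proof.
move=> bx; rewrite (zmap_beam H bx)/=; set s := sgn_par R i * _.
have ss : s * s = 1 by rewrite /s mulrACA !sgn_par_sq mulr1.
rewrite mulrA ss mul1r; by rewrite !mulr_ge0 ?expR_ge0 ?(ltW lam0)//; exact: (h3_ge0 H (beam_coord_Q bx)).
Qed.

Lemma two_beams i j (x : R3) : in_beam i j x -> on_bdQ (beam_coord i j x) ->
  exists i' j', in_beam i' j' x /\ sgn_par R i' * sgn_par R j' = - (sgn_par R i * sgn_par R j).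
Proof.
move=> [b1 b2] [_ bd].
have nb (k : int) (s : R) : `|sgn_par R k * (s - 2 * k%:~R)| = 1 ->
    exists k' : int, 2 * k'%:~R - 1 <= s <= 2 * k'%:~R + 1 /\ sgn_par R k' = - sgn_par R k.
  rewrite normrM; have -> : `|sgn_par R k| = 1.
    by case: (sgn_par_cases R k) => ->; rewrite ?normrN normr1.
  rewrite mul1r => /eqP; rewrite eqr_norml ler01 andbT => /orP[|] /eqP sE.
    by exists (k + 1); rewrite sgn_parS intrD; split => //; lra.
  exists (k - 1); split; first by rewrite intrB; lra.
  by have := sgn_parS R (k - 1); rewrite subrK => ->; rewrite opprK.
case: bd => /= /nb [k [kb ks]].
- by exists k, j; rewrite ks mulNr.
- by exists i, k; rewrite ks mulrN.
Qed.

(** One beam fills only one closed half-space. This suffices off the plane of height 0; over that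
    plane the point lies on a wall, and the beam across it has the opposite sign and fills the other
    half. *)
Lemma zmap_open x (U : set R3) : nbhs x U -> nbhs (zmap h lam x) (zmap h lam @` U).
Proof.
move=> Ux; set i := strip 1 x.1.1; set j := strip 1 x.1.2.
have bx : in_beam i j x by exact: in_beam_strip.
have N := beam_open bx Ux.
have [E|NE] := eqVneq (zmap h lam x).2 0; last first.
  have := h3_zmap_sign bx; set s := _ * _ in N *.
  rewrite le_eqVlt => /predU1P[/esym/eqP|s0].
    rewrite mulf_eq0 (negbTE NE) orbF /s => /eqP s0.
    by have := sgn_par_sq i; have := sgn_par_sq j; nra.
  have N2 : \forall y \near zmap h lam x, 0 < s * y.2.
    have [_ _ c3] := coord3_continuous R.
    have cf : continuous (fun y : R3 => s * y.2).
      by move=> y; apply: cvgM; [exact: cvg_cst|exact: c3].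
    exact: (cvgr_gt (f := fun y : R3 => s * y.2) _ (cf _) _ s0).
  by apply: filterS2 N N2 => y Ny /ltW; exact: Ny.
have [] := @two_beams i j x bx.
  apply: (h3_eq0_bd H); first exact: beam_coord_Q.
  move/eqP: E; rewrite (zmap_beam H bx)/= !mulf_eq0 (gt_eqF (expR_gt0 _)) (gt_eqF lam0)/=.
  case/orP => [s0|/eqP//]; exfalso; move: s0.
  by have := sgn_par_sq i; have := sgn_par_sq j => ? ? /orP[] /eqP; nra.
move=> i' [j' [bx' sE]]; have N' := beam_open bx' Ux.
rewrite sE in N'; apply: filterS2 N N' => y Ny Ny'.
have [y0|y0] := leP 0 (sgn_par R i * sgn_par R j * y.2); first exact: Ny.
by apply: Ny'; lra.
Qed.

Lemma iter_zmap_open n x (U : set R3) : nbhs x U ->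
  nbhs (iter n (zmap h lam) x) (iter n (zmap h lam) @` U).
Proof.
move=> Ux; elim: n => [|n IH] /=; first by rewrite image_id.
by have := zmap_open IH; rewrite -image_comp.
Qed.

End Open.

(** * Blow-up near the third axis *)

Section Blowup.
Variable R : realType.
Notation R3 := (R * R * R)%type.
Variables (h : R * R -> R3) (L sn eps m lam : R).
Hypothesis H : chart h L sn eps m lam.
Let g := zmap h lam.

Let lam0 : 0 < lam. Proof. by have := lam_ge4 H; lra. Qed.

Lemma zmap_axis (k l : int) (z : R) : g (2 * k%:~R, 2 * l%:~R, z) =
  (0, 0, sgn_par R k * sgn_par R l * (lam * expR z)).
Proof.
have b : in_beam k l (2 * k%:~R, 2 * l%:~R, z : R) by split => /=; lra.
rewrite /g (zmap_beam H b) /beam_coord/= !subrr !mulr0 /zup /refl3 (h00 H)/= !mulr0.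
by congr (_, _, _); ring.
Qed.

Lemma zmap_axis0 (z : R) : g (0, 0, z) = (0, 0, lam * expR z).
Proof.
have := zmap_axis 0 0 z; rewrite !mulr0 => ->.
by rewrite sgn_par_sq mul1r.
Qed.

(** The beams [(2 j, 0)] and [(2 j + 1, 0)] have opposite signs, so together they reach both
    half-spaces. The bounds on [nsq] translate into the bounds on the height of the preimage. *)
Lemma zmap_shell (j : int) (c X : R) (y : R3) : 0 <= X ->
  (lam * expR (c - X)) ^+ 2 <= nsq lam y <= (lam * m * expR (c + X)) ^+ 2 ->
  exists x, [/\ 4 * j%:~R - 1 <= x.1.1 <= 4 * j%:~R + 3, -1 <= x.1.2 <= 1,
    c - X <= x.2 <= c + X & g x = y].
Proof.
move=> X0 /andP[n1 n2]; have m0 := m_gt0 H.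
have y0 : y <> 0.
  move=> E; move: n1; rewrite E /nsq/= !mulr0 !expr0n/= !addr0.
  by rewrite leNgt exprn_gt0// mulr_gt0 ?expR_gt0.
have zb v z : inQ v -> nsq lam (zup h lam v z) = nsq lam y -> c - X <= z <= c + X.
  move=> qv E; have := nsq_zup H z qv; rewrite E => /andP[p1 p2].
  have := le_trans n1 p2; have := le_trans p1 n2.
  have sq (k p q : R) : 0 < k -> (k * expR p) ^+ 2 <= (k * expR q) ^+ 2 -> p <= q.
    move=> k0; rewrite ler_pXn2r ?nnegrE ?mulr_ge0 ?expR_ge0 ?(ltW k0)//.
    by rewrite ler_pM2l// ler_expR.
  have lm0 : 0 < lam * m by exact: mulr_gt0.
  by move=> /(sq _ _ _ lm0) u1 /(sq _ _ _ lam0) u2; rewrite u2 u1.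
have j2 : sgn_par R (j + j) = 1.
  by rewrite /sgn_par -mulr2n -mulr_natl abszM oddM.
have [y3|y3] := leP 0 y.2.
  have [v [z [qv E _]]] := zup_surj H y0 y3.
  exists (beam_pt (j + j) 0 (v, z)); rewrite /g (zmap_beam H (in_beam_pt _ _ (x := (v, z)) qv)).
  rewrite beam_coordK/= /beam_pt/= j2 mulr1 intrD /sgn_par/=.
  case: (qv) => q1 q2; split; [lra|lra|by apply: (zb v z qv); rewrite E|].
  by rewrite E /refl3 mul1r; case: (y) => -[].
have y0' : refl3 (-1) y <> 0.
  case: y y0 {n1 n2 zb y3} => -[y1 y2] y3 y0 [e1 e2 e3]; apply: y0.
  by rewrite e1 e2; congr (_, _, _); lra.
have [|v [z [qv E _]]] := zup_surj H y0'; first by rewrite /refl3/=; lra.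
exists (beam_pt (j + j + 1) 0 (v, z)); rewrite /g (zmap_beam H (in_beam_pt _ _ (x := (v, z)) qv)).
rewrite beam_coordK/= /beam_pt/= sgn_parS j2 !intrD [sgn_par R 0]/sgn_par/= mulr1.
case: (qv) => q1 q2; split; [lra|lra| |].
  by apply: (zb v z qv); rewrite E /nsq /refl3/= mulN1r sqrrN.
by rewrite E refl3K//; ring.
Qed.

Definition box (b r : R) : set R3 :=
  [set x | [/\ `|x.1.1| < r, `|x.1.2| < r & `|x.2 - b| < r]].

Lemma expR_near1 (t s : R) : s <= 2^-1 -> `|expR t - 1| <= s -> `|t| <= 2 * s.
Proof.
move=> s2; rewrite ler_norml => /andP[e1 e2].
have s0 : 0 <= s by lra.
have := expR_ge1Dx t; have := expR_ge1Dx (- t); rewrite expRN.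
have ep := expR_gt0 t.
have : (expR t)^-1 <= 1 + 2 * s.
  rewrite -[leLHS]mul1r ler_pdivrMr//; nra.
rewrite ler_norml; lra.
Qed.

(* Non-tangentiality at the pole [h (0, 0) = (0, 0, 1)]. *)
Lemma pole_dist v : inQ v -> norm3 (sub3 (h v) (h (0, 0))) <= eps ->
  norm3 (sub3 (h v) (h (0, 0))) ^+ 2 * sn ^+ 2 <= (h v).1.1 ^+ 2 + (h v).1.2 ^+ 2.
Proof.
move=> qv ve; have q0 : inQ (0, 0 : R) by split => /=; lra.
have := h_nontangent H qv q0 ve.
rewrite !norm3_sq (h00 H) /sub3 /dot3/= ; nra.
Qed.

(** Raising [z] by [b] multiplies [g] by [expR b], so one estimate at [b = 0] serves all heights
    with the same constants. There openness becomes quantitative: [pole_dist] bounds the distance of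
    [h v] from the pole by the horizontal displacement, and the lower Lipschitz bound then controls
    [v]. *)
Lemma box_grow : exists rho C : R, [/\ 0 < rho, 0 < C & forall b t r, 0 < t -> t <= rho -> C * t <= r ->
  box (lam * expR b) (t * expR b) `<=` g @` box b r].
Proof.
have L0 := L_gt0 H; have s0 := sn_gt0 H; have e0 := eps_gt0 H.
have q0 : inQ (0, 0 : R) by split => /=; lra.
set e := expR (1 : R); have ep : 0 < e by exact: expR_gt0.
pose d := Num.min 1 (eps / (2 * L)).
have d0 : 0 < d by rewrite lt_min ltr01 divr_gt0// mulr_gt0.
have N : nbhs ((0, 0), 0 : R) [set x : R3 | `|(0, 0, 0) - x| < d] by apply/nbhs3P; exists d.
have [rho0 r0 Hr] := (nbhs3P _ _).1 (zup_open H q0 N).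
(* [e] bounds [expR z] and its inverse for [z] between -1 and 1. Then [2 e t / sn] bounds the
   distance from the pole, [K t] bounds [expR z - 1], and [2 K t] bounds [z]. *)
pose K := 1 + e * (2 * e / sn); pose C := 2 * K + L * (2 * e / sn).
have K1 : 1 <= K by rewrite lerDl !mulr_ge0 ?invr_ge0// ltW.
have LK : 0 < L * (2 * e / sn) by rewrite mulr_gt0// divr_gt0// mulr_gt0.
exists (Num.min rho0 (Num.min 1 (2 * K)^-1)), C; split.
- by rewrite !lt_min r0 ltr01 invr_gt0 mulr_gt0// (lt_le_trans ltr01 K1).
- by rewrite /C; lra.
move=> b t r t0; rewrite !le_min => /and3P[tr t1 tK] Cr y [y1 y2 y3].
have eb := expR_gt0 b.
pose y' := scale3 (expR (- b)) y.
have ebK : expR (- b) * expR b = 1 by rewrite expRN mulVf// gt_eqF.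
have c1 : `|y'.1.1| < t.
  by rewrite /y'/= normrM gtr0_norm ?expR_gt0// mulrC expRN ltr_pdivrMr.
have c2 : `|y'.1.2| < t.
  by rewrite /y'/= normrM gtr0_norm ?expR_gt0// mulrC expRN ltr_pdivrMr.
have c3 : `|y'.2 - lam| < t.
  have -> : y'.2 - lam = expR (- b) * (y.2 - lam * expR b).
    by rewrite mulrBr mulrCA ebK mulr1.
  by rewrite normrM gtr0_norm ?expR_gt0// mulrC expRN ltr_pdivrMr.
have z0E : zup h lam (0, 0) 0 = (0, 0, lam).
  by rewrite /zup (h00 H)/= expR0 !mulr0 !mul1r mulr1.
have [||v [z [qv vd E]]] := Hr y'.
- rewrite z0E norm_lt3; apply/and3P; split; apply: lt_le_trans tr;
    by rewrite distrC /= ?subr0.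
- by have := lam_ge4 H; move: c3; rewrite ltr_norml; lra.
move: vd; rewrite /= norm_lt3/= !sub0r !normrN !lt_min => /and3P[/andP[v1 v1e] /andP[v2 v2e] /andP[z1 _]].
have D0 : norm3 (sub3 (h v) (h (0, 0))) <= eps.
  have le : eps = 2 * L * (eps / (2 * L)) by field; rewrite gt_eqF.
  by rewrite [leRHS]le; apply: (h_lip_sup H qv q0); rewrite subr0 ltW.
have P := pole_dist qv D0; set D := norm3 _ in P.
have Dp : 0 <= D by exact: norm3_ge0.
have ez : expR (- z) <= e by rewrite ler_expR; move: z1; rewrite ltr_norml; clear - H; lra.
have ez' : expR z <= e by rewrite ler_expR; move: z1; rewrite ltr_norml; clear - H; lra.
have ezK : expR (- z) * expR z = 1 by rewrite expRN mulVf// gt_eqF// expR_gt0.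
have hb x x' : expR z * x = x' -> `|x'| < t -> `|x| <= e * t.
  move=> <- xt; have -> : x = expR (- z) * (expR z * x) by rewrite mulrA ezK mul1r.
  by rewrite normrM (gtr0_norm (expR_gt0 _)); apply: ler_pM => //; exact: ltW.
have E1 : expR z * (h v).1.1 = y'.1.1 by rewrite -E.
have E2 : expR z * (h v).1.2 = y'.1.2 by rewrite -E.
have E3 : expR z * (lam * (h v).2) = y'.2 by rewrite -E.
have h1 := hb _ _ E1 c1; have h2 := hb _ _ E2 c2.
have sqb (x c : R) : `|x| <= c -> x ^+ 2 <= c ^+ 2.
  move=> xc; rewrite -real_normK ?num_real//.
  by apply: lerXn2r; rewrite ?nnegrE// (le_trans _ xc).
have Db : D <= 2 * e / sn * t.
  rewrite mulrAC ler_pdivlMr//.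
  have p1 : 0 <= D * sn by rewrite mulr_ge0// ltW.
  have p2 : 0 <= 2 * e * t by rewrite !mulr_ge0// ltW.
  rewrite -(@ler_pXn2r _ 2)// ?nnegrE// exprMn; apply: le_trans P _.
  have := sqb _ _ h1; have := sqb _ _ h2; have := sqr_ge0 (e * t).
  rewrite [(2 * e * t) ^+ 2](_ : _ = 4 * (e * t) ^+ 2); last by ring.
  by clear - H g lam0; lra.
have vb : norm2 (sub2 v (0, 0)) <= L * (2 * e / sn) * t.
  apply: le_trans (h_lower H qv q0) _; rewrite -mulrA.
  by apply: ler_wpM2l => //; exact: ltW.
have vi : `|v.1| <= norm2 (sub2 v (0, 0)) /\ `|v.2| <= norm2 (sub2 v (0, 0)).
  rewrite /norm2 /sub2/= !subr0 -!sqrtr_sqr; split; apply: ler_wsqrtr; rewrite ?lerDl ?lerDr; exact: sqr_ge0.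
have h3 : `|1 - (h v).2| <= D.
  have [_ _] := norm3_comp (sub3 (h v) (h (0, 0))).
  by rewrite -/D /sub3 (h00 H)/= distrC.
have zb : `|expR z - 1| <= K * t.
  have -> : expR z - 1 = (expR z * (1 - (h v).2)) + (y'.2 - lam) / lam.
    by rewrite -E3; field; rewrite gt_eqF.
  apply: le_trans (ler_normD _ _) _; 
  have -> : K * t = e * (2 * e / sn) * t + t by rewrite /K; ring.
  apply: lerD; last first.
    rewrite normrM [X in _ * X]gtr0_norm ?invr_gt0// ler_pdivrMr//.
    apply: le_trans (ltW c3) _; rewrite -[leLHS]mulr1; apply: ler_wpM2l; first exact: ltW.
    by apply: le_trans (ltW (lam_ge4 H)); rewrite (ler_nat _ 1 4).
  rewrite normrM (gtr0_norm (expR_gt0 _)) -mulrA; apply: ler_pM; rewrite ?normr_ge0 ?expR_ge0//.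
  exact: le_trans h3 Db.
have zz : `|z| <= 2 * (K * t).
  apply: expR_near1 zb; move: tK; rewrite -[leRHS]mul1r ler_pdivlMr; last by clear - H g lam0 K1; lra.
  by clear - H g lam0; lra.
have Kt : 0 < K * t by rewrite mulr_gt0// (lt_le_trans ltr01).
have LKt : 0 < L * (2 * e / sn) * t by rewrite mulr_gt0.
have CE : C * t = 2 * (K * t) + L * (2 * e / sn) * t by rewrite /C; ring.
exists (v.1, v.2, z + b).
  case: vi => vi1 vi2; split => /=; rewrite ?addrK.
  - by clear - H g lam0 vi1 vb Cr CE Kt; lra.
  - by clear - H g lam0 vi2 vb Cr CE Kt; lra.
  - by clear - H g lam0 zz LKt Cr CE Kt; lra.
have bm : in_beam 0 0 (v.1, v.2, z + b : R) by case: qv => q1 q2; split; rewrite /= mulr0 sub0r add0r.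
rewrite /g (zmap_beam H bm) /beam_coord/= !mulr0 !subr0 !mul1r.
have -> : sgn_par R 0 = 1 by [].
have bb : expR b * expR (- b) = 1 by rewrite mulrC.
rewrite /refl3 mul1r /zup/= -surjective_pairing expRD.
have y'E i : expR b * (expR (- b) * i) = i by rewrite mulrA bb mul1r.
rewrite ![expR z * expR b]mulrC -!mulrA E1 E2 E3 /y'/= !y'E.
by case: (y) => -[].
Qed.

Lemma box_sub b r r' : r <= r' -> box b r `<=` box b r'.
Proof. by move=> rr x [b1 b2 b3]; split; apply: lt_le_trans rr. Qed.

(** Heights tend to infinity under [lam * expR b], whatever happens to the radius. Once
    [expR b >= 2 * C], each step doubles the radius until it reaches [M], which high up is below the
    cap [rho * expR b]. *)
Lemma box_reach (U : set R3) (M Bd : R) n b r : 0 < M -> 0 <= b -> 0 < r ->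
  box b r `<=` iter n g @` U ->
  exists n' b', Bd <= b' /\ box b' M `<=` iter n' g @` U.
Proof.
move=> M0 b0 r0 bU; have [rho [C [rho0 C0 grow]]] := box_grow.
have l4 := lam_ge4 H.
have up c : 0 <= c -> c + 4 <= lam * expR c.
  by move=> c0; have := expR_ge1Dx c; nra.
have stepU n1 b1 r1 r2 : 0 < r2 -> r2 <= rho * expR b1 -> C * r2 <= r1 * expR b1 ->
    box b1 r1 `<=` iter n1 g @` U -> box (lam * expR b1) r2 `<=` iter n1.+1 g @` U.
  move=> r20 r2r Cr sub; have eb := expR_gt0 b1.
  have -> : r2 = r2 / expR b1 * expR b1 by rewrite divfK// gt_eqF.
  apply: subset_trans (grow b1 _ r1 _ _ _) _.
  - exact: divr_gt0.
  - by rewrite ler_pdivrMr.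
  - by rewrite mulrA ler_pdivrMr.
  - by move=> _ [x /sub[u Uu <-] <-]; exists u.
have phase1 k : exists n1 b1 r1, [/\ 4 * k%:R <= b1, 0 < r1 & box b1 r1 `<=` iter n1 g @` U].
  elim: k => [|k [n1 [b1 [r1 [kb r10 sub]]]]]; first by exists n, b, r; rewrite mulr0.
  have eb := expR_gt0 b1.
  exists n1.+1, (lam * expR b1), (Num.min (rho * expR b1) (r1 * expR b1 / C)).
  have k0 : 0 <= k%:R :> R by [].
  split.
  - by apply: le_trans (up b1 _); rewrite -?natr1; lra.
  - by rewrite lt_min !divr_gt0 ?mulr_gt0.
  - apply: stepU sub.
    + by rewrite lt_min !divr_gt0 ?mulr_gt0.
    + by rewrite ge_min lexx.
    + rewrite -ler_pdivlMl// ge_min; apply/orP; right; by rewrite mulrC.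
pose B1 := `|Bd| + M / rho + 2 * C.
have Mr : 0 < M / rho by rewrite divr_gt0.
have [n1 [b1 [r1 [kb r10 sub1]]]] := phase1 (Num.truncn B1).+1.
have B1b : B1 <= b1.
  have := truncnS_gt B1; have : 0 <= (Num.truncn B1).+1%:R :> R by []; lra.
have phase2 j : exists n2 b2, B1 <= b2 /\ box b2 (Num.min M (2 ^+ j * r1)) `<=` iter n2 g @` U.
  elim: j => [|j [n2 [b2 [Bb sub]]]].
    exists n1, b1; split => //; apply: subset_trans sub1; apply: box_sub.
    by rewrite expr0 mul1r ge_min lexx orbT.
  have b20 : 0 <= b2 by have := normr_ge0 Bd; rewrite /B1 in Bb; lra.
  exists n2.+1, (lam * expR b2); split; first by have := up _ b20; lra.
  have e2 : B1 <= expR b2 by have := expR_ge1Dx b2; lra.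
  have p0 : 0 < 2 ^+ j * r1 by rewrite mulr_gt0// exprn_gt0.
  apply: stepU sub.
  - by rewrite lt_min M0 mulr_gt0// exprn_gt0.
  - rewrite ge_min; apply/orP; left.
    by rewrite mulrC -ler_pdivrMr//; have := normr_ge0 Bd; rewrite /B1 in e2; lra.
  - have e2C : 2 * C <= expR b2 by have := normr_ge0 Bd; rewrite /B1 in e2; lra.
    rewrite exprS -mulrA; move: (2 ^+ j * r1) p0 => p p0.
    have [Mp|pM] := leP M p.
      have -> : Num.min M (2 * p) = M by apply/min_idPl; lra.
      nra.
    apply: (@le_trans _ _ (C * (2 * p))); last nra.
    by apply: ler_wpM2l; [exact: ltW|by rewrite ge_min lexx orbT].
have [n2 [b2 [Bb sub]]] := phase2 (Num.truncn (M / r1)).+1.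
exists n2, b2; split; first by have := ler_norm Bd; rewrite /B1 in Bb; clear - H g lam0 Bb C0 Mr; lra.
apply: subset_trans sub; apply: box_sub; rewrite le_min lexx/=.
rewrite -ler_pdivrMr//; apply: le_trans (ltW (truncnS_gt _)) _.
by rewrite -natrX ler_nat ltnW// ltn_expl.
Qed.

End Blowup.

(** * From large cubes on the axis to the punctured space *)

Section Cover.
Variable R : realType.
Notation R3 := (R * R * R)%type.
Variables (h : R * R -> R3) (L sn eps m lam : R).
Hypothesis H : chart h L sn eps m lam.
Let g := zmap h lam.

Let lam0 : 0 < lam. Proof. by have := lam_ge4 H; lra. Qed.

(** In the norm given by [nsq], the image of a high cube contains the shell between the radii
    [lam * N] and [100 * lam * N]. In this shell, in two beams at distance of order [N] from the
    axis, lies a preimage [x] of [y] with height at most [lam * N] in absolute value. *)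
Lemma large_covers (y : R3) : y <> 0 -> exists M Bd, 0 < M /\ forall b (W : set R3),
  Bd <= b -> box b M `<=` W -> (g @` (g @` W)) y.
Proof.
move=> y0; have m0 := m_gt0 H; have m1 := m_le1 H; have l4 := lam_ge4 H.
have q0 : 0 < nsq lam y.
  have n0 : 0 <= nsq lam y by rewrite !addr_ge0 ?sqr_ge0.
  rewrite lt_neqAle eq_sym n0 andbT; apply/eqP => /eqP.
  rewrite /nsq paddr_eq0 ?addr_ge0 ?sqr_ge0// paddr_eq0 ?sqr_ge0//.
  rewrite !sqrf_eq0 !mulf_eq0 (gt_eqF lam0)/= => /andP[/andP[/eqP e1 /eqP e2] /eqP e3].
  by apply: y0; case: y e1 e2 e3 {n0} => -[a b] c /= -> -> ->.
set q := nsq lam y in q0.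
(* Makes [m * expR (M' + M') >= 100], a lower bound for the ratio of the radii of the shell. *)
pose M' := 100 / m; have M'0 : 0 < M' by rewrite divr_gt0.
have M'm : 100 <= m * expR (M' + M').
  have -> : 100 = m * M' by rewrite /M'; field; rewrite gt_eqF.
  rewrite ler_pM2l//; have := expR_ge1Dx (M' + M'); lra.
exists (M' + 4), (M' + q / (lam * m) ^+ 2 + lam ^+ 2 / q); split; first lra.
move=> b W bB bW.
have a1 : 0 < q / (lam * m) ^+ 2 by rewrite divr_gt0// exprn_gt0// mulr_gt0.
have a2 : 0 < lam ^+ 2 / q by rewrite divr_gt0// exprn_gt0.
pose N := expR (b - M').
have N1 : 1 + (q / (lam * m) ^+ 2 + lam ^+ 2 / q) <= N.
  by have := expR_ge1Dx (b - M'); rewrite -/N; lra.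
(* Puts the first coordinate of [x] between [N] and [9 * N]. *)
pose j := Num.ceil ((N + 1) / 4).
have j1 : N + 1 <= 4 * j%:~R by have := ceil_ge ((N + 1) / 4); rewrite -/j; lra.
have j2 : 4 * j%:~R < N + 5 by have := ceil_itv ((N + 1) / 4); rewrite -/j; lra.
have lN : 0 <= lam * N by rewrite mulr_ge0 ?expR_ge0 ?(ltW lam0).
have lNN : N <= lam * N by rewrite -[leLHS]mul1r ler_wpM2r ?expR_ge0//; lra.
have [|x [x1 x2 x3 gx]] := @zmap_shell _ _ _ _ _ _ _ H j 0 (lam * N) y lN.
  rewrite sub0r add0r -/q; apply/andP; split.
    rewrite exprMn -ler_pdivlMl ?exprn_gt0// -[_ * q]invrK -[leLHS]invrK lef_pV2 ?posrE ?invr_gt0 ?exprn_gt0 ?expR_gt0//; last first.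
      by rewrite mulr_gt0// invr_gt0 exprn_gt0.
    rewrite invfM invrK -exprVn -expRN opprK -expRM_natl.
    have := expR_ge1Dx (2 * (lam * N)); lra.
  rewrite [leRHS]exprMn -ler_pdivrMl ?exprn_gt0 ?mulr_gt0// -expRM_natl.
  rewrite mulrC; have := expR_ge1Dx (2 * (lam * N)); lra.
exists x => //; move: gx => _.
rewrite sub0r add0r in x3.
have [|w [w1 w2 w3 gw]] := @zmap_shell _ _ _ _ _ _ _ H 0 b M' x (ltW M'0).
  rewrite -/N; apply/andP; split.
    rewrite exprMn; apply: (@le_trans _ _ (lam ^+ 2 * x.1.1 ^+ 2)).
      apply: ler_wpM2l; first exact: sqr_ge0.
      by rewrite lerXn2r ?nnegrE ?expR_ge0//; move: x1 j1 N1 a1 a2; clear - H; lra.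
    by rewrite /nsq exprMn -addrA lerDl addr_ge0 ?sqr_ge0.
  have E : lam * m * expR (b + M') = lam * (m * expR (M' + M') * N).
    by rewrite /N -!mulrA -expRD; congr (_ * (_ * expR _)); ring.
  have N0 : 1 <= N by move: N1 a1 a2; clear - H; lra.
  rewrite E [leRHS]exprMn; apply: (@le_trans _ _ (lam ^+ 2 * (100 * N) ^+ 2)); last first.
    apply: ler_wpM2l; first exact: sqr_ge0.
    by rewrite lerXn2r ?nnegrE ?mulr_ge0 ?expR_ge0 ?(ltW m0)// ler_wpM2r ?expR_ge0.
  have b1 : x.1.1 ^+ 2 <= (9 * N) ^+ 2 by rewrite lerXn2r ?nnegrE//; move: x1 j1 j2 N0; clear - H; lra.
  have b2 : x.1.2 ^+ 2 <= 1 by move: x2; clear - H; nra.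
  have b3 : x.2 ^+ 2 <= (lam * N) ^+ 2.
    by rewrite -real_normK ?num_real// lerXn2r ?nnegrE// ler_norml; clear - H x3 lN; lra.
  have -> : nsq lam x = lam ^+ 2 * (x.1.1 ^+ 2 + x.1.2 ^+ 2) + x.2 ^+ 2 by rewrite /nsq; ring.
  have b12 : x.1.1 ^+ 2 + x.1.2 ^+ 2 + N ^+ 2 <= (100 * N) ^+ 2 by move: b1 b2 N0; clear - H; nra.
  move: b12 b3; rewrite [(lam * N) ^+ 2]exprMn => b12 b3.
  apply: (@le_trans _ _ (lam ^+ 2 * (x.1.1 ^+ 2 + x.1.2 ^+ 2 + N ^+ 2))).
    by rewrite [leRHS]mulrDr; clear - H b3; lra.
  by apply: ler_wpM2l b12; exact: sqr_ge0.
rewrite mulr0 sub0r add0r in w1.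
exists w => //; apply: bW; split; rewrite ltr_norml; clear - H w1 w2 w3 M'0; lra.
Qed.

(** The first image may fall on the negative half of the axis; the second image then has positive
    height. *)
Lemma axis_cover (U : set R3) (k l : int) (z : R) : nbhs ((2 * k%:~R, 2 * l%:~R, z) : R3) U ->
  forall y, y <> 0 -> exists2 n, (0 < n)%N & (iter n g @` U) y.
Proof.
move=> Ux; have l4 := lam_ge4 H.
have [n [b [b0 Nb]]] : exists n b, 0 <= b /\ nbhs ((0, 0, b) : R3) (iter n g @` U).
  have G1 := iter_zmap_open H 1 Ux; have G2 := iter_zmap_open H 2 Ux.
  move: G1 G2; rewrite /= (zmap_axis H) => G1.
  have [s0|s0] := leP 0 (sgn_par R k * sgn_par R l * (lam * expR z)).
    by move=> _; exists 1%N, (sgn_par R k * sgn_par R l * (lam * expR z)).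
  move: (_ * _) => w; rewrite (zmap_axis0 H) => G2.
  by exists 2%N, (lam * expR w); rewrite mulr_ge0 ?expR_ge0 ?(ltW lam0).
have [r r0 br] : exists2 r, 0 < r & box b r `<=` iter n g @` U.
  have [r r0 rb] := (nbhs3P _ _).1 Nb; exists r => // x [x1 x2 x3]; apply: rb.
  by rewrite distrC norm_lt3/= !subr0 x1 x2 x3.
move=> y /large_covers[M [Bd [M0 cov]]].
have [n' [b' [bb sub]]] := box_reach H Bd M0 b0 r0 br.
exists n'.+2 => //; have [x [w [u Uu uw] wx] xy] := cov b' _ bb sub.
by exists u => //=; rewrite uw wx.
Qed.

End Cover.

(** * Volume expansion *)

Section VolumeTools.
Variable R : realType.
Notation R3 := (R * R * R)%type.

Lemma geometric_cover (F : nat -> set R3) (V : set R3) (C r : R) :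
  (forall n, mble3 R (F n)) -> mble3 R V -> 0 <= C -> 0 <= r < 1 ->
  (forall n, (leb3 (F n) <= (C * r ^+ n)%:E)%E) -> V `<=` \bigcup_n F n ->
  (leb3 V <= (C / (1 - r))%:E)%E.
Proof.
move=> mF mV C0 /andP[r0 r1] FC VF.
have := @measure_sigma_subadditive _ _ _ (@leb3 R) V F mF mV VF.
move=> /le_trans; apply.
apply: lime_le; first by apply: is_cvg_nneseries => n _ _; exact: (measure_ge0 (@leb3 R)).
apply: nearW => n; apply: (@le_trans _ _ (\sum_(0 <= k < n) (C * r ^+ k)%:E)%E).
  by apply: lee_sum => k _; exact: FC.
rewrite sumEFin lee_fin.
have [r0'|r0'] := eqVneq r 0.
  rewrite r0' subr0 divr1; case: n => [|n]; first by rewrite big_nil.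
  rewrite big_nat_recl//= expr0 mulr1 big1 ?addr0// => i _; rewrite exprS mul0r mulr0//.
have := @geometric_le_lim _ n C r C0; rewrite lt_neqAle eq_sym r0' r0 ger0_norm// => /(_ isT r1).
by rewrite /series/=.
Qed.

Definition comb2 (D1 D2 : R3) (u : R * R) : R3 :=
  (u.1 * D1.1.1 + u.2 * D2.1.1, u.1 * D1.1.2 + u.2 * D2.1.2, u.1 * D1.2 + u.2 * D2.2).

(* The second hypothesis is used for the [u] such that [comb2 D1 D2 u] is a
   multiple of the projection of [h0] to the plane of [D1] and [D2]. *)
Lemma det_lower (D1 D2 h0 : R3) (l c m : R) :
  0 < l -> 0 <= m -> c ^+ 2 <= 1 -> m ^+ 2 <= dot3 h0 h0 ->
  (forall u, l ^+ 2 * (u.1 ^+ 2 + u.2 ^+ 2) <= dot3 (comb2 D1 D2 u) (comb2 D1 D2 u)) ->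
  (forall u, dot3 h0 (comb2 D1 D2 u) ^+ 2 <=
     c ^+ 2 * dot3 h0 h0 * dot3 (comb2 D1 D2 u) (comb2 D1 D2 u)) ->
  (1 - c ^+ 2) * m ^+ 2 * l ^+ 4 <= det3 D1 D2 h0 ^+ 2.
Proof.
move=> l0 m0 c1 mn low ang.
set a := dot3 D1 D1; set b := dot3 D1 D2; set d := dot3 D2 D2.
set p := dot3 D1 h0; set q := dot3 D2 h0; set n := dot3 h0 h0 in mn ang *.
have DD u : dot3 (comb2 D1 D2 u) (comb2 D1 D2 u) = a * u.1 ^+ 2 + 2 * b * (u.1 * u.2) + d * u.2 ^+ 2.
  by rewrite /comb2 /a /b /d /dot3/=; ring.
have Dh u : dot3 h0 (comb2 D1 D2 u) = u.1 * p + u.2 * q.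
  by rewrite /comb2 /p /q /dot3/=; ring.
(* [G] is the Gram determinant of [D1] and [D2], and [S / G] is the squared length of the projection
   of [h0] to their plane. *)
pose G := a * d - b ^+ 2; pose S := d * p ^+ 2 - 2 * b * (p * q) + a * q ^+ 2.
have detE : det3 D1 D2 h0 ^+ 2 = G * n - S.
  by rewrite /G /S /n /p /q /a /b /d /det3 /dot3 /cross3/=; ring.
have l2 : 0 < l ^+ 2 by rewrite exprn_gt0.
have al : l ^+ 2 <= a by have := low (1, 0); rewrite DD/=; lra.
have a0 : 0 < a by lra.
have Gl : l ^+ 4 <= G.
  have := low (- b, a); rewrite DD/= [X in _ <= X](_ : _ = a * G); last by rewrite /G; ring.
  have -> : l ^+ 4 = l ^+ 2 * l ^+ 2 by ring.
  have := sqr_ge0 b => b2 aG.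
  have : a * (l ^+ 2 * a) <= a * G by nra.
  by rewrite ler_pM2l//; nra.
have l4 : 0 < l ^+ 4 by rewrite exprn_gt0.
have S0 : 0 <= S.
  have := low (d * p - b * q, a * q - b * p); rewrite DD/=.
  rewrite [X in _ <= X](_ : _ = G * S); last by rewrite /G /S; ring.
  move=> /(le_trans _) GS; have : 0 <= G * S by apply: GS; rewrite mulr_ge0 ?addr_ge0 ?sqr_ge0.
  by rewrite pmulr_rge0//; lra.
have key : S <= c ^+ 2 * n * G.
  have := ang (d * p - b * q, a * q - b * p); rewrite DD Dh/=.
  rewrite [X in X ^+ 2 <= _](_ : _ = S); last by rewrite /S; ring.
  rewrite [X in _ <= _ * X](_ : _ = G * S); last by rewrite /G /S; ring.
  have [<- _|/eqP S1] := eqVneq 0 S.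
    apply: mulr_ge0; last lra.
    by apply: mulr_ge0; [exact: sqr_ge0|exact: le_trans (sqr_ge0 _) mn].
  have Sp : 0 < S by lra.
  by rewrite [leRHS](_ : _ = c ^+ 2 * n * G * S) 1?expr2 ?ler_pM2r//; ring.
rewrite detE; apply: (@le_trans _ _ ((1 - c ^+ 2) * (n * G))); last by lra.
rewrite -mulrA; apply: ler_wpM2l; first by lra.
by apply: ler_pM => //; [exact: sqr_ge0|exact: ltW].
Qed.

End VolumeTools.

(** * A volume bound for nearly linear maps *)

Section PieceVolume.
Variable R : realType.
Notation R3 := (R * R * R)%type.

Lemma expR_taylor1 (s : R) : `|s| <= 2^-1 -> `|expR s - 1 - s| <= 2 * s ^+ 2.
Proof.
move=> s2; have s2' : s <= 2^-1 /\ - s <= 2^-1 by move: s2; rewrite ler_norml; lra.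
have e1 := expR_ge1Dx s; have := expR_ge1Dx (- s); rewrite expRN => e2.
have ep := expR_gt0 s.
have e3 : expR s * (1 - s) <= 1.
  by move: e2; rewrite -[X in _ <= X]mul1r ler_pdivlMr// mulrC.
by rewrite ler_norml; apply/andP; split; [have := sqr_ge0 s; lra|nra].
Qed.

Lemma expR_near (s e : R) : 0 <= e <= 2^-1 -> `|s| <= e -> `|expR s - 1| <= 2 * e.
Proof.
move=> /andP[e0 e2] se; have := @expR_taylor1 s (le_trans se e2).
have ss : s ^+ 2 <= e * e.
  by rewrite -real_normK ?num_real// expr2; apply: ler_pM.
by move: se; rewrite !ler_norml; nra.
Qed.

Lemma cramer3 (D1 D2 h0 d : R3) :
  let c := (d.1.1 * D1.1.1 + d.1.2 * D2.1.1 + d.2 * h0.1.1,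
    d.1.1 * D1.1.2 + d.1.2 * D2.1.2 + d.2 * h0.1.2, d.1.1 * D1.2 + d.1.2 * D2.2 + d.2 * h0.2) in
  [/\ dot3 (cross3 D2 h0) c = det3 D1 D2 h0 * d.1.1, dot3 (cross3 h0 D1) c = det3 D1 D2 h0 * d.1.2 &
    dot3 (cross3 D1 D2) c = det3 D1 D2 h0 * d.2].
Proof. by rewrite /det3 /dot3 /cross3/=; split; ring. Qed.

Lemma det3_cofactor (D1 D2 h0 : R3) (k : R) : k != 0 ->
  let a (r : R3) := (r.1.1, r.1.2, r.2 / k) in
  det3 (a (cross3 D2 h0)) (a (cross3 h0 D1)) (a (cross3 D1 D2)) = det3 D1 D2 h0 ^+ 2 / k.
Proof. by move=> k0; rewrite /det3 /dot3 /cross3/=; field. Qed.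

(** The cofactor rows [r1], [r2], [r3] turn the linear part into [det3 D1 D2 h0] times the identity.
    Their entries are at most [2 B ^ 2], so the three error terms cost [6 B ^ 2 e], and the composed
    map expands the sup norm by [b]. *)
Lemma volume_lower (K : set R3) (phi : R3 -> R3) (D1 D2 h0 : R3) (ez k B e : R) :
  compact K -> continuous phi -> 0 < ez -> k != 0 -> 0 <= e -> 0 <= B ->
  `|D1| <= B -> `|D2| <= B -> `|h0| <= B ->
  6 * B ^+ 2 * e < `|det3 D1 D2 h0| ->
  (forall x y, K x -> K y ->
     let d := x - y in let w := phi x - phi y in
     [/\ `|w.1.1 - ez * (d.1.1 * D1.1.1 + d.1.2 * D2.1.1 + d.2 * h0.1.1)| <= ez * e * `|d|,
      `|w.1.2 - ez * (d.1.1 * D1.1.2 + d.1.2 * D2.1.2 + d.2 * h0.1.2)| <= ez * e * `|d| &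
      `|w.2 / k - ez * (d.1.1 * D1.2 + d.1.2 * D2.2 + d.2 * h0.2)| <= ez * e * `|d| ]) ->
  (((ez * (`|det3 D1 D2 h0| - 6 * B ^+ 2 * e)) ^+ 3 * `|k|)%:E * leb3 K <=
  (det3 D1 D2 h0 ^+ 2)%:E * leb3 (phi @` K))%E.
Proof.
move=> cK cphi ez0 k0 e0 B0; rewrite !norm_le3.
move=> /and3P[D11 D12 D13] /and3P[D21 D22 D23] /and3P[h1 h2 h3].
set D := det3 D1 D2 h0 => dr H.
pose r1 := cross3 D2 h0; pose r2 := cross3 h0 D1; pose r3 := cross3 D1 D2.
have [b bE b0] : exists2 b, b = ez * (`|D| - 6 * B ^+ 2 * e) & 0 < b.
  by exists (ez * (`|D| - 6 * B ^+ 2 * e)); rewrite // mulr_gt0// subr_gt0.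
have nk : 0 < `|k| by rewrite normr_gt0.
pose a (r : R3) : R3 := (r.1.1, r.1.2, r.2 / k).
have D0 : D != 0.
  by rewrite -normr_gt0; apply: le_lt_trans dr; rewrite !mulr_ge0// sqr_ge0.
have deta : det3 (a r1) (a r2) (a r3) = D ^+ 2 / k.
  exact: det3_cofactor.
have detb : det3 (b, 0, 0) (0, b, 0) (0, 0, b) = b ^+ 3.
  by rewrite /det3 /dot3 /cross3/=; ring.
have := @leb3_expand_lin R K phi (a r1) (a r2) (a r3) (b, 0, 0) (0, b, 0) (0, 0, b) cK cphi.
have na : `|D ^+ 2 / k| = D ^+ 2 / `|k|.
  by rewrite normf_div ger0_norm ?sqr_ge0.
have nb : `|b ^+ 3| = b ^+ 3 by rewrite gtr0_norm ?exprn_gt0.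
rewrite deta detb na nb => /(_ _ _ _)/(lee_wpmul2l (x := `|k|%:E)).
rewrite !muleA -!EFinM -bE [`|k| * _]mulrC [`|k| * (_ / _)]mulrCA mulfV ?normr_eq0// mulr1.
apply => //.
- by rewrite mulf_neq0 ?invr_eq0// expf_neq0.
- by rewrite expf_neq0// gt_eqF.
move=> x y Kx Ky; have := H x y Kx Ky; set d := x - y; set w := phi x - phi y => /=.
set E1 := (X in `|X| <= _); set E2 := (X in [/\ _, `|X| <= _ & _]).
set E3 := (X in [/\ _, _ & `|X| <= _]) => -[e1 e2 e3].
have d0 : 0 <= `|d| by [].
have cr (u v : R3) : [&& `|u.1.1| <= B, `|u.1.2| <= B & `|u.2| <= B] ->
    [&& `|v.1.1| <= B, `|v.1.2| <= B & `|v.2| <= B] ->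
    [&& `|(cross3 u v).1.1| <= 2 * B ^+ 2, `|(cross3 u v).1.2| <= 2 * B ^+ 2 & `|(cross3 u v).2| <= 2 * B ^+ 2].
  have pr (p q r s : R) : `|p| <= B -> `|q| <= B -> `|r| <= B -> `|s| <= B -> `|p * q - r * s| <= 2 * B ^+ 2.
    move=> pB qB rB sB; apply: le_trans (ler_normB _ _) _; rewrite !normrM.
    have : `|p| * `|q| <= B * B by apply: ler_pM.
    have : `|r| * `|s| <= B * B by apply: ler_pM.
    by rewrite expr2; clear; lra.
  by move=> /and3P[? ? ?] /and3P[? ? ?]; apply/and3P; split; exact: pr.
pose c : R3 := (d.1.1 * D1.1.1 + d.1.2 * D2.1.1 + d.2 * h0.1.1,
  d.1.1 * D1.1.2 + d.1.2 * D2.1.2 + d.2 * h0.1.2, d.1.1 * D1.2 + d.1.2 * D2.2 + d.2 * h0.2).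
have [cr1 cr2 cr3] := cramer3 D1 D2 h0 d.
have row (r : R3) (t : R) : [&& `|r.1.1| <= 2 * B ^+ 2, `|r.1.2| <= 2 * B ^+ 2 & `|r.2| <= 2 * B ^+ 2] ->
    dot3 r c = D * t -> `|t| = `|d| ->
    `|b * `|d| | <= `|dot3 (a r) w|.
  move=> /and3P[r11 r12 r13] rc td.
  have -> : dot3 (a r) w = ez * (D * t) + (r.1.1 * E1 + r.1.2 * E2 + r.2 * E3).
    rewrite -rc /E1 /E2 /E3 /c /a /dot3; rewrite /=; clear; ring.
  rewrite ger0_norm ?mulr_ge0 ?(ltW b0)//.
  have p (q E : R) : `|q| <= 2 * B ^+ 2 -> `|E| <= ez * e * `|d| -> `|q * E| <= 2 * B ^+ 2 * (ez * e * `|d|).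
    by move=> qB Ed; rewrite normrM; apply: ler_pM.
  have s : `|r.1.1 * E1 + r.1.2 * E2 + r.2 * E3| <= 3 * (2 * B ^+ 2 * (ez * e * `|d|)).
    apply: le_trans (ler_normD _ _) _; apply: le_trans (lerD (ler_normD _ _) (lexx _)) _.
    by have := p _ _ r11 e1; have := p _ _ r12 e2; have := p _ _ r13 e3; clear; lra.
  have bdE : b * `|d| = `|ez * (D * t)| - 3 * (2 * B ^+ 2 * (ez * e * `|d|)).
    by rewrite !normrM (gtr0_norm ez0) td bE; ring.
  have := lerB_normD (ez * (D * t)) (r.1.1 * E1 + r.1.2 * E2 + r.2 * E3).
  by rewrite bdE; clear - s; lra.
have lb : `|lin3 (b, 0, 0) (0, b, 0) (0, 0, b) d| <= b * `|d|.
  have [d1 d2 d3] := norm_comp3 d.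
  by rewrite norm_le3 /lin3 /dot3/= !mul0r !addr0 !add0r !normrM !(gtr0_norm b0) !ler_pM2l//; apply/and3P.
apply: le_trans lb _.
have bd : b * `|d| = `|b * `|d| | by rewrite ger0_norm// mulr_ge0// ltW.
have [l1 l2 l3] := norm_comp3 (lin3 (a r1) (a r2) (a r3) w).
have B1 : [&& `|D1.1.1| <= B, `|D1.1.2| <= B & `|D1.2| <= B] by apply/and3P.
have B2 : [&& `|D2.1.1| <= B, `|D2.1.2| <= B & `|D2.2| <= B] by apply/and3P.
have B3 : [&& `|h0.1.1| <= B, `|h0.1.2| <= B & `|h0.2| <= B] by apply/and3P.
have : `|d| = `|d.1.1| \/ `|d| = `|d.1.2| \/ `|d| = `|d.2|.
  rewrite !prod_normE /=.
  by case: (leP (Num.max _ _)) => _; [right; right|case: (leP `|d.1.1|) => _; [right; left|left]].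
rewrite bd; case=> [E|[E|E]].
- apply: le_trans l1; apply: (row r1 d.1.1) => //; exact: cr.
- apply: le_trans l2; apply: (row r2 d.1.2) => //; exact: cr.
- apply: le_trans l3; apply: (row r3 d.2) => //; exact: cr.
Qed.

End PieceVolume.

Section Euclid.
Variable R : realType.
Notation R3 := (R * R * R)%type.

Lemma dot3_cauchy (x y : R3) : `|dot3 x y| <= norm3 x * norm3 y.
Proof.
have n0 : 0 <= norm3 x * norm3 y by rewrite mulr_ge0// norm3_ge0.
rewrite -(@ler_pXn2r _ 2)// ?nnegrE// real_normK ?num_real// exprMn !norm3_sq.
rewrite -subr_ge0 [leRHS](_ : _ = dot3 (cross3 x y) (cross3 x y)); first exact: dot3_ge0.
by rewrite /dot3 /cross3/=; ring.
Qed.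

Lemma norm3_triangle (x y : R3) : norm3 (x + y) <= norm3 x + norm3 y.
Proof.
have n0 : 0 <= norm3 x + norm3 y by rewrite addr_ge0// norm3_ge0.
rewrite norm3_le// sqrrD !norm3_sq.
have := le_trans (ler_norm _) (dot3_cauchy x y).
have -> : dot3 (x + y) (x + y) = dot3 x x + 2 * dot3 x y + dot3 y y by rewrite /dot3/=; ring.
lra.
Qed.

Lemma norm3N (x : R3) : norm3 (- x) = norm3 x.
Proof. by rewrite /norm3; congr Num.sqrt; rewrite /dot3/=; ring. Qed.

Lemma norm3_sup (x : R3) : norm3 x <= 2 * `|x|.
Proof.
rewrite norm3_le ?mulr_ge0//; have [c1 c2 c3] := norm_comp3 x.
have sq (t : R) : `|t| <= `|x| -> t ^+ 2 <= `|x| ^+ 2.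
  by move=> tx; rewrite -real_normK ?num_real// lerXn2r ?nnegrE.
have := sq _ c1; have := sq _ c2; have := sq _ c3; have := sqr_ge0 `|x|.
by rewrite /dot3 -!expr2 exprMn; lra.
Qed.

End Euclid.

(** * Closed sets with uniform difference quotients *)

Section Pieces.
Variable R : realType.
Notation R3 := (R * R * R)%type.
Variables (h : R * R -> R3) (L sn eps m lam : R).
Hypothesis H : chart h L sn eps m lam.

Definition hx (x : R3) : R3 := h (fold2 x).

(** An Egorov-type set: existence of partial derivatives is made quantitative by fixing the range of
    steps and the approximate values, which leaves only closed conditions on [x]. *)
Definition piece (D1 D2 : R3) (e : R) (k : nat) : set R3 :=
  [set x | forall t : R, `|t| <= k.+1%:R^-1 ->
    `|hx (x + (t, 0, 0)) - hx x - scale3 t D1| <= e * `|t| /\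
    `|hx (x + (0, t, 0)) - hx x - scale3 t D2| <= e * `|t| ].

Lemma hx_continuous : continuous hx.
Proof.
have [h1 h2 h3] := h_fold_continuous H.
have := continuous_pair3 h1 h2 h3.
rewrite (_ : (fun x => _) = hx)//.
by apply/funext => x; rewrite /hx; case: (h _) => -[].
Qed.

Lemma piece_closed D1 D2 e k : closed (piece D1 D2 e k).
Proof.
have cc (T : R3 -> R3) (v : R3) (a : R) : continuous T -> closed [set x | `|hx (T x) - hx x - v| <= a].
  move=> cT; apply: (@preimage_closed _ _ (fun x : R3 => `|hx (T x) - hx x - v|) [set t | t <= a]).
    move=> x _; apply: cvg_norm; apply: cvgB; last exact: cvg_cst.
    apply: cvgB; last exact: hx_continuous.
    by apply: continuous_comp; [exact: cT|exact: hx_continuous].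
  exact: closed_le.
rewrite (_ : piece _ _ _ _ = \bigcap_(t in [set t : R | `|t| <= k.+1%:R^-1])
  ([set x | `|hx (x + (t, 0, 0)) - hx x - scale3 t D1| <= e * `|t| ] `&`
   [set x | `|hx (x + (0, t, 0)) - hx x - scale3 t D2| <= e * `|t| ])); last first.
  by apply/seteqP; split.
apply: closed_bigI => t _; apply: closedI; apply: cc => x;
  by apply: cvgD; [exact: cvg_id|exact: cvg_cst].
Qed.

Lemma hx_lip x y : `|hx x - hx y| <= 2 * L * `|x - y|.
Proof.
apply: le_trans (h_fold_lip H x y).
by rewrite norm_le3; apply/and3P; have [] := norm3_comp (sub3 (h (fold2 x)) (h (fold2 y))).
Qed.

(** Partial derivatives give an affine approximation between two points of the same piece: the
    horizontal step from [y] and the vertical step from [x] end at a common corner, which may lie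
    off the piece. *)
Lemma piece_pair D1 D2 e k x y : 0 <= e -> piece D1 D2 e k x -> piece D1 D2 e k y ->
  `|x - y| <= k.+1%:R^-1 ->
  `|hx x - hx y - comb2 D1 D2 (x - y).1| <= 2 * e * `|x - y|.
Proof.
move=> e0 px py xy; have [d1 d2 _] := norm_comp3 (x - y).
have [+ _] := py (x - y).1.1 (le_trans d1 xy).
have d2' : `|- (x - y).1.2| <= `|x - y| by rewrite normrN.
have [_ +] := px (- (x - y).1.2) (le_trans d2' xy).
have -> : hx (x + (0, - (x - y).1.2, 0)) = hx (y + ((x - y).1.1, 0, 0)).
  by rewrite /hx; congr h; rewrite /fold2/=; congr (fold _ _, fold _ _); ring.
set c := hx (y + _) => px' py'.
have -> : hx x - hx y - comb2 D1 D2 (x - y).1 =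
  (c - hx y - scale3 (x - y).1.1 D1) - (c - hx x - scale3 (- (x - y).1.2) D2).
  by rewrite /comb2 /scale3; apply/eqP; rewrite -subr_eq0; apply/eqP;
    congr (_, _, _) => /=; ring.
apply: le_trans (ler_normB _ _) _.
have := ler_wpM2l e0 d1; have := ler_wpM2l e0 d2'; lra.
Qed.

Lemma piece_bound D1 D2 e k x : e <= 1 -> piece D1 D2 e k x -> `|D1| <= 2 * L + 1 /\ `|D2| <= 2 * L + 1.
Proof.
move=> e1 px; pose t : R := k.+1%:R^-1.
have t0 : 0 < t by rewrite invr_gt0.
have tt : `|t| <= t by rewrite gtr0_norm.
have [p1 p2] := px t tt.
have key (D v : R3) : `|v| = t -> `|hx (x + v) - hx x - scale3 t D| <= e * `|t| -> `|D| <= 2 * L + 1.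
  move=> vt p; have tD : `|scale3 t D| <= (2 * L + 1) * t.
    rewrite -[scale3 t D](subKr (hx (x + v) - hx x)); apply: le_trans (ler_normB _ _) _.
    have := hx_lip (x + v) x; rewrite addrAC subrr add0r vt.
    move: p; rewrite (gtr0_norm t0); have := ler_wpM2r (ltW t0) e1; lra.
  move: tD; rewrite !norm_le3 /scale3/= !normrM !(gtr0_norm t0) ![t * _]mulrC.
  by rewrite !ler_pM2r.
have n (a b c : R) : `|(a, b, c) : R3| = Num.max (Num.max `|a| `|b|) `|c| by [].
split; [apply: key p1|apply: key p2]; rewrite n normr0 (gtr0_norm t0).
  by rewrite !max_l// ltW.
by rewrite max_l ?max_r// ltW.
Qed.

(** The cosine of the angle bound, worsened by the relative error [a] of the position vector and [b]
    of the chord. At [e = 0] it is the true cosine. *)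
Definition cosb (e : R) : R :=
  let a := 2 * e / m in let b := 8 * L * e in
  Num.sqrt (1 - sn ^+ 2) * (1 + a) * (1 + b) + a * (1 + b) + b.

(** A set of positive measure contains, for each horizontal direction [u], two distinct points that
    differ by a multiple of [u]. The bi-Lipschitz and angle conditions for their chord pass, with
    errors of order [e], to the tangent vector [comb2 D1 D2 u], and [det_lower] applies. *)
Lemma piece_det D1 D2 e k (h0 : R3) (K : set R3) (i j : int) :
  0 <= e -> 4 * e <= eps -> 8 * L * e <= 1 -> 2 * e <= m -> cosb e ^+ 2 <= 1 -> m <= norm3 h0 ->
  compact K -> leb3 K != 0%E -> K `<=` piece D1 D2 e k ->
  (forall x y, K x -> K y -> `|x - y| <= k.+1%:R^-1) ->
  (forall x, K x -> in_beam i j x /\ `|hx x - h0| <= e) ->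
  (1 - cosb e ^+ 2) * m ^+ 2 * (L^-1 - 4 * e) ^+ 4 <= det3 D1 D2 h0 ^+ 2.
Proof.
move=> e0 eeps eL em c1 mh cK K0 Kp Kd Kb; set l := L^-1 - 4 * e.
have L0 := L_gt0 H; have m0 := m_gt0 H.
have l0 : 0 < l /\ (2 * L)^-1 <= l.
  have : 8 * e <= L^-1 by rewrite -[leRHS]mul1r ler_pdivlMr//; lra.
  have iL : 0 < L^-1 by rewrite invr_gt0.
  have -> : (2 * L)^-1 = L^-1 / 2 by field; rewrite gt_eqF.
  by rewrite /l; split; lra.
have n2 (u : R * R) : norm2 u = 0 -> u = 0.
  move=> E; have := norm2_sq u; rewrite E expr0n/= => /esym/eqP.
  rewrite paddr_eq0 ?sqr_ge0// !sqrf_eq0 => /andP[/eqP u1 /eqP u2].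
  by case: u u1 u2 {E} => a b /= -> ->.
have pair (u : R * R) : u != 0 -> exists r W hb, [/\ r != 0, hb = h0 \/ `|hb - h0| <= e,
    `|r| * norm2 u <= L * norm3 W, norm3 (W - comb2 D1 D2 (r * u.1, r * u.2)) <= 4 * e * (`|r| * norm2 u) &
    dot3 hb W ^+ 2 <= (1 - sn ^+ 2) * dot3 hb hb * dot3 W W].
  move=> u0; have : ~ forall x y r, K x -> K y -> x - y = (r * u.1, r * u.2, 0) -> x = y.
    by move=> /(leb3_line_null u0 (compact3_measurable cK)) E; rewrite E eqxx in K0.
  move=> /existsNP[x /existsNP[y /existsNP[r /not_implyP[Kx /not_implyP[Ky /not_implyP[xyE xy]]]]]].
  have r0 : r != 0.
    apply/eqP => r0; apply: xy; apply/eqP; rewrite -subr_eq0 xyE r0 !mul0r; exact/eqP.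
  have [bx hxx] := Kb x Kx; have [by_ hyy] := Kb y Ky.
  exists r, (hx x - hx y), (hx y); split => //; first by right.
  - have -> : `|r| * norm2 u = norm2 (sub2 (fold2 x) (fold2 y)).
      have s1 (s : int) : sgn_par R s ^+ 2 = 1 by case: (sgn_par_cases R s) => ->; ring.
      have E1 : x.1.1 - y.1.1 = r * u.1 by have := congr1 (fun p : R3 => p.1.1) xyE.
      have E2 : x.1.2 - y.1.2 = r * u.2 by have := congr1 (fun p : R3 => p.1.2) xyE.
      rewrite (fold2_beam bx) (fold2_beam by_) /norm2 /sub2 /beam_coord/=.
      have -> (s a b c : R) : s * (a - c) - s * (b - c) = s * (a - b) by ring.
      have -> (s a b c : R) : s * (a - c) - s * (b - c) = s * (a - b) by ring.
      rewrite E1 E2 !exprMn !s1 !mul1r -mulrDr sqrtrM ?sqr_ge0// sqrtr_sqr//.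
    by apply: (h_lower H); exact: fold2_Q.
  - have := piece_pair e0 (Kp _ Kx) (Kp _ Ky) (Kd _ _ Kx Ky); rewrite xyE/= => pp.
    apply: le_trans (norm3_sup _) _; have -> : 4 * e * (`|r| * norm2 u) = 2 * (2 * e * (`|r| * norm2 u)) by ring.
    rewrite ler_pM2l//; apply: le_trans pp _; apply: ler_wpM2l; first by rewrite mulr_ge0.
    have ui : `|u.1| <= norm2 u /\ `|u.2| <= norm2 u.
      by rewrite /norm2 -!sqrtr_sqr; split; apply: ler_wsqrtr; rewrite ?lerDl ?lerDr; exact: sqr_ge0.
    case: ui => u1 u2; rewrite norm_le3/= normr0 !normrM !ler_wpM2l//.
    by rewrite mulr_ge0// norm2_ge0.
  - have q := fold2_Q; apply: (h_nontangent H) => //.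
    apply: le_trans eeps; apply: le_trans (norm3_sup _) _.
    have -> : sub3 (h (fold2 x)) (h (fold2 y)) = (hx x - h0) - (hx y - h0) by rewrite opprB addrA subrK.
    have := ler_normB (hx x - h0) (hx y - h0); lra.
have low u : l * norm2 u <= norm3 (comb2 D1 D2 u).
  have [->|u0] := eqVneq u 0.
    have -> : norm2 (0 : R * R) = 0 by rewrite /norm2/= !expr0n addr0 sqrtr0.
    by rewrite mulr0 norm3_ge0.
  have [r [W [hb [r0 _ WL WE _]]]] := pair u u0; have r1 : 0 < `|r| by rewrite normr_gt0.
  have cE : comb2 D1 D2 (r * u.1, r * u.2) = scale3 r (comb2 D1 D2 u).
    by rewrite /comb2 /scale3/=; congr (_, _, _); ring.
  have := norm3_triangle (W - scale3 r (comb2 D1 D2 u)) (scale3 r (comb2 D1 D2 u)).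
  rewrite cE in WE; rewrite subrK norm3_scale => tri.
  rewrite -(ler_pM2l r1); have : `|r| * norm2 u / L <= norm3 W by rewrite ler_pdivrMr// [leRHS]mulrC.
  by rewrite /l; lra.
apply: det_lower => //; [by case: l0|exact: ltW| | |].
- by rewrite -norm3_sq lerXn2r ?nnegrE ?norm3_ge0 ?(ltW m0).
- move=> u; rewrite -norm2_sq -exprMn -norm3_sq lerXn2r ?nnegrE ?norm3_ge0//.
  by rewrite mulr_ge0 ?norm2_ge0//; case: l0 => /ltW.
move=> u; have [->|u0] := eqVneq u 0.
  have -> : comb2 D1 D2 0 = 0 by rewrite /comb2/= !mul0r !addr0.
  by rewrite /dot3/= !mulr0 !addr0 mulr0 expr0n.
have [r [W [hb [r0 hbh WL WE nt]]]] := pair u u0; have r1 : 0 < `|r| by rewrite normr_gt0.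
have cE : comb2 D1 D2 (r * u.1, r * u.2) = scale3 r (comb2 D1 D2 u).
  by rewrite /comb2 /scale3/=; congr (_, _, _); ring.
rewrite cE in WE; have ru := low u.
set V := comb2 D1 D2 u in WE ru *; pose a := 2 * e / m; pose b := 8 * L * e.
have a0 : 0 <= a by rewrite divr_ge0 ?mulr_ge0// ltW.
have b0 : 0 <= b by rewrite !mulr_ge0// ltW.
have rV : 0 <= `|r| * norm3 V by rewrite mulr_ge0// norm3_ge0.
have Eb : norm3 (W - scale3 r V) <= b * (`|r| * norm3 V).
  apply: le_trans WE _; have -> : b * (`|r| * norm3 V) = 4 * e * (`|r| * (2 * L * norm3 V)) by rewrite /b; ring.
  apply: ler_wpM2l; first by rewrite mulr_ge0.
  apply: ler_wpM2l => //; rewrite -ler_pdivrMl ?mulr_gt0//; apply: le_trans ru.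
  by apply: ler_wpM2r; [exact: norm2_ge0|case: l0].
have Wb : norm3 W <= (1 + b) * (`|r| * norm3 V).
  have := norm3_triangle (W - scale3 r V) (scale3 r V); rewrite subrK norm3_scale; clear - H Eb; lra.
have hbb : norm3 (hb - h0) <= a * norm3 h0 /\ norm3 hb <= (1 + a) * norm3 h0.
  have h1 : norm3 (hb - h0) <= 2 * e.
    case: hbh => [->|hh]; last by apply: le_trans (norm3_sup _) _; lra.
    by rewrite subrr [norm3 _](_ : _ = 0) ?mulr_ge0// /norm3 /dot3/= !mulr0 !addr0 sqrtr0.
  have h2 : 2 * e <= a * norm3 h0.
    rewrite /a mulrAC ler_pdivlMr//; apply: ler_wpM2l => //; clear - H e0; lra.
  split; first by clear - H h1 h2; lra.
  by have := norm3_triangle (hb - h0) h0; rewrite subrK; clear - H h1 h2; lra.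
case: hbb => hb1 hb2; set n := norm3 h0 in mh hb1 hb2 *.
have n0 : 0 <= n by exact: norm3_ge0.
pose ct := Num.sqrt (1 - sn ^+ 2).
have ct0 : 0 <= ct by exact: sqrtr_ge0.
have ctE : 1 - sn ^+ 2 = ct ^+ 2.
  by rewrite sqr_sqrtr// subr_ge0 -(expr1n _ 2) lerXn2r ?nnegrE ?(ltW (sn_gt0 H)) ?(ltW (sn_lt1 H)).
have hW : `|dot3 hb W| <= ct * norm3 hb * norm3 W.
  rewrite -(@ler_pXn2r _ 2)// ?nnegrE ?mulr_ge0 ?norm3_ge0//.
  by rewrite real_normK ?num_real// !exprMn !norm3_sq -ctE.
(* Passing from [hb] to [h0] and from the chord [W] to the tangent vector costs one term each. *)
have main : `|dot3 h0 (scale3 r V)| <= cosb e * n * (`|r| * norm3 V).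
  have -> : dot3 h0 (scale3 r V) = dot3 hb W - dot3 (hb - h0) W - dot3 h0 (W - scale3 r V).
    by rewrite /dot3/=; ring.
  apply: le_trans (ler_normB _ _) _; apply: le_trans (lerD (ler_normB _ _) (lexx _)) _.
  have t1 : `|dot3 hb W| <= ct * ((1 + a) * n) * ((1 + b) * (`|r| * norm3 V)).
    apply: le_trans hW _; apply: ler_pM; rewrite ?mulr_ge0 ?norm3_ge0//.
    by apply: ler_wpM2l.
  have t2 : `|dot3 (hb - h0) W| <= a * n * ((1 + b) * (`|r| * norm3 V)).
    by apply: le_trans (dot3_cauchy _ _) _; apply: ler_pM; rewrite ?norm3_ge0.
  have t3 : `|dot3 h0 (W - scale3 r V)| <= n * (b * (`|r| * norm3 V)).
    by apply: le_trans (dot3_cauchy _ _) _; apply: ler_pM; rewrite ?norm3_ge0.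
  have -> : cosb e * n * (`|r| * norm3 V) = ct * ((1 + a) * n) * ((1 + b) * (`|r| * norm3 V)) +
     a * n * ((1 + b) * (`|r| * norm3 V)) + n * (b * (`|r| * norm3 V)).
    by rewrite /cosb -/a -/b -/ct; ring.
  by clear - t1 t2 t3; lra.
have rE : dot3 h0 (scale3 r V) = r * dot3 h0 V by rewrite /dot3/=; ring.
have : `|dot3 h0 V| <= cosb e * n * norm3 V.
  rewrite -(ler_pM2l r1) -normrM -rE; apply: le_trans main _.
  by rewrite [leRHS]mulrCA.
move=> mm; have pos : 0 <= cosb e * n * norm3 V by exact: le_trans mm.
rewrite -[leLHS]real_normK ?num_real//.
have -> : cosb e ^+ 2 * dot3 h0 h0 * dot3 V V = (cosb e * n * norm3 V) ^+ 2.
  by rewrite !exprMn !norm3_sq.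
by rewrite lerXn2r ?nnegrE.
Qed.

End Pieces.

(** * Error terms and the choice of the tolerance *)

Section LocalVolume.
Variable R : realType.
Notation R3 := (R * R * R)%type.
Variables (h : R * R -> R3) (L sn eps m lam : R).
Hypothesis H : chart h L sn eps m lam.

(** The sum of the errors of four substitutions: the first-order expansion of [expR], [q] for [X], 1
    for [expR t'], and [P] for [X - Y]. *)
Lemma exp_pair_err (t t' e X Y P q d l : R) : 0 <= e <= 2^-1 -> `|t| <= e / 2 -> `|t'| <= e / 2 ->
  `|X| <= 1 -> `|X - q| <= e -> `|X - Y| <= l * d -> `|X - Y - P| <= 2 * e * d -> `|t - t'| <= d ->
  `|expR t * X - expR t' * Y - (P + (t - t') * q)| <= (9 + 2 * l) * e * d.
Proof.
move=> /andP[e0 e1] te te' X1 Xq XY XYP td.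
have d0 : 0 <= d by exact: le_trans td.
set s := t - t' in td *.
have es : expR t = expR t' * expR s by rewrite -expRD /s addrCA subrr addr0.
have se : `|s| <= e by apply: le_trans (ler_normB _ _) _; lra.
have e2 : 0 <= e <= 2^-1 by rewrite e0.
have n1 : `|expR t' - 1| <= e.
  have -> : e = 2 * (e / 2) by field.
  by apply: expR_near => //; lra.
have n2 := expR_taylor1 (le_trans se e1).
have ep : expR t' <= 2 by move: n1; rewrite ler_norml; lra.
have n3 : `|expR s - 1 - s| <= 2 * e * d.
  apply: le_trans n2 _; rewrite -real_normK ?num_real// -mulrA; apply: ler_wpM2l => //.
  by rewrite expr2; apply: ler_pM.
have a1 : `|(expR t - expR t' - s) * X| <= 5 * e * d.
  rewrite normrM; apply: (@le_trans _ _ (5 * e * d * 1)); last by rewrite mulr1.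
  apply: ler_pM => //; have -> : expR t - expR t' - s = expR t' * (expR s - 1 - s) + (expR t' - 1) * s.
    by rewrite es; ring.
  apply: le_trans (ler_normD _ _) _; rewrite !normrM (gtr0_norm (expR_gt0 _)).
  have : expR t' * `|expR s - 1 - s| <= 2 * (2 * e * d) by apply: ler_pM; rewrite ?expR_ge0.
  have : `|expR t' - 1| * `|s| <= e * d by apply: ler_pM.
  by clear - H; lra.
have a2 : `|s * (X - q)| <= d * e by rewrite normrM; apply: ler_pM.
have a3 : `|(expR t' - 1) * (X - Y)| <= e * (l * d) by rewrite normrM; apply: ler_pM.
have -> : expR t * X - expR t' * Y - (P + s * q) =
  (expR t - expR t' - s) * X + s * (X - q) + (expR t' - 1) * (X - Y) + (X - Y - P) by ring.
have ed : 0 <= e * d by rewrite mulr_ge0.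
have eld : 0 <= e * (l * d) by apply: le_trans a3.
apply: le_trans (ler_normD _ _) _; apply: le_trans (lerD (ler_normD _ _) (lexx _)) _.
apply: le_trans (lerD (lerD (ler_normD _ _) (lexx _)) (lexx _)) _.
by move: a1 a2 a3 XYP eld ed; clear - H; lra.
Qed.

(** The quotient of [(D - r) ^ 3] by [D ^ 2] increases with [D]. The volume factor of [volume_lower]
    has this form, so the determinant may be replaced by its lower bound. *)
Lemma det_ratio_mono (D d r : R) : 0 <= r < d -> d <= D ->
  (d - r) ^+ 3 * D ^+ 2 <= (D - r) ^+ 3 * d ^+ 2.
Proof.
move=> /andP[r0 rd] dD; have d0 : 0 < d by lra.
have k1 : (d - r) * D <= (D - r) * d by nra.
have k2 : ((d - r) * D) ^+ 3 <= ((D - r) * d) ^+ 3.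
  by rewrite lerXn2r ?nnegrE// mulr_ge0; lra.
rewrite -(ler_pM2r d0); apply: (@le_trans _ _ (((d - r) * D) ^+ 3)).
  have -> : ((d - r) * D) ^+ 3 = (d - r) ^+ 3 * D ^+ 2 * D by ring.
  by apply: ler_wpM2l => //; rewrite mulr_ge0 ?exprn_ge0//; lra.
by have -> : (D - r) ^+ 3 * d ^+ 2 * d = ((D - r) * d) ^+ 3 by ring.
Qed.

Let ct := Num.sqrt (1 - sn ^+ 2).

(** Everything is continuous in the tolerance. At [e = 0] the error [r] vanishes and [d] is
    [m * sn / L ^ 2], so the last inequality becomes the strict bound assumed on [eta]; hence
    [e = 1 / (n + 1)] works for large [n]. *)
Lemma volume_margin (ez eta : R) : 0 < ez -> 0 < eta < ez ^+ 3 * (lam * m * sn / L ^+ 2) ->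
  exists n : nat, let e := n.+1%:R^-1 in
   [/\ e <= 2^-1, 4 * e <= eps, 8 * L * e <= 1, 2 * e <= m &
    cosb L sn m e ^+ 2 <= 1 /\
    exists d, let r := 6 * (2 * L + 1) ^+ 2 * ((9 + 4 * L) * e) in
    [/\ r < d, d ^+ 2 = (1 - cosb L sn m e ^+ 2) * m ^+ 2 * (L^-1 - 4 * e) ^+ 4 &
     eta * d ^+ 2 <= ez ^+ 3 * lam * (d - r) ^+ 3] ].
Proof.
move=> ez0 /andP[eta0 etaJ]; have L0 := L_gt0 H; have m0 := m_gt0 H; have s0 := sn_gt0 H.
have lm0 := eps_gt0 H; have ss1 : sn ^+ 2 < 1.
  by have := sn_lt1 H; nra.
pose r (e : R) := 6 * (2 * L + 1) ^+ 2 * ((9 + 4 * L) * e).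
pose P (e : R) := (1 - cosb L sn m e ^+ 2) * m ^+ 2 * (L^-1 - 4 * e) ^+ 4.
pose c := m * sn / L ^+ 2.
have c0 : 0 < c by rewrite divr_gt0 ?mulr_gt0// exprn_gt0.
have cX (f : R -> R) k : continuous f -> continuous (fun e => f e ^+ k).
  move=> cf e; elim: k => [|k IH]; first exact: cvg_cst.
  rewrite (_ : (fun e => f e ^+ k.+1) = (fun e => f e * f e ^+ k)); last by apply/funext => x; rewrite exprS.
  by apply: cvgM; [exact: cf|exact: IH].
have lin (a b : R) : continuous (fun e : R => a - b * e).
  by move=> e; apply: cvgB; [exact: cvg_cst|apply: cvgM; [exact: cvg_cst|exact: cvg_id]].
have lin0 (b : R) : continuous (fun e : R => b * e).
  by move=> e; apply: cvgM; [exact: cvg_cst|exact: cvg_id].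
have cc : continuous (cosb L sn m).
  have ca : continuous (fun e : R => 2 * e / m) by move=> e; apply: cvgM; [exact: lin0|exact: cvg_cst].
  have cb := lin0 (8 * L).
  have ca1 : continuous (fun e : R => 1 + 2 * e / m) by move=> e; apply: cvgD; [exact: cvg_cst|exact: ca].
  have cb1 : continuous (fun e : R => 1 + 8 * L * e) by move=> e; apply: cvgD; [exact: cvg_cst|exact: cb].
  move=> e; rewrite /cosb; apply: cvgD; last exact: cb.
  apply: cvgD; last by apply: cvgM; [exact: ca|exact: cb1].
  by apply: cvgM; last exact: cb1; apply: cvgM; [exact: cvg_cst|exact: ca1].
have cr : continuous r.
  move=> e; rewrite /r; apply: cvgM; [exact: cvg_cst|exact: lin0].
have cP : continuous P.
  move=> e; rewrite /P; apply: cvgM; last exact: (cX _ 4 (lin L^-1 4)).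
  apply: cvgM; last exact: cvg_cst.
  by apply: cvgB; [exact: cvg_cst|exact: (cX _ 2 cc)].
have cd : continuous (fun e => Num.sqrt (P e)).
  by move=> e; apply: (@continuous_comp _ _ _ P Num.sqrt e); [exact: cP|exact: sqrt_continuous].
have cosb0 : cosb L sn m 0 = ct by rewrite /cosb !mulr0 !mul0r !addr0 !mulr1.
have ct2 : ct ^+ 2 = 1 - sn ^+ 2 by rewrite sqr_sqrtr//; lra.
have P0 : P 0 = c ^+ 2.
  by rewrite /P cosb0 ct2 /c; field; rewrite gt_eqF.
have d0 : Num.sqrt (P 0) = c by rewrite P0 sqrtr_sqr gtr0_norm.
have r0 : r 0 = 0 by rewrite /r !mulr0.
have ev (q : R -> R) : continuous q -> 0 < q 0 -> \forall n \near \oo, 0 < q (n.+1%:R^-1).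
  move=> cq q0; have cv : (q \o (fun n : nat => n.+1%:R^-1)) @ \oo --> q 0.
    exact: (cvg_comp _ _ (@cvg_harmonic R) (cq 0)).
  exact: (cvgr_gt (f := q \o (fun n : nat => n.+1%:R^-1)) _ cv _ q0).
have evl (a b : R) : 0 < a -> \forall n \near \oo, 0 < a - b * (n.+1%:R^-1).
  by move=> a0; apply: (ev _ (lin a b)); rewrite mulr0 subr0.
have i2 : 0 < 2^-1 :> R by rewrite invr_gt0.
have E1 := evl _ 1 i2; have E2 := evl _ 4 lm0.
have E3 := evl _ (8 * L) ltr01; have E4 := evl _ 2 m0.
have E5 : \forall n \near \oo, 0 < 1 - cosb L sn m (n.+1%:R^-1) ^+ 2.
  apply: (ev (fun e => 1 - cosb L sn m e ^+ 2)).
    by move=> e; apply: cvgB; [exact: cvg_cst|apply: cvgM; exact: cc].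
  by rewrite cosb0 ct2; have := exprn_gt0 2 s0; lra.
have E6 : \forall n \near \oo, 0 < Num.sqrt (P (n.+1%:R^-1)) - r (n.+1%:R^-1).
  apply: (ev (fun e => Num.sqrt (P e) - r e)).
    by move=> e; apply: cvgB; [exact: cd|exact: cr].
  by rewrite d0 r0 subr0.
have E7 : \forall n \near \oo, 0 < ez ^+ 3 * lam * (Num.sqrt (P (n.+1%:R^-1)) - r (n.+1%:R^-1)) ^+ 3 -
    eta * P (n.+1%:R^-1).
  apply: (ev (fun e => ez ^+ 3 * lam * (Num.sqrt (P e) - r e) ^+ 3 - eta * P e)).
    move=> e; apply: cvgB; last by apply: cvgM; [exact: cvg_cst|exact: cP].
    apply: cvgM; first exact: cvg_cst.
    apply: (cX (fun e => Num.sqrt (P e) - r e) 3) => e'.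
    by apply: cvgB; [exact: cd|exact: cr].
  rewrite d0 r0 P0 subr0; move: etaJ.
  have -> : ez ^+ 3 * (lam * m * sn / L ^+ 2) = ez ^+ 3 * lam * c by rewrite /c; ring.
  have c2 : 0 < c ^+ 2 by rewrite exprn_gt0.
  by move: (ez ^+ 3 * lam) => z; rewrite (exprS _ 2) => zc; nra.
have : \forall n \near \oo, [/\ 0 < 2^-1 - 1 * (n.+1%:R^-1 : R), 0 < eps - 4 * (n.+1%:R^-1 : R),
    0 < 1 - 8 * L * (n.+1%:R^-1 : R), 0 < m - 2 * (n.+1%:R^-1 : R) &
    [/\ 0 < 1 - cosb L sn m (n.+1%:R^-1) ^+ 2, 0 < Num.sqrt (P (n.+1%:R^-1)) - r (n.+1%:R^-1) &
     0 < ez ^+ 3 * lam * (Num.sqrt (P (n.+1%:R^-1)) - r (n.+1%:R^-1)) ^+ 3 - eta * P (n.+1%:R^-1)]].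
  near=> n; split; [by near: n|by near: n|by near: n|by near: n|].
  by split; [near: n|near: n|near: n].
move=> [n _ /(_ n (leqnn n))[e1 e2 e3 e4 [e5 e6 e7]]]; exists n.
move: (n.+1%:R^-1 : R) e1 e2 e3 e4 e5 e6 e7 => e e1 e2 e3 e4 e5 e6 e7 /=.
split; [move: e1|move: e2|move: e3|move: e4|split; [move: e5|]]; [clear - H; lra..|].
exists (Num.sqrt (P e)).
have PE : Num.sqrt (P e) ^+ 2 = P e.
  apply: sqr_sqrtr; apply: mulr_ge0; last by rewrite (_ : 4%N = (2 * 2)%N)// exprM sqr_ge0.
  by apply: mulr_ge0; [exact: ltW|exact: sqr_ge0].
split; [rewrite -/(r _); move: e6|by rewrite PE|rewrite PE -/(r _); move: e7]; clear - H; lra.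
Unshelve. all: by end_near.
Qed.

End LocalVolume.

(** * The Jacobian bound near a single point *)

Section LocalJacobian.
Variable R : realType.
Notation R3 := (R * R * R)%type.
Variables (h : R * R -> R3) (L sn eps m lam : R).
Hypothesis H : chart h L sn eps m lam.

Definition hx_pd (x : R3) : Prop := exists A1 A2 : R3, forall e : R, 0 < e ->
  exists2 d, 0 < d & forall t : R, `|t| < d ->
    `|hx h (x + (t, 0, 0)) - hx h x - scale3 t A1| <= e * `|t| /\
    `|hx h (x + (0, t, 0)) - hx h x - scale3 t A2| <= e * `|t|.

Definition rat3 (q : rat * rat * rat) : R3 := (ratr q.1.1, ratr q.1.2, ratr q.2).

(** Rational approximate derivatives and tolerances [1 / (n + 1)] keep the family countable. *)
Definition pieces (j : nat) : set R3 :=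
  if unpickle j is Some (D1, D2, n, k) then piece h (rat3 D1) (rat3 D2) n.+1%:R^-1 k else setT.

Lemma pieces_closed j : closed (pieces j).
Proof.
rewrite /pieces; case: unpickle => [[[[D1 D2] n] k]|]; last exact: closedT.
exact: (piece_closed H).
Qed.

Lemma in_piece x n : hx_pd x -> exists D1 D2 k, piece h (rat3 D1) (rat3 D2) n.+1%:R^-1 k x.
Proof.
move=> [A1 [A2 pd]]; set e : R := n.+1%:R^-1.
have e0 : 0 < e by rewrite invr_gt0.
have e2 : 0 < e / 2 by rewrite divr_gt0.
have [D1 DA1] := rat_triple_near A1 e2; have [D2 DA2] := rat_triple_near A2 e2.
have [d d0 dP] := pd _ e2.
exists D1, D2, (Num.truncn d^-1) => t tk.
have td : `|t| < d.
  apply: le_lt_trans tk _; rewrite invf_plt ?posrE//; exact: truncnS_gt.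
have [p1 p2] := dP t td.
have key (A D v : R3) : `|A - D| < e / 2 -> `|v - scale3 t A| <= e / 2 * `|t| -> `|v - scale3 t D| <= e * `|t|.
  move=> AD vA; have -> : v - scale3 t D = (v - scale3 t A) + scale3 t (A - D).
    by rewrite /scale3; apply/eqP; rewrite -subr_eq0; apply/eqP; congr (_, _, _) => /=; ring.
  apply: le_trans (ler_normD _ _) _.
  have : `|scale3 t (A - D)| <= `|t| * (e / 2).
    move: (ltW AD); rewrite !norm_le3 /scale3/= !normrM => /and3P[a1 a2 a3].
    by rewrite !ler_wpM2l.
  by move: vA; clear - H; lra.
by split; apply: key; [exact: DA1|exact: p1|exact: DA2|exact: p2].
Qed.

Lemma beam_near (x : R3) : `|fold 1 x.1.1| < 1 -> `|fold 1 x.1.2| < 1 ->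
  exists2 d, 0 < d & forall y, `|x - y| < d -> in_beam (strip 1 x.1.1) (strip 1 x.1.2) y.
Proof.
have E (s : R) : `|fold 1 s| = `|s - 2 * (strip 1 s)%:~R|.
  rewrite /fold mulr1 normrM; case: (sgn_par_cases R (strip 1 s)) => ->;
  by rewrite ?normrN normr1 mul1r.
rewrite !E; move: (strip 1 x.1.1) (strip 1 x.1.2) => i j x1 x2.
exists (Num.min (1 - `|x.1.1 - 2 * i%:~R|) (1 - `|x.1.2 - 2 * j%:~R|)).
  by rewrite lt_min !subr_gt0 x1.
move=> y; rewrite lt_min => /andP[y1 y2]; have [c1 c2 _] := norm_comp3 (x - y).
have k (s t u : R) : `|s - t| <= `|x - y| -> `|x - y| < 1 - `|s - u| -> u - 1 <= t <= u + 1.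
  move=> a b; have : `|s - t| < 1 - `|s - u| by exact: le_lt_trans b.
  rewrite ltrBrDr => c; have := le_lt_trans (ler_normB (s - t) (s - u)) c.
  by rewrite ltr_norml; clear - H; lra.
by split; [apply: k y1|apply: k y2].
Qed.

Lemma local_volume x0 eta : `|fold 1 x0.1.1| < 1 -> `|fold 1 x0.1.2| < 1 -> hx_pd x0 ->
  0 < eta < expR x0.2 ^+ 3 * (lam * m * sn / L ^+ 2) ->
  exists j, pieces j x0 /\ exists2 d, 0 < d & forall K, compact K -> K `<=` pieces j ->
    (forall y, K y -> `|x0 - y| < d) -> (eta%:E * leb3 K <= leb3 (zmap h lam @` K))%E.
Proof.
move=> x1 x2 pd etaJ; have L0 := L_gt0 H; have l4 := lam_ge4 H; have eta0 : 0 < eta by case/andP: etaJ.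
have ez0 := expR_gt0 x0.2.
have [n] := volume_margin H ez0 etaJ; set e : R := n.+1%:R^-1 => /= -[e2 eeps eL em [c1 [d [rd dE etad]]]].
have e0 : 0 < e by rewrite invr_gt0.
have [D1 [D2 [k px0]]] := in_piece n pd; rewrite -/e in px0.
exists (pickle (D1, D2, n, k)).
have pE : pieces (pickle (D1, D2, n, k)) = piece h (rat3 D1) (rat3 D2) e k by rewrite /pieces pickleK.
rewrite pE; split => //.
have [d1 d10 beam] := beam_near x1 x2; set i := strip 1 x0.1.1 in beam; set j := strip 1 x0.1.2 in beam.
pose dk : R := k.+1%:R^-1.
have dk0 : 0 < dk by rewrite invr_gt0.
(* The four radii keep [K] in one beam, its diameter within [1 / (k + 1)], its heights within
   [e / 2] of that of [x0], and [hx] within [e] of its value at [x0]. *)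
exists (Num.min d1 (Num.min (dk / 2) (Num.min (e / 2) (e / (2 * L))))).
  by rewrite !lt_min d10 !divr_gt0// mulr_gt0.
move=> K cK Kp Kd.
have [K0|K0] := eqVneq (leb3 K) 0%E; first by rewrite K0 mule0; exact: (measure_ge0 (@leb3 R)).
have near y : K y -> [/\ in_beam i j y, `|x0 - y| <= dk / 2, `|x0 - y| <= e / 2 & `|hx h y - hx h x0| <= e].
  move=> /Kd; rewrite !lt_min => /and4P[y1 y2 y3 y4]; split; [exact: beam|exact: ltW|exact: ltW|].
  apply: le_trans (hx_lip H _ _) _; rewrite distrC.
  by move: (ltW y4); rewrite ler_pdivlMr ?mulr_gt0// mulrC.
have Kdk x y : K x -> K y -> `|x - y| <= dk.
  move=> /near[_ a _ _] /near[_ b _ _]; rewrite distrC in a.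
  by have := ler_distD x0 x y; move: a b; clear - H; lra.
have L1 := L_ge1 H.
have hQ y : norm3 (hx h y) <= 1 by apply: (h_le1 H); exact: fold2_Q.
have hsup y : `|hx h y| <= 1.
  by rewrite norm_le3; have [a b c] := norm3_comp (hx h y); have := hQ y; move=> q;
    rewrite (le_trans a q) (le_trans b q) (le_trans c q).
set h0 := hx h x0.
have Dlow : (1 - cosb L sn m e ^+ 2) * m ^+ 2 * (L^-1 - 4 * e) ^+ 4 <= det3 (rat3 D1) (rat3 D2) h0 ^+ 2.
  apply: (@piece_det _ _ _ _ _ _ _ H _ _ e k h0 K i j) => //; first exact: ltW.
    by apply: (m_le H); exact: fold2_Q.
  by move=> y /near[].
have dp : 0 < d.
  by apply: le_lt_trans rd; rewrite !mulr_ge0 ?sqr_ge0 ?(ltW e0)//; clear - H L0; lra.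
have dD : d <= `|det3 (rat3 D1) (rat3 D2) h0|.
  rewrite -(@ler_pXn2r _ 2)// ?nnegrE ?(ltW dp)// real_normK ?num_real//.
  by rewrite dE.
pose B := 2 * L + 1.
have B0 : 0 <= B by rewrite /B; clear - H L0; lra.
have e_1 : e <= 1 by rewrite (le_trans e2)// invf_le1// ler1n.
have [b1 b2] := piece_bound H e_1 px0.
pose e' := (9 + 4 * L) * e.
have e'0 : 0 <= e' by rewrite mulr_ge0 ?(ltW e0)//; clear - H L0; lra.
pose s := sgn_par R i * sgn_par R j.
have ss : s * s = 1 by rewrite /s mulrACA; case: (sgn_par_cases R i) => ->; case: (sgn_par_cases R j) => ->; ring.
have s0 : s != 0 by apply/eqP => s0; move: ss; rewrite s0 mul0r => /eqP; rewrite eq_sym oner_eq0.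
have sl0 : s * lam != 0 by rewrite mulf_neq0// gt_eqF//; clear - H l4; lra.
have kk (t c : R) : s * (t * (lam * c)) / (s * lam) = t * c.
  by rewrite (_ : s * (t * (lam * c)) = t * c * (s * lam)); [rewrite mulfK|ring].
have slN : `|s * lam| = lam.
  rewrite normrM [X in _ * X]gtr0_norm; last by clear - H l4; lra.
  suff -> : `|s| = 1 by rewrite mul1r.
  by apply/eqP; rewrite -(@eqrXn2 _ 2)// real_normK ?num_real// expr1n expr2 ss.
have := @volume_lower R K (zmap h lam) (rat3 D1) (rat3 D2) h0 (expR x0.2) (s * lam) B e' cK
  (zmap_continuous H) ez0 sl0 e'0 B0 b1 b2.
set D := det3 _ _ _ in dD Dlow *; set r := 6 * _ * e' in rd etad *.
have r0 : 0 <= r by apply: mulr_ge0 => //; apply: mulr_ge0 => //; exact: sqr_ge0.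
rewrite slN => /(_ _ _ _) vol.
have D0 : 0 < D ^+ 2 by rewrite -real_normK ?num_real// exprn_gt0//; apply: lt_le_trans dD.
suff : ((eta * D ^+ 2)%:E * leb3 K <= (D ^+ 2)%:E * leb3 (zmap h lam @` K))%E.
  have iD : (0 <= ((D ^+ 2)^-1)%:E)%E by rewrite lee_fin invr_ge0 ltW.
  have DK : (D ^+ 2)^-1 * (eta * D ^+ 2) = eta by field; rewrite -sqrf_eq0 gt_eqF.
  move=> /(lee_wpmul2l iD); rewrite !muleA -!EFinM DK mulVf ?gt_eqF// mul1e.
  by [].
apply: le_trans (vol _ _ _).
- apply: lee_wpmul2r; first exact: (measure_ge0 (@leb3 R)).
  rewrite lee_fin exprMn; have rd' : 0 <= r < d by rewrite r0.
  have := det_ratio_mono rd' dD; rewrite real_normK ?num_real//.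
  have z3 : 0 < expR x0.2 ^+ 3 * lam by rewrite mulr_gt0 ?exprn_gt0//; clear - H l4; lra.
  have d2 : 0 < d ^+ 2 by rewrite exprn_gt0.
  move: etad; move: (d ^+ 2) (D ^+ 2) d2 D0 => d2 D2' d20 D20 etad mono.
  rewrite -(ler_pM2r d20); apply: (@le_trans _ _ (eta * d2 * D2')); first by rewrite mulrAC.
  apply: (@le_trans _ _ (expR x0.2 ^+ 3 * lam * (d - r) ^+ 3 * D2')); first by rewrite ler_pM2r.
  rewrite [leRHS](_ : _ = expR x0.2 ^+ 3 * lam * ((`|D| - r) ^+ 3 * d2)); last by ring.
  by rewrite -mulrA ler_pM2l.
- by apply: le_trans (hsup x0) _; rewrite /B; clear - H L0; lra.
- by apply: lt_le_trans dD.
move=> x y Kx Ky; have [bx kx ex hxx] := near x Kx; have [by_ ky ey hyy] := near y Ky.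
have pp := piece_pair (ltW e0) (Kp _ Kx) (Kp _ Ky) (Kdk _ _ Kx Ky).
have lp := hx_lip H x y.
have X1 := hsup x.
rewrite !norm_le3 in pp lp X1 hxx.
case/and3P: pp => p1 p2 p3; case/and3P: lp => q1 q2 q3; case/and3P: X1 => u1 u2 u3; case/and3P: hxx => w1 w2 w3.
have [_ _ xy3] := norm_comp3 (x - y).
have tx : `|x.2 - x0.2| <= e / 2 by rewrite distrC; apply: le_trans ex; have [_ _] := norm_comp3 (x0 - x).
have ty : `|y.2 - x0.2| <= e / 2 by rewrite distrC; apply: le_trans ey; have [_ _] := norm_comp3 (x0 - y).
have e02 : 0 <= e <= 2^-1 by rewrite (ltW e0).
have tE : (x.2 - x0.2) - (y.2 - x0.2) = (x - y).2 by rewrite /=; ring.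
have td : `|(x.2 - x0.2) - (y.2 - x0.2)| <= `|x - y| by rewrite tE.
have zx t : expR t = expR x0.2 * expR (t - x0.2) by rewrite -expRD addrCA subrr addr0.
have fin (a b X Y P q : R) : a = expR x.2 * X -> b = expR y.2 * Y ->
  `|X| <= 1 -> `|X - q| <= e -> `|X - Y| <= 2 * L * `|x - y| -> `|X - Y - P| <= 2 * e * `|x - y| ->
  `|a - b - expR x0.2 * (P + (x - y).2 * q)| <= expR x0.2 * e' * `|x - y|.
  move=> -> -> X1 Xq XY XYP; have := exp_pair_err e02 tx ty X1 Xq XY XYP td.
  rewrite tE (zx x.2) (zx y.2) -!mulrA -!mulrBr normrM (gtr0_norm ez0) => er.
  rewrite ler_pM2l// mulrA; apply: le_trans er _; rewrite /e' !mulrA.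
  by rewrite le_eqVlt; apply/orP; left; apply/eqP; ring.
rewrite (zmap_beam H bx) (zmap_beam H by_) /refl3 /zup/= -!(fold2_beam bx) -!(fold2_beam by_).
split.
- by apply: (fin _ _ _ _ _ _ (erefl _) (erefl _) u1 w1 q1 p1).
- by apply: (fin _ _ _ _ _ _ (erefl _) (erefl _) u2 w2 q2 p2).
- rewrite mulrBl; apply: (fin _ _ _ _ _ _ _ _ u3 w3 q3 p3).
  + exact: kk.
  + exact: kk.
Qed.

End LocalJacobian.

(** * The exceptional null set *)

Section NullSet.
Variable R : realType.
Notation R3 := (R * R * R)%type.

Lemma derivable_linear (f : R -> R) (a : R) : derivable f a 1 ->
  exists A : R, forall e : R, 0 < e -> exists2 d, 0 < d & forall t, `|t| < d ->
    `|f (a + t) - f a - t * A| <= e * `|t|.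
Proof.
move=> /cvg_ex[/= A /cvgrPdist_le dA]; exists A => e e0.
have /nbhs_ballP[d d0 dP] := dA e e0.
exists d => // t td; have [->|t0] := eqVneq t 0; first by rewrite addr0 subrr mul0r subrr normr0 mulr0.
have := dP t; rewrite /ball/= sub0r normrN => /(_ td t0).
rewrite /GRing.scale/= mulr1 [t + a]addrC => dd.
have -> : f (a + t) - f a - t * A = - (t * (A - t^-1 * (f (a + t) - f a))) by field.
by rewrite normrN normrM mulrC ler_wpM2r.
Qed.

Lemma leb2_affine_null (P : set (R * R)) (c1 c2 t1 t2 : R) : c1 != 0 -> c2 != 0 ->
  mble2 R P -> leb2 P = 0%E ->
  mble2 R [set p | P (c1 * p.1 + t1, c2 * p.2 + t2)] /\
  leb2 [set p | P (c1 * p.1 + t1, c2 * p.2 + t2)] = 0%E.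
Proof.
move=> c10 c20 mP P0.
have m1 : mble2 R [set p : R * R | P (c1 * p.1 + t1, p.2)].
  have mf : measurable_fun setT (fun p : mR R * mR R => (c1 * p.1 + t1, p.2) : mR R * mR R).
    apply: measurable_fun_pair; last exact: measurable_snd.
    by apply: (measurableT_comp (affine_measurable c1 t1)); exact: measurable_fst.
  by have := mf measurableT _ mP; rewrite setTI.
have m2 : mble2 R [set p : R * R | P (c1 * p.1 + t1, c2 * p.2 + t2)].
  have mf : measurable_fun setT (fun p : mR R * mR R => (p.1, c2 * p.2 + t2) : mR R * mR R).
    apply: measurable_fun_pair; first exact: measurable_fst.
    by apply: (measurableT_comp (affine_measurable c2 t2)); exact: measurable_snd.
  by have := mf measurableT _ m1; rewrite setTI.
split => //.
have z (c : R) (x : \bar R) : c != 0 -> (`|c|%:E * x = 0 -> x = 0)%E.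
  by move=> c0 /eqP; rewrite mule_eq0 eqe normr_eq0 (negbTE c0)/= => /eqP.
apply: (z c2) => //; rewrite (@leb2_fibery R c2 (fun=> t2) _ _ c20 m1 m2)//.
apply: (z c1) => //.
by rewrite (@leb2_fiberx R c1 (fun=> t1) _ _ c10 mP m1).
Qed.

Lemma leb3_cylinder_null (P : set (R * R)) : mble2 R P -> leb2 P = 0%E ->
  mble3 R (P `*` setT) /\ leb3 (P `*` setT : set R3) = 0%E.
Proof.
move=> mP P0; split; first exact: measurableX.
have -> : leb3 (P `*` setT : set R3) = (@leb2 R \x leb R)%E (P `*` setT) by [].
rewrite product_measure1E//; transitivity (leb2 P * leb R setT)%E; first by [].
by rewrite P0 mul0e.
Qed.

Lemma leb2_line_null (a : R) : [/\ mble2 R ([set a] `*` setT), leb2 ([set a] `*` setT : set (R * R)) = 0%E,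
  mble2 R (setT `*` [set a]) & leb2 (setT `*` [set a] : set (R * R)) = 0%E].
Proof.
have m1 : @measurable _ (mR R) [set a] by exact: measurable_set1.
have l1 : leb R [set a] = 0%E by exact: lebesgue_measure_set1.
split; [exact: measurableX| |exact: measurableX|].
- have -> : leb2 ([set a] `*` setT : set (R * R)) = (leb R \x leb R)%E ([set a] `*` setT) by [].
  rewrite product_measure1E//; transitivity (leb R [set a] * leb R setT)%E; first by [].
  by rewrite l1 mul0e.
- have -> : leb2 (setT `*` [set a] : set (R * R)) = (leb R \x leb R)%E (setT `*` [set a]) by [].
  rewrite product_measure1E//; transitivity (leb R setT * leb R [set a])%E; first by [].
  by rewrite l1 mule0.
Qed.

Variables (h : R * R -> R3) (L sn eps m lam : R).
Hypothesis H : chart h L sn eps m lam.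

Lemma hx_pd_of x : `|fold 1 x.1.1| < 1 -> `|fold 1 x.1.2| < 1 ->
  [/\ pd_ex (comp1 h) (fold2 x), pd_ex (comp2 h) (fold2 x) & pd_ex (comp3 h) (fold2 x)] -> hx_pd h x.
Proof.
move=> x1 x2 [[p11 p12] [p21 p22] [p31 p32]].
have [d0 d00 beam] := beam_near x1 x2.
have bx := beam x; rewrite subrr normr0 in bx; have {}bx := bx d00.
rewrite (fold2_beam bx) in p11 p12 p21 p22 p31 p32.
move: (strip 1 x.1.1) (strip 1 x.1.2) beam bx p11 p12 p21 p22 p31 p32 => i j beam bx.
rewrite /comp1 /comp2 /comp3 /=.
move=> /derivable_linear[A11 d11] /derivable_linear[A12 d12] /derivable_linear[A21 d21].
move=> /derivable_linear[A22 d22] /derivable_linear[A31 d31] /derivable_linear[A32 d32].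
pose si := sgn_par R i; pose sj := sgn_par R j.
have sN (k : int) (t : R) : `|sgn_par R k * t| = `|t|.
  by rewrite normrM; case: (sgn_par_cases R k) => ->; rewrite ?normrN normr1 mul1r.
exists (si * A11, si * A21, si * A31), (sj * A12, sj * A22, sj * A32) => e e0.
have [e11 e110 E11] := d11 e e0; have [e12 e120 E12] := d12 e e0.
have [e21 e210 E21] := d21 e e0; have [e22 e220 E22] := d22 e e0.
have [e31 e310 E31] := d31 e e0; have [e32 e320 E32] := d32 e e0.
exists (Num.min d0 (Num.min (Num.min e11 (Num.min e21 e31)) (Num.min e12 (Num.min e22 e32)))).
  by rewrite !lt_min d00 e110 e120 e210 e220 e310 e320.
move=> t; rewrite !lt_min => /and3P[td /and3P[t11 t21 t31] /and3P[t12 t22 t32]].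
have nx (a b : R) : `|a| <= `|t| -> `|b| <= `|t| -> in_beam i j (x + (a, b, 0)).
  move=> at_ bt; apply: beam; apply: le_lt_trans td.
  by rewrite opprD addrA subrr add0r normrN norm_le3/= normr0 at_ bt normr_ge0.
have b1 : in_beam i j (x + (t, 0, 0)) by apply: nx; rewrite ?normr0.
have b2 : in_beam i j (x + (0, t, 0)) by apply: nx; rewrite ?normr0.
rewrite /hx (fold2_beam bx) (fold2_beam b1) (fold2_beam b2) /beam_coord/= !addr0.
have sD (k : int) (u : R) : sgn_par R k * (u + t - 2 * k%:~R) = sgn_par R k * (u - 2 * k%:~R) + sgn_par R k * t by ring.
rewrite !sD -/si -/sj.
have fin (s u A e' : R) (f : R -> R) : `|s * t| = `|t| -> `|t| < e' ->
   (forall t, `|t| < e' -> `|f (u + t) - f u - t * A| <= e * `|t|) ->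
   `|f (u + s * t) - f u - t * (s * A)| <= e * `|t|.
  move=> st te' /(_ (s * t)); rewrite st => /(_ te').
  by rewrite [t * (s * A)]mulrA [t * s]mulrC.
split; rewrite norm_le3 /scale3/=; apply/and3P; split.
- exact: (fin _ _ _ _ (fun u => (h (u, _)).1.1) (sN i t) t11 E11).
- exact: (fin _ _ _ _ (fun u => (h (u, _)).1.2) (sN i t) t21 E21).
- exact: (fin _ _ _ _ (fun u => (h (u, _)).2) (sN i t) t31 E31).
- exact: (fin _ _ _ _ (fun u => (h (_, u)).1.1) (sN j t) t12 E12).
- exact: (fin _ _ _ _ (fun u => (h (_, u)).1.2) (sN j t) t22 E22).
- exact: (fin _ _ _ _ (fun u => (h (_, u)).2) (sN j t) t32 E32).
Qed.

(** The exceptional set in the square, enlarged by the lines that carry the sides, is pulled back to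
    each beam by an affine map and multiplied by the vertical line. *)
Lemma hx_bad_null : exists N : set R3, [/\ mble3 R N, leb3 N = 0%E &
  forall x, ~ N x -> [/\ `|fold 1 x.1.1| < 1, `|fold 1 x.1.2| < 1 & hx_pd h x]].
Proof.
have [N0 [mN0 N00 sub]] := h_pd H.
have [l1 l2 l3 l4] := leb2_line_null 1; have [k1 k2 k3 k4] := leb2_line_null (-1).
pose N2 := N0 `|` (([set 1] `*` setT `|` setT `*` [set 1]) `|` ([set -1] `*` setT `|` setT `*` [set -1])).
have mN2 : mble2 R N2.
  by apply: measurableU; [|apply: measurableU; apply: measurableU].
have N20 : leb2 N2 = 0%E.
  have u0 (A B : set (R * R)) : mble2 R A -> mble2 R B -> leb2 A = 0%E -> leb2 B = 0%E -> leb2 (A `|` B) = 0%E.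
    move=> mA mB A0 B0; apply/eqP; rewrite eq_le (measure_ge0 (@leb2 R)) andbT.
    apply: (@le_trans _ _ (leb2 A + leb2 B)%E); last by rewrite A0 B0 adde0.
    exact: (@measureU2 _ _ _ (@leb2 R) A B mA mB).
  have ml := measurableU _ _ l1 l3; have mk := measurableU _ _ k1 k3.
  have zl := u0 _ _ l1 l3 l2 l4; have zk := u0 _ _ k1 k3 k2 k4.
  exact: (u0 _ _ mN0 (measurableU _ _ ml mk) N00 (u0 _ _ ml mk zl zk)).
have sg0 (k : int) : sgn_par R k != 0.
  by case: (sgn_par_cases R k) => ->; rewrite ?oppr_eq0 oner_neq0.
pose P (i j : int) : set R3 := [set p : R * R | N2 (sgn_par R i * p.1 + - (sgn_par R i * (2 * i%:~R)),
   sgn_par R j * p.2 + - (sgn_par R j * (2 * j%:~R)))] `*` setT.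
have PE i j : mble3 R (P i j) /\ leb3 (P i j) = 0%E.
  have [a b] := leb2_affine_null (- (sgn_par R i * (2 * i%:~R))) (- (sgn_par R j * (2 * j%:~R))) (sg0 i) (sg0 j) mN2 N20.
  exact: (leb3_cylinder_null a b).
pose F n : set R3 := if unpickle n is Some (i, j) then P i j else set0.
have FE n : mble3 R (F n) /\ leb3 (F n) = 0%E.
  rewrite /F; case: unpickle => [[i j]|]; first exact: PE.
  by split; [exact: measurable0|exact: leb3_set0].
have mF : mble3 R (\bigcup_n F n) by apply: bigcupT_measurable => n; case: (FE n).
exists (\bigcup_n F n); split => //.
  apply/eqP; rewrite eq_le (measure_ge0 (@leb3 R)) andbT.
  have := @geometric_cover R F (\bigcup_n F n) 0 0 (fun n => (FE n).1) mF (lexx _).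
  rewrite lexx ltr01 => /(_ isT); rewrite mul0r; apply => // n.
  by rewrite mul0r; have [_ ->] := FE n.
move=> x Nx; have bx := in_beam_strip x; move: (strip 1 x.1.1) (strip 1 x.1.2) bx => i j bx.
have N2x : ~ N2 (fold2 x).
  move=> nn; apply: Nx; exists (pickle (i, j)); first exact: I.
  rewrite /F pickleK /P; split; last exact: I.
  by move: nn; rewrite (fold2_beam bx) /beam_coord/= !mulrBr.
have [q1 q2] := fold2_Q x.
have lt1 (s : R) : -1 <= s <= 1 -> s <> 1 -> s <> -1 -> `|s| < 1.
  by move=> /andP[s1 s2] a b; rewrite ltr_norml !lt_neqAle s1 s2 !andbT; apply/andP; split; [rewrite eq_sym|]; apply/eqP.
have x1 : `|fold 1 x.1.1| < 1.
  by apply: lt1 => // E; apply: N2x; right; [left; left|right; left].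
have x2 : `|fold 1 x.1.2| < 1.
  by apply: lt1 => // E; apply: N2x; right; [left; right|right; right].
split => //; apply: hx_pd_of => //; apply: contrapT => npd; apply: N2x; left; apply: sub => /= pd.
by apply: npd; apply: pd; exact: fold2_Q.
Qed.

End NullSet.

(** * Expansion of volume and of the weighted measure *)

Section Expansion.
Variable R : realType.
Notation R3 := (R * R * R)%type.
Notation lint chi A := (\int[@leb3 R]_(x in A) (chi x)%:E)%E.
Variables (h : R * R -> R3) (L sn eps m lam : R).
Hypothesis H : chart h L sn eps m lam.
Let g := zmap h lam.

Definition seam : set R3 := [set x | 1 <= `|fold 1 x.1.1| \/ 1 <= `|fold 1 x.1.2| ].

Lemma seam_closed : closed seam.
Proof.
have cf : continuous (fun x : R3 => fold 1 x.1.1) /\ continuous (fun x : R3 => fold 1 x.1.2).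
  split; apply: (@lip_continuous _ _ 1) => x y; rewrite mul1r; apply: le_trans (fold_lip _ _) _;
    by have [] := norm_comp3 (x - y).
have -> : seam = (fun x : R3 => `|fold 1 x.1.1|) @^-1` [set t | 1 <= t] `|`
   (fun x : R3 => `|fold 1 x.1.2|) @^-1` [set t | 1 <= t] by apply/seteqP; split.
apply: closedU; apply: preimage_closed; try exact: closed_ge;
  move=> x _; apply: cvg_norm; [exact: cf.1|exact: cf.2].
Qed.

Definition inj_off (E : set R3) : Prop :=
  forall x y, E x -> E y -> ~ seam x -> ~ seam y -> g x = g y -> x = y.

Definition jac (x : R3) : R := expR x.2 ^+ 3 * (lam * m * sn / L ^+ 2).

Lemma jacK_gt0 : 0 < lam * m * sn / L ^+ 2.
Proof.
have l0 := lam_ge4 H; rewrite divr_gt0 ?exprn_gt0 ?(L_gt0 H)// !mulr_gt0 ?(m_gt0 H) ?(sn_gt0 H)//; lra.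
Qed.

Lemma expand_int (E : set R3) (chi psi : R3 -> R) : compact E -> inj_off E ->
  measurable_fun setT (chi : mR R * mR R * mR R -> R) -> (forall x, 0 <= chi x) ->
  measurable_fun setT (psi : mR R * mR R * mR R -> R) -> (forall x, 0 <= psi x) ->
  (forall x, E x -> [/\ {for x, continuous psi}, {for g x, continuous chi} &
     psi x < chi (g x) * jac x]) ->
  (lint psi E <= lint chi (g @` E))%E.
Proof.
move=> cE inj mchi chi0 mpsi psi0 HE; have [N [mN N0 good]] := hx_bad_null H.
apply: (@int_image_ge_local R E N seam g chi psi jac (@pieces R h)) => //.
- exact: zmap_continuous H.
- exact: pieces_closed H.
- exact: seam_closed.
- move=> x Ex Nx; have [c1 c2 lt] := HE x Ex; have [x1 x2 _] := good x Nx; split => //.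
    by rewrite mulr_gt0 ?exprn_gt0 ?expR_gt0// jacK_gt0.
  by case; rewrite leNgt ?x1 ?x2.
move=> x eta Ex Nx ej; have [x1 x2 pd] := good x Nx.
have [j [Qj [d d0 loc]]] := local_volume H x1 x2 pd ej.
by exists j; split => //; exists d => // K cK _ KQ Kd; exact: loc.
Qed.

(** The factor 1/2 creates the strict inequality that [expand_int] asks for. *)
Lemma expand_leb3 (E : set R3) (k : R) : compact E -> inj_off E -> (forall x, E x -> k <= x.2) ->
  ((expR k ^+ 3 * (lam * m * sn / L ^+ 2) / 2)%:E * leb3 E <= leb3 (g @` E))%E.
Proof.
move=> cE inj Ek; have J0 := jacK_gt0; have ek := exprn_gt0 3 (expR_gt0 k).
have mE := compact3_measurable cE.
have mgE := compact3_measurable (compact3_image (zmap_continuous H) cE).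
set c := _ / 2; have c0 : 0 <= c by rewrite divr_ge0// mulr_ge0// ltW.
have := @expand_int E (cst 1) (cst c) cE inj (measurable_cst _) (fun=> ler01) (measurable_cst _) (fun=> c0).
rewrite !int_cst// mul1e; apply => x Ex; split; [exact: cvg_cst|exact: cvg_cst|].
rewrite /cst mul1r /jac /c; have : expR k ^+ 3 <= expR x.2 ^+ 3.
  by rewrite lerXn2r ?nnegrE ?expR_ge0// ler_expR; exact: Ek.
move: J0 ek; move: (_ / L ^+ 2) (expR k ^+ 3) (expR x.2 ^+ 3) => a b d a0 b0 bd.
have := mulr_gt0 b0 a0; have := ler_wpM2r (ltW a0) bd; lra.
Qed.

Definition axdist (x : R3) : R := x.1.1 ^+ 2 + x.1.2 ^+ 2.

(** The inverse cube of the distance to the axis, written with [expR] and [ln] so as to be defined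
    and measurable everywhere. *)
Definition weight (x : R3) : R := expR (- (3 / 2) * ln (axdist x)).

Lemma axdist_continuous : continuous axdist.
Proof.
have [c1 c2 _] := coord3_continuous R.
by move=> x; apply: cvgD; apply: cvgM; [exact: c1|exact: c1|exact: c2|exact: c2].
Qed.

Lemma weight_measurable : measurable_fun setT (weight : mR R * mR R * mR R -> R).
Proof.
apply: (measurableT_comp (@measurable_expR R)).
apply: (@measurable_funM _ _ _ _ (cst (- (3 / 2)))); first exact: measurable_cst.
apply: (measurableT_comp (@measurable_ln R)).
by have := measurable_fun_continuous3 axdist_continuous.
Qed.

Lemma weight_continuous x : 0 < axdist x -> {for x, continuous weight}.
Proof.
move=> x0; apply: (@continuous_comp _ _ _ (fun x => - (3 / 2) * ln (axdist x)) expR); last exact: continuous_expR.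
apply: cvgM; first exact: cvg_cst.
apply: (@continuous_comp _ _ _ axdist (@ln R)); first exact: axdist_continuous.
exact: continuous_ln.
Qed.

(** The pole [h (0, 0)] lies on the axis, so the distance of [h v] to the axis is at most its
    distance to the pole, and the upper Lipschitz bound applies; folding brings points no farther
    from the axis. *)
Lemma axdist_zmap x : axdist (g x) <= (expR x.2 * L) ^+ 2 * axdist x.
Proof.
have q0 : inQ (0, 0 : R) by split => /=; lra.
have := h_upper H (fold2_Q x) q0.
rewrite norm3_le; last by rewrite mulr_ge0 ?norm2_ge0// ltW// (L_gt0 H).
rewrite exprMn norm2_sq /dot3 /sub3 /sub2 (h00 H)/= !subr0 => up.
have fx (s : R) : fold 1 s ^+ 2 <= s ^+ 2.
  by rewrite -[leLHS]real_normK ?num_real// -[leRHS]real_normK ?num_real// lerXn2r ?nnegrE// fold_norm.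
have -> : axdist (g x) = expR x.2 ^+ 2 * ((h (fold2 x)).1.1 ^+ 2 + (h (fold2 x)).1.2 ^+ 2).
  by rewrite /axdist /g /zmap /refl3 /zup/=; ring.
rewrite [leRHS](_ : _ = expR x.2 ^+ 2 * (L ^+ 2 * axdist x)); last by ring.
apply: ler_wpM2l; first exact: sqr_ge0.
have L2 : 0 <= L ^+ 2 by exact: sqr_ge0.
have := ler_wpM2l L2 (lerD (fx x.1.1) (fx x.1.2)).
have := sqr_ge0 ((h (fold2 x)).2 - 1).
rewrite /axdist; lra.
Qed.

(** The mean of 1 and the actual factor, so that both comparisons are strict. *)
Definition kappa : R := (1 + lam * m * sn / L ^+ 5) / 2.

Lemma kappa_bounds : 1 < kappa < lam * m * sn / L ^+ 5.
Proof.
have : 1 < lam * m * sn / L ^+ 5.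
  by rewrite ltr_pdivlMr ?exprn_gt0 ?(L_gt0 H)// mul1r; exact: lam_gt H.
rewrite /kappa; lra.
Qed.

(** The weight falls at most by the factor [(expR z * L) ^ 3], while volume grows by
    [expR z ^ 3 * (lam * m * sn / L ^ 2)]: the exponentials cancel. *)
Lemma weight_expand (E : set R3) : compact E -> inj_off E ->
  (forall x, E x -> 0 < axdist x /\ 0 < axdist (g x)) ->
  (kappa%:E * lint weight E <= lint weight (g @` E))%E.
Proof.
move=> cE inj Ex0; have L0 := L_gt0 H; have /andP[k1 k2] := kappa_bounds.
have mE := compact3_measurable cE.
have -> : (kappa%:E * lint weight E = lint (fun x => kappa * weight x) E)%E.
  under [in RHS]eq_integral do rewrite EFinM.
  rewrite ge0_integralZl//.
  - by apply: measurable_funTS; apply/measurable_EFinP; exact: weight_measurable.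
  - by move=> x _; rewrite lee_fin expR_ge0.
  - by rewrite lee_fin; lra.
apply: expand_int => //.
- exact: weight_measurable.
- by move=> x; exact: expR_ge0.
- by apply: measurable_funM; [exact: measurable_cst|exact: weight_measurable].
- by move=> x; rewrite mulr_ge0 ?expR_ge0//; lra.
move=> x Ex; have [x0 gx0] := Ex0 x Ex; split.
- by apply: cvgM; [exact: cvg_cst|exact: weight_continuous].
- exact: weight_continuous.
have lnle : ln (axdist (g x)) <= 2 * x.2 + 2 * ln L + ln (axdist x).
  have e0 := expR_gt0 x.2.
  have -> : 2 * x.2 + 2 * ln L + ln (axdist x) = ln ((expR x.2 * L) ^+ 2 * axdist x).
    rewrite lnM ?posrE ?exprn_gt0 ?mulr_gt0// lnXn ?mulr_gt0// lnM ?posrE// expRK.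
    by rewrite mulr2n; ring.
  by rewrite ler_ln ?posrE ?mulr_gt0 ?exprn_gt0 ?mulr_gt0//; exact: axdist_zmap.
have wle : expR (- (3 * x.2)) * L ^- 3 * weight x <= weight (g x).
  have -> : L ^- 3 = expR (- (3 * ln L)).
    by rewrite expRN expRM_natl lnK ?posrE.
  rewrite /weight -!expRD ler_expR; lra.
have w0 : 0 < weight x by exact: expR_gt0.
have jE : jac x = expR (3 * x.2) * (lam * m * sn / L ^+ 2) by rewrite /jac expRM_natl.
have J0 : 0 < jac x by rewrite mulr_gt0 ?exprn_gt0 ?expR_gt0// jacK_gt0.
apply: lt_le_trans (ler_wpM2r (ltW J0) wle).
rewrite jE expRN.
have e3 := expR_gt0 (3 * x.2).
rewrite [X in _ < X](_ : _ = lam * m * sn / L ^+ 5 * weight x); last by field; rewrite !gt_eqF.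
by rewrite ltr_pM2r.
Qed.

End Expansion.

(** * Open sets reach the invariant planes *)

Section Visits.
Variable R : realType.
Notation R3 := (R * R * R)%type.
Variables (h : R * R -> R3) (L sn eps m lam : R).
Hypothesis H : chart h L sn eps m lam.
Let g := zmap h lam.

(** Within [q] of the axis [h] has height at least 1/2, and [lam > 4] turns this into a new height
    of at least [2 * expR z]. The new distance to the axis is bounded below by [pole_dist] and the
    lower Lipschitz bound. *)
Lemma near_axis_step (q : R) (x : R3) : 0 < q -> q <= 2^-1 -> L * q <= eps -> L * q <= 2^-1 ->
  axdist x < q ^+ 2 ->
  2 * expR x.2 <= (g x).2 /\ (expR x.2 * (sn / L)) ^+ 2 * axdist x <= axdist (g x).
Proof.
move=> q0 q2 qe qL xq; have L0 := L_gt0 H; have l4 := lam_ge4 H.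
have sq1 (s : R) : s ^+ 2 <= axdist x -> `|s| <= q.
  move=> sx; rewrite -(@ler_pXn2r _ 2)// ?nnegrE ?(ltW q0)// real_normK ?num_real//.
  by apply: le_trans sx (ltW xq).
have v1 : `|x.1.1| <= q by apply: sq1; rewrite /axdist lerDl sqr_ge0.
have v2 : `|x.1.2| <= q by apply: sq1; rewrite /axdist lerDr sqr_ge0.
have qv : inQ x.1 by split; [move: v1|move: v2]; rewrite ler_norml; lra.
have bx : in_beam 0 0 x by case: qv => a b; split => /=; rewrite mulr0 sub0r add0r.
have bc : beam_coord 0 0 x = x.1 by case: (x) => -[a b] c; rewrite /beam_coord/= !mulr0 !subr0 !mul1r.
have q00 : inQ (0, 0 : R) by split => /=; lra.
have n2 : norm2 (sub2 x.1 (0, 0)) <= q.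
  by rewrite norm2_le ?(ltW q0)// /sub2/= !subr0; exact: ltW.
have up : norm3 (sub3 (h x.1) (h (0, 0))) <= L * q.
  by apply: le_trans (h_upper H qv q00) _; rewrite ler_pM2l.
have h3 : 2^-1 <= (h x.1).2.
  have [_ _ /le_trans/(_ up)] := norm3_comp (sub3 (h x.1) (h (0, 0))).
  by rewrite /sub3 (h00 H)/= ler_norml; lra.
have gE : g x = zup h lam x.1 x.2.
  by rewrite /g (zmap_beam H bx) bc sgn_par_sq /refl3 mul1r.
have e0 := expR_gt0 x.2.
rewrite gE /zup/=; split.
  have : expR x.2 * 2 <= expR x.2 * (lam * (h x.1).2) by rewrite ler_pM2l//; nra.
  lra.
have P := pole_dist H qv (le_trans up qe); set D := norm3 _ in P.
have -> : axdist (expR x.2 * (h x.1).1.1, expR x.2 * (h x.1).1.2, expR x.2 * (lam * (h x.1).2)) =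
    expR x.2 ^+ 2 * ((h x.1).1.1 ^+ 2 + (h x.1).1.2 ^+ 2) by rewrite /axdist/=; ring.
apply: (@le_trans _ _ (expR x.2 ^+ 2 * (D ^+ 2 * sn ^+ 2))); last first.
  by apply: ler_wpM2l => //; exact: sqr_ge0.
have : axdist x <= L ^+ 2 * D ^+ 2.
  have := h_lower H qv q00; rewrite -/D -exprMn => lo.
  have -> : axdist x = norm2 (sub2 x.1 (0, 0)) ^+ 2 by rewrite norm2_sq /sub2/= !subr0.
  by rewrite lerXn2r ?nnegrE ?norm2_ge0// mulr_ge0 ?norm3_ge0// ltW.
move=> aD; have es : 0 <= (expR x.2 * (sn / L)) ^+ 2 by exact: sqr_ge0.
apply: le_trans (ler_wpM2l es aD) _.
by rewrite le_eqVlt; apply/orP; left; apply/eqP; field; rewrite gt_eqF.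
Qed.

Lemma axdist_le_exp x : axdist (g x) <= expR x.2 ^+ 2.
Proof.
have -> : axdist (g x) = expR x.2 ^+ 2 * ((h (fold2 x)).1.1 ^+ 2 + (h (fold2 x)).1.2 ^+ 2).
  by rewrite /axdist /g /zmap /refl3 /zup/=; ring.
rewrite -[leRHS]mulr1; apply: ler_wpM2l; first exact: sqr_ge0.
have := h_le1 H (fold2_Q x); rewrite norm3_le// expr1n /dot3.
by have := sqr_ge0 (h (fold2 x)).2; rewrite -!expr2; lra.
Qed.

(** As long as the orbit stays in the tube its heights increase without bound, and once
    [expR z * (sn / L) >= 2] the distance to the axis doubles at each step. At the first exit the
    preceding point is in the tube, which makes the new height positive. *)
Lemma leave_axis (q : R) (x : nat -> R3) n : 0 < q -> q <= 2^-1 -> L * q <= eps -> L * q <= 2^-1 ->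
  (forall k, x k.+1 = g (x k)) -> (forall k, 0 < axdist (x k)) -> axdist (x n) < q ^+ 2 ->
  exists2 n', (n < n')%N & q ^+ 2 <= axdist (x n') /\ 0 < (x n').2.
Proof.
move=> q0 q2 qe qL xS x0 xn.
have step k : axdist (x k) < q ^+ 2 -> 2 * expR (x k).2 <= (x k.+1).2 /\
    (expR (x k).2 * (sn / L)) ^+ 2 * axdist (x k) <= axdist (x k.+1).
  by rewrite xS; exact: near_axis_step.
have ex : exists n', (n < n')%N && (q ^+ 2 <= axdist (x n')).
  apply: contrapT => nex.
  have sm k : (n <= k)%N -> axdist (x k) < q ^+ 2.
    rewrite leq_eqVlt => /orP[/eqP <-//|nk]; rewrite ltNge; apply/negP => qk.
    by apply: nex; exists k; rewrite nk.
  have zk k : 2 * k%:R <= (x (n.+1 + k)%N).2.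
    elim: k => [|k IH].
      by rewrite mulr0 addn0; have [+ _] := step _ (sm n (leqnn n)); have := expR_gt0 (x n).2; lra.
    rewrite addnS; have [+ _] := step _ (sm (n.+1 + k)%N (leq_trans (leqnSn n) (leq_addr _ _))).
    have := expR_ge1Dx (x (n.+1 + k)%N).2.
    have : 0 <= k%:R :> R by []. rewrite -natr1; lra.
  have c0 : 0 < sn / L by rewrite divr_gt0 ?(sn_gt0 H) ?(L_gt0 H).
  pose K := (Num.truncn (2 / (sn / L))).+1.
  have dbl k : (K <= k)%N -> 4 * axdist (x (n.+1 + k)%N) <= axdist (x (n.+1 + k.+1)%N).
    move=> Kk; rewrite addnS.
    have [_] := step _ (sm (n.+1 + k)%N (leq_trans (leqnSn n) (leq_addr _ _))).
    apply: le_trans; apply: ler_wpM2r; first exact: ltW.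
    have : 2 / (sn / L) <= expR (x (n.+1 + k)%N).2.
      apply: le_trans (ltW (truncnS_gt _)) _; apply: (@le_trans _ _ k%:R); first by rewrite ler_nat.
      have := expR_ge1Dx (x (n.+1 + k)%N).2; have := zk k.
      have : 0 <= k%:R :> R by []. lra.
    rewrite ler_pdivrMr// => e2; have -> : 4 = 2 ^+ 2 :> R by ring.
    by rewrite lerXn2r ?nnegrE// (le_trans _ e2).
  have big j : 4 ^+ j * axdist (x (n.+1 + K)%N) <= axdist (x (n.+1 + (K + j))%N).
    elim: j => [|j IH]; first by rewrite mul1r addn0.
    rewrite addnS; apply: le_trans (dbl _ (leq_addr _ _)).
    by rewrite exprS -mulrA ler_pM2l.
  have a0 := x0 (n.+1 + K)%N; set a := axdist _ in a0 big.
  pose j := (Num.truncn (q ^+ 2 / a)).+1.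
  have := big j; rewrite leNgt => /negP; apply.
  apply: lt_le_trans (sm _ _) _; first by rewrite (leq_trans (leqnSn n))// leq_addr.
  rewrite -ler_pdivrMr//; apply: le_trans (ltW (truncnS_gt _)) _.
  by rewrite -natrX ler_nat ltnW// ltn_expl.
case: (ex_minnP ex) => n' /andP[nn' qn'] min; exists n' => //; split => //.
case: n' nn' qn' min => // n' nn' qn' min.
have : axdist (x n') < q ^+ 2.
  move: nn'; rewrite ltnS leq_eqVlt => /orP[/eqP <-//|nn']; rewrite ltNge; apply/negP => qk.
  by have := min n'; rewrite nn' qk ltnn => /(_ isT).
by move=> /step[+ _]; have := expR_gt0 (x n').2; lra.
Qed.

(** A point at height below [- 1 / q] is sent into the tube around the axis, and from the tube the
    orbit exits at positive height. *)
Lemma visits : exists q T : R, [/\ 0 < q & forall x : nat -> R3,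
  (forall k, x k.+1 = g (x k)) -> (forall k, 0 < axdist (x k)) ->
  forall N, exists2 n, (N <= n)%N & q ^+ 2 <= axdist (x n) /\ - T <= (x n).2].
Proof.
have L0 := L_gt0 H; have e0 := eps_gt0 H.
pose q := Num.min 2^-1 (Num.min (eps / L) (2^-1 / L)).
have i2 : 0 < 2^-1 :> R by rewrite invr_gt0.
have q0 : 0 < q by rewrite !lt_min i2 !divr_gt0.
have q2 : q <= 2^-1 by rewrite ge_min lexx.
have qe : L * q <= eps by rewrite mulrC -ler_pdivlMr// !ge_min lexx orbT.
have qL : L * q <= 2^-1 by rewrite mulrC -ler_pdivlMr// !ge_min lexx !orbT.
exists q, q^-1; split => // x xS x0 N.
have key n : (N <= n)%N -> axdist (x n) < q ^+ 2 ->
    exists2 n, (N <= n)%N & q ^+ 2 <= axdist (x n) /\ - q^-1 <= (x n).2.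
  move=> Nn /(leave_axis q0 q2 qe qL xS x0)[n' nn' [a b]]; exists n'.
    by rewrite (leq_trans Nn)// ltnW.
  by split => //; have : 0 < q^-1 by [rewrite invr_gt0]; lra.
have [xN|xN] := ltP (axdist (x N)) (q ^+ 2); first exact: key xN.
have [zN|zN] := leP (- q^-1) (x N).2; first by exists N.
apply: (key N.+1) => //; rewrite xS; apply: le_lt_trans (axdist_le_exp _) _.
have : expR (x N).2 < q.
  apply: (@lt_le_trans _ _ (expR (- q^-1))); first by rewrite ltr_expR.
  rewrite expRN -[leRHS]invrK lef_pV2 ?posrE ?expR_gt0 ?invr_gt0//.
  by have := expR_ge1Dx q^-1; lra.
by have := expR_gt0 (x N).2; move=> ? ?; nra.
Qed.

End Visits.

(** * Cells between the planes, and injectivity on them *)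

Section PlaneHit.
Variable R : realType.
Notation R3 := (R * R * R)%type.
Notation lint chi A := (\int[@leb3 R]_(x in A) (chi x)%:E)%E.

Lemma expr_unbounded (k M : R) : 1 < k -> exists n, M < k ^+ n.
Proof.
move=> k1; have b n : 1 + n%:R * (k - 1) <= k ^+ n.
  elim: n => [|n IH]; first by rewrite mul0r addr0.
  have n0 : 0 <= n%:R :> R by [].
  have k0 : 0 <= k by lra.
  have := ler_wpM2l k0 IH; have := mulr_ge0 n0 (sqr_ge0 (k - 1)).
  by rewrite (exprS k n) -natr1; move: (n%:R) (k ^+ n) => t u; lra.
exists (Num.truncn (M / (k - 1))).+1; apply: lt_le_trans (b _).
have := truncnS_gt (M / (k - 1)); rewrite ltr_pdivrMr; lra.
Qed.

(** The ball is convex: on a segment along which [f] leaves the interval, the intermediate value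
    theorem would produce an even integer. *)
Lemma even_cell (f : R3 -> R) (x0 : R3) (r : R) : continuous f -> 0 <= r ->
  (forall x (k : int), `|x - x0| <= r -> f x <> 2 * k%:~R) ->
  exists a : int, forall x, `|x - x0| <= r -> 2 * a%:~R < f x < 2 * a%:~R + 2.
Proof.
move=> cf r0 av; pose a := Num.floor (f x0 / 2).
have fl : 2 * a%:~R < f x0 < 2 * a%:~R + 2.
  have := floor_itv (f x0 / 2); rewrite -/a intrD => /andP[a1 a2].
  apply/andP; split; last by lra.
  rewrite lt_neqAle; apply/andP; split; last by lra.
  by apply/eqP => /esym; apply: av; rewrite subrr normr0.
exists a => x xr; pose ga (s : R) : R3 := (x0.1.1 + s * (x - x0).1.1, x0.1.2 + s * (x - x0).1.2, x0.2 + s * (x - x0).2).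
have cga : continuous ga.
  apply: continuous_pair3 => s; apply: cvgD; try exact: cvg_cst; apply: cvgM;
    by [exact: cvg_id|exact: cvg_cst].
have cfg : continuous (f \o ga) by move=> s; apply: continuous_comp; [exact: cga|exact: cf].
have g0 : ga 0 = x0 by rewrite /ga !mul0r !addr0; case: (x0) => -[].
have g1 : ga 1 = x.
  rewrite /ga !mul1r; case: (x) => -[p q] w; case: (x0) => -[p' q'] w' /=.
  by congr (_, _, _); ring.
have gb s : 0 <= s <= 1 -> `|ga s - x0| <= r.
  move=> /andP[s0 s1]; apply: le_trans xr.
  have E (t u : R) : `|t + s * u - t| <= `|u|.
    by rewrite addrAC subrr add0r normrM ger0_norm// -[leRHS]mul1r ler_wpM2r.
  have [c1 c2 c3] := norm_comp3 (x - x0).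
  by rewrite norm_le3; apply/and3P; split; [apply: le_trans c1|apply: le_trans c2|apply: le_trans c3]; exact: E.
have key (v : R) : f x0 <= v <= f x \/ f x <= v <= f x0 -> exists2 y, `|y - x0| <= r & f y = v.
  move=> vb; have [|s] := @IVT _ (f \o ga) 0 1 v ler01 (continuous_subspaceT cfg).
    rewrite /= g0 g1 ge_min le_max.
    by case: vb => /andP[-> ->]; rewrite ?orbT.
  by rewrite in_itv/= => sb fs; exists (ga s) => //; exact: gb.
case/andP: fl => f1 f2; apply/andP; split; rewrite ltNge; apply/negP => fx.
  have [|y yr fy] := key (2 * a%:~R); first by right; lra.
  exact: (av y a yr).
have [|y yr fy] := key (2 * a%:~R + 2); first by left; lra.
by apply: (av y (a + 1) yr); rewrite fy intrD; ring.
Qed.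

Lemma leb3_ball (x0 : R3) (r : R) : 0 <= r ->
  leb3 [set x : R3 | `|x - x0| <= r] = ((2 * r) ^+ 3)%:E.
Proof.
move=> r0; have r2 : 0 <= 2 * r by rewrite mulr_ge0.
rewrite -[RHS](@leb3_cc R (x0.1.1 - r) (x0.1.2 - r) (x0.2 - r) _ r2); apply: (congr1 (@leb3 R)).
apply/seteqP; split => -[[x y] z]; rewrite /= norm_le3/= !in_itv/= !ler_norml.
  by move=> /and3P[a b c]; split; [split|]; lra.
by move=> [[a b] c]; apply/and3P; split; lra.
Qed.

Lemma ball_compact (x0 : R3) (r : R) : compact [set x : R3 | `|x - x0| <= r].
Proof.
apply: (@bounded_closed3_compact _ _ (r + `|x0|)).
  apply: (@preimage_closed _ _ (fun x : R3 => `|x - x0|) [set t | t <= r]).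
    by move=> x _; apply: cvg_norm; apply: cvgB; [exact: cvg_id|exact: cvg_cst].
  exact: closed_le.
by move=> x /= xr; have := ler_normD (x - x0) x0; rewrite subrK; lra.
Qed.

Variables (h : R * R -> R3) (L sn eps m lam : R).
Hypothesis H : chart h L sn eps m lam.
Let g := zmap h lam.

(** In cross-section a diamond centred at the midpoint of a wall between two beams; it meets only
    these two. *)
Definition cell (a b : int) : set R3 :=
  [set x | 2 * a%:~R < x.1.1 + x.1.2 < 2 * a%:~R + 2 /\ 2 * b%:~R < x.1.1 - x.1.2 < 2 * b%:~R + 2].

(** On this interval [fold] takes equal values at points symmetric about the wall [2 k + 1]; the
    parity of the strip tells them apart. *)
Lemma fold_near_odd (k : int) (s t : R) : 2 * k%:~R < s < 2 * k%:~R + 2 -> 2 * k%:~R < t < 2 * k%:~R + 2 ->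
  fold 1 s = fold 1 t -> sgn_par R (strip 1 s) = sgn_par R (strip 1 t) -> s = t.
Proof.
move=> sb tb; have ks (u : R) : 2 * k%:~R < u < 2 * k%:~R + 2 -> strip 1 u = k \/ strip 1 u = k + 1.
  move=> ub; have [u1|u1] := ltP u (2 * k%:~R + 1); [left|right]; apply: strip_eq; rewrite ?intrD; lra.
have F (u : R) : u = 2 * (strip 1 u)%:~R + sgn_par R (strip 1 u) * fold 1 u.
  by rewrite /fold mulrA sgn_par_sq mul1r; ring.
move=> fE sE; have kE : strip 1 s = strip 1 t.
  have nk : sgn_par R k != - sgn_par R k by case: (sgn_par_cases R k) => ->; apply/eqP; lra.
  by case: (ks _ sb) sE => ->; case: (ks _ tb) => -> //; rewrite sgn_parS => /eqP;
    rewrite ?(negbTE nk)// eq_sym (negbTE nk).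
by rewrite (F s) (F t) fE kE.
Qed.

Lemma zmap_fold_eq x y : ~ seam x -> g x = g y ->
  [/\ fold 1 x.1.1 = fold 1 y.1.1, fold 1 x.1.2 = fold 1 y.1.2, x.2 = y.2 & sgn2 x = sgn2 y].
Proof.
move=> sx gxy; have s1 (z : R3) : sgn2 z * sgn2 z = 1 by rewrite /sgn2 mulrACA !sgn_par_sq mulr1.
have l0 : 0 < lam by have := lam_ge4 H; lra.
have hp (z : R3) : 0 <= expR z.2 * (lam * (h (fold2 z)).2).
  by rewrite !mulr_ge0 ?expR_ge0 ?(ltW l0)//; apply: (h3_ge0 H); exact: fold2_Q.
have sc (z : R3) : sgn2 z = 1 \/ sgn2 z = -1.
  by rewrite /sgn2; case: (sgn_par_cases R (strip 1 z.1.1)) => ->;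
    case: (sgn_par_cases R (strip 1 z.1.2)) => ->; rewrite ?mulrNN ?mulr1 ?mul1r; [left|right|right|left].
have [E1 E2 E3] : [/\ (g x).1.1 = (g y).1.1, (g x).1.2 = (g y).1.2 & (g x).2 = (g y).2] by rewrite gxy.
have pos : 0 < expR x.2 * (lam * (h (fold2 x)).2).
  rewrite lt_neqAle hp andbT eq_sym; apply: mulf_neq0; first by rewrite gt_eqF// expR_gt0.
  apply: mulf_neq0; first by rewrite gt_eqF.
  apply/eqP => /(h3_eq0_bd H (fold2_Q x))[_ [e|e]]; apply: sx; [left|right];
    by rewrite -[leLHS]e.
move: E3; rewrite /g /zmap /refl3/= => E3 {gxy}.
have sE : sgn2 x = sgn2 y.
  by have := hp y; case: (sc x) E3 => ->; case: (sc y) => -> // E3 hy; exfalso; lra.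
have E3' : expR x.2 * (lam * (h (fold2 x)).2) = expR y.2 * (lam * (h (fold2 y)).2).
  by rewrite -[LHS]mul1r -(s1 x) -mulrA E3 sE mulrA s1 mul1r.
have [] := zup_inj H (fold2_Q x) (fold2_Q y) (z := x.2) (z' := y.2).
  by apply: pair3_eq.
by rewrite /fold2 => -[-> ->] ->.
Qed.

(** One coordinate stays in a single strip and is recovered from its fold. The other crosses one
    wall, and there the sign of the image gives the parity of the strip. The parity of [a + b]
    decides which coordinate crosses. *)
Lemma cell_inj a b (E : set R3) : E `<=` cell a b -> inj_off h lam E.
Proof.
move=> Ec x y /Ec[xa xb] /Ec[ya yb] sx sy /(zmap_fold_eq sx)[f1 f2 z s].
suff [e1 e2] : x.1.1 = y.1.1 /\ x.1.2 = y.1.2 by apply: pair3_eq.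
have sg0 (k : int) : sgn_par R k != 0.
  by case: (sgn_par_cases R k) => ->; rewrite ?oppr_eq0 oner_neq0.
have sg (k : int) (u v : R) : 2 * k%:~R - 1 < u < 2 * k%:~R + 1 -> 2 * k%:~R - 1 < v < 2 * k%:~R + 1 ->
    fold 1 u = fold 1 v -> u = v /\ strip 1 u = strip 1 v.
  move=> ub vb; have uk : strip 1 u = k by apply: strip_eq; clear - H ub; lra.
  have vk : strip 1 v = k by apply: strip_eq; clear - H vb; lra.
  by rewrite /fold uk vk => /(mulfI (sg0 k)) uv; split => //; clear - H uv; lra.
pose c := ((a + b) %/ 2)%Z; pose r := ((a + b) %% 2)%Z.
have abE : a + b = c * 2 + r by rewrite /c /r -divz_eq.
have [r0|r1] : r = 0 \/ r = 1.
  have := modz_ge0 (a + b) (isT : (2 : int) != 0); have := ltz_pmod (a + b) (isT : 0 < 2 :> int).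
  by rewrite -/r; case: (r) => [[|[|?]]|?]//; [left|right].
- have aE : (a%:~R : R) = 2 * c%:~R - b%:~R.
    have : (a + b)%:~R = (c * 2 + r)%:~R :> R by rewrite abE.
    by rewrite r0 addr0 intrM intrD; clear - H; lra.
  have [e2 s2] : x.1.2 = y.1.2 /\ strip 1 x.1.2 = strip 1 y.1.2.
    by apply: (sg (c - b)); rewrite ?intrB//; clear - H xa xb ya yb aE; lra.
  split => //; apply: (@fold_near_odd c) => //; [clear - H xa xb ya yb aE; lra|clear - H xa xb ya yb aE; lra|].
  by apply: (mulIf (sg0 (strip 1 x.1.2))); move: s; rewrite /sgn2 {1}s2 s2.
- have aE : (a%:~R : R) = 2 * c%:~R + 1 - b%:~R.
    have : (a + b)%:~R = (c * 2 + r)%:~R :> R by rewrite abE.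
    by rewrite r1 !intrD intrM; clear - H; lra.
  have [e2 s2] : x.1.1 = y.1.1 /\ strip 1 x.1.1 = strip 1 y.1.1.
    by apply: (sg (c + 1)); rewrite ?intrD//; clear - H xa xb ya yb aE; lra.
  split => //; apply: (@fold_near_odd (c - b)) => //; rewrite ?intrB; [clear - H xa xb ya yb aE; lra|clear - H xa xb ya yb aE; lra|].
  by apply: (mulfI (sg0 (strip 1 x.1.1))); move: s; rewrite /sgn2 {1}s2 s2.
Qed.

End PlaneHit.

(** * Some iterate of a ball meets one of the planes *)

Section PlaneReach.
Variable R : realType.
Notation R3 := (R * R * R)%type.
Notation lint chi A := (\int[@leb3 R]_(x in A) (chi x)%:E)%E.
Variables (h : R * R -> R3) (L sn eps m lam : R).
Hypothesis H : chart h L sn eps m lam.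
Let g := zmap h lam.

Lemma zmap_z_le x : `|(g x).2| <= lam * expR x.2.
Proof.
have l0 : 0 < lam by have := lam_ge4 H; lra.
rewrite /g /zmap /refl3/= normrM sgn2_norm mul1r !normrM (gtr0_norm (expR_gt0 _)) (gtr0_norm l0).
rewrite mulrCA ler_pM2l// -[leRHS]mulr1 ler_pM2l ?expR_gt0//.
have [_ _ c] := norm3_comp (h (fold2 x)); apply: le_trans c _.
by apply: (h_le1 H); exact: fold2_Q.
Qed.

Lemma cell_leb3 a b (S : set R3) (M : R) : mble3 R S -> 0 <= M -> S `<=` cell a b ->
  (forall x, S x -> `|x.2| <= M) -> (leb3 S <= (8 * M)%:E)%E.
Proof.
move=> mS M0 Sc SM.
pose c1 : R := (a + b)%:~R; pose c2 : R := (a - b)%:~R - 1.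
have -> : (8 * M)%:E = leb3 (`[c1, c1 + 2] `*` `[c2, c2 + 2] `*` `[- M, M] : set R3).
  rewrite leb3_box// !lebesgue_cc ?lerDl//; last lra.
  by rewrite -!EFinM; congr EFin; ring.
apply: (@le_measure _ _ _ (@leb3 R)); rewrite ?inE//.
  by apply: measurableX => //; exact: measurableX.
move=> x Sx; have [xa xb] := Sc x Sx; have := SM x Sx.
rewrite ler_norml => xM; rewrite /c1 /c2 intrD intrB; split; [split|] => /=; rewrite in_itv/=; clear - H xa xb xM; lra.
Qed.

(** The image lies in a cell at heights up to [lam * expR (k + 1)], so its measure is of order
    [expR k], while volume has grown by a factor of order [expR (3 * k)]. *)
Lemma slab_leb3 a b a' b' (S : set R3) (k : R) : compact S -> S `<=` cell a b ->
  g @` S `<=` cell a' b' -> (forall x, S x -> k <= x.2 <= k + 1) ->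
  (leb3 S <= (16 * lam * expR 1 / (lam * m * sn / L ^+ 2) * expR (- (2 * k)))%:E)%E.
Proof.
move=> cS Sc gSc Sk; have l0 : 0 < lam by have := lam_ge4 H; lra.
have J0 := jacK_gt0 H; set J := _ / L ^+ 2 in J0 *.
have := expand_leb3 H cS (cell_inj H Sc) (fun x Sx => (andP (Sk x Sx)).1).
rewrite -/J => low.
have M0 : 0 <= lam * expR (k + 1) by rewrite mulr_ge0 ?expR_ge0 ?ltW.
have := cell_leb3 (compact3_measurable (compact3_image (zmap_continuous H) cS)) M0 gSc.
move=> /(_ _)/(le_trans low) up.
have c0 : 0 < expR k ^+ 3 * J / 2 by rewrite divr_gt0// mulr_gt0// exprn_gt0// expR_gt0.
have : ((expR k ^+ 3 * J / 2)%:E * leb3 S <= (8 * (lam * expR (k + 1)))%:E)%E.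
  apply: up => _ [x Sx <-]; apply: le_trans (zmap_z_le x) _.
  by rewrite ler_pM2l// ler_expR; have /andP[] := Sk x Sx.
rewrite -lee_pdivlMl// => /le_trans; apply.
rewrite -EFinM lee_fin le_eqVlt; apply/orP; left; apply/eqP.
rewrite expRD expRN expRM_natl; field.
by rewrite !gt_eqF// expR_gt0.
Qed.

Lemma tail_leb3 a b a' b' (S : set R3) (T : R) : compact S -> S `<=` cell a b ->
  g @` S `<=` cell a' b' -> (forall x, S x -> - T <= x.2) ->
  (leb3 S <= (16 * lam * expR 1 / (lam * m * sn / L ^+ 2) * expR (2 * T) / (1 - expR (- 2)))%:E)%E.
Proof.
move=> cS Sc gSc ST; have l0 : 0 < lam by have := lam_ge4 H; lra.
have J0 := jacK_gt0 H; set C := _ / (_ / _).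
have C0 : 0 <= C.
  by rewrite /C divr_ge0 ?(ltW J0)// mulr_ge0 ?expR_ge0// mulr_ge0// ltW.
have [_ _ c3] := coord3_continuous R.
pose F n : set R3 := S `&` (fun x : R3 => x.2) @^-1` `[n%:R - T, n%:R - T + 1].
have cF n : compact (F n).
  apply: (subclosed_compact _ cS); last exact: subIsetl.
  apply: closedI; first exact: compact3_closed.
  apply: preimage_closed; [by move=> x _; exact: c3|exact: interval_closed].
apply: (@geometric_cover R F S (C * expR (2 * T)) (expR (- 2))).
- by move=> n; exact: compact3_measurable.
- exact: compact3_measurable.
- by rewrite mulr_ge0 ?expR_ge0.
- by rewrite expR_ge0/= expR_lt1; lra.
- move=> n; have Fk x : F n x -> n%:R - T <= x.2 <= n%:R - T + 1 by move=> [_]; rewrite /= in_itv/=.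
  have FS : F n `<=` S by exact: subIsetl.
  have := slab_leb3 (cF n) (subset_trans FS Sc) (subset_trans (image_subset g FS) gSc) Fk.
  move=> /le_trans; apply; rewrite lee_fin -/C -[leRHS]mulrA; apply: ler_wpM2l => //.
  by rewrite -expRM_natl -expRD ler_expR; lra.
move=> x Sx; exists (Num.truncn (x.2 + T)) => //; split => //=; rewrite in_itv/=.
have xT : 0 <= x.2 + T by have := ST x Sx; lra.
by have := truncn_itv xT; rewrite -natr1; lra.
Qed.

Lemma iter_g_continuous n : continuous (iter n g).
Proof.
elim: n => [|n IH] x; first exact: cvg_id.
by apply: (@continuous_comp _ _ _ (iter n g) g); [exact: IH|exact: (zmap_continuous H)].
Qed.

(** A Borel-Cantelli argument: the points of [V] whose [n]-th iterate lies in the recurrent region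
    [P] form a set of measure of order [k ^- n], yet each point of [V] belongs to infinitely many of
    these sets. *)
Lemma plane_hit (x0 : R3) (r : R) : 0 < r -> exists n x (k : int), `|x - x0| <= r /\
  ((iter n g x).1.1 + (iter n g x).1.2 = 2 * k%:~R \/ (iter n g x).1.1 - (iter n g x).1.2 = 2 * k%:~R).
Proof.
move=> r0; apply: contrapT => no.
pose V := [set x : R3 | `|x - x0| <= r].
have cV : compact V by exact: ball_compact.
have [c1 c2 _] := coord3_continuous R.
have cg := zmap_continuous H.
have cells n : exists ab : int * int, iter n g @` V `<=` cell ab.1 ab.2.
  have [||a Ha] := @even_cell R (fun x => (iter n g x).1.1 + (iter n g x).1.2) x0 r _ (ltW r0).
  - move=> x; apply: cvgD.
      exact: (@continuous_comp _ _ _ (iter n g) (fun x : R3 => x.1.1) x (@iter_g_continuous n x) (c1 _)).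
    exact: (@continuous_comp _ _ _ (iter n g) (fun x : R3 => x.1.2) x (@iter_g_continuous n x) (c2 _)).
  - by move=> x k xr E; apply: no; exists n, x, k; split => //; left.
  have [||b Hb] := @even_cell R (fun x => (iter n g x).1.1 - (iter n g x).1.2) x0 r _ (ltW r0).
  - move=> x; apply: cvgB.
      exact: (@continuous_comp _ _ _ (iter n g) (fun x : R3 => x.1.1) x (@iter_g_continuous n x) (c1 _)).
    exact: (@continuous_comp _ _ _ (iter n g) (fun x : R3 => x.1.2) x (@iter_g_continuous n x) (c2 _)).
  - by move=> x k xr E; apply: no; exists n, x, k; split => //; right.
  by exists (a, b) => _ [x Vx <-]; split; [exact: Ha|exact: Hb].
have ax n x : V x -> 0 < axdist (iter n g x).
  move=> Vx; have a0 : 0 <= axdist (iter n g x) by rewrite addr_ge0 ?sqr_ge0.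
  rewrite lt_neqAle eq_sym a0 andbT paddr_eq0 ?sqr_ge0// !sqrf_eq0; apply/negP => /andP[/eqP e1 /eqP e2].
  by apply: no; exists n, x, 0; split => //; left; rewrite e1 e2 mulr0 addr0.
have [q [T [q0 vis]]] := visits H.
pose P := [set x : R3 | q ^+ 2 <= axdist x /\ - T <= x.2].
have cP : closed P.
  have -> : P = (@axdist R) @^-1` [set t | q ^+ 2 <= t] `&` (fun x : R3 => x.2) @^-1` [set t | - T <= t].
    by apply/seteqP; split.
  have [_ _ c3] := coord3_continuous R.
  by apply: closedI; apply: preimage_closed; try exact: closed_ge; move=> x _; [exact: axdist_continuous|exact: c3].
pose E n := V `&` iter n g @^-1` P.
have cE n : compact (E n) by apply: compact3_preimage => //; exact: iter_g_continuous.
pose k := kappa L sn m lam.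
have [k1 _] := andP (kappa_bounds H); rewrite -/k in k1.
have wexp (S : set R3) n : compact S -> S `<=` V ->
    ((k ^+ n)%:E * lint (@weight R) S <= lint (@weight R) (iter n g @` S))%E.
  move=> cS SV; elim: n => [|n IH]; first by rewrite mul1e image_id.
  have cSn : compact (iter n g @` S) by apply: compact3_image => //; exact: iter_g_continuous.
  have [ab Hab] := cells n.
  have := weight_expand H cSn (cell_inj H (subset_trans (image_subset _ SV) Hab)).
  rewrite -/g -/k image_comp => step.
  rewrite exprS EFinM -muleA; apply: le_trans (step _).
    by apply: lee_wpmul2l => //; rewrite lee_fin; clear - H k1; lra.
  by move=> _ [x Sx <-]; split; [apply: (ax n)|apply: (ax n.+1)]; exact: SV.
pose C' := 16 * lam * expR 1 / (lam * m * sn / L ^+ 2) * expR (2 * T) / (1 - expR (- 2)).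
have l0 : 0 < lam by have := lam_ge4 H; lra.
have C'0 : 0 <= C'.
  rewrite /C'; apply: divr_ge0; last by rewrite subr_ge0 ltW// expR_lt1; lra.
  apply: mulr_ge0; last exact: expR_ge0.
  apply: divr_ge0; last exact: ltW (jacK_gt0 H).
  apply: mulr_ge0; last exact: expR_ge0.
  by apply: mulr_ge0 => //; exact: ltW.
pose W0 := expR (- (3 / 2) * ln (q ^+ 2)).
have W00 : 0 < W0 by exact: expR_gt0.
have [M M0 VM] := compact3_bounded cV.
pose w0 := expR (- (3 / 2) * ln (2 * M ^+ 2)).
have w00 : 0 < w0 by exact: expR_gt0.
have q20 : 0 < q ^+ 2 by rewrite exprn_gt0.
(* The [n]-th image of [E n] has weighted measure at least [k ^ n] times that of [E n], but at most
   [W0 * C']: the weight is at most [W0] on [P], and [tail_leb3] bounds the measure. On [V] the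
   weight is at least [w0]. *)
have lE n : (leb3 (E n) <= (W0 * C' / w0 * k^-1 ^+ n)%:E)%E.
  have EV : E n `<=` V by exact: subIsetl.
  have mE := compact3_measurable (cE n).
  have cgE : compact (iter n g @` E n) by apply: compact3_image => //; exact: iter_g_continuous.
  have mgE := compact3_measurable cgE.
  have up : (lint (@weight R) (iter n g @` E n) <= (W0 * C')%:E)%E.
    apply: (@le_trans _ _ (W0%:E * leb3 (iter n g @` E n))%E).
      rewrite -(int_cst W0 mgE); apply: (@ge0_le_integral _ _ _ (@leb3 R) _ mgE).
      + by move=> x _; rewrite lee_fin expR_ge0.
      + by apply: measurable_funTS; apply/measurable_EFinP; exact: weight_measurable.
      + by apply: measurable_funTS; apply/measurable_EFinP; exact: measurable_cst.
      move=> _ [x [Vx [xq _]] <-]; rewrite lee_fin /weight /W0 ler_expR ler_nM2l; last by rewrite oppr_lt0 divr_gt0.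
      by rewrite ler_ln ?posrE ?(ax n).
    rewrite EFinM; apply: lee_wpmul2l; first by rewrite lee_fin ltW.
    have [ab Hab] := cells n; have [ab' Hab'] := cells n.+1.
    apply: (@tail_leb3 ab.1 ab.2 ab'.1 ab'.2) => //.
    - exact: subset_trans (image_subset _ EV) Hab.
    - rewrite image_comp; exact: subset_trans (image_subset _ EV) Hab'.
    - by move=> _ [x [_ [_ xT]] <-].
  have lo : (w0%:E * leb3 (E n) <= lint (@weight R) (E n))%E.
    rewrite -(int_cst w0 mE); apply: (@ge0_le_integral _ _ _ (@leb3 R) _ mE).
    + by move=> x _; rewrite lee_fin ltW.
    + by apply: measurable_funTS; apply/measurable_EFinP; exact: measurable_cst.
    + by apply: measurable_funTS; apply/measurable_EFinP; exact: weight_measurable.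
    move=> x [Vx _]; rewrite lee_fin /weight /w0 ler_expR ler_nM2l; last by rewrite oppr_lt0 divr_gt0.
    have x0' := ax 0%N x Vx; rewrite ler_ln ?posrE ?mulr_gt0 ?exprn_gt0//.
    have [a1 a2 _] := norm_comp3 x; have := VM x Vx => xM.
    have sq (t : R) : `|t| <= `|x| -> t ^+ 2 <= M ^+ 2.
      by move=> tx; rewrite -real_normK ?num_real// lerXn2r ?nnegrE ?(ltW M0)// (le_trans tx).
    by rewrite /axdist; have := sq _ a1; have := sq _ a2; clear - H; lra.
  have kn : 0 < k ^+ n by rewrite exprn_gt0//; clear - H k1; lra.
  have kn0 : (0 <= (k ^+ n)%:E)%E by rewrite lee_fin ltW.
  have := le_trans (lee_wpmul2l kn0 lo) (le_trans (wexp _ n (cE n) EV) up).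
  rewrite muleA -EFinM -lee_pdivlMl ?mulr_gt0// => /le_trans; apply.
  rewrite -EFinM lee_fin le_eqVlt; apply/orP; left; apply/eqP.
  by rewrite exprVn; field; rewrite !gt_eqF.
have mV := compact3_measurable cV.
(* For every [N] the sets [E n] with [n >= N] cover [V]. *)
have vN N : ((2 * r) ^+ 3 <= W0 * C' / w0 * k^-1 ^+ N / (1 - k^-1)).
  rewrite -lee_fin -(leb3_ball x0 (ltW r0)).
  apply: (@geometric_cover R (fun n => E (N + n)%N)) => //.
  - by move=> n; exact: compact3_measurable.
  - apply: mulr_ge0; last by apply: exprn_ge0; rewrite invr_ge0; clear - H k1; lra.
    by apply: divr_ge0; [apply: mulr_ge0 => //; exact: ltW|exact: ltW].
  - by rewrite invr_ge0 invf_lt1//; clear - H k1; lra.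
  - by move=> n; apply: le_trans (lE _) _; rewrite exprD mulrA.
  - move=> x Vx; have [n Nn [a b]] := vis (fun n => iter n g x) (fun _ => erefl) (fun n => ax n x Vx) N.
    by exists (n - N)%N => //; rewrite subnKC.
have [N] := @expr_unbounded _ k (W0 * C' / w0 / (1 - k^-1) / (2 * r) ^+ 3) k1.
have r3 : 0 < (2 * r) ^+ 3 by rewrite exprn_gt0// mulr_gt0.
have kN : 0 < k ^+ N by rewrite exprn_gt0//; clear - H k1; lra.
rewrite ltr_pdivrMr// => lt; have := vN N; rewrite exprVn leNgt => /negP; apply.
by rewrite [ltLHS]mulrAC ltr_pdivrMr// [ltRHS]mulrC.
Qed.

End PlaneReach.

(** * Area expansion on the invariant planes *)

Section Planar.
Variable R : realType.
Notation R3 := (R * R * R)%type.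
Variables (h : R * R -> R3) (L sn eps m lam : R).
Hypothesis H : chart h L sn eps m lam.
Let g := zmap h lam.

Definition diag (b : bool) (t : R) : R := if b then t else - t.

Definition gam (b : bool) (u : R) : R3 := h (u, diag b u).

Definition diagi (b : bool) (i : int) : int := if b then i else - i.

Lemma gam2 b u : -1 <= u <= 1 -> (gam b u).1.2 = diag b (gam b u).1.1.
Proof.
by rewrite /gam /diag => ub; case: b; rewrite ?(h_diag1 H ub)// (h_diag2 H ub) opprK.
Qed.

(** On a diagonal plane the two strip indices agree up to sign, so the reflection sign is 1 and the
    image lies in the upper half-space. The symmetry of [h] on the diagonals keeps it in the
    plane. *)
Lemma diag_beam b i t z : 2 * i%:~R - 1 <= t <= 2 * i%:~R + 1 ->
  g (t, diag b t, z) = (expR z * (gam b (sgn_par R i * (t - 2 * i%:~R))).1.1,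
   diag b (expR z * (gam b (sgn_par R i * (t - 2 * i%:~R))).1.1),
   lam * (expR z * (gam b (sgn_par R i * (t - 2 * i%:~R))).2)).
Proof.
move=> tb; have bm : in_beam i (diagi b i) (t, diag b t, z).
  by split => //=; rewrite /diag /diagi; case: b => //; rewrite intrN; lra.
set u := _ * (t - _).
have ub : -1 <= u <= 1 by rewrite /u; case: (sgn_par_cases R i) => ->; lra.
have sE : sgn_par R (diagi b i) = sgn_par R i by rewrite /diagi; case: b {bm} => //; exact: sgn_parN.
rewrite /g (zmap_beam H bm) sE sgn_par_sq.
have -> : beam_coord i (diagi b i) (t, diag b t, z) = (u, diag b u).
  by rewrite /beam_coord/= sE /u /diag /diagi; case: b {bm sE} => //; rewrite intrN; congr (_, _); ring.
rewrite /refl3 /zup -/(gam b u) mul1r /= gam2//; congr (_, _, _); last by ring.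
by rewrite /diag; case: b {bm sE} => //; ring.
Qed.

(** The restriction of [g] to the plane, in the coordinates [(v_1, z)]. The middle coordinate is
    carried along unchanged, so that the three-dimensional measure lemmas apply to area. *)
Definition planar b (x : R3) : R3 :=
  ((g (x.1.1, diag b x.1.1, x.2)).1.1, x.1.2, (g (x.1.1, diag b x.1.1, x.2)).2).

Lemma diag_continuous b : continuous (fun x : R3 => (x.1.1, diag b x.1.1, x.2) : R3).
Proof.
have [c1 c2 c3] := coord3_continuous R.
apply: continuous_pair3 => // x; rewrite /diag; case: b; first exact: c1.
by apply: cvgN; exact: c1.
Qed.

Lemma planar_continuous b : continuous (planar b).
Proof.
have [c1 c2 c3] := coord3_continuous R.
have cg : continuous (fun x : R3 => g (x.1.1, diag b x.1.1, x.2)).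
  move=> x; apply: (@continuous_comp _ _ _ (fun x : R3 => (x.1.1, diag b x.1.1, x.2) : R3) g).
    exact: diag_continuous.
  exact: (zmap_continuous H).
apply: continuous_pair3 => // x.
  exact: (@continuous_comp _ _ _ _ (fun x : R3 => x.1.1) x (cg x) (c1 _)).
exact: (@continuous_comp _ _ _ _ (fun x : R3 => x.2) x (cg x) (c3 _)).
Qed.

Lemma near_beam (t : R) : exists i : int, 2 * i%:~R - 1 <= t <= 2 * i%:~R + 1.
Proof. by exists (strip 1 t); have := strip_bounds t; lra. Qed.

Lemma diag_iter b n (t y z : R) :
  iter n g (t, diag b t, z) =
  ((iter n (planar b) (t, y, z)).1.1, diag b (iter n (planar b) (t, y, z)).1.1,
   (iter n (planar b) (t, y, z)).2).
Proof.
elim: n => [//|n IH]; rewrite !iterS IH; move: (iter n _ _) => p.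
have [i ti] := near_beam p.1.1.
by rewrite /planar (diag_beam b p.2 ti).
Qed.

Lemma planar_beam b i x : 2 * i%:~R - 1 <= x.1.1 <= 2 * i%:~R + 1 ->
  planar b x = (expR x.2 * (gam b (sgn_par R i * (x.1.1 - 2 * i%:~R))).1.1, x.1.2,
   lam * (expR x.2 * (gam b (sgn_par R i * (x.1.1 - 2 * i%:~R))).2)).
Proof. by move=> xi; rewrite /planar (diag_beam _ _ xi). Qed.

Lemma gam_inQ b u : -1 <= u <= 1 -> inQ (u, diag b u).
Proof. by move=> ub; split => //=; rewrite /diag; case: b; lra. Qed.

Lemma beam_u i (t : R) : 2 * i%:~R - 1 <= t <= 2 * i%:~R + 1 -> -1 <= sgn_par R i * (t - 2 * i%:~R) <= 1.
Proof. by case: (sgn_par_cases R i) => ->; lra. Qed.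

Lemma planar_z b x : 0 <= (planar b x).2 <= lam * expR x.2.
Proof.
have [i xi] := near_beam x.1.1; rewrite (planar_beam _ xi)/=.
have q := gam_inQ b (beam_u xi); have l0 : 0 < lam by have := lam_ge4 H; lra.
have h0 := h3_ge0 H q; have [_ _ c] := norm3_comp (h (sgn_par R i * (x.1.1 - 2 * i%:~R), diag b (sgn_par R i * (x.1.1 - 2 * i%:~R)))).
have h1 := le_trans c (h_le1 H q); have e0 := expR_gt0 x.2.
rewrite /gam !mulr_ge0 ?(ltW l0) ?(ltW e0)//= ler_pM2l// -[leRHS]mulr1 ler_pM2l//.
exact: le_trans (ler_norm _) h1.
Qed.

Lemma planar_inj b i x y : 2 * i%:~R - 1 <= x.1.1 <= 2 * i%:~R + 1 ->
  2 * i%:~R - 1 <= y.1.1 <= 2 * i%:~R + 1 -> planar b x = planar b y -> x = y.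
Proof.
move=> xi yi; rewrite (planar_beam _ xi) (planar_beam _ yi).
have ux := beam_u xi; have uy := beam_u yi.
set u := (sgn_par R i * (x.1.1 - _)) in ux *; set v := (sgn_par R i * (y.1.1 - _)) in uy *.
move=> [e1 e2 e3].
have [] := zup_inj H (gam_inQ b ux) (gam_inQ b uy) (z := x.2) (z' := y.2).
  rewrite /zup -/(gam b u) -/(gam b v) !gam2// ![expR _ * (lam * _)]mulrCA e1 e3; congr (_, _, _).
  by rewrite /diag; case: b e1 {e3} => // e1; rewrite !mulrN e1.
move=> [uv _] z; apply: pair3_eq => //.
have s0 : sgn_par R i != 0 by case: (sgn_par_cases R i) => ->; rewrite ?oppr_eq0 oner_neq0.
by move: uv; rewrite /u /v => /(mulfI s0) uv; lra.
Qed.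

End Planar.

(** * Angles and tolerances in the diagonal planes *)

Section PlanarVolume.
Variable R : realType.
Notation R3 := (R * R * R)%type.
Variables (h : R * R -> R3) (L sn eps m lam : R).
Hypothesis H : chart h L sn eps m lam.

Lemma small_pos (q : R -> R) (e0 : R) : continuous q -> 0 < q 0 -> 0 < e0 ->
  exists e, [/\ 0 < e, e <= e0 & 0 < q e].
Proof.
move=> cq q0 e00; have : \forall e \near 0, 0 < q e by exact: (cvgr_gt (f := q) _ (cq 0) _ q0).
move=> /nbhs_ballP[d /= d0 dq]; exists (Num.min e0 (d / 2)).
have p : 0 < Num.min e0 (d / 2) by rewrite lt_min e00 divr_gt0.
split => //; first by rewrite ge_min lexx.
apply: dq; rewrite /ball/= sub0r normrN gtr0_norm// gt_min; apply/orP; right; lra.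
Qed.

(** [M] shrinks the radial coordinate of the image. At [e = 0] the area factor obtained is
    [ez ^ 2 * lam * n * sn / L] times [M / (M + 2 / sn)]; a large [M] brings the last ratio near 1,
    and continuity then allows a positive [e]. *)
Lemma planar_margin (ez n eta : R) : 0 < ez -> m <= n -> 0 < eta < ez ^+ 2 * (lam * m * sn / L) ->
  exists M e, let e' := 2 * (M + 2) / m * e in [/\ 0 < M, 0 < e, 4 * e <= eps /\ e <= 2^-1 , 2 * e < n &
    eta * n ^+ 2 * (L * (1 + e') * (M + e' + 2 / sn * (1 + e'))) <=
    lam * M * (sn * (ez * (1 - e)) ^+ 2 * (n - 2 * e) ^+ 3)].
Proof.
move=> ez0 mn /andP[eta0 etaJ]; have L0 := L_gt0 H; have m0 := m_gt0 H; have s0 := sn_gt0 H.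
have e0 := eps_gt0 H; have l0 : 0 < lam by have := lam_ge4 H; lra.
have n0 : 0 < n by lra.
pose J := ez ^+ 2 * (lam * n * sn) - eta * L.
have J0 : 0 < J.
  have : eta * L < ez ^+ 2 * (lam * m * sn / L) * L by rewrite ltr_pM2r.
  have -> : ez ^+ 2 * (lam * m * sn / L) * L = ez ^+ 2 * (lam * sn) * m by field; rewrite gt_eqF.
  have : ez ^+ 2 * (lam * sn) * m <= ez ^+ 2 * (lam * sn) * n.
    by rewrite ler_pM2l// mulr_gt0 ?mulr_gt0// exprn_gt0.
  rewrite /J; lra.
(* With this value the inequality at [e = 0] has the margin [n ^ 2]. *)
pose M := (eta * L * (2 / sn) + 1) / J.
have aL : 0 < eta * L * (2 / sn) by rewrite !mulr_gt0// invr_gt0.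
have M0 : 0 < M by rewrite divr_gt0//; lra.
have MJ : M * J = eta * L * (2 / sn) + 1 by rewrite /M divfK// gt_eqF.
pose c := 2 * (M + 2) / m.
pose q e := lam * M * (sn * (ez * (1 - e)) ^+ 2 * (n - 2 * e) ^+ 3) -
  eta * n ^+ 2 * (L * (1 + c * e) * (M + c * e + 2 / sn * (1 + c * e))).
have lin0 (b : R) : continuous (fun e : R => b * e).
  by move=> e; apply: cvgM; [exact: cvg_cst|exact: cvg_id].
have lin (a b : R) : continuous (fun e : R => a - b * e).
  by move=> e; apply: cvgB; [exact: cvg_cst|exact: lin0].
have linp (a b : R) : continuous (fun e : R => a + b * e).
  by move=> e; apply: cvgD; [exact: cvg_cst|exact: lin0].
have cX (f : R -> R) k : continuous f -> continuous (fun e => f e ^+ k).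
  move=> cf e; elim: k => [|k IH]; first exact: cvg_cst.
  rewrite (_ : (fun e => f e ^+ k.+1) = (fun e => f e * f e ^+ k)); last by apply/funext => x; rewrite exprS.
  by apply: cvgM; [exact: cf|exact: IH].
have c1 : continuous (fun e : R => 1 - e) by move=> e; apply: cvgB; [exact: cvg_cst|exact: cvg_id].
have cq : continuous q.
  move=> e; apply: cvgB.
    apply: cvgM; first exact: cvg_cst.
    apply: cvgM; last exact: (cX _ 3 (lin n 2)).
    apply: cvgM; first exact: cvg_cst.
    apply: (cX (fun e => ez * (1 - e)) 2) => x; apply: cvgM; [exact: cvg_cst|exact: c1].
  apply: cvgM; first exact: cvg_cst.
  apply: cvgM; first by apply: cvgM; [exact: cvg_cst|exact: linp].
  by apply: cvgD; [exact: linp|apply: cvgM; [exact: cvg_cst|exact: linp]].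
have q0 : 0 < q 0.
  rewrite /q !mulr0 !subr0 !addr0 !mulr1.
  rewrite [X in 0 < X](_ : _ = n ^+ 2 * (M * J - eta * L * (2 / sn))); last by rewrite /J; ring.
  by rewrite MJ mulr_gt0 ?exprn_gt0//; lra.
have e00 : 0 < Num.min (eps / 4) (Num.min 2^-1 (n / 4)).
  by rewrite !lt_min; apply/and3P; split; lra.
have [e [ep ee qe]] := small_pos cq q0 e00.
move: ee; rewrite !le_min => /and3P[e1 e2 e3].
exists M, e; split => //; [split; [|clear - H e2; lra]; clear - H ep e1 e3 M0; lra|clear - H ep e1 e3 M0; lra|].
by rewrite -subr_ge0; apply: ltW; move: qe; rewrite /q /c.
Qed.

Definition wedge (w c : R3) : R := w.1.1 * c.2 - w.2 * c.1.1.

Definition symv (b : bool) (c : R3) : Prop := c.1.2 = diag b c.1.1.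

(** Lagrange's identity; the 2 is the squared length of the horizontal direction of the plane. *)
Lemma symv_id b w c : symv b w -> symv b c ->
  dot3 w w * dot3 c c = dot3 w c ^+ 2 + 2 * wedge w c ^+ 2.
Proof. by rewrite /symv /diag /dot3 /wedge => -> ->; case: b; ring. Qed.

Lemma symv_norm b w c : symv b w -> symv b c -> norm3 w * norm3 c <= `|dot3 w c| + 2 * `|wedge w c|.
Proof.
move=> sw sc; have p : 0 <= `|dot3 w c| + 2 * `|wedge w c| by rewrite addr_ge0 ?mulr_ge0.
rewrite -(@ler_pXn2r _ 2)// ?nnegrE ?mulr_ge0 ?norm3_ge0// exprMn !norm3_sq (symv_id sw sc).
rewrite -[dot3 w c ^+ 2]real_normK ?num_real// -[wedge w c ^+ 2]real_normK ?num_real//.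
have := normr_ge0 (dot3 w c); have := normr_ge0 (wedge w c).
by move: `|dot3 w c| `|wedge w c| => x y x0 y0; nra.
Qed.

(** Both the distance of the parameters on the diagonal and the area spanned carry a factor sqrt 2.
    These cancel in the last bound, which therefore keeps the sharp constant; the middle bound
    rounds sqrt 2 up to 2. *)
Lemma gam_nontangent b u v : -1 <= u <= 1 -> -1 <= v <= 1 ->
  norm3 (sub3 (gam h b u) (gam h b v)) <= eps ->
  let d := sub3 (gam h b u) (gam h b v) in
  [/\ symv b d, sn * norm3 (gam h b v) * norm3 d <= 2 * `|wedge d (gam h b v)| &
     sn * norm3 (gam h b v) * `|u - v| <= L * `|wedge d (gam h b v)| ].
Proof.
move=> ub vb de d; have sv : symv b (gam h b v) by exact: (gam2 H).
have sd : symv b d.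
  by rewrite /symv /d /sub3/= (gam2 H)// (gam2 H)// /diag; case: (b) => //; ring.
have s0 := sn_gt0 H; have L0 := L_gt0 H.
have := h_nontangent H (gam_inQ b ub) (gam_inQ b vb) de; rewrite -/(gam h b u) -/(gam h b v) -/d => nt.
have id := symv_id sd sv; have dC : dot3 (gam h b v) d = dot3 d (gam h b v) by rewrite /dot3; ring.
have key : (sn * norm3 (gam h b v) * norm3 d) ^+ 2 <= 2 * wedge d (gam h b v) ^+ 2.
  by rewrite !exprMn !norm3_sq; move: nt id; rewrite dC; lra.
have n0 := norm3_ge0 (gam h b v); have d0 := norm3_ge0 d.
split => //.
  rewrite -(@ler_pXn2r _ 2)// ?nnegrE ?mulr_ge0 ?(ltW s0)//.
  rewrite [leRHS]exprMn real_normK ?num_real//; have := sqr_ge0 (wedge d (gam h b v)); lra.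
have lo := h_lower H (gam_inQ b ub) (gam_inQ b vb); rewrite -/(gam h b u) -/(gam h b v) -/d in lo.
have n2 : norm2 (sub2 (u, diag b u) (v, diag b v)) ^+ 2 = 2 * (u - v) ^+ 2.
  by rewrite norm2_sq /sub2/= /diag; case: (b); ring.
have lo2 : 2 * (u - v) ^+ 2 <= L ^+ 2 * norm3 d ^+ 2.
  by rewrite -n2 -exprMn lerXn2r ?nnegrE ?norm2_ge0// mulr_ge0 ?(ltW L0).
rewrite -(@ler_pXn2r _ 2)// ?nnegrE ?mulr_ge0 ?(ltW s0) ?(ltW L0)//.
have -> : (sn * norm3 (gam h b v) * `|u - v|) ^+ 2 = (sn * norm3 (gam h b v)) ^+ 2 * (u - v) ^+ 2.
  by rewrite exprMn real_normK ?num_real.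
have -> : (L * `|wedge d (gam h b v)|) ^+ 2 = L ^+ 2 * wedge d (gam h b v) ^+ 2.
  by rewrite exprMn real_normK ?num_real.
rewrite exprMn in key.
have c0 : 0 <= (sn * norm3 (gam h b v)) ^+ 2 by exact: sqr_ge0.
have k1 := ler_wpM2l c0 lo2; have L2 : 0 <= L ^+ 2 by exact: sqr_ge0.
by have k2 := ler_wpM2l L2 key; lra.
Qed.

End PlanarVolume.

(** * The area bound near a single point *)

Section PlanarLocal.
Variable R : realType.
Notation R3 := (R * R * R)%type.
Variables (h : R * R -> R3) (L sn eps m lam : R).
Hypothesis H : chart h L sn eps m lam.

Lemma expR_diff_ge (c s t : R) : 0 <= c -> c <= expR s -> c <= expR t ->
  c * `|s - t| <= `|expR s - expR t|.
Proof.
move=> c0; wlog st : s t / t <= s => [W cs ct|cs ct].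
  by have [?|/ltW ?] := leP t s; [exact: W|rewrite distrC [leRHS]distrC; exact: W].
rewrite !ger0_norm ?subr_ge0 ?ler_expR//.
have -> : expR s = expR t * expR (s - t) by rewrite -expRD addrCA subrr addr0.
have := expR_ge1Dx (s - t) => e1.
rewrite -[X in _ <= _ - X]mulr1 -mulrBr; apply: ler_pM => //; lra.
Qed.

(** Up to errors of order [e], the wedge of the displacement with [c0] ignores the radial motion, so
    it bounds the motion along the curve and with it [u - v]. Once this is known, the dot product
    with [c0] bounds the radial motion, hence [z - z']. *)
Lemma planar_pair b (M e ez n : R) (c0 c c' : R3) (u v z z' : R) :
  let e' := 2 * (M + 2) / m * e in let w := scale3 (expR z) c - scale3 (expR z') c' in
  c = gam h b u -> c' = gam h b v -> symv b c0 -> n = norm3 c0 -> m <= n ->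
  -1 <= u <= 1 -> -1 <= v <= 1 -> 0 < ez -> 0 < M -> 0 < e -> e <= 2^-1 -> 2 * e < n -> 4 * e <= eps ->
  `|c - c0| <= e -> `|c' - c0| <= e -> ez * (1 - e) <= expR z -> ez * (1 - e) <= expR z' ->
  forall A, `|wedge w c0| <= A -> `|dot3 w c0| <= M * A ->
  ez * (1 - e) * sn * (n - 2 * e) * `|u - v| <= L * (1 + e') * A /\
  ez * (1 - e) * (n - 2 * e) ^+ 2 * `|z - z'| <= (M + e' + 2 / sn * (1 + e')) * A.
Proof.
move=> e' w cE cE' sc0 nE mn ub vb ez0 M0 e0 e2 en e4 cc cc' ez1 ez2 A wA dA.
have s0 := sn_gt0 H; have L0 := L_gt0 H; have m0 := m_gt0 H.
have sc : symv b c by rewrite cE; exact: (gam2 H).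
have sc' : symv b c' by rewrite cE'; exact: (gam2 H).
have sw : symv b w by rewrite /w /symv /= sc sc' /diag; case: (b); ring.
have A0 : 0 <= A by exact: le_trans wA.
have n0 : 0 < n by clear - H e0 en; lra.
have wn : norm3 w <= (M + 2) * A / m.
  have := symv_norm sw sc0; rewrite -nE => wn.
  rewrite ler_pdivlMr//; apply: (@le_trans _ _ (norm3 w * n)); first by rewrite ler_wpM2l// norm3_ge0.
  by clear - H wn wA dA; lra.
have e'E : 2 * e * ((M + 2) * A / m) = e' * A by rewrite /e'; ring.
have w2 : 2 * e * norm3 w <= e' * A by rewrite -e'E ler_pM2l// mulr_gt0.
have [w1 _ w3] := norm3_comp w; have [k1 k2 k3] := norm_comp3 (c' - c0).
have W' : `|wedge w c'| <= (1 + e') * A.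
  have -> : wedge w c' = wedge w c0 + (w.1.1 * (c' - c0).2 - w.2 * (c' - c0).1.1) by rewrite /wedge/=; ring.
  apply: le_trans (ler_normD _ _) _; have := ler_normB (w.1.1 * (c' - c0).2) (w.2 * (c' - c0).1.1).
  rewrite !normrM; have : `|w.1.1| * `|(c' - c0).2| <= norm3 w * e by apply: ler_pM => //; exact: le_trans k3 cc'.
  have : `|w.2| * `|(c' - c0).1.1| <= norm3 w * e by apply: ler_pM => //; exact: le_trans k1 cc'.
  by move: wA w2; clear - H; lra.
have D' : `|dot3 w c'| <= (M + e') * A.
  have -> : dot3 w c' = dot3 w c0 + dot3 w (c' - c0) by rewrite /dot3/=; ring.
  apply: le_trans (ler_normD _ _) _; have := dot3_cauchy w (c' - c0).
  have : norm3 w * norm3 (c' - c0) <= norm3 w * (2 * e).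
    by apply: ler_wpM2l; [exact: norm3_ge0|apply: le_trans (norm3_sup _) _; rewrite ler_pM2l].
  by move: dA w2; clear - H; lra.
pose d := sub3 c c'.
have de : norm3 d <= eps.
  apply: le_trans e4; apply: le_trans (norm3_sup _) _.
  have -> : d = (c - c0) - (c' - c0) by rewrite /d opprB addrA subrK.
  by have := ler_normB (c - c0) (c' - c0); move: cc cc'; clear - H; lra.
have n'b : n - 2 * e <= norm3 c'.
  have := norm3_triangle (c0 - c') c'; rewrite subrK -nE.
  have := norm3_sup (c0 - c'); rewrite distrC; move: cc'; clear - H; lra.
rewrite /d cE cE' in de; have [sd N1 N2] := gam_nontangent H ub vb de.
rewrite -cE -cE' -/d in sd N1 N2.
have wE : wedge w c' = expR z * wedge d c' by rewrite /wedge /w /d /scale3 /sub3/=; ring.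
have dE : dot3 w c' = expR z * dot3 d c' + (expR z - expR z') * dot3 c' c'.
  by rewrite /dot3 /w /d /scale3 /sub3/=; ring.
have ep := expR_gt0 z; have e10 : 0 <= ez * (1 - e) by rewrite mulr_ge0 ?(ltW ez0)//; clear - H e2; lra.
rewrite wE normrM (gtr0_norm ep) in W'.
have n'0 : 0 <= n - 2 * e by clear - H en; lra.
split.
  apply: (@le_trans _ _ (L * (expR z * `|wedge d c'|))); last first.
    by rewrite -mulrA ler_pM2l.
  rewrite mulrCA; apply: le_trans (ler_wpM2l (ltW ep) N2).
  rewrite [leLHS](_ : _ = ez * (1 - e) * (sn * (n - 2 * e) * `|u - v|)); last by ring.
  apply: ler_pM => //.
  - by apply: mulr_ge0 => //; apply: mulr_ge0 => //; exact: ltW.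
  - by apply: ler_wpM2r => //; rewrite ler_pM2l.
have c2 : (n - 2 * e) ^+ 2 <= dot3 c' c' by rewrite -norm3_sq lerXn2r ?nnegrE ?norm3_ge0.
have zz := expR_diff_ge e10 ez1 ez2.
apply: (@le_trans _ _ (`|expR z - expR z'| * dot3 c' c')).
  by rewrite [leLHS]mulrAC; apply: ler_pM => //; [exact: mulr_ge0|exact: sqr_ge0].
have -> : `|expR z - expR z'| * dot3 c' c' = `|dot3 w c' - expR z * dot3 d c'|.
  by rewrite dE addrAC subrr add0r normrM [X in _ = _ * X]ger0_norm// dot3_ge0.
apply: le_trans (ler_normB _ _) _; rewrite normrM (gtr0_norm ep).
have : expR z * `|dot3 d c'| <= 2 / sn * ((1 + e') * A).
  apply: (@le_trans _ _ (expR z * (2 / sn * `|wedge d c'|))).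
    rewrite ler_pM2l//; apply: le_trans (dot3_cauchy _ _) _.
    by rewrite mulrAC ler_pdivlMr//; move: N1; clear - H; lra.
  by rewrite mulrCA ler_pM2l// divr_gt0.
by move: D'; clear - H; lra.
Qed.

Lemma planar_local (b : bool) (i : int) (x0 : R3) (eta : R) : 2 * i%:~R - 1 <= x0.1.1 <= 2 * i%:~R + 1 ->
  0 < eta < expR x0.2 ^+ 2 * (lam * m * sn / L) ->
  exists2 d : R, 0 < d & forall K : set R3, compact K ->
    (forall y : R3, K y -> 2 * i%:~R - 1 <= y.1.1 <= 2 * i%:~R + 1 /\ `|x0 - y| < d) ->
    (eta%:E * leb3 K <= leb3 (planar h lam b @` K))%E.
Proof.
move=> xi ej; have L0 := L_gt0 H; have m0 := m_gt0 H; have s0 := sn_gt0 H.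
have l0 : 0 < lam by have := lam_ge4 H; lra.
have ez0 := expR_gt0 x0.2; have eta0 : 0 < eta by case/andP: ej.
pose up (y : R3) := sgn_par R i * (y.1.1 - 2 * i%:~R).
have u0b := beam_u xi; rewrite -/(up x0) in u0b.
set c0 := gam h b (up x0); have sc0 : symv b c0 by exact: (gam2 H).
have mn : m <= norm3 c0 by apply: (m_le H); exact: gam_inQ.
have [M [e [M0 e0 [e4 e2] en marg]]] := planar_margin H ez0 mn ej.
set n := norm3 c0 in mn en marg; set e' := 2 * (M + 2) / m * e in marg.
have e'0 : 0 < e' by rewrite !mulr_gt0 ?invr_gt0//; clear - H M0; lra.
have n0 : 0 < n by clear - H e0 en; lra.
pose q1 := L * (1 + e'); pose q3 := M + e' + 2 / sn * (1 + e').
have q10 : 0 < q1 by rewrite mulr_gt0//; clear - H e'0; lra.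
have q30 : 0 < q3.
  have : 0 < 2 / sn * (1 + e') by rewrite mulr_gt0 ?divr_gt0//; clear - H e'0; lra.
  by rewrite /q3; move: M0 e'0; clear - H; lra.
pose p1 := expR x0.2 * (1 - e) * sn * (n - 2 * e); pose p3 := expR x0.2 * (1 - e) * (n - 2 * e) ^+ 2.
have p10 : 0 < p1 by rewrite !mulr_gt0//; clear - H e2 en; lra.
have p30 : 0 < p3 by rewrite !mulr_gt0 ?exprn_gt0//; clear - H e2 en; lra.
exists (Num.min e (e / (2 * L))); first by rewrite lt_min e0 divr_gt0// mulr_gt0.
move=> K cK Kd.
have near y : K y -> [/\ 2 * i%:~R - 1 <= y.1.1 <= 2 * i%:~R + 1, -1 <= up y <= 1,
    `|gam h b (up y) - c0| <= e & expR x0.2 * (1 - e) <= expR y.2].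
  move=> /Kd[yi]; rewrite lt_min => /andP[y1 y2]; have [d1 _ d3] := norm_comp3 (x0 - y).
  have uy := beam_u yi; split => //.
    have ud : `|up y - up x0| <= `|x0 - y|.
      apply: le_trans d1; rewrite /up -mulrBr normrM.
      have -> : y.1.1 - 2 * i%:~R - (x0.1.1 - 2 * i%:~R) = - (x0.1.1 - y.1.1) by ring.
      by rewrite normrN; case: (sgn_par_cases R i) => ->; rewrite ?normrN normr1 mul1r.
    have ud2 : `|diag b (up y) - diag b (up x0)| <= `|x0 - y|.
      by rewrite /diag; case: (b) => //; rewrite -opprD normrN.
    have := @h_lip_sup _ _ _ _ _ _ _ H _ _ (gam_inQ b uy) (gam_inQ b u0b) _ ud ud2.
    have [a1 a2 a3] := norm3_comp (sub3 (gam h b (up y)) c0).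
    move=> hl; have le : norm3 (sub3 (gam h b (up y)) c0) <= e.
      apply: le_trans hl _; move: (ltW y2); rewrite ler_pdivlMr ?mulr_gt0//.
      by rewrite mulrC.
    by rewrite norm_le3; apply/and3P; split; [exact: le_trans a1 le|exact: le_trans a2 le|exact: le_trans a3 le].
  have -> : expR y.2 = expR x0.2 * expR (y.2 - x0.2) by rewrite -expRD addrCA subrr addr0.
  rewrite ler_pM2l//; have := expR_ge1Dx (y.2 - x0.2).
  by move: (le_lt_trans d3 y1); rewrite ltr_norml/=; clear - H; lra.
(* [a1] reads off the wedge with [c0], and [a3] the dot product with [c0] divided by [M]. In these
   coordinates [planar_pair] says that the map expands by [p1 / q1] and [p3 / q3]. *)
pose a1 : R3 := (c0.2, 0, - c0.1.1 / lam); pose a3 : R3 := (2 * c0.1.1 / M, 0, c0.2 / (lam * M)).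
have nn : n ^+ 2 = 2 * c0.1.1 ^+ 2 + c0.2 ^+ 2.
  by rewrite norm3_sq /dot3 sc0 /diag; case: (b); ring.
have deta : det3 a1 (0, 1, 0) a3 = n ^+ 2 / (lam * M).
  by rewrite nn /det3 /dot3 /cross3/=; field; rewrite !gt_eqF.
have detb : det3 (p1 / q1, 0, 0) (0, 1, 0) (0, 0, p3 / q3) = p1 / q1 * (p3 / q3).
  by rewrite /det3 /dot3 /cross3/=; ring.
have da0 : 0 < n ^+ 2 / (lam * M) by rewrite divr_gt0 ?exprn_gt0// mulr_gt0.
have db0 : 0 < p1 / q1 * (p3 / q3) by rewrite mulr_gt0// divr_gt0.
have := @leb3_expand_lin R K (planar h lam b) a1 (0, 1, 0) a3 (p1 / q1, 0, 0) (0, 1, 0) (0, 0, p3 / q3)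
  cK (planar_continuous H (b:=b)).
rewrite deta detb (gt_eqF da0) (gt_eqF db0) (gtr0_norm da0) (gtr0_norm db0) => /(_ isT isT) vol.
have {vol} : ((p1 / q1 * (p3 / q3))%:E * leb3 K <= (n ^+ 2 / (lam * M))%:E * leb3 (planar h lam b @` K))%E.
  apply: vol => x y Kx Ky; have [xi' ux gx ezx] := near x Kx; have [yi' uy gy ezy] := near y Ky.
  rewrite (planar_beam H _ xi') (planar_beam H _ yi') -/(up x) -/(up y).
  set P : R3 := (_, _, _) - _; set a := lin3 a1 _ _ P.
  have [A1 A2 A3] := norm_comp3 a.
  pose w : R3 := scale3 (expR x.2) (gam h b (up x)) - scale3 (expR y.2) (gam h b (up y)).
  have aw : a.1.1 = wedge w c0.
    by rewrite /a /P /lin3 /dot3 /a1 /wedge /w /scale3/=; field; rewrite gt_eqF.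
  have ad : a.2 = dot3 w c0 / M.
    rewrite /a /P /lin3 /dot3 /a3 /w /scale3/= sc0 (gam2 H b ux) (gam2 H b uy) /diag.
    by case: (b); field; rewrite !gt_eqF.
  have ay : a.1.2 = (x - y).1.2 by rewrite /a /P /lin3 /dot3/=; ring.
  have dA : `|dot3 w c0| <= M * `|a|.
    rewrite mulrC -ler_pdivrMr//; apply: le_trans A3.
    by rewrite ad normrM normfV (gtr0_norm M0).
  have wA : `|wedge w c0| <= `|a| by rewrite -aw.
  have [] := planar_pair erefl erefl sc0 erefl mn ux uy ez0 M0 e0 e2 en e4 gx gy ezx ezy wA dA.
  rewrite -/n -/e' -/q1 -/q3 -/p1 -/p3 => T1 T3.
  have uxy : `|up x - up y| = `|(x - y).1.1|.
    rewrite /up -mulrBr normrM.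
    have -> : x.1.1 - 2 * i%:~R - (y.1.1 - 2 * i%:~R) = (x - y).1.1 by rewrite /=; ring.
    by case: (sgn_par_cases R i) => ->; rewrite ?normrN normr1 mul1r.
  have pq (p q t : R) : 0 < p -> 0 < q -> p * `|t| <= q * `|a| -> `|p / q * t| <= `|a|.
    move=> p0 q0 pt; rewrite normrM (gtr0_norm (divr_gt0 p0 q0)) mulrAC ler_pdivrMr// [leRHS]mulrC.
    exact: pt.
  rewrite norm_le3 /lin3 /dot3/= !mul0r !addr0 !add0r mul1r; apply/and3P; split.
  - by apply: pq => //; rewrite -[x.1.1 - _]/((x - y).1.1) -uxy.
  - by rewrite -[x.1.2 - _]/((x - y).1.2) -ay.
  - by apply: pq.
have mar : eta <= p1 / q1 * (p3 / q3) * (lam * M) / n ^+ 2.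
  rewrite ler_pdivlMr ?exprn_gt0//.
  have -> : p1 / q1 * (p3 / q3) * (lam * M) = lam * M * (sn * (expR x0.2 * (1 - e)) ^+ 2 * (n - 2 * e) ^+ 3) / (q1 * q3).
    by rewrite /p1 /p3; field; rewrite !gt_eqF.
  by rewrite ler_pdivlMr; [exact: marg|exact: mulr_gt0].
have n20 : 0 < (n ^+ 2 / (lam * M))^-1 by rewrite invr_gt0.
have n20' : (0 <= ((n ^+ 2 / (lam * M))^-1)%:E)%E by rewrite lee_fin ltW.
move=> /(lee_wpmul2l n20').
rewrite muleA -EFinM muleA -EFinM mulVf ?gt_eqF// mul1e; apply: le_trans.
apply: lee_wpmul2r; first exact: (measure_ge0 (@leb3 R)).
rewrite lee_fin; apply: le_trans mar _.
by rewrite le_eqVlt; apply/orP; left; apply/eqP; field; rewrite !gt_eqF.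
Qed.

End PlanarLocal.

(** * Some iterate meets an axis within the invariant plane *)

Section AxisHit.
Variable R : realType.
Notation R3 := (R * R * R)%type.
Variables (h : R * R -> R3) (L sn eps m lam : R).
Hypothesis H : chart h L sn eps m lam.
Variable b : bool.
Let G := planar h lam b.

(** The area factor at height 0 exceeds 4; the value 3 leaves a strict inequality and is still more
    than 2. *)
Lemma planar_expand (i : int) (E : set R3) (k : R) : compact E ->
  (forall x, E x -> 2 * i%:~R - 1 <= x.1.1 <= 2 * i%:~R + 1 /\ k <= x.2) ->
  ((3 * expR k ^+ 2)%:E * leb3 E <= leb3 (G @` E))%E.
Proof.
move=> cE Ei; have L0 := L_gt0 H; set A := lam * m * sn / L.
have A4 : 4 < A.
  have l5 := lam_gt H; have l2 := L_sq H; rewrite /A ltr_pdivlMr//; apply: le_lt_trans l5.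
  have -> : L ^+ 5 = L ^+ 2 * L ^+ 2 * L by ring.
  by rewrite ler_pM2r//; nra.
have cG : continuous G by exact: (planar_continuous H).
have mE := compact3_measurable cE; have mG := compact3_measurable (compact3_image cG cE).
have ek : 0 < expR k ^+ 2 by rewrite exprn_gt0 ?expR_gt0.
have c0 : 0 <= 3 * expR k ^+ 2 by rewrite mulr_ge0// ltW.
have := @int_image_ge_local R E set0 set0 G (cst 1) (cst (3 * expR k ^+ 2)) (fun x => expR x.2 ^+ 2 * A)
  (fun=> setT) cE cG (measurable_cst _) (fun=> ler01) (measurable_cst _) (fun=> c0)
  (fun=> closedT) closed0 measurable0 (leb3_set0 R).
rewrite !int_cst// mul1e; apply.
- by move=> x y Ex Ey _ _; apply: (planar_inj H (i := i)); [case: (Ei x Ex)|case: (Ei y Ey)].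
- move=> x Ex _; split => //; [exact: cvg_cst|exact: cvg_cst| |].
    by rewrite mulr_gt0 ?exprn_gt0 ?expR_gt0//; lra.
  have : expR k ^+ 2 <= expR x.2 ^+ 2.
    by rewrite lerXn2r ?nnegrE ?expR_ge0// ler_expR; case: (Ei x Ex).
  rewrite /cst mul1r; move: (expR k ^+ 2) (expR x.2 ^+ 2) ek => p q p0 pq; nra.
move=> x eta Ex _ ej; exists 0%N; split => //.
have [xi _] := Ei x Ex; have [d d0 dK] := planar_local H b xi ej.
exists d => // K cK KE _ Kd; apply: dK => // y Ky; split; last exact: Kd.
by have [] := Ei y (KE y Ky).
Qed.

(** The strip consists of halves of two neighbouring beams. The map is injective on each half, but
    the images may overlap, so the factor 3 is halved. *)
Lemma strip_expand (i : int) (E : set R3) (k : R) : compact E ->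
  (forall x, E x -> 2 * i%:~R < x.1.1 < 2 * i%:~R + 2 /\ k <= x.2) ->
  ((3 / 2 * expR k ^+ 2)%:E * leb3 E <= leb3 (G @` E))%E.
Proof.
move=> cE Ei; have [c1 _ _] := coord3_continuous R.
have cG : continuous G by exact: (planar_continuous H).
pose E1 := E `&` (fun x : R3 => x.1.1) @^-1` [set t | t <= 2 * i%:~R + 1].
pose E2 := E `&` (fun x : R3 => x.1.1) @^-1` [set t | 2 * i%:~R + 1 <= t].
have cE1 : compact E1.
  apply: (subclosed_compact _ cE); last exact: subIsetl.
  apply: closedI; first exact: compact3_closed.
  by apply: preimage_closed; [move=> x _; exact: c1|exact: closed_le].
have cE2 : compact E2.
  apply: (subclosed_compact _ cE); last exact: subIsetl.
  apply: closedI; first exact: compact3_closed.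
  by apply: preimage_closed; [move=> x _; exact: c1|exact: closed_ge].
have mE := compact3_measurable cE.
have m1 := compact3_measurable cE1; have m2 := compact3_measurable cE2.
have sub (F : set R3) : compact F -> F `<=` E -> (leb3 (G @` F) <= leb3 (G @` E))%E.
  move=> cF FE; apply: (@le_measure _ _ _ (@leb3 R)); rewrite ?inE.
  - exact: compact3_measurable (compact3_image cG cF).
  - exact: compact3_measurable (compact3_image cG cE).
  - exact: image_subset.
have ek : 0 < expR k ^+ 2 by rewrite exprn_gt0 ?expR_gt0.
have c0 : (0 <= (3 * expR k ^+ 2)%:E)%E by rewrite lee_fin mulr_ge0// ltW.
have x1 : ((3 * expR k ^+ 2)%:E * leb3 E1 <= leb3 (G @` E))%E.
  apply: le_trans (sub _ cE1 (@subIsetl _ _ _)); apply: (@planar_expand i) => // x [/Ei[xi xk] /= x1].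
  by split => //; lra.
have x2 : ((3 * expR k ^+ 2)%:E * leb3 E2 <= leb3 (G @` E))%E.
  apply: le_trans (sub _ cE2 (@subIsetl _ _ _)); apply: (@planar_expand (i + 1)) => // x [/Ei[xi xk] /= x2].
  by rewrite intrD; split => //; lra.
have EU : (leb3 E <= leb3 E1 + leb3 E2)%E.
  apply: (@le_trans _ _ (leb3 (E1 `|` E2))).
    apply: (@le_measure _ _ _ (@leb3 R)); rewrite ?inE//; first exact: measurableU.
    by move=> x Ex; have [?|/ltW ?] := leP x.1.1 (2 * i%:~R + 1); [left|right]; split.
  exact: (@measureU2 _ _ _ (@leb3 R) _ _ m1 m2).
have sum : ((3 * expR k ^+ 2)%:E * leb3 E <= leb3 (G @` E) + leb3 (G @` E))%E.
  have mu0 (F : set R3) : (0 <= leb3 F)%E by exact: (measure_ge0 (@leb3 R)).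
  apply: le_trans (lee_wpmul2l c0 EU) _; rewrite (ge0_muleDr _ (mu0 _) (mu0 _)).
  exact: (leeD x1 x2).
move: sum; move: (leb3 (G @` E)) (leb3 E) => X y.
have -> : (X + X = 2%:E * X)%E by rewrite mule_natl mule2n.
have p2 : 0 < 2 :> R by [].
rewrite -(lee_pdivrMl _ _ p2) muleA -EFinM => le.
by have -> : 3 / 2 * expR k ^+ 2 = 2^-1 * (3 * expR k ^+ 2) by ring.
Qed.

Lemma strip_leb3 (i : int) (S : set R3) (Y M : R) : mble3 R S -> 0 <= Y -> 0 <= M ->
  (forall x, S x -> [/\ 2 * i%:~R < x.1.1 < 2 * i%:~R + 2, `|x.1.2| <= Y & 0 <= x.2 <= M]) ->
  (leb3 S <= (4 * Y * M)%:E)%E.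
Proof.
move=> mS Y0 M0 Sb.
pose c1 : R := 2 * i%:~R.
have -> : (4 * Y * M)%:E = leb3 (`[c1, c1 + 2] `*` `[- Y, Y] `*` `[0, M] : set R3).
  rewrite leb3_box// !lebesgue_cc ?lerDl//; last lra.
  by rewrite -!EFinM; congr EFin; ring.
apply: (@le_measure _ _ _ (@leb3 R)); rewrite ?inE//.
  by apply: measurableX => //; exact: measurableX.
move=> x Sx; have [xa xb xc] := Sb x Sx; move: xb.
by rewrite ler_norml => xb; split; [split|] => /=; rewrite in_itv/= /c1; lra.
Qed.

Lemma iter_planar_continuous n : continuous (iter n G).
Proof.
elim: n => [|n IH] x; first exact: cvg_id.
by apply: (@continuous_comp _ _ _ (iter n G) G); [exact: IH|exact: (planar_continuous H)].
Qed.

Lemma iter_planar_y n x : (iter n G x).1.2 = x.1.2.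
Proof. by elim: n => [//|n IH]; rewrite iterS /G /planar/=. Qed.

(** Otherwise each iterate of the ball stays in one strip and its measure grows by 3/2 at every
    step. But from the first image on heights are nonnegative, and the slice at height [k] has
    measure of order [expR (- k)], so the total is bounded. *)
Lemma axis_hit (x0 : R3) (r : R) : 0 < r -> exists n x (k : int), `|x - x0| <= r /\
  (iter n G x).1.1 = 2 * k%:~R.
Proof.
move=> r0; apply: contrapT => no; have l0 : 0 < lam by have := lam_ge4 H; lra.
pose V := [set x : R3 | `|x - x0| <= r].
have cV : compact V by exact: ball_compact.
have [c1 c2 c3] := coord3_continuous R.
have cG : continuous G by exact: (planar_continuous H).
have cells n : exists a : int, forall x, V x -> 2 * a%:~R < (iter n G x).1.1 < 2 * a%:~R + 2.
  have [||a Ha] := @even_cell R (fun x => (iter n G x).1.1) x0 r _ (ltW r0).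
  - by move=> x; exact: (@continuous_comp _ _ _ (iter n G) (fun x : R3 => x.1.1) x (@iter_planar_continuous n x) (c1 _)).
  - by move=> x k xr E; apply: no; exists n, x, k.
  by exists a.
have [Y Y0 VY] := compact3_bounded cV.
have Vy n x : V x -> `|(iter n G x).1.2| <= Y.
  by move=> Vx; rewrite iter_planar_y; apply: le_trans (VY x Vx); have [] := norm_comp3 x.
pose Vn n := iter n G @` V.
have cVn n : compact (Vn n) by apply: compact3_image => //; exact: iter_planar_continuous.
have mVn n := compact3_measurable (cVn n).
have VnS n : G @` Vn n = Vn n.+1 by rewrite /Vn image_comp.
have z0 n x : V x -> 0 <= (iter n.+1 G x).2.
  by move=> Vx; rewrite iterS; have /andP[] := planar_z H b (iter n G x).
pose C := 4 * Y * (lam * expR 1) / (3 / 2).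
have C0 : 0 <= C.
  by rewrite divr_ge0// !mulr_ge0 ?expR_ge0 ?(ltW l0) ?(ltW Y0).
have slab n (k : nat) (S : set R3) : compact S -> S `<=` Vn n.+1 ->
    (forall x, S x -> k%:R <= x.2 <= k%:R + 1) -> (leb3 S <= (C * expR (- 1) ^+ k)%:E)%E.
  move=> cS SV Sk; have [a Ha] := cells n.+1; have [a' Ha'] := cells n.+2.
  have up : (leb3 (G @` S) <= (4 * Y * (lam * expR (k%:R + 1)))%:E)%E.
    apply: (@strip_leb3 a') => //.
    - exact: compact3_measurable (compact3_image cG cS).
    - exact: ltW.
    - by rewrite mulr_ge0 ?expR_ge0// ltW.
    move=> _ [x Sx <-]; have [v Vv vx] := SV x Sx.
    have vx' : iter n.+2 G v = G x by rewrite iterS vx.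
    split; first by rewrite -vx'; exact: Ha'.
      by rewrite -vx'; exact: Vy.
    have /andP[g1 g2] := planar_z H b x; apply/andP; split => //; apply: le_trans g2 _.
    by rewrite ler_pM2l// ler_expR; have /andP[] := Sk x Sx.
  have Sa x : S x -> 2 * a%:~R < x.1.1 < 2 * a%:~R + 2 /\ k%:R <= x.2.
    by move=> Sx; split; [have [v Vv <-] := SV x Sx; exact: Ha|have /andP[] := Sk x Sx].
  have low := le_trans (@strip_expand a S k%:R cS Sa) up.
  have e0 := expR_gt0 (k%:R : R).
  have p0 : 0 < 3 / 2 * expR k%:R ^+ 2 :> R by rewrite mulr_gt0 ?exprn_gt0 ?divr_gt0.
  move: low; rewrite -lee_pdivlMl// => /le_trans; apply.
  rewrite -EFinM lee_fin le_eqVlt; apply/orP; left; apply/eqP.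
  have -> : expR (- 1) ^+ k = (expR k%:R)^-1 :> R by rewrite -expRM_natl mulrN1 expRN.
  rewrite expRD /C; field.
  by rewrite gt_eqF.
have bound n : (leb3 (Vn n.+1) <= (C / (1 - expR (- 1)))%:E)%E.
  pose F k : set R3 := Vn n.+1 `&` (fun x : R3 => x.2) @^-1` `[k%:R, k%:R + 1].
  have cF k : compact (F k).
    apply: (subclosed_compact _ (cVn n.+1)); last exact: subIsetl.
    apply: closedI; first exact: compact3_closed.
    by apply: preimage_closed; [move=> x _; exact: c3|exact: interval_closed].
  apply: (@geometric_cover R F) => //.
  - by move=> k; exact: compact3_measurable.
  - by rewrite expR_ge0/= expR_lt1; lra.
  - move=> k; apply: (@slab n k (F k)) => //; first exact: subIsetl.
    by move=> x [_]; rewrite /= in_itv/=.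
  move=> _ [x Vx <-]; exists (Num.truncn (iter n.+1 G x).2); first exact: I.
  split; first by exists x.
  by rewrite /= in_itv/=; have := truncn_itv (z0 n x Vx); rewrite -natr1 /=; lra.
have growth n : (((3 / 2) ^+ n)%:E * leb3 (Vn 1%N) <= leb3 (Vn n.+1))%E.
  elim: n => [|n IH]; first by rewrite expr0 mul1e.
  have [a Ha] := cells n.+1.
  have := @strip_expand a (Vn n.+1) 0 (cVn _); rewrite expR0 expr1n mulr1 VnS => st.
  rewrite exprS EFinM -muleA; apply: le_trans (st _).
    by apply: lee_wpmul2l => //; rewrite lee_fin divr_ge0.
  by move=> _ [x Vx <-]; split; [exact: Ha|exact: z0].
(* The ball itself may lie at negative heights, where one step guarantees only a multiple of
   [expR (- Y) ^ 2]. *)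
have pos : exists2 c, 0 < c & (c%:E <= leb3 (Vn 1%N))%E.
  have [a Ha] := cells 0%N.
  exists (3 / 2 * expR (- Y) ^+ 2 * (2 * r) ^+ 3).
    by rewrite mulr_gt0 ?exprn_gt0 ?mulr_gt0// ?exprn_gt0 ?expR_gt0// divr_gt0.
  rewrite EFinM -(leb3_ball x0 (ltW r0)) /Vn -/V.
  have := @strip_expand a V (- Y) cV; apply => x Vx; split; first exact: Ha.
  by have [_ _ d] := norm_comp3 x; have := le_trans d (VY x Vx); rewrite ler_norml => /andP[].
have [c cp cV1] := pos.
have k1 : 1 < 3 / 2 :> R by lra.
have [n] := @expr_unbounded _ (3 / 2) (C / (1 - expR (- 1)) / c) k1.
rewrite ltr_pdivrMr// ltNge => /negP; apply.
rewrite -lee_fin; apply: le_trans (bound n); apply: le_trans (growth n).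
by rewrite EFinM; apply: lee_wpmul2l => //; rewrite lee_fin exprn_ge0.
Qed.

End AxisHit.

(** * Iterates of open sets cover the punctured space *)

Section Expanding.
Variable R : realType.
Notation R3 := (R * R * R)%type.
Variables (h : R * R -> R3) (L sn eps m lam : R).
Hypothesis H : chart h L sn eps m lam.
Let g := zmap h lam.

(** [fold 1] is odd and changes sign under translation by 2. *)
Lemma fold_reflect (k : int) (s t : R) : s + t = 2 * k%:~R \/ s - t = 2 * k%:~R ->
  exists b, fold 1 t = diag b (fold 1 s).
Proof.
move=> st; have [i si] := near_beam s; rewrite (fold_beam si).
have sg (p q : int) : exists b, forall u : R, sgn_par R p * u = diag b (sgn_par R q * u).
  case: (sgn_par_cases R p) => ->; case: (sgn_par_cases R q) => ->.
  - by exists true.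
  - by exists false => u; rewrite /diag; ring.
  - by exists false => u; rewrite /diag; ring.
  - by exists true.
case: st => st.
- have ti : 2 * (k - i)%:~R - 1 <= t <= 2 * (k - i)%:~R + 1 by rewrite intrB; lra.
  rewrite (fold_beam ti); have [b E] := sg (k - i) i; exists (~~ b).
  have -> : t - 2 * (k - i)%:~R = - (s - 2 * i%:~R) by rewrite intrB; lra.
  by rewrite mulrN E /diag; case: (b) => //=; rewrite opprK.
- have ti : 2 * (i - k)%:~R - 1 <= t <= 2 * (i - k)%:~R + 1 by rewrite intrB; lra.
  rewrite (fold_beam ti); have [b E] := sg (i - k) i; exists b.
  have -> : t - 2 * (i - k)%:~R = s - 2 * i%:~R by rewrite intrB; lra.
  by rewrite E.
Qed.

Lemma nbhs_ball3 (x : R3) (U : set R3) : nbhs x U ->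
  exists2 r, 0 < r & forall y, `|y - x| <= r -> nbhs y U.
Proof.
move=> /nbhs3P[e e0 eU]; exists (e / 2); first by rewrite divr_gt0.
move=> y yx; apply/nbhs3P; exists (e / 2); first by rewrite divr_gt0.
move=> z yz; apply: eU; have := ler_distD y x z; rewrite [`|x - y|]distrC; lra.
Qed.

(** A point on a plane of the first kind folds onto a diagonal of the square, so its image is on an
    invariant plane. The ball of [axis_hit] is three-dimensional; the point of the plane with the
    same first and third coordinates as [x'] is just as close. *)
Lemma zmap_cover (x0 : R3) (U : set R3) : nbhs x0 U ->
  forall y, y <> 0 -> exists2 n, (0 < n)%N & (iter n g @` U) y.
Proof.
move=> /nbhs_ball3[r r0 rU].
have [n [x [k [xr xk]]]] := plane_hit H x0 r0.
have [b bE] := fold_reflect xk.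
set p := iter n g x in bE xk.
pose u := fold 1 p.1.1; have ub : -1 <= u <= 1 by exact: fold_bounds.
have gp : exists t z, g p = (t, diag b t, z).
  exists (expR p.2 * (gam h b u).1.1), (g p).2.
  rewrite /g /zmap /fold2 bE -/u /refl3 /zup -/(gam h b u) /= (gam2 H b ub); congr (_, _, _).
  by rewrite /diag; case: (b); ring.
case: gp => t [z gp].
have W := iter_zmap_open H n.+1 (rU x xr); rewrite iterS -/g -/p gp in W.
have [r2 r20 rW] := nbhs_ball3 W.
have [n' [x' [k' [xr' xk']]]] := axis_hit H b (t, 0, z) r20.
have [d1 _ d3] := norm_comp3 (x' - (t, 0, z)).
have Nq : nbhs ((x'.1.1, diag b x'.1.1, x'.2) : R3) (iter n.+1 g @` U).
  apply: rW; rewrite norm_le3/=; apply/and3P; split; [exact: le_trans d1 xr'| |exact: le_trans d3 xr'].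
  apply: le_trans xr'; apply: le_trans d1; rewrite /diag; case: (b) => //.
  by rewrite -opprD normrN.
have := iter_zmap_open H n' Nq; rewrite -/g.
have -> : iter n' g (x'.1.1, diag b x'.1.1, x'.2) = (2 * k'%:~R, 2 * (diagi b k')%:~R,
   (iter n' (planar h lam b) x').2).
  have xE : x' = (x'.1.1, x'.1.2, x'.2) by case: (x') => -[].
  rewrite /g (diag_iter H b n' x'.1.1 x'.1.2 x'.2) -xE xk'; congr (_, _, _).
  by rewrite /diag /diagi; case: (b) => //; rewrite intrN mulrN.
move=> Nax y y0; have [n2 n20 [_ [_ [v Uv <-] <-] vy]] := axis_cover H Nax y0.
exists (n2 + (n' + n.+1))%N; first by rewrite addn_gt0 n20.
by exists v => //; rewrite !iterD.
Qed.

End Expanding.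

(** * A point has zero capacity *)

Section Flat.
Variable R : realType.

(* The exponent makes the family stable under differentiation, up to linear combinations. *)
Definition flat (k : nat) (x : R) : R := if 0 < x then x^-1 ^+ k * expR (- x^-1) else 0.

(** From [1 + t <= expR t] at [t = y / j], raised to the power [j]. *)
Lemma pow_le_exp (j : nat) (y : R) : 0 <= y -> y ^+ j <= j%:R ^+ j * expR y.
Proof.
move=> y0; case: j => [|j]; first by rewrite !expr0 mul1r; have := expR_ge1Dx y; lra.
have j0 : 0 < j.+1%:R :> R by [].
have -> : expR y = expR (y / j.+1%:R) ^+ j.+1.
  by rewrite -expRM_natl; congr expR; field; rewrite gt_eqF.
rewrite -exprMn lerXn2r ?nnegrE ?mulr_ge0 ?expR_ge0//.
rewrite mulrC -ler_pdivrMr//; have := expR_ge1Dx (y / j.+1%:R).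
by move: (y / _) => t; lra.
Qed.

Lemma flat_ge0 k x : 0 <= flat k x.
Proof. by rewrite /flat; case: ifP => // x0; rewrite mulr_ge0 ?expR_ge0// exprn_ge0// invr_ge0 ltW. Qed.

Lemma flat_le k x : flat k x <= k%:R ^+ k.
Proof.
rewrite /flat; case: ifP => [x0|_]; last by rewrite exprn_ge0.
rewrite expRN ler_pdivrMr ?expR_gt0//; apply: pow_le_exp; by rewrite invr_ge0 ltW.
Qed.

(** Quadratic decay at 0 gives the derivative 0 there. *)
Lemma flat_sq k x : flat k x <= k.+2%:R ^+ k.+2 * x ^+ 2.
Proof.
have -> : flat k x = flat k.+2 x * x ^+ 2.
  rewrite /flat; case: ifP => [x0|_]; last by rewrite mul0r.
  by rewrite !exprSr; field; rewrite gt_eqF.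
by apply: ler_wpM2r; [exact: sqr_ge0|exact: flat_le].
Qed.

Lemma flat_le0 k x : x <= 0 -> flat k x = 0.
Proof. by rewrite /flat ltNge => ->. Qed.

Lemma is_derive_of_sq (f : R -> R) (C : R) : f 0 = 0 -> (forall x, `|f x| <= C * x ^+ 2) -> is_derive (0 : R) (1 : R) f 0.
Proof.
move=> f0 fC; have C0 : 0 <= C by have := le_trans (normr_ge0 _) (fC 1); rewrite expr1n mulr1.
have cv : (fun t : R => t^-1 *: ((f \o shift 0) (t *: (1 : R)) - f 0)) @ 0^' --> (0 : R).
  apply/cvgrPdist_le => e e0; apply/nbhs_ballP; exists (e / (C + 1)); first by rewrite /= divr_gt0//; lra.
  move=> t; rewrite /ball/= sub0r normrN => te t0.
  rewrite sub0r normrN /GRing.scale/= mulr1 addr0 f0 subr0 normrM normfV.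
  have tp : 0 < `|t| by rewrite normr_gt0.
  rewrite mulrC ler_pdivrMr//; apply: le_trans (fC t) _.
  rewrite -[t ^+ 2]real_normK ?num_real// expr2 mulrA; apply: ler_wpM2r; first exact: ltW.
  move: te; rewrite ltr_pdivlMr; last lra.
  by nra.
apply: DeriveDef; first by apply/cvg_ex; exists 0.
exact: (cvg_lim _ cv).
Qed.

Lemma is_derive_flat k x : is_derive x (1 : R) (flat k) (flat k.+2 x - k%:R * flat k.+1 x).
Proof.
have [x0|x0|->] := ltgtP x 0.
- rewrite !flat_le0 ?(ltW x0)// mulr0 subr0.
  apply: (@near_eq_is_derive _ _ _ (cst (0 : R))).
  near=> y; rewrite flat_le0//; apply: ltW; near: y.
  exact: (cvgr_lt (f := id) x cvg_id _ x0).
- pose F : R -> R := ((fun t : R => t^-1) ^+ k * (expR \o (fun t : R => - t^-1)))%R.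
  apply: (@near_eq_is_derive _ _ _ F).
    near=> y; rewrite /F /flat !fctE /= ifT//; near: y.
    exact: (cvgr_gt (f := id) x cvg_id _ x0).
  have xn : x != 0 by rewrite gt_eqF.
  have dV : is_derive x (1 : R) (fun t : R => t^-1) (- x ^- 2).
    by have := @is_deriveV R id x 1 1 xn (is_derive_id _ _); rewrite /GRing.scale/= mulr1.
  have dN : is_derive x (1 : R) (fun t : R => - t^-1) (x ^- 2).
    by have := @is_deriveN _ _ _ _ _ _ _ dV; rewrite opprK.
  have dE : is_derive x (1 : R) (expR \o (fun t : R => - t^-1)) (expR (- x^-1) * x ^- 2).
    by have := @is_derive1_comp R expR (fun t => - t^-1) x _ _ (is_derive_expR _) dN.
  have dX := @is_deriveX _ _ _ k _ _ _ dV.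
  have D := is_deriveM dX dE.
  apply: (is_derive_eq D); rewrite !fctE /flat !ifT// /GRing.scale/=.
  case: k {F dX D} => [|k]; rewrite ?expr0 ?exprS /=.
    by field.
  rewrite ?exprS ?expr1 -mulr_natl; field; rewrite xn//.
- rewrite !flat_le0// mulr0 subr0; apply: (@is_derive_of_sq _ (k.+2%:R ^+ k.+2)); first by rewrite flat_le0.
  by move=> y; rewrite ger0_norm ?flat_ge0// flat_sq.
Unshelve. all: by end_near.
Qed.

Lemma flat_continuous k : continuous (flat k).
Proof.
move=> x; have [d _] := is_derive_flat k x.
exact/differentiable_continuous/derivable1_diffP.
Qed.

End Flat.

(** * Smooth bump functions *)

Section Smooth.
Variable R : realType.
Notation R3 := (R * R * R)%type.

(** A class closed under partial derivatives, thanks to [is_derive_flat]; smoothness follows by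
    induction on the order. *)
Inductive smo : (R3 -> R) -> Prop :=
| smo_flat k a b i : (i < 3)%N -> smo (fun x => flat k (a + b * coord3 i x))
| smo_cst c : smo (fun=> c)
| smo_add u v : smo u -> smo v -> smo (fun x => u x + v x)
| smo_mul u v : smo u -> smo v -> smo (fun x => u x * v x).

Lemma coord3_cont i : continuous (coord3 i : R3 -> R).
Proof. by have [c1 c2 c3] := coord3_continuous R; case: i => [|[|i]]. Qed.

Lemma smo_continuous u : smo u -> continuous u.
Proof.
elim=> [k a b i _|c|{}u v _ cu _ cv|{}u v _ cu _ cv] x.
- apply: (@continuous_comp _ _ _ (fun x : R3 => a + b * coord3 i x) (@flat R k)); last exact: flat_continuous.
  by apply: cvgD; [exact: cvg_cst|apply: cvgM; [exact: cvg_cst|exact: coord3_cont]].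
- exact: cvg_cst.
- by apply: cvgD; [exact: cu|exact: cv].
- by apply: cvgM; [exact: cu|exact: cv].
Qed.

Lemma coord3_line3 i j (x : R3) t : (i < 3)%N -> (j < 3)%N ->
  coord3 j (line3 i x t) = if i == j then t else coord3 j x.
Proof. by case: i => [|[|[|i]]] //; case: j => [|[|[|j]]]. Qed.

Lemma line3_coord3 i (x : R3) : line3 i x (coord3 i x) = x.
Proof. by case: x => [[a b] c]; case: i => [|[|i]]. Qed.

Lemma is_derive_affine (a b x : R) : is_derive x (1 : R) (fun t : R => a + b * t) b.
Proof.
have d1 := @is_deriveM R _ (cst b) id x 1 0 1 (is_derive_cst _ _ _) (is_derive_id _ _).
have := @is_deriveD _ _ _ (cst a) _ _ _ _ _ (is_derive_cst a x 1) d1.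
by rewrite /GRing.scale/= !(mulr1, mulr0, addr0, add0r).
Qed.

Lemma smo_derive u i : (i < 3)%N -> smo u ->
  exists2 v, smo v & forall x, is_derive (coord3 i x) (1 : R) (fun t => u (line3 i x t)) (v x).
Proof.
move=> i3; elim=> [k a b j j3|c|{}u v su [u' su' du] sv [v' sv' dv]|{}u v su [u' su' du] sv [v' sv' dv]].
- have [ij|ij] := eqVneq i j.
    exists (fun x => (flat k.+2 (a + b * coord3 j x) + (- k%:R) * flat k.+1 (a + b * coord3 j x)) * b).
      apply: smo_mul; last exact: smo_cst.
      by apply: smo_add; [exact: smo_flat|apply: smo_mul; [exact: smo_cst|exact: smo_flat]].
    move=> x; rewrite (_ : (fun t => _) = flat k \o (fun t => a + b * t)); last first.
      by apply/funext => t; rewrite coord3_line3// ij eqxx.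
    have dl := is_derive_affine a b (coord3 i x).
    have := @is_derive1_comp R (flat k) (fun t => a + b * t) (coord3 i x) _ _ (is_derive_flat k _) dl.
    by rewrite ij mulNr.
  exists (fun=> 0); first exact: smo_cst.
  move=> x; rewrite (_ : (fun t => _) = cst (flat k (a + b * coord3 j x))); last first.
    by apply/funext => t; rewrite coord3_line3// (negbTE ij).
  exact: is_derive_cst.
- by exists (fun=> 0); [exact: smo_cst|move=> x; exact: is_derive_cst].
- exists (fun x => u' x + v' x); first exact: smo_add.
  by move=> x; have := @is_deriveD _ _ _ _ _ _ _ _ _ (du x) (dv x).
- exists (fun x => u x * v' x + v x * u' x); first by apply: smo_add; exact: smo_mul.
  move=> x; have := @is_deriveM _ _ _ _ _ _ _ _ (du x) (dv x).
  by rewrite !line3_coord3.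
Qed.

Lemma partial3_of i (u : R3 -> R) x d : is_derive (coord3 i x) (1 : R) (fun t => u (line3 i x t)) d ->
  partial3_ex i u x /\ partial3 i u x = d.
Proof. by move=> [d1 d2]; split => //; rewrite /partial3 derive1E d2. Qed.

Lemma smo_smooth3 u : smo u -> smooth3 u.
Proof.
move=> + n; elim: n u => [|n IH] u su; first by split => //; exact: smo_continuous.
split; first exact: smo_continuous.
move=> i i3; have [v sv dv] := smo_derive i3 su; split; first by move=> x; have [] := partial3_of (dv x).
have -> : partial3 i u = v by apply/funext => x; have [_ ->] := partial3_of (dv x).
exact: IH.
Qed.

Lemma smo_partial_continuous u i : (i < 3)%N -> smo u -> continuous (partial3 i u).
Proof.
move=> i3 su; have [v sv dv] := smo_derive i3 su.
have -> : partial3 i u = v by apply/funext => x; have [_ ->] := partial3_of (dv x).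
exact: smo_continuous.
Qed.

Lemma grad_norm_continuous u : smo u -> continuous (grad_norm u).
Proof.
move=> su x; rewrite /grad_norm.
apply: (@continuous_comp _ _ _ (fun x => partial3 0 u x ^+ 2 + partial3 1 u x ^+ 2 + partial3 2 u x ^+ 2) Num.sqrt);
  last exact: sqrt_continuous.
have sq i : (i < 3)%N -> (fun x => partial3 i u x ^+ 2) @ x --> partial3 i u x ^+ 2.
  by move=> i3; apply: cvgM; exact: smo_partial_continuous.
by apply: cvgD; [apply: cvgD|]; exact: sq.
Qed.

Let e2 : R := expR 1 ^+ 2.

(** The factor [e2] normalises the value at 0 to 1. *)
Definition bump (x : R) : R := e2 * (flat 0 (1 + x) * flat 0 (1 - x)).
Definition dbump (x : R) : R := e2 * (flat 2 (1 + x) * flat 0 (1 - x) - flat 0 (1 + x) * flat 2 (1 - x)).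

Lemma is_derive_bump x : is_derive x (1 : R) bump (dbump x).
Proof.
have dc s := @is_derive1_comp R (flat 0) (fun t => 1 + s * t) x _ _ (is_derive_flat 0 _) (is_derive_affine 1 s x).
have dM := is_deriveM (dc 1) (dc (-1)).
have dE := is_deriveM (is_derive_cst e2 x (1 : R)) dM.
have -> : bump = (cst e2 * ((flat 0 \o (fun t => 1 + 1 * t)) * (flat 0 \o (fun t => 1 + -1 * t))))%R.
  by apply/funext => t; rewrite /bump !fctE/= mul1r mulN1r.
apply: (is_derive_eq dE); rewrite /dbump !fctE /GRing.scale/= !mul0r !subr0 !mul1r !mulN1r; ring.
Qed.

Let e2_ge0 : 0 <= e2. Proof. exact: sqr_ge0. Qed.

Lemma bump_bounds x : 0 <= bump x <= e2.
Proof.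
have f1 := flat_ge0 0 (1 + x); have f2 := flat_ge0 0 (1 - x).
have l1 := flat_le 0 (1 + x); have l2 := flat_le 0 (1 - x); rewrite !expr0 in l1 l2.
rewrite /bump mulr_ge0 ?mulr_ge0//= -[leRHS]mulr1; apply: ler_wpM2l => //.
by rewrite -[leRHS]mulr1; apply: ler_pM.
Qed.

Lemma dbump_bound x : `|dbump x| <= 8 * e2.
Proof.
have f1 := flat_ge0 0 (1 + x); have f2 := flat_ge0 0 (1 - x).
have l1 := flat_le 0 (1 + x); have l2 := flat_le 0 (1 - x); rewrite !expr0 in l1 l2.
have f3 := flat_ge0 2 (1 + x); have f4 := flat_ge0 2 (1 - x).
have l3 := flat_le 2 (1 + x); have l4 := flat_le 2 (1 - x).
rewrite /dbump normrM ger0_norm// mulrC; apply: ler_wpM2r => //.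
apply: le_trans (ler_normB _ _) _; rewrite !ger0_norm ?mulr_ge0//.
have : flat 2 (1 + x) * flat 0 (1 - x) <= 2 ^+ 2 * 1 by apply: ler_pM.
have : flat 0 (1 + x) * flat 2 (1 - x) <= 1 * 2 ^+ 2 by apply: ler_pM.
lra.
Qed.

Lemma bump_out x : 1 <= `|x| -> bump x = 0 /\ dbump x = 0.
Proof.
rewrite ler_normr => /orP[x1|x1]; rewrite /bump /dbump.
  have n0 : 1 - x <= 0 by lra.
  by rewrite !(flat_le0 _ n0) !mulr0 subrr mulr0.
have n0 : 1 + x <= 0 by lra.
by rewrite !(flat_le0 _ n0) !mul0r subrr mulr0.
Qed.

Lemma bump0 : bump 0 = 1.
Proof.
rewrite /bump addr0 subr0 /flat ltr01 !expr0 !mul1r invr1 /e2 -expr2 -exprMn.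
by rewrite -expRD subrr expR0 expr1n.
Qed.

Definition bump3 (c : R) (x : R3) : R := bump (c * x.1.1) * (bump (c * x.1.2) * bump (c * x.2)).

Lemma bump3_smo c : smo (bump3 c).
Proof.
have s i : (i < 3)%N -> smo (fun x => bump (c * coord3 i x)).
  move=> i3; rewrite (_ : (fun x => _) = (fun x => e2 * (flat 0 (1 + c * coord3 i x) * flat 0 (1 + (- c) * coord3 i x)))).
    apply: smo_mul; first exact: smo_cst.
    by apply: smo_mul; exact: smo_flat.
  by apply/funext => x; rewrite /bump mulNr.
by apply: smo_mul; [exact: (s 0%N)|apply: smo_mul; [exact: (s 1%N)|exact: (s 2%N)]].
Qed.

Lemma bump3_out c (x : R3) : 1 <= `|c| * `|x| -> bump3 c x = 0.
Proof.
move=> cx; have : [\/ 1 <= `|c * x.1.1|, 1 <= `|c * x.1.2| | 1 <= `|c * x.2| ].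
  rewrite !normrM; have : `|x| = `|x.1.1| \/ `|x| = `|x.1.2| \/ `|x| = `|x.2|.
    rewrite !prod_normE /=.
    by case: (leP (Num.max _ _)) => _; [right; right|case: (leP `|x.1.1|) => _; [right; left|left]].
  by case=> [E|[E|E]]; rewrite E in cx; [apply: Or31|apply: Or32|apply: Or33].
by rewrite /bump3 => -[] /bump_out[-> _]; rewrite ?mul0r ?mulr0 ?mul0r.
Qed.

End Smooth.

(** * Test functions concentrated at the origin *)

Section PointCapacity.
Variable R : realType.
Notation R3 := (R * R * R)%type.

Let e2 : R := expR 1 ^+ 2.
Let M : R := 8 * e2 * (e2 * e2).
Let M_ge0 : 0 <= M. Proof. by rewrite !mulr_ge0 ?sqr_ge0. Qed.

Definition dyadic (k : nat) : set R3 := [set x | `|x| <= 2 ^- k].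

Lemma dyadicE k : dyadic k = [set x | `|x - 0| <= 2 ^- k].
Proof. by apply/seteqP; split => x; rewrite /dyadic /= subr0. Qed.

Lemma dyadic_measurable k : mble3 R (dyadic k).
Proof.
by rewrite dyadicE; apply: compact3_measurable; exact: ball_compact.
Qed.

Lemma leb3_dyadic k : leb3 (dyadic k) = ((2 * 2 ^- k) ^+ 3)%:E.
Proof.
have r0 : 0 <= 2 ^- k :> R by rewrite invr_ge0 exprn_ge0.
by rewrite dyadicE; exact: (leb3_ball 0 r0).
Qed.

Lemma bump3_derive c i (x : R3) : 0 < c -> (i < 3)%N -> exists d,
  [/\ is_derive (coord3 i x) (1 : R) (fun t => bump3 c (line3 i x t)) d,
      `|d| <= M * c & 1 <= c * `|x| -> d = 0].
Proof.
move=> c0 i3.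
have [a [b [E xE]]] : exists a b, (forall t, bump3 c (line3 i x t) = bump (c * t) * (bump (c * a) * bump (c * b))) /\
    (1 <= c * `|x| -> [\/ 1 <= `|c * coord3 i x|, 1 <= `|c * a| | 1 <= `|c * b| ]).
  have xc : 1 <= c * `|x| -> [\/ 1 <= `|c * x.1.1|, 1 <= `|c * x.1.2| | 1 <= `|c * x.2| ].
    rewrite !normrM (gtr0_norm c0) !prod_normE /=.
    by case: (leP (Num.max _ _)) => _; [apply: Or33|case: (leP `|x.1.1|) => _; [apply: Or32|apply: Or31]].
  case: i i3 => [|[|[|//]]] _.
  - by exists x.1.2, x.2; split.
  - exists x.1.1, x.2; split; first by move=> t; rewrite /bump3/=; ring.
    by move=> /xc[]; [apply: Or32|apply: Or31|apply: Or33].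
  - exists x.1.1, x.1.2; split; first by move=> t; rewrite /bump3/=; ring.
    by move=> /xc[]; [apply: Or32|apply: Or33|apply: Or31].
have /andP[a0 a1] := bump_bounds (c * a); have /andP[b0 b1] := bump_bounds (c * b).
exists (dbump (c * coord3 i x) * c * (bump (c * a) * bump (c * b))); split.
- rewrite (_ : (fun t => _) = (@bump R \o (fun t => 0 + c * t)) * cst (bump (c * a) * bump (c * b))); last first.
    by apply/funext => t; rewrite E !fctE/= add0r.
  have dc := @is_derive1_comp R _ (fun t => 0 + c * t) (coord3 i x) _ _ (is_derive_bump _) (is_derive_affine 0 c _).
  have dM := is_deriveM dc (is_derive_cst (bump (c * a) * bump (c * b)) (coord3 i x) (1 : R)).
  by apply: (is_derive_eq dM); rewrite /GRing.scale/= mulr0 !add0r mulrC.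
- rewrite normrM [X in X * _]normrM (gtr0_norm c0) [X in _ * X](ger0_norm (mulr_ge0 a0 b0)) /M mulrAC.
  apply: ler_wpM2r; first exact: ltW.
  by apply: ler_pM; [exact: normr_ge0|exact: mulr_ge0|exact: dbump_bound|exact: ler_pM].
- by move=> /xE[] /bump_out[z1 z2]; rewrite ?z2 ?z1 ?mul0r ?mulr0 ?mul0r ?mulr0.
Qed.

(** Bumps at the scales [2 ^- k], each equal to 1 at 0. Divided by their number they imitate a
    truncated logarithm, the extremal profile when the exponent of the gradient equals the
    dimension. *)
Definition tower (N : nat) (x : R3) : R := \sum_(k < N) bump3 (2 ^+ k) x.

Lemma tower_smo N : smo (tower N).
Proof.
elim: N => [|N IH].
  by rewrite (_ : tower 0 = fun=> 0); [exact: smo_cst|apply/funext => x; rewrite /tower big_ord0].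
rewrite (_ : tower N.+1 = fun x => tower N x + bump3 (2 ^+ N) x).
  by apply: smo_add => //; exact: bump3_smo.
by apply/funext => x; rewrite /tower big_ord_recr.
Qed.

Lemma tower_derive N i x : (i < 3)%N -> exists d,
  is_derive (coord3 i x) (1 : R) (fun t => tower N (line3 i x t)) d /\
  `|d| <= M * \sum_(k < N) 2 ^+ k * \1_(dyadic k) x.
Proof.
move=> i3; elim: N => [|N [d [dd dM]]].
  exists 0; rewrite big_ord0 normr0 mulr0; split => //.
  rewrite (_ : (fun t => _) = cst 0); first exact: is_derive_cst.
  by apply/funext => t; rewrite /tower big_ord0.
have p2 : 0 < 2 ^+ N :> R by rewrite exprn_gt0.
have [d' [dd' d'M d'0]] := bump3_derive x p2 i3.
exists (d + d'); split.
  rewrite (_ : (fun t => _) = (fun t => tower N (line3 i x t)) + (fun t => bump3 (2 ^+ N) (line3 i x t))).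
    exact: is_deriveD.
  by apply/funext => t; rewrite fctE /tower big_ord_recr.
rewrite big_ord_recr mulrDr; apply: le_trans (ler_normD _ _) _; apply: lerD => //.
rewrite indicE; have [_|xN] := boolP (x \in dyadic N); first by rewrite mulr1.
rewrite d'0 ?normr0 ?mulr0// -ler_pdivrMl// mulr1.
by move: xN; rewrite notin_setE /dyadic/= => /negP; rewrite -ltNge => /ltW.
Qed.

(** The cubes are nested, so both sums stop at the same index, and a geometric sum of powers of 2 is
    at most twice its last term. *)
Lemma dyadic_cube_sum N x :
  (\sum_(k < N) 2 ^+ k * \1_(dyadic k) x) ^+ 3 <= 8 * \sum_(k < N) 8 ^+ k * \1_(dyadic k) x :> R.
Proof.
elim: N => [|N IH]; first by rewrite !big_ord0 expr0n mulr0.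
rewrite !big_ord_recr/=; have [xN|xN] := boolP (x \in dyadic N); last first.
  by rewrite !indicE (negbTE xN) !mulr0 !addr0.
have sub k : (k <= N)%N -> \1_(dyadic k) x = 1 :> R.
  move=> kN; rewrite indicE mem_set//; move: xN; rewrite in_setE /dyadic/= => /le_trans; apply.
  by rewrite lef_pV2 ?posrE ?exprn_gt0// ler_eXn2l// ltr1n.
have s1 : \sum_(k < N) 2 ^+ k * \1_(dyadic k) x <= 2 ^+ N :> R.
  elim: (N) sub {IH xN} => [|n IH] sub; first by rewrite big_ord0.
  rewrite big_ord_recr/= sub// mulr1 exprS; have := IH (fun k kn => sub k (leqW kn)).
  lra.
have s0 : 0 <= \sum_(k < N) 2 ^+ k * \1_(dyadic k) x :> R.
  by apply: sumr_ge0 => k _; rewrite mulr_ge0 ?exprn_ge0// indicE.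
have t0 : 0 <= \sum_(k < N) 8 ^+ k * \1_(dyadic k) x :> R.
  by apply: sumr_ge0 => k _; rewrite mulr_ge0 ?exprn_ge0// indicE.
rewrite sub// !mulr1 mulrDr; apply: (@le_trans _ _ (8 * 8 ^+ N)); last by rewrite lerDr mulr_ge0.
have -> : 8 * 8 ^+ N = (2 * 2 ^+ N) ^+ 3 :> R.
  by rewrite exprMn -exprM mulnC exprM -[2 ^+ 3]/(2 * (2 * 2)); congr (_ * _ ^+ _); ring.
by rewrite lerXn2r ?nnegrE ?addr_ge0 ?mulr_ge0 ?exprn_ge0//; lra.
Qed.

Lemma sqrt3_le (p q r b : R) : 0 <= b -> p <= b ^+ 2 -> q <= b ^+ 2 -> r <= b ^+ 2 ->
  Num.sqrt (p + q + r) <= 2 * b.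
Proof.
move=> b0 pb qb rb; have -> : 2 * b = Num.sqrt ((2 * b) ^+ 2) by rewrite sqrtr_sqr ger0_norm// mulr_ge0.
by apply: ler_wsqrtr; rewrite exprMn; have := sqr_ge0 b; lra.
Qed.

Definition cutoff (N : nat) (x : R3) : R := N.+1%:R^-1 * tower N.+1 x.

Lemma cutoff_smo N : smo (cutoff N).
Proof. by apply: smo_mul; [exact: smo_cst|exact: tower_smo]. Qed.

Lemma cutoff_grad N x : grad_norm (cutoff N) x ^+ 3 <=
  \sum_(k < N.+1) (8 * (2 * M / N.+1%:R) ^+ 3 * 8 ^+ k) * \1_(dyadic k) x.
Proof.
pose S := \sum_(k < N.+1) 2 ^+ k * \1_(dyadic k) x : R.
have S0 : 0 <= S by apply: sumr_ge0 => k _; rewrite mulr_ge0 ?exprn_ge0// indicE.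
have n0 : 0 < N.+1%:R^-1 :> R by rewrite invr_gt0.
have pb i : (i < 3)%N -> partial3 i (cutoff N) x ^+ 2 <= (M * S * N.+1%:R^-1) ^+ 2.
  move=> i3; have [d [dd dM]] := tower_derive N.+1 x i3.
  have dc : is_derive (coord3 i x) (1 : R) (fun t => cutoff N (line3 i x t)) (N.+1%:R^-1 * d).
    have dM' := is_deriveM (is_derive_cst (N.+1%:R^-1 : R) (coord3 i x) (1 : R)) dd.
    by apply: (is_derive_eq dM'); rewrite /GRing.scale/= mulr0 addr0.
  have [_ ->] := partial3_of dc.
  rewrite -real_normK ?num_real// lerXn2r ?nnegrE ?mulr_ge0 ?(ltW n0)//.
  by rewrite normrM (gtr0_norm n0) mulrC ler_pM2r.
have b0 : 0 <= M * S * N.+1%:R^-1 by rewrite !mulr_ge0 ?(ltW n0).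
have gb : grad_norm (cutoff N) x <= 2 * M / N.+1%:R * S.
  rewrite [leRHS](_ : _ = 2 * (M * S * N.+1%:R^-1)); last by ring.
  exact: (sqrt3_le b0 (pb 0%N isT) (pb 1%N isT) (pb 2%N isT)).
have c0 : 0 <= (2 * M / N.+1%:R) ^+ 3 by rewrite exprn_ge0// !mulr_ge0// ltW.
apply: (@le_trans _ _ ((2 * M / N.+1%:R * S) ^+ 3)).
  by rewrite lerXn2r ?nnegrE ?sqrtr_ge0// mulr_ge0// !mulr_ge0// ltW.
rewrite exprMn; apply: le_trans (ler_wpM2l c0 (dyadic_cube_sum _ _)) _.
rewrite mulrA mulr_sumr le_eqVlt; apply/orP; left; apply/eqP; apply: eq_bigr => k _; ring.
Qed.

Lemma dyadic_term_measurable (A : set R3) (c : R) k :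
  measurable_fun A (fun x : mR R * mR R * mR R => (c * \1_(dyadic k) x)%:E).
Proof.
apply: measurable_funTS; apply/measurable_EFinP; apply: measurable_funM; first exact: measurable_cst.
by apply: measurable_indic; exact: dyadic_measurable.
Qed.

Lemma int_dyadic_sum (A : set R3) (a : nat -> R) N : mble3 R A -> (forall k, 0 <= a k) ->
  (\int[@leb3 R]_(x in A) (\sum_(k < N) a k * \1_(dyadic k) x)%:E <=
   (\sum_(k < N) a k * (2 * 2 ^- k) ^+ 3)%:E)%E.
Proof.
move=> mA a0; have mi k : measurable_fun A (fun x : mR R * mR R * mR R => (a k * \1_(dyadic k) x)%:E).
  exact: dyadic_term_measurable.
have i0 k x : 0 <= a k * \1_(dyadic k) x by rewrite mulr_ge0// indicE.
elim: N => [|N IH].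
  rewrite big_ord0 (_ : (fun x => _) = cst 0%E); first by rewrite integral0.
  by apply/funext => x; rewrite big_ord0.
under eq_integral do rewrite big_ord_recr/= EFinD.
rewrite ge0_integralD//; last 4 first.
- by move=> x _; rewrite lee_fin sumr_ge0.
- rewrite (_ : (fun x => _) = (fun x => \sum_(k < N) (a k * \1_(dyadic k) x)%:E)%E); last first.
    by apply/funext => x; rewrite sumEFin.
  by apply: emeasurable_sum => k _; exact: mi.
- by move=> x _; rewrite lee_fin.
- exact: mi.
rewrite big_ord_recr/= EFinD; apply: leeD => //.
under eq_integral do rewrite EFinM.
rewrite ge0_integralZl//; last 2 first.
- by apply: measurable_funTS; apply/measurable_EFinP; apply: measurable_indic; exact: dyadic_measurable.
- by rewrite lee_fin.
rewrite EFinM; apply: lee_wpmul2l; first by rewrite lee_fin.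
rewrite integral_indic//; last exact: dyadic_measurable.
rewrite -leb3_dyadic; apply: (@le_measure _ _ _ (@leb3 R)); rewrite ?inE//.
- by apply: measurableI => //; exact: dyadic_measurable.
- exact: dyadic_measurable.
Qed.

(** The cubed gradient of [cutoff N] is at most a sum over [N + 1] scales of terms of order
    [8 ^ k / (N + 1) ^ 3] on cubes of volume of order [8 ^- k]. Each scale contributes equally, and
    the total tends to 0. *)
Lemma point_capacity (C : set R3) : C `<=` [set 0] -> compact_zero_cap C.
Proof.
move=> C0; pose A : set R3 := [set x | `|x| < 2].
have oA : open A.
  apply/open3P => x x2; exists (2 - `|x|); first by rewrite subr_gt0.
  by move=> y xy; have := ler_normD x (y - x); rewrite addrCA subrr addr0 [`|y - x|]distrC /A/=; lra.
have mA := open3_measurable oA.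
exists A; split => //.
- exists 4 => x xA; apply: le_trans (norm3_sup x) _; rewrite /A/= in xA; lra.
- by move=> x /C0 ->; rewrite /A/= normr0.
have outQ N x : 1 <= `|x| -> cutoff N x = 0.
  move=> x1; rewrite /cutoff /tower big1 ?mulr0// => k _; apply: bump3_out.
  by rewrite ger0_norm ?exprn_ge0// -[leLHS]mul1r ler_pM// exprn_ege1// ler1n.
have sup N : support3 (cutoff N) `<=` [set x | `|x - 0| <= 1].
  have cB : closed [set x : R3 | `|x - 0| <= 1] by apply: compact3_closed; exact: ball_compact.
  rewrite /support3 closureE; apply: smallest_sub => // x /= /eqP ux.
  by rewrite subr0 leNgt; apply/negP => /ltW /(outQ N).
have adm N : cap_admissible A C (cutoff N).
  split.
  - exact: smo_smooth3 (cutoff_smo N).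
  - apply: (subclosed_compact _ (@ball_compact R 0 1)); last exact: sup.
    exact: closed_closure.
  - by move=> x /sup; rewrite /A /= subr0 => x1; lra.
  - move=> x; rewrite mulr_ge0 ?invr_ge0// sumr_ge0// => k _.
    have b0 (t : R) : 0 <= bump t by have /andP[] := bump_bounds t.
    by apply: mulr_ge0; [|apply: mulr_ge0]; exact: b0.
  - move=> x /C0 ->; rewrite /cutoff /tower (eq_bigr (fun=> 1)).
      by rewrite sumr_const card_ord mulVf.
    by move=> k _; rewrite /bump3/= !mulr0 bump0 !mulr1.
have val N : (\int[@leb3 R]_(x in A) ((grad_norm (cutoff N) x) ^+ 3)%:E <= (8 ^+ 3 * M ^+ 3 / N.+1%:R)%:E)%E.
  have n0 : 0 < N.+1%:R :> R by [].
  have c0 : 0 <= 8 * (2 * M / N.+1%:R) ^+ 3.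
    by rewrite mulr_ge0// exprn_ge0// !mulr_ge0// invr_ge0 ltW.
  apply: (@le_trans _ _ (\int[@leb3 R]_(x in A) (\sum_(k < N.+1) (8 * (2 * M / N.+1%:R) ^+ 3 * 8 ^+ k) * \1_(dyadic k) x)%:E)%E).
    apply: (@ge0_le_integral _ _ _ (@leb3 R) _ mA).
    - by move=> x _; rewrite lee_fin exprn_ge0// sqrtr_ge0.
    - apply: measurable_funTS; apply/measurable_EFinP; apply: measurable_fun_continuous3.
      move=> x; have gc := grad_norm_continuous (cutoff_smo N).
      by rewrite (_ : (fun x => _) = (fun x => grad_norm (cutoff N) x * (grad_norm (cutoff N) x * grad_norm (cutoff N) x)));
        [apply: cvgM; [exact: gc|apply: cvgM; exact: gc]|apply/funext => y; ring].
    - rewrite (_ : (fun x => _) = (fun x => \sum_(k < N.+1) (8 * (2 * M / N.+1%:R) ^+ 3 * 8 ^+ k * \1_(dyadic k) x)%:E)%E); last first.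
        by apply/funext => x; rewrite sumEFin.
      by apply: emeasurable_sum => k _; exact: dyadic_term_measurable.
    - by move=> x _; rewrite lee_fin; exact: cutoff_grad.
  apply: le_trans (@int_dyadic_sum A (fun k => 8 * (2 * M / N.+1%:R) ^+ 3 * 8 ^+ k) N.+1 mA _) _.
    by move=> k; rewrite mulr_ge0// exprn_ge0.
  rewrite lee_fin (eq_bigr (fun=> 64 * (2 * M / N.+1%:R) ^+ 3)); last first.
    move=> k _; have p2 : 2 ^+ k != 0 :> R by rewrite expf_neq0.
    have -> : 8 ^+ k = (2 ^+ k) ^+ 3 :> R by rewrite -exprM mulnC exprM; congr (_ ^+ _); ring.
    by field; rewrite p2 gt_eqF.
  rewrite sumr_const card_ord -[_ *+ N.+1]mulr_natr.
  have -> : 64 * (2 * M / N.+1%:R) ^+ 3 * N.+1%:R = 8 ^+ 3 * M ^+ 3 / N.+1%:R / N.+1%:R by field; rewrite gt_eqF.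
  have K0 : 0 <= 8 ^+ 3 * M ^+ 3 by apply: mulr_ge0; apply: exprn_ge0.
  move: (8 ^+ 3 * M ^+ 3) K0 => K K0.
  rewrite ler_pdivrMr// ler_peMr//; last by rewrite ler1n.
  by rewrite divr_ge0.
apply/eqP; rewrite eq_le; apply/andP; split; last first.
  by apply: le_ereal_inf_tmp => _ [u _ <-]; apply: integral_ge0 => x _; rewrite lee_fin exprn_ge0// sqrtr_ge0.
apply/lee_addgt0Pr => e e0; rewrite add0e.
pose N := Num.truncn (8 ^+ 3 * M ^+ 3 / e).
apply: (@le_trans _ _ (8 ^+ 3 * M ^+ 3 / N.+1%:R)%:E).
  apply: le_trans (val N); apply: ereal_inf_lbound; exists (cutoff N) => //; exact: adm.
rewrite lee_fin ler_pdivrMr// [leRHS]mulrC -ler_pdivrMr//; apply: ltW; exact: truncnS_gt.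
Qed.

End PointCapacity.

(** * The Julia set *)

Section Final.
Variable R : realType.
Notation R3 := (R * R * R)%type.

(** The cosine decreases on the range of [acos], so a lower bound on the angle bounds the quotient
    by [cos theta]. If a vector is 0 there is no quotient to speak of, but the dot product
    vanishes. *)
Lemma acute_angle_dot (theta : R) (u v : R3) : 0 < theta < pi / 2 -> theta < acute_angle u v ->
  dot3 u v ^+ 2 <= (1 - sin theta ^+ 2) * dot3 u u * dot3 v v.
Proof.
move=> /andP[t0 t2]; rewrite /acute_angle.
have [E|N] := eqVneq (norm3 u * norm3 v) 0.
  have : `|dot3 u v| <= 0 by rewrite -E; exact: dot3_cauchy.
  rewrite normr_le0 => /eqP -> _; rewrite expr0n/= -cos2sin2.
  by apply: mulr_ge0 (dot3_ge0 _); apply: mulr_ge0 (dot3_ge0 _); exact: sqr_ge0.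
have n0 : 0 < norm3 u * norm3 v by rewrite lt_neqAle eq_sym N mulr_ge0// norm3_ge0.
set c := _ / _ => tc; have pp := pi_gt0 R.
have c0 : 0 <= c by rewrite divr_ge0// ltW.
have c1 : c <= 1 by rewrite ler_pdivrMr// mul1r; exact: dot3_cauchy.
have cb : -1 <= c <= 1 by lra.
have a0 := acos_ge0 cb; have api := acos_lepi cb.
have cc : c < cos theta.
  rewrite -(acosK (x := c)); last by rewrite in_itv/=.
  by rewrite ltr_cos// in_itv/=; lra.
have dE : `|dot3 u v| = c * (norm3 u * norm3 v) by rewrite /c divfK.
move: c c0 c1 cc dE {tc cb a0 api} => c c0 c1 cc dE.
rewrite -[dot3 u v ^+ 2]real_normK ?num_real// dE !exprMn !norm3_sq -cos2sin2.
rewrite [leRHS](_ : _ = cos theta ^+ 2 * (dot3 u u * dot3 v v)); last by rewrite mulrA.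
apply: ler_wpM2r; first by rewrite mulr_ge0 ?dot3_ge0.
by rewrite lerXn2r ?nnegrE ?(ltW cc)// (le_trans c0)// ltW.
Qed.

Lemma chart_of (h : R * R -> R3) (L theta eps m lam : R)
  (h_bilip : forall a b, inQ a -> inQ b ->
     norm2 (sub2 a b) / L <= norm3 (sub3 (h a) (h b)) <= L * norm2 (sub2 a b))
  (h_sp : sense_preserving h)
  (h_up : forall x, inQ x -> 0 <= (h x).2)
  (h_bd : forall x, on_bdQ x -> (h x).2 = 0)
  (h_ray : forall x y t, inQ x -> inQ y -> 0 <= t ->
     h y = scale3 t (h x) -> h y = h x)
  (theta_bds : 0 < theta < pi / 2) (eps_gt0 : 0 < eps)
  (h_ntan : forall a b, inQ a -> inQ b -> h a <> h b ->
     norm3 (sub3 (h a) (h b)) <= eps ->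
     theta < acute_angle (h b) (sub3 (h a) (h b)))
  (m_min : forall x, inQ x -> m <= norm3 (h x))
  (m_gt0 : 0 < m)
  (h_diag : forall t, -1 <= t <= 1 ->
     (h (t, t)).1.1 = (h (t, t)).1.2 /\ (h (t, - t)).1.1 = - (h (t, - t)).1.2)
  (h_00 : h (0, 0) = (0, 0, 1))
  (h_sup : forall x, inQ x -> norm3 (h x) <= 1)
  (lam_big : Num.max (L ^+ 5) (2 * L) / (m * sin theta) < lam) :
  chart h L (sin theta) eps m lam.
Proof.
have q1 : inQ (1, 1 : R) by split => /=; lra.
have q2 : inQ (-1, -1 : R) by split => /=; lra.
have q0 : inQ (0, 0 : R) by split => /=; lra.
have b1 : on_bdQ (1, 1 : R) by split => //; left; rewrite normr1.
have pp := pi_gt0 R; have /andP[t0 t2] := theta_bds.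
(* With [L <= 0] the images of [(1, 1)] and [(0, 0)] would coincide, but their heights are 0 and
   1. *)
have L0 : 0 < L.
  rewrite ltNge; apply/negP => L0.
  have /andP[_ up] := h_bilip _ _ q1 q0.
  have : norm3 (sub3 (h (1, 1)) (h (0, 0))) <= 0.
    by apply: le_trans up _; rewrite mulr_le0_ge0// norm2_ge0.
  have [_ _] := norm3_comp (sub3 (h (1, 1)) (h (0, 0))).
  by rewrite /sub3 h_00 (h_bd _ b1)/= sub0r normrN normr1; lra.
have s0 : 0 < sin theta by apply: sin_gt0_pi; lra.
have c0 : 0 < cos theta by apply: cos_gt0_pihalf; lra.
have s1 : sin theta < 1.
  by have := cos2Dsin2 theta; have := exprn_gt0 2 c0; nra.
split => //.
(* Opposite corners of the square are [2 sqrt 2] apart and their images at most 2, whence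
   [2 <= L ^ 2]. *)
- have /andP[lo _] := h_bilip _ _ q1 q2.
  have n4 : norm2 (sub2 (1, 1) (-1, -1) : R * R) ^+ 2 = 8.
    by rewrite norm2_sq /sub2/=; ring.
  have up : norm3 (sub3 (h (1, 1)) (h (-1, -1))) <= 2.
    have := norm3_triangle (h (1, 1)) (- h (-1, -1)); rewrite norm3N.
    by have := h_sup _ q1; have := h_sup _ q2; rewrite /sub3/=; lra.
  have : norm2 (sub2 (1, 1) (-1, -1) : R * R) <= 2 * L.
    by rewrite -ler_pdivrMr//; exact: le_trans lo up.
  rewrite -(@ler_pXn2r _ 2)// ?nnegrE ?norm2_ge0// ?n4 ?exprMn; first lra.
  by rewrite mulr_ge0// ltW.
- move=> a b qa qb; have /andP[lo _] := h_bilip _ _ qa qb.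
  by rewrite mulrC -ler_pdivrMr.
- by move=> a b qa qb; have /andP[] := h_bilip _ _ qa qb.
- have [N [mN N0 sub]] := h_sp; exists N; split => //; apply: subset_trans sub => x /= nx Hx.
  by apply: nx => /Hx[p1 p2 p3 _]; split.
- move=> a b qa qb ab; have [E|/eqP N] := eqVneq (h a) (h b); last first.
    by apply: acute_angle_dot => //; exact: h_ntan.
  rewrite E; have -> : sub3 (h b) (h b) = 0 by rewrite /sub3 !subrr.
  by rewrite /dot3/= !mulr0 !addr0 mulr0 expr0n.
- by move=> t /h_diag[].
- by move=> t /h_diag[].
- move: lam_big; rewrite ltr_pdivrMr ?mulr_gt0// => lb.
  by rewrite -mulrA; apply: le_lt_trans lb; rewrite le_max lexx.
Qed.

End Final.

Theorem theorem1p4 (R : realType) (h : R * R -> R * R * R)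
  (L theta eps m lam : R)
  (* h is sense-preserving and L-bi-Lipschitz on Q *)
  (h_bilip : forall a b, inQ a -> inQ b ->
     norm2 (sub2 a b) / L <= norm3 (sub3 (h a) (h b)) <= L * norm2 (sub2 a b))
  (h_sp : sense_preserving h)
  (* (1) S lies in the upper half-space *)
  (h_up : forall x, inQ x -> 0 <= (h x).2)
  (* (2) the boundary of S lies in the plane x3 = 0 *)
  (h_bd : forall x, on_bdQ x -> (h x).2 = 0)
  (* (3) each ray from 0 through a point of S meets S only there *)
  (h_ray : forall x y t, inQ x -> inQ y -> 0 <= t ->
     h y = scale3 t (h x) -> h y = h x)
  (* (4) non-tangential position vector property with constants theta, eps *)
  (theta_bds : 0 < theta < pi / 2) (eps_gt0 : 0 < eps)
  (h_ntan : forall a b, inQ a -> inQ b -> h a <> h b ->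
     norm3 (sub3 (h a) (h b)) <= eps ->
     theta < acute_angle (h b) (sub3 (h a) (h b)))
  (* (5) m = min_{x in Q} |h(x)| > 0 *)
  (m_min : (exists x0, inQ x0 /\ norm3 (h x0) = m) /\
           (forall x, inQ x -> m <= norm3 (h x)))
  (m_gt0 : 0 < m)
  (* symmetry and normalisation *)
  (h_diag : forall t, -1 <= t <= 1 ->
     (h (t, t)).1.1 = (h (t, t)).1.2 /\ (h (t, - t)).1.1 = - (h (t, - t)).1.2)
  (h_00 : h (0, 0) = (0, 0, 1))
  (h_sup : (forall x, inQ x -> norm3 (h x) <= 1) /\
           (exists x, inQ x /\ norm3 (h x) = 1))
  (* scale factor *)
  (lam_ge1 : 1 <= lam)
  (lam_big : Num.max (L ^+ 5) (2 * L) / (m * sin theta) < lam) :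
  julia (zorich h lam) = setT.
Proof.
have H := chart_of h_bilip h_sp h_up h_bd h_ray theta_bds eps_gt0 h_ntan m_min.2 m_gt0
  h_diag h_00 h_sup.1 lam_big.
have l0 : lam != 0 by rewrite gt_eqF//; lra.
pose phi (v : R * R * R) : R * R * R := (lam * v.1.1, lam * v.1.2, v.2).
pose psi (v : R * R * R) : R * R * R := (v.1.1 / lam, v.1.2 / lam, v.2).
have psiK : cancel psi phi.
  by move=> [[a b] c]; rewrite /phi /psi/=; congr (_, _, _); field.
have cphi : continuous phi.
  have [c1 c2 c3] := coord3_continuous R.
  apply: continuous_pair3 => // x; apply: cvgM; try exact: cvg_cst; [exact: c1|exact: c2].
have conj n v : iter n (zorich h lam) (phi v) = phi (iter n (zmap h lam) v).
  by elim: n => [//|n IH]; rewrite !iterS IH (zorich_zmap h _ l0).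
(* A set that misses all iterates of [U] contains at most the origin. *)
apply/seteqP; split => // x _ U Ux C CU _; apply: point_capacity => w Cw.
apply: contrapT => w0; apply: (CU w Cw).
have Nx : nbhs (psi x) (phi @^-1` U) by apply: cphi; rewrite psiK.
have y0 : psi w <> 0.
  move=> E; apply: w0; rewrite -[w]psiK E /phi/= !mulr0.
  by [].
have [n n0 [v Uv vw]] := zmap_cover H Nx y0.
by exists n => //; exists (phi v) => //; rewrite conj vw psiK.
Qed.
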